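(* Let $n\ge 2$ and let $F$ be a continuous distribution function on $[0,1]^n$. Suppose there exists a function $h$ defined on a set $L\subseteq[0,1]^{n-1}$ with $\lambda_{n-1}(L)\neq 0$ and $\lambda_{n-1}(\partial L)=0$ (i.e. $L$ is Jordan measurable) such that, writing $\tilde{x}=(x_1,\dots,x_{n-1})$, $$\mathcal{D}:=\{x=(\tilde{x},h(\tilde{x})):\tilde{x}\in L\}=\Big\{x\in[0,1]^n: F(x)=\tfrac12\Big\}.$$ Assume that $h$ is continuously differentiable in the interior of $L$ and that there are positive continuous functions $a_1,\dots,a_n$ such that $$\lim_{\delta\to 0}\ \sup_{z\in\mathcal{D}}\ \sup_{\substack{|x-z|\le\delta,\ |y-z|\le\delta\\ x\neq y}}\frac{\big|F(x)-F(y)-\sum_{i=1}^n a_i(z)(x_i-y_i)\big|}{\sum_{i=1}^n|x_i-y_i|}=0 .$$ Then for every $w\in\mathbb{R}$, as $u\to\infty$, $$\mathbb{P}\Big\{\sup_{x\in[0,1]^n}W(x)>u\,\Big|\,W(\mathbf 1)=w\Big\}\sim K\,u^{2(n-1)}e^{-2u^2+2uw},\qquad K:=2^{3(n-1)}\int_L\prod_{i=1}^{n-1}a_i(\tilde{x},h(\tilde{x}))\,d\tilde{x}\in(0,\infty).$$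
   Context: For $x\in\mathbb{R}^n$, $|x|=\sum_{i=1}^n|x_i|$; $x\wedge y=(x_1\wedge y_1,\dots,x_n\wedge y_n)$; $\mathbf 1=(1,\dots,1)$; $\lambda_k$ is Lebesgue measure on $\mathbb{R}^k$. $W$ is the Brownian sheet determined by $F$: the centered Gaussian random field on $[0,1]^n$ with covariance $\mathbb{E}[W(x)W(y)]=F(x\wedge y)$. The conditional probability given $W(\mathbf 1)=w$ is understood via the conditional law of the field, i.e. $\mathbb{P}\{\sup_{x}W(x)>u\mid W(\mathbf 1)=w\}=\mathbb{P}\{\sup_x (W(x)-F(x)W(\mathbf 1)+F(x)w)>u\}$. *)

(* Defs.v *)
From HB Require Import structures.
From mathcomp Require Import all_boot all_order all_algebra.
From mathcomp Require Import all_classical all_reals all_analysis.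
Set Implicit Arguments. Unset Strict Implicit. Unset Printing Implicit Defensive.
Import Order.TTheory GRing.Theory Num.Theory.
Import numFieldNormedType.Exports.
Local Open Scope classical_set_scope.
Local Open Scope ring_scope.

Section defs.
Context {R : realType}.

Definition cube k : set 'rV[R]_k := [set x | forall i, 0 <= x 0 i <= 1].

Definition norm1 k (x : 'rV[R]_k) : R := \sum_(i < k) `|x 0 i|.

Definition rmin k (x y : 'rV[R]_k) : 'rV[R]_k := \row_i Num.min (x 0 i) (y 0 i).

Definition ext k (xt : 'rV[R]_k) (t : R) : 'rV[R]_k.+1 :=
  \row_i (if unlift ord_max i is Some j then xt 0 j else t).

Definition ones k : 'rV[R]_k := const_mx 1.

(* lower orthant (-oo, x] ; generators of the Borel sigma-algebra of R^k *)
Definition orthant k (x : 'rV[R]_k) : set 'rV[R]_k := [set y | forall i, y 0 i <= x 0 i].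
Definition orthants k : set (set 'rV[R]_k) := [set orthant x | x in [set: 'rV[R]_k]].

Definition is_cdf_on_cube k (mu : probability (g_sigma_algebraType (@orthants k)) R)
  (F : 'rV[R]_k -> R) : Prop :=
  mu (@cube k) = 1%E /\ forall x, @cube k x -> (F x)%:E = mu (orthant x).

Definition centered_gauss (v : R) : set R -> \bar R :=
  if v == 0 then \d_(0 : R) else normal_prob 0 (Num.sqrt v).

Definition rat_cube k : set 'rV[R]_k :=
  [set q | @cube k q /\ forall i, exists r : rat, q 0 i = ratr r].

Definition rbox k (a b : 'rV[R]_k) : set 'rV[R]_k := [set x | forall i, a 0 i <= x 0 i <= b 0 i].
Definition rvol k (a b : 'rV[R]_k) : R := \prod_(i < k) (b 0 i - a 0 i).

Definition leb_outer k (A : set 'rV[R]_k) : \bar R :=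
  ereal_inf [set s | exists a b : nat -> 'rV[R]_k,
     (forall j i, a j 0 i <= b j 0 i) /\
     A `<=` \bigcup_j rbox (a j) (b j) /\
     s = (\sum_(j <oo) (rvol (a j) (b j))%:E)%E].

Definition leb_measurable k (A : set 'rV[R]_k) : Prop :=
  forall B, leb_outer B = (leb_outer (B `&` A) + leb_outer (B `&` ~` A))%E.

Definition leb_integral k (L : set 'rV[R]_k) (g : 'rV[R]_k -> R) : \bar R :=
  ereal_sup [set s | exists (p : nat) (c : 'I_p -> R) (A : 'I_p -> set 'rV[R]_k),
     (forall j, 0 <= c j) /\ (forall j, leb_measurable (A j)) /\
     (forall x, \sum_(j < p) c j * \1_(A j) x <= (if `[< L x >] then g x else 0)) /\
     s = (\sum_(j < p) (c j)%:E * leb_outer (A j))%E].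

Definition boundary k (A : set 'rV[R]_k) : set 'rV[R]_k := closure A `&` ~` interior A.

Definition lin_err k (F : 'rV[R]_k -> R) (a : 'I_k -> 'rV[R]_k -> R)
  (D : set 'rV[R]_k) (delta : R) : \bar R :=
  ereal_sup [set s | exists z x y, D z /\ @cube k x /\ @cube k y /\
     norm1 (x - z) <= delta /\ norm1 (y - z) <= delta /\ x != y /\
     s = ((`|F x - F y - \sum_(i < k) a i z * (x 0 i - y 0 i)|) / norm1 (x - y))%:E].

End defs.
Arguments cube {R} k.
Arguments rat_cube {R} k.
Arguments ones {R} k.

(* Main.v *)
Require Import Defs.
From HB Require Import structures.
From mathcomp Require Import all_boot all_order all_algebra.
From mathcomp Require Import all_classical all_reals all_analysis.
From mathcomp Require Import measurable_realfun.
From mathcomp Require Import ring lra.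
From mathcomp.multinomials Require freeg.
Set Implicit Arguments. Unset Strict Implicit. Unset Printing Implicit Defensive.
Import Order.TTheory GRing.Theory Num.Theory.
Import numFieldNormedType.Exports.
Local Open Scope classical_set_scope.
Local Open Scope ring_scope.

(** Tilting a Gaussian field by exp (X e) shifts X v by <v, e>. On a block of side of order u^-2 around
a point of D this splits the exceedance event into independent pieces: a walk in the last coordinate
that must pass a level of order u, which reflection computes, and one exponential factor per remaining
coordinate, worth 8 a_i u^2 r for a side r, up to a relative error that vanishes as u^2 r grows. The
blocks of a grid give a Riemann sum of K, and Bonferroni's inequality makes it exact: two blocks that
are n gaps apart can be tilted away from each other at a cost exp (-c n). Away from D the variance of
the bridge is below 1/4 by a fixed amount. *)

(** The variance F (1 - F) of the bridge peaks at 1/4 on D, whence exp (-2 u^2). Blocks have side r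
    with u^2 r of a fixed order T: u tends to infinity before T does, so a block is treated by
    explicit inequalities for finite walks and no limiting process is needed. The tilt has slope l =
    2 (2 u - w) / (1 - v), about 4 u, and a leg of variance a_i r contributes half of l^2 a_i r,
    that is 8 a_i u^2 r, to leading order: this is the origin of 2^(3(n-1)). F is linear near D only
    up to eps, so the noise of a block is not exactly a sum over its coordinates; what is left after
    removing the legs has variance of order eps r, and eps is chosen after T. All estimates concern
    finite lists of points and are uniform in them; separability restores the supremum at the end.
    The upper bound needs no comparison between blocks. For the lower bound the blocks are shrunk by
    1 - kp, which opens gaps between neighbours, and the pair terms are a small fraction of the main
    term once T is large. *)

Lemma eqle d (T : porderType d) (x y : T) : (x = y -> x <= y)%O. Proof. by move->. Qed.

Lemma measurable_expRf {R : realType} d (T : measurableType d) (f : T -> R) :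
  measurable_fun setT f -> measurable_fun setT (fun t => expR (f t)).
Proof. exact: (measurableT_comp (@measurable_expR R)). Qed.

(** * Centered Gaussian laws on the line: shifts, sums, changes of variance *)

Section gaussian_integrals.
Context {R : realType}.
Local Notation leb := (@lebesgue_measure R).
Local Notation T := (measurableTypeR R).
Local Open Scope ereal_scope.

Lemma lebesgue_shift (c : R) (A : set R) : measurable A ->
  leb ((fun x : R => (x + c)%R) @^-1` A) = leb A.
Proof.
move=> mA.
have mc : measurable_fun setT (fun x : measurableTypeR R => (x + c)%R : measurableTypeR R).
  exact: measurable_funD.
pose mu := pushforward leb (fun x : measurableTypeR R => (x + c)%R : measurableTypeR R).
pose cm := isMeasurableFun.Build _ _ _ _ _ mc.
pose cf : {mfun (measurableTypeR R) >-> (measurableTypeR R)} := HB.pack (fun x : measurableTypeR R => (x + c)%R : measurableTypeR R) cm.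
apply/esym.
rewrite (@lebesgue_measure_unique R (pushforward leb cf)) //.
move=> X [[a b] _ <-] /=; rewrite /pushforward /=.
have -> : (fun x : R => (x + c)%R) @^-1` `]a, b] = `](a - c)%R, (b - c)%R]%classic.
  by apply/seteqP; split => x /=; rewrite !in_itv/= ltrBlDr lerBrDr.
rewrite !lebesgue_measure_itv /= !lte_fin ltrD2r.
by case: ifP => // _; rewrite -!EFinB; congr EFin; ring.
Qed.

Lemma ge0_integral_shift (c : R) (f : T -> \bar R) :
  measurable_fun setT f -> (forall x, 0 <= f x) ->
  \int[leb]_x f ((x : R) + c)%R = \int[leb]_x f x.
Proof.
move=> mf f0.
have mc : measurable_fun setT (fun x : measurableTypeR R => (x + c)%R : measurableTypeR R).
  exact: measurable_funD.
transitivity (\int[pushforward leb (fun x : measurableTypeR R => (x + c)%R : measurableTypeR R)]_x f x).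
  by rewrite ge0_integral_pushforward.
apply: eq_measure_integral => A mA _; exact: lebesgue_shift.
Qed.

Import HBNNSimple.

(** Monotone convergence from simple functions, for which the identity is the hypothesis on [nu]. *)
Lemma ge0_integral_density d (T : measurableType d) (mu nu : {measure set T -> \bar R})
  (p : T -> R) (f : T -> \bar R) :
  measurable_fun setT p -> (forall x, (0 <= p x)%R) ->
  (forall A, measurable A -> nu A = \int[mu]_(x in A) (p x)%:E) ->
  measurable_fun setT f -> (forall x, 0 <= f x) ->
  \int[nu]_x f x = \int[mu]_x (f x * (p x)%:E).
Proof.
move=> mp p0 nuE mf f0.
have mpE : measurable_fun setT (EFin \o p) by exact/measurable_EFinP.
pose f_ := nnsfun_approx measurableT mf.
have nn n r x : 0 <= (r * \1_(f_ n @^-1` [set r]) x)%:E by rewrite EFinM nnfun_muleindic_ge0.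
have f_ge0 n x : 0 <= (f_ n x)%:E by rewrite lee_fin.
have mf_ n : measurable_fun setT (EFin \o f_ n) by exact/measurable_EFinP.
transitivity (limn (fun n => \int[nu]_x (f_ n x)%:E)).
  rewrite -monotone_convergence //.
  - apply: eq_integral => y _; apply/esym/cvg_lim => //.
    by apply: cvg_nnsfun_approx.
  - by move=> y _ m n mn; rewrite lee_fin; exact/lefP/nd_nnsfun_approx.
transitivity (limn (fun n => \int[mu]_x ((f_ n x)%:E * (p x)%:E))).
  congr (limn _); apply/funext => n.
  transitivity (\int[nu]_x (\sum_(r \in range (f_ n)) (r * \1_(f_ n @^-1` [set r]) x)%:E)).
    by apply: eq_integral => x _; rewrite fsumEFin // -fimfunE.
  have mr (r : R) : measurable (f_ n @^-1` [set r]) by exact: measurable_funPTI.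
  rewrite ge0_integral_fsum //; last by move=> r; exact/measurable_EFinP/measurable_funM.
  transitivity (\int[mu]_x (\sum_(r \in range (f_ n)) ((r * \1_(f_ n @^-1` [set r]) x)%:E * (p x)%:E))); last first.
    apply: eq_integral => x _; rewrite [in RHS](fimfunE (f_ n)) -fsumEFin //.
    by rewrite -ge0_mule_fsuml //.
  rewrite ge0_integral_fsum //; first last.
  - by move=> r x _; rewrite mule_ge0 // lee_fin.
  - move=> r; apply: emeasurable_funM => //.
    by exact/measurable_EFinP/measurable_funM.
  apply: eq_fsbigr => r _.
  have [r0|r0] := leP 0%R r; last first.
    rewrite !integral0_eq // => x _; rewrite /= preimage_nnfun0 //= indicE in_set0 mulr0 //.
    by rewrite mul0e.
  under eq_integral do rewrite EFinM.
  rewrite ge0_integralZl_EFin //; last exact/measurable_EFinP.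
  under [in RHS]eq_integral do rewrite EFinM -muleA.
  rewrite [in RHS]ge0_integralZl_EFin //; first last.
  - by apply: emeasurable_funM => //; exact/measurable_EFinP.
  - by move=> x _; rewrite mule_ge0 ?lee_fin.
  congr (_ * _); rewrite integral_indic // setIT nuE // integral_mkcond.
  apply: eq_integral => x _; rewrite patchE indicE; case: ifP => _; rewrite ?mul1e ?mul0e //.
rewrite -monotone_convergence //.
- apply: eq_integral => y _; apply/cvg_lim => //.
  apply: cvgeZr => //; exact: cvg_nnsfun_approx.
- by move=> n; apply: emeasurable_funM; [exact: mf_ n|exact: mpE].
- by move=> n x _; rewrite mule_ge0 ?lee_fin.
- by move=> y _ m n mn; rewrite lee_wpmul2r ?lee_fin //; exact/lefP/nd_nnsfun_approx.
Qed.

(** The law [centered_gauss v], packed as a probability. The point mass at v = 0 is kept because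
    vectors of norm zero do occur, for instance points where F vanishes or legs of length zero. *)
Definition gm (v : R) : probability T R :=
  if v == 0%R then (\d_(0%R : T) : probability T R)
  else (normal_prob 0 (Num.sqrt v) : probability T R).

Lemma centered_gaussE v A : centered_gauss v A = gm v A.
Proof. by rewrite /centered_gauss /gm; case: ifP. Qed.

Definition gdens (v x : R) : R := ((Num.sqrt (v * pi *+ 2))^-1 * expR (- x ^+ 2 / (v *+ 2)))%R.

Lemma gdens_pdf (v m x : R) : (0 < v)%R -> normal_pdf m (Num.sqrt v) x = gdens v (x - m)%R.
Proof.
move=> v0; rewrite normal_pdfE ?gt_eqF ?sqrtr_gt0 //.
by rewrite /gdens /normal_peak /normal_fun sqr_sqrtr ?ltW.
Qed.

Lemma gdens_ge0 v x : (0 <= gdens v x)%R.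
Proof. by rewrite mulr_ge0 ?invr_ge0 ?sqrtr_ge0 ?expR_ge0. Qed.

Lemma measurable_gdens v : measurable_fun setT (gdens v : T -> R).
Proof.
apply: measurable_funM => //; apply: measurableT_comp => //.
by apply: measurable_funM => //; apply: measurableT_comp => //; exact: measurable_funX.
Qed.

Lemma measurable_gdensE v : measurable_fun setT (fun x : T => (gdens v x)%:E).
Proof. by apply/measurable_EFinP; exact: measurable_gdens. Qed.

Lemma integral_gdens v m : (0 < v)%R -> \int[leb]_x (gdens v (x - m)%R)%:E = 1.
Proof.
move=> v0; rewrite -(@integral_normal_pdf R m (Num.sqrt v)).
by apply: eq_integral => x _; rewrite gdens_pdf.
Qed.

Lemma gm_int v (f : T -> \bar R) : (0 < v)%R -> measurable_fun setT f -> (forall x, 0 <= f x) ->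
  \int[gm v]_x f x = \int[leb]_x (f x * (gdens v x)%:E).
Proof.
move=> v0 mf f0; apply: ge0_integral_density => //.
- exact: measurable_gdens.
- exact: gdens_ge0.
- move=> A mA; rewrite /gm gt_eqF //=.
  by apply: eq_integral => x _; rewrite gdens_pdf // subr0.
Qed.

Lemma gm0_int (f : T -> \bar R) : measurable_fun setT f -> \int[gm 0]_x f x = f 0%R.
Proof. by move=> mf; rewrite /gm eqxx integral_dirac // diracT mul1e. Qed.

Lemma gm0E (A : set T) : gm 0 A = \d_(0%R : T) A.
Proof. by rewrite /gm eqxx. Qed.

Opaque gm gdens.

(** Cameron-Martin on the line: the shift is a multiple of the variance, and completing the square
    gives the density. For v = 0 both sides are [f 0]. *)
Lemma gm_shift v c (f : T -> \bar R) : (0 <= v)%R -> measurable_fun setT f -> (forall x, 0 <= f x) ->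
  \int[gm v]_x f ((x:R) + c * v)%R = \int[gm v]_x (f x * (expR (c * x - c ^+ 2 * v / 2))%:E).
Proof.
move=> v0 mf f0.
have me : measurable_fun setT (fun x : T => f x * (expR (c * x - c ^+ 2 * v / 2))%:E).
  apply: emeasurable_funM => //; apply/measurable_EFinP; apply: measurableT_comp => //.
  by apply: measurable_funD => //; exact: measurable_funM.
have ms a : measurable_fun setT (fun x : T => f ((x:R) + a)%R).
  by apply: (measurableT_comp mf); exact: measurable_funD.
move: v0; rewrite le_eqVlt => /predU1P[v0|v0]; first rewrite -v0 in me *.
  by rewrite (gm0_int (ms _)) (gm0_int me) !mulr0 !mul0r subr0 expR0 mule1 addr0.
rewrite (gm_int v0 (ms _)) // (gm_int v0 me); last by move=> x; rewrite mule_ge0 ?lee_fin ?expR_ge0.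
rewrite -(@ge0_integral_shift (c * v)%R (fun x => f x * _ * _)); first last.
- by move=> x; rewrite !mule_ge0 ?lee_fin ?expR_ge0 ?gdens_ge0.
- by apply: emeasurable_funM; [exact: me|exact: measurable_gdensE].
apply: eq_integral => x _; rewrite -muleA -EFinM; congr (_ * _%:E).
Transparent gdens. rewrite /gdens. Opaque gdens. rewrite mulrCA -expRD; congr (_ * expR _)%R.
by field; rewrite gt_eqF.
Qed.

Lemma gm_conv v1 v2 (f : T -> \bar R) : (0 <= v1)%R -> (0 <= v2)%R -> measurable_fun setT f -> (forall x, 0 <= f x) ->
  \int[gm v1]_x \int[gm v2]_y f ((x:R) + y)%R = \int[gm (v1 + v2)]_x f x.
Proof.
move=> v10 v20 mf f0.
have ms a : measurable_fun setT (fun x : T => f (a + (x:R))%R).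
  by apply: (measurableT_comp mf); exact: measurable_funD.
move: v10; rewrite le_eqVlt => /predU1P[<-|v10].
  have E : measurable_fun setT (fun x : T => \int[gm v2]_y f ((x:R) + y)%R).
    apply: (@measurable_fun_fubini_tonelli_F _ _ _ _ _ (gm v2) (fun z : T * T => f ((z.1:R) + z.2)%R)) => //.
    by apply: (measurableT_comp mf); exact: measurable_funD.
  apply: (etrans (gm0_int E)); rewrite add0r.
  by apply: eq_integral => x _; rewrite add0r.
move: v20; rewrite le_eqVlt => /predU1P[<-|v20].
  by rewrite addr0; apply: eq_integral => x _; rewrite (gm0_int (ms x)) addr0.
have v12 : (0 < v1 + v2)%R by rewrite addr_gt0.
have mE : measurable_fun setT (fun x : T => \int[gm v2]_y f ((x:R) + y)%R).
  apply: (@measurable_fun_fubini_tonelli_F _ _ _ _ _ (gm v2) (fun z : T * T => f ((z.1:R) + z.2)%R)) => //.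
  by apply: (measurableT_comp mf); exact: measurable_funD.
have iE (x : T) : 0 <= \int[gm v2]_y f ((x:R) + y)%R by apply: integral_ge0.
apply: (etrans (gm_int v10 mE iE)).
have md := measurable_gdens.
have g0 := gdens_ge0.
transitivity (\int[leb]_x \int[leb]_y (f y * (gdens v2 (y - x) * gdens v1 x)%:E)).
  apply: eq_integral => x _.
  rewrite (gm_int v20 (ms x) (fun y => f0 _)) -ge0_integralZr; first last.
  - by rewrite lee_fin.
  - by move=> y _; rewrite mule_ge0 ?lee_fin.
  - by apply: emeasurable_funM => //; exact/measurable_EFinP.
  - exact: measurableT.
  rewrite -(@ge0_integral_shift x (fun y => f y * _)); first last.
  - by move=> y; rewrite mule_ge0 // lee_fin mulr_ge0.
  - apply: emeasurable_funM => //; apply/measurable_EFinP/measurable_funM => //.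
    by apply: (measurableT_comp (md _)); exact: measurable_funD.
  by apply: eq_integral => y _; rewrite -muleA -EFinM addrK (addrC x).
pose h (z : T * T) := f z.2 * (gdens v2 ((z.2 : R) - z.1) * gdens v1 z.1)%:E.
have := @fubini_tonelli _ _ _ _ _ leb leb h; rewrite /h /=.
move=> -> //; first last.
- by move=> z; rewrite mule_ge0 // lee_fin mulr_ge0.
- apply: emeasurable_funM; first exact: (measurableT_comp mf).
  apply/measurable_EFinP/measurable_funM; last exact: (measurableT_comp (md _)).
  by apply: (measurableT_comp (md _)); exact: measurable_funB.
apply: (etrans _ (esym (gm_int v12 mf f0))); apply: eq_integral => z _.
(* k z and r are the mean and the variance of the first summand when the sum equals z. The product
   of the two densities is the density of the sum times this conditional density, which integrates
   to 1. *)
pose k := (v1 / (v1 + v2))%R; pose r := (v1 * v2 / (v1 + v2))%R.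
have r0 : (0 < r)%R by rewrite divr_gt0 // mulr_gt0.
transitivity (\int[leb]_x (f z * (gdens (v1 + v2) z)%:E * (gdens r (x - k * z))%:E)).
  apply: eq_integral => x _; rewrite -muleA -EFinM; congr (_ * _%:E).
  Transparent gdens. rewrite /gdens. Opaque gdens. rewrite mulrACA [in RHS]mulrACA -!expRD -!invfM -!sqrtrM ?mulrn_wge0 ?mulr_ge0 ?pi_ge0 ?ltW //.
  have -> : (v2 * pi *+ 2 * (v1 * pi *+ 2) = (v1 + v2) * pi *+ 2 * (r * pi *+ 2) :> R)%R.
    by rewrite /r; move: (pi : R) => q; field; rewrite gt_eqF.
  congr (_ * _)%R; apply: f_equal.
  by rewrite /r /k; field; rewrite !gt_eqF.
rewrite ge0_integralZl //; first last.
- by rewrite mule_ge0 ?lee_fin.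
- by move=> x _; rewrite lee_fin.
- by apply/measurable_EFinP; apply: (measurableT_comp (md _)); exact: measurable_funB.
by rewrite integral_gdens // mule1.
Qed.

(** Likelihood ratio of N(m, v th) against N(0, v). It serves with th = 1 - v and m = v w, the law
    of X o when X one = w. *)
Lemma gm_ratio (v th m : R) (f : T -> \bar R) : (0 < v)%R -> (0 < th)%R -> measurable_fun setT f -> (forall x, 0 <= f x) ->
  \int[gm (v * th)]_x f ((x:R) + m)%R =
  \int[gm v]_x (f x * ((Num.sqrt th)^-1 * expR (x ^+ 2 / (v *+ 2) - (x - m) ^+ 2 / (v * th *+ 2)))%:E).
Proof.
move=> v0 th0 mf f0; have vt0 : (0 < v * th)%R by rewrite mulr_gt0.
have ms a : measurable_fun setT (fun x : T => f ((x:R) + a)%R).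
  by apply: (measurableT_comp mf); exact: measurable_funD.
apply: (etrans (gm_int vt0 (ms m) (fun x => f0 _))).
apply: (etrans _ (esym (@gm_int _ (fun x : T => f x * _) v0 _ _))); first last.
- by move=> x; rewrite mule_ge0 // lee_fin mulr_ge0 ?invr_ge0 ?expR_ge0.
- apply: emeasurable_funM => //; apply/measurable_EFinP; apply: measurable_funM => //.
  apply: measurableT_comp => //; apply: measurable_funB.
    by apply: measurable_funM => //; exact: measurable_funX.
  by apply: measurable_funM => //; apply: measurable_funX; exact: measurable_funB.
rewrite -(@ge0_integral_shift (- m) (fun x => f (x + m)%R * _)); first last.
- by move=> x; rewrite mule_ge0 // lee_fin gdens_ge0.
- by apply: emeasurable_funM; [exact: ms|exact: measurable_gdensE].
apply: eq_integral => x _; rewrite -muleA -EFinM subrK; congr (_ * _%:E).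
Transparent gdens. rewrite /gdens. Opaque gdens. rewrite mulrACA -expRD -invfM -sqrtrM ?ltW //.
have -> : (v * th * pi *+ 2 = th * (v * pi *+ 2) :> R)%R by move: (pi : R) => q; ring.
congr (_ * _)%R; apply: f_equal.
by field; rewrite !gt_eqF.
Qed.

End gaussian_integrals.

(** * Half-line indicators from trigonometric functions and bounded limits *)

Section trigonometric_class.
Context {R : realType}.
Variable E : (R -> R) -> Prop.
Hypothesis Ecos : forall c b, E (fun x => cos (c * x + b)).
Hypothesis ED : forall f g, E f -> E g -> E (fun x => f x + g x).
Hypothesis EZ : forall k f, E f -> E (fun x => k * f x).
Hypothesis EM : forall f g, E f -> E g -> E (fun x => f x * g x).
Hypothesis Elim : forall (f_ : nat -> R -> R) (f : R -> R) (M : R), (forall n, E (f_ n)) ->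
  (forall n x, `|f_ n x| <= M) -> (forall x, f_ n x @[n --> \oo] --> f x) -> E f.

Let Ecst k : E (fun=> k).
Proof.
have -> : (fun=> k) = (fun x : R => k * cos (0 * x + 0)) by apply/funext => x; rewrite mul0r addr0 cos0 mulr1.
exact/EZ/Ecos.
Qed.

Let EX f n : E f -> E (fun x => f x ^+ n).
Proof.
move=> Ef; elim: n => [|n IH]; first exact: Ecst.
have -> : (fun x => f x ^+ n.+1) = (fun x => f x * f x ^+ n) by apply/funext => x; rewrite exprS.
exact: EM.
Qed.

(** The partial sums of the exponential series are polynomials in f, bounded by [expR M]. *)
Let Eexp (f : R -> R) (M : R) : E f -> (forall x, `|f x| <= M) -> E (fun x => expR (f x)).
Proof.
move=> Ef fM.
apply: (@Elim (fun n x => \sum_(0 <= k < n) exp_coeff (f x) k) _ (expR M)).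
- move=> n; elim: n => [|n IH].
    rewrite [X in E X](_ : _ = fun=> 0); first exact: Ecst.
    by apply/funext => x; rewrite big_geq.
  rewrite [X in E X](_ : _ = (fun x => \sum_(0 <= k < n) exp_coeff (f x) k + n`!%:R^-1 * f x ^+ n)).
    by apply: ED => //; exact/EZ/EX.
  by apply/funext => x; rewrite big_nat_recr //= /exp_coeff /= (mulrC (f x ^+ n)).
- move=> n x; apply: (@le_trans _ _ (\sum_(0 <= k < n) exp_coeff M k)).
    apply: (le_trans (ler_norm_sum _ _ _)); apply: ler_sum => k _.
    rewrite /exp_coeff /= normrM normrX normfV normr_nat ler_wpM2r ?invr_ge0 ?ler0n //.
    by apply: lerXn2r; rewrite ?nnegrE // (le_trans _ (fM x)).
  have M0 : 0 <= M by rewrite (le_trans _ (fM 0)).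
  apply: (@nondecreasing_cvgn_le _ (series (exp_coeff M))); last exact: is_cvg_series_exp_coeff.
  by apply/nondecreasing_series => k _ _; rewrite /exp_coeff /= divr_ge0 ?exprn_ge0.
- by move=> x; exact: is_cvg_series_exp_coeff.
Qed.

Let sin_lim (t : R) : n.+1%:R * sin (t / n.+1%:R) @[n --> \oo] --> t.
Proof.
have [->|t0] := eqVneq t 0.
  under eq_fun do rewrite mul0r sin0 mulr0; exact: cvg_cst.
have [D1 D2] := is_derive_sin (0 : R).
have D3 : (fun h : R => h^-1 *: (sin (h *: (1:R) + 0) - sin 0)) @ 0^' --> (1 : R).
  rewrite cos0 in D2; rewrite -[X in _ --> X]D2; exact: D1.
have cu : t / n.+1%:R @[n --> \oo] --> 0^'.
  move=> A [e /= e0 Ae].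
  have : t / n.+1%:R @[n --> \oo] --> (0 : R).
    by rewrite -[0](mulr0 t); apply: cvgM; [exact: cvg_cst|exact: cvg_harmonic].
  move=> /cvgrPdist_lt /(_ e e0); apply: filterS => n; rewrite sub0r normrN => h.
  by apply: Ae; rewrite /= ?sub0r ?normrN // mulf_neq0 // invr_eq0 pnatr_eq0.
have : t * ((t / n.+1%:R)^-1 *: (sin ((t / n.+1%:R) *: (1 : R) + 0) - sin 0)) @[n --> \oo] --> t * 1.
  by apply: cvgM; [exact: cvg_cst|exact: (cvg_comp _ _ cu D3)].
rewrite mulr1; apply: cvg_trans; apply: near_eq_cvg.
apply: nearW => n /=; rewrite invf_div addr0 sin0 subr0 /GRing.scale /= mulr1.
by field; rewrite ?t0 ?pnatr_eq0.
Qed.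

Let cexp (u : nat -> R) l : u n @[n --> \oo] --> l -> expR (u n) @[n --> \oo] --> expR l.
Proof. by move=> h; apply: (cvg_comp u expR h); exact: continuous_expR. Qed.

(** A double exponential is used because it stays in [0, 1] whatever the sign of x - a. The
    unbounded x - a is first replaced by n sin ((x - a) / n), which is bounded for each n and tends
    to it. *)
Let Edexp (a : R) k : 0 < k -> E (fun x => expR (- expR (- (k * (x - a))))).
Proof.
move=> k0.
apply: (@Elim (fun n x => expR (- expR (- (k * (n.+1%:R * sin ((x - a) / n.+1%:R)))))) _ 1).
- move=> n.
  have Es : E (fun x => sin ((x - a) / n.+1%:R)).
    rewrite [X in E X](_ : _ = (fun x => cos (n.+1%:R^-1 * x + (- a / n.+1%:R - pi / 2)))) //.
    by apply/funext => x; rewrite addrA cosBpihalf; congr sin; ring.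
  have E1 : E (fun x => expR (- (k * (n.+1%:R * sin ((x - a) / n.+1%:R))))).
    apply: (@Eexp _ (k * n.+1%:R)) => [|x].
      rewrite [X in E X](_ : _ = (fun x => - (k * n.+1%:R) * sin ((x - a) / n.+1%:R))); first exact: EZ.
      by apply/funext => x; ring.
    rewrite normrN mulrA normrM ger0_norm; last by rewrite mulr_ge0 // ltW.
    rewrite ler_piMr //; first by rewrite mulr_ge0 // ltW.
    by rewrite -cosBpihalf cos_max.
  apply: (@Eexp _ (expR (k * n.+1%:R))) => [|x].
    rewrite [X in E X](_ : _ = (fun x => - 1 * expR (- (k * (n.+1%:R * sin ((x - a) / n.+1%:R)))))); first exact: EZ.
    by apply/funext => x; rewrite mulN1r.
  rewrite normrN ger0_norm ?expR_ge0 // ler_expR mulrA -mulrN.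
  rewrite ler_piMr //; first by rewrite mulr_ge0 // ltW.
- by move=> n x; rewrite ger0_norm ?expR_ge0 // -expR0 ler_expR oppr_le0 expR_ge0.
- move=> x; apply: cexp.
  apply: cvgN; apply: cexp; apply: cvgN.
  by apply: cvgM; [exact: cvg_cst|exact: sin_lim].
Qed.

Let cvg_natMy (c : R) : 0 < c -> n.+1%:R * c @[n --> \oo] --> +oo.
Proof.
move=> c0; apply/cvgryPge => A; near=> n; rewrite -ler_pdivrMr //.
apply: (@le_trans _ _ n%:R); last by rewrite ler_nat.
by near: n; exact: nbhs_infty_ger.
Unshelve. all: by end_near. Qed.

(** As k grows the double exponential tends to 1 to the right of a, to 0 to the left and to exp (-1)
    at a; the powers of this limit send the value at a to 0. *)
Lemma trig_class_gt (a : R) : E (fun x => ((a < x)%R%:R : R)).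
Proof.
pose chi x : R := if a < x then 1 else if x == a then expR (- 1) else 0.
have chi1 x : `|chi x| <= 1.
  rewrite /chi; case: ifP => _; rewrite ?normr1 //; case: ifP => _; rewrite ?normr0 //.
  by rewrite ger0_norm ?expR_ge0 // -expR0 ler_expR; lra.
have Ec : E chi.
  apply: (@Elim (fun n x => expR (- expR (- (n.+1%:R * (x - a))))) _ 1) => [n|n x|x].
  - exact: Edexp.
  - by rewrite ger0_norm ?expR_ge0 // -expR0 ler_expR oppr_le0 expR_ge0.
  - rewrite /chi; have [ax|xa] := ltP a x; last (move: xa; rewrite le_eqVlt => /predU1P[->|xa]).
    + have c0 := cvg_comp _ _ (@cvg_natMy (x - a) ltac:(lra)) (@cvgr_expR R).
      rewrite [X in _ --> X](_ : 1 = expR (- 0)); last by rewrite oppr0 expR0.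
      by apply: cexp; apply: cvgN; exact: c0.
    + rewrite eqxx subrr; under eq_fun do rewrite mulr0 oppr0 expR0.
      exact: cvg_cst.
    + rewrite lt_eqF //.
      have c0 := cvg_comp _ _ (@cvg_natMy (a - x) ltac:(lra)) (@cvgr_expR R).
      apply: (@squeeze_cvgr _ _ _ _ (fun=> 0) _ _ _ _ _ c0); last exact: cvg_cst.
      apply: nearW => n; rewrite expR_ge0 /= ler_expR lerN2.
      have -> : - (n.+1%:R * (x - a)) = n.+1%:R * (a - x) by ring.
      by apply: le_trans (expR_ge1Dx _); lra.
apply: (@Elim (fun n x => chi x ^+ n.+1) _ 1) => [n|n x|x].
- exact: EX.
- by rewrite normrX exprn_ile1.
- rewrite /chi; case: ltP => ax; first by under eq_fun do rewrite expr1n; exact: cvg_cst.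
  have : `|if x == a then expR (- 1) else 0 : R| < 1.
    case: ifP => _; rewrite ?normr0 // ger0_norm ?expR_ge0 // -expR0 ltr_expR; lra.
  rewrite /=; move: (if x == a then _ else _ : R) => q /cvg_expr h.
  by rewrite (cvg_shiftS (fun n => q ^+ n)).
Qed.
End trigonometric_class.

(** * Paths over an arbitrary index set and their sigma-algebra *)

Section path_space.
Context {R : realType} (I : Type).

(** Finite conjunctions of strict lower bounds, given by a list: concatenation is intersection and
    the empty list is everything, so the generators form a pi-system. *)
Definition cyl : set (set (I -> R)) :=
  [set C | exists s : seq (I * R), C = [set y | all (fun x => x.2 < y x.1) s]].

Definition path := g_sigma_algebraType cyl.

Lemma measurable_coord (i : I) : measurable_fun setT (fun y : path => y i).
Proof.
apply: (measurability _ (RGenOInfty.measurableE R)).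
move=> _ [_ [a ->] <-]; rewrite setTI; apply: sub_sigma_algebra.
exists [:: (i, a)]; apply/seteqP; split => y /=; rewrite in_itv /= andbT //.
Qed.

Lemma measurable_to_path d (T : measurableType d) (Y : I -> T -> R) :
  (forall i, measurable_fun setT (Y i)) -> measurable_fun setT (fun t : T => (fun i => Y i t) : path).
Proof.
move=> mY; apply: (@measurability _ _ _ path _ _ cyl) => // _ [_ [s ->] <-]; rewrite setTI.
elim: s => [|[i a] s IH] /=.
  by rewrite [X in measurable X](_ : _ = setT) //; apply/seteqP; split.
rewrite [X in measurable X](_ : _ = (Y i @^-1` `]a, +oo[) `&` [set t | all (fun x => x.2 < Y x.1 t) s]); last first.
  by apply/seteqP; split => t /=; rewrite in_itv /= andbT; [move=> /andP[]|move=> [-> ]].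
apply: measurableI => //; rewrite -[X in measurable X]setTI; exact: mY.
Qed.
End path_space.
Arguments path {R} I.

Lemma ge0_integral_law {R : realType} d1 d2 d3 (T : measurableType d1) (T' : measurableType d2)
  (S : measurableType d3) (P : {measure set T -> \bar R}) (P' : {measure set T' -> \bar R})
  (X : T -> S) (X' : T' -> S) (f : S -> \bar R) :
  measurable_fun setT X -> measurable_fun setT X' ->
  (forall A, measurable A -> P (X @^-1` A) = P' (X' @^-1` A)) ->
  measurable_fun setT f -> (forall y, 0 <= f y)%E ->
  (\int[P]_t f (X t) = \int[P']_t f (X' t))%E.
Proof.
move=> mX mX' E mf f0.
pose c := isMeasurableFun.Build _ _ _ _ _ mX.
pose c' := isMeasurableFun.Build _ _ _ _ _ mX'.
pose g : {mfun T >-> S} := HB.pack X c.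
pose g' : {mfun T' >-> S} := HB.pack X' c'.
transitivity (\int[pushforward P g]_y f y)%E; first by rewrite ge0_integral_pushforward.
transitivity (\int[pushforward P' g']_y f y)%E; last by rewrite ge0_integral_pushforward.
by apply: eq_measure_integral => A mA _; exact: E.
Qed.

(** * Equality of path laws from one-dimensional projections *)

Section cramer_wold.
Context {R : realType} (I : Type).
Context d d' (T : measurableType d) (T' : measurableType d').
Variables (P : probability T R) (P' : probability T' R).
Variables (Y : I -> T -> R) (Y' : I -> T' -> R).
Hypothesis mY : forall i, measurable_fun setT (Y i).
Hypothesis mY' : forall i, measurable_fun setT (Y' i).
Hypothesis lawE : forall (s : seq (R * I)) (A : set R), measurable A ->
  P [set t | A (\sum_(x <- s) x.1 * Y x.2 t)] = P' [set t | A (\sum_(x <- s) x.1 * Y' x.2 t)].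

Let lin (s : seq (R * I)) (y : I -> R) : R := \sum_(x <- s) x.1 * y x.2.

(** The cosine factor is carried along so that the class is closed under multiplication by further
    cosines, hence by the indicators that they generate. *)
Definition cwc (G : (I -> R) -> R) : Prop :=
  [/\ exists M : R, forall y, `|G y| <= M,
      measurable_fun setT (fun t => G (Y^~ t)), measurable_fun setT (fun t => G (Y'^~ t)) &
      forall s b, (\int[P]_t (G (Y^~ t) * cos (lin s (Y^~ t) + b))%:E =
                  \int[P']_t (G (Y'^~ t) * cos (lin s (Y'^~ t) + b))%:E)%E].

Let mlin s b : measurable_fun setT (fun t => cos (lin s (Y^~ t) + b)).
Proof.
apply: (measurableT_comp (f := @cos R)); first by apply: continuous_measurable_fun; exact: continuous_cos.
apply: measurable_funD => //; apply: measurable_sum => x; exact: measurable_funM.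
Qed.

Let mlin' s b : measurable_fun setT (fun t => cos (lin s (Y'^~ t) + b)).
Proof.
apply: (measurableT_comp (f := @cos R)); first by apply: continuous_measurable_fun; exact: continuous_cos.
apply: measurable_funD => //; apply: measurable_sum => x; exact: measurable_funM.
Qed.

Lemma bounded_integrable dd (S : measurableType dd) (Q : probability S R) (f : S -> R) (M : R) :
  measurable_fun setT f -> (forall t, `|f t| <= M) -> Q.-integrable setT (EFin \o f).
Proof.
move=> mf fM; apply: measurable_bounded_integrable => //.
  by rewrite -ge0_fin_numE // fin_num_measure.
exists M; split; first exact: num_real.
by move=> x Mx y _; apply: le_trans (fM y) (ltW Mx).
Qed.

Let Gcos G M s b : (forall y, `|G y| <= M) -> forall y, `|G y * cos (lin s y + b)| <= M.
Proof.
move=> GM y; rewrite normrM; apply: le_trans (GM y).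
by rewrite ler_piMr // cos_max.
Qed.

(** This is where the laws of the projections enter: the cosine is integrated against the common law
    of the linear combination. *)
Lemma cwc1 : cwc (fun=> 1).
Proof.
split=> [|//|//|s b]; first by exists 1 => y; rewrite normr1.
have mZ : measurable_fun setT (fun t => lin s (Y^~ t)) by apply: measurable_sum => x; exact: measurable_funM.
have mZ' : measurable_fun setT (fun t => lin s (Y'^~ t)) by apply: measurable_sum => x; exact: measurable_funM.
have mc : measurable_fun setT (fun x : R => cos (x + b)).
  apply: (measurableT_comp (f := @cos R)); first by apply: continuous_measurable_fun; exact: continuous_cos.
  exact: measurable_funD.
transitivity (\int[pushforward P (fun t => lin s (Y^~ t))]_x (cos (x + b))%:E)%E.
  rewrite integral_pushforward //.
  - by apply: eq_integral => t _; rewrite /= mul1r.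
  - exact/measurable_EFinP.
  - by apply: (@bounded_integrable _ _ _ _ 1) => [|t]; [exact: mlin|exact: cos_max].
transitivity (\int[pushforward P' (fun t => lin s (Y'^~ t))]_x (cos (x + b))%:E)%E.
  by apply: eq_measure_integral => A mA _; exact: lawE.
rewrite integral_pushforward //.
- by apply: eq_integral => t _; rewrite /= mul1r.
- exact/measurable_EFinP.
- by apply: (@bounded_integrable _ _ _ _ 1) => [|t]; [exact: mlin'|exact: cos_max].
Qed.

Lemma cwcD F G : cwc F -> cwc G -> cwc (fun y => F y + G y).
Proof.
move=> [[M FM] mF mF' EF] [[N GN] mG mG' EG]; split=> [|||s b].
- by exists (M + N) => y; rewrite (le_trans (ler_normD _ _)) // lerD.
- exact: measurable_funD.
- exact: measurable_funD.
have iF := @bounded_integrable _ _ P _ M (measurable_funM mF (mlin s b)) (fun t => Gcos s b FM _).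
have iG := @bounded_integrable _ _ P _ N (measurable_funM mG (mlin s b)) (fun t => Gcos s b GN _).
have iF' := @bounded_integrable _ _ P' _ M (measurable_funM mF' (mlin' s b)) (fun t => Gcos s b FM _).
have iG' := @bounded_integrable _ _ P' _ N (measurable_funM mG' (mlin' s b)) (fun t => Gcos s b GN _).
under eq_integral do rewrite mulrDl EFinD.
under [RHS]eq_integral do rewrite mulrDl EFinD.
rewrite (integralD measurableT iF iG) (integralD measurableT iF' iG').
by rewrite EF EG.
Qed.

Lemma cwcZ k G : cwc G -> cwc (fun y => k * G y).
Proof.
move=> [[N GN] mG mG' EG]; split=> [|||s b].
- by exists (`|k| * N) => y; rewrite normrM ler_wpM2l.
- exact: measurable_funM.
- exact: measurable_funM.
have iG := @bounded_integrable _ _ P _ N (measurable_funM mG (mlin s b)) (fun t => Gcos s b GN _).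
have iG' := @bounded_integrable _ _ P' _ N (measurable_funM mG' (mlin' s b)) (fun t => Gcos s b GN _).
under eq_integral do rewrite -mulrA EFinM.
under [RHS]eq_integral do rewrite -mulrA EFinM.
by rewrite (integralZl measurableT iG) (integralZl measurableT iG') EG.
Qed.

(** The product-to-sum formula turns two cosines into cosines of concatenated combinations. *)
Lemma cwc_cos G s b : cwc G -> cwc (fun y => G y * cos (lin s y + b)).
Proof.
move=> [[N GN] mG mG' EG]; split=> [|||s' b'].
- by exists N; exact: Gcos.
- by apply: measurable_funM => //; exact: mlin.
- by apply: measurable_funM => //; exact: mlin'.
have [_ _ _ E] := cwcZ 2^-1 (cwcD (And4 (ex_intro _ N GN) mG mG' EG) (And4 (ex_intro _ N GN) mG mG' EG)).
pose sN := [seq (- x.1, x.2) | x <- s'].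
have linN y : lin sN y = - lin s' y.
  by rewrite /lin /sN big_map -sumrN; apply: eq_bigr => x _ /=; rewrite mulNr.
have linc s1 s2 y : lin (s1 ++ s2) y = lin s1 y + lin s2 y by rewrite /lin big_cat.
have ce y : G y * cos (lin s y + b) * cos (lin s' y + b') =
  2^-1 * (G y * cos (lin (s ++ s') y + (b + b'))) + 2^-1 * (G y * cos (lin (s ++ sN) y + (b - b'))).
  rewrite !linc linN.
  have -> : lin s y + lin s' y + (b + b') = (lin s y + b) + (lin s' y + b') by ring.
  have -> : lin s y - lin s' y + (b - b') = (lin s y + b) - (lin s' y + b') by ring.
  by move: (lin s y + b) (lin s' y + b') => x1 x2; rewrite cosD cosB; field.
under eq_integral do rewrite ce EFinD.
under [RHS]eq_integral do rewrite ce EFinD.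
have i1 s1 b1 := @bounded_integrable _ _ P _ N (measurable_funM mG (mlin s1 b1)) (fun t => Gcos s1 b1 GN _).
have i2 s1 b1 := @bounded_integrable _ _ P' _ N (measurable_funM mG' (mlin' s1 b1)) (fun t => Gcos s1 b1 GN _).
rewrite !integralD //; try by [under eq_fun do rewrite EFinM; apply: integrableZl => //; first exact: i1|
  under eq_fun do rewrite EFinM; apply: integrableZl => //; first exact: i2].
under eq_integral do rewrite EFinM.
under [X in (_ + X)%E = _]eq_integral do rewrite EFinM.
under [X in _ = (X + _)%E]eq_integral do rewrite EFinM.
under [X in _ = (_ + X)%E]eq_integral do rewrite EFinM.
rewrite (integralZl measurableT (i1 _ _)) (integralZl measurableT (i1 _ _)).
by rewrite (integralZl measurableT (i2 _ _)) (integralZl measurableT (i2 _ _)) !EG.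
Qed.

Lemma cwc_lim (G_ : nat -> (I -> R) -> R) G M : (forall n, cwc (G_ n)) ->
  (forall n y, `|G_ n y| <= M) -> (forall y, G_ n y @[n --> \oo] --> G y) -> cwc G.
Proof.
move=> cG GM Gl.
have GM' y : `|G y| <= M.
  have h : `|G_ n y| @[n --> \oo] --> `|G y| by apply: cvg_norm; exact: Gl.
  by rewrite -(cvg_lim _ h) //; apply: limr_le; [exact: cvgP h|exact: nearW].
have mG : measurable_fun setT (fun t => G (Y^~ t)).
  by apply: (measurable_fun_cvg (h := fun n t => G_ n (Y^~ t))) => [n|t _]; [have [] := cG n|exact: Gl].
have mG' : measurable_fun setT (fun t => G (Y'^~ t)).
  by apply: (measurable_fun_cvg (h := fun n t => G_ n (Y'^~ t))) => [n|t _]; [have [] := cG n|exact: Gl].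
split=> [|//|//|s b]; first by exists M.
have dc dd (S : measurableType dd) (Q : probability S R) (V : I -> S -> R) :
  (forall n, measurable_fun setT (fun t => G_ n (V^~ t))) -> measurable_fun setT (fun t => G (V^~ t)) ->
  measurable_fun setT (fun t => cos (lin s (V^~ t) + b)) ->
  (\int[Q]_t (G_ n (V^~ t) * cos (lin s (V^~ t) + b))%:E @[n --> \oo] --> \int[Q]_t (G (V^~ t) * cos (lin s (V^~ t) + b))%:E)%E.
  move=> m1 m2 m3.
  have [] := @dominated_convergence _ _ _ Q setT measurableT
    (fun n t => (G_ n (V^~ t) * cos (lin s (V^~ t) + b))%:E) (fun t => (G (V^~ t) * cos (lin s (V^~ t) + b))%:E) (fun=> M%:E).
  - by move=> n; apply/measurable_EFinP/measurable_funM.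
  - by apply/measurable_EFinP/measurable_funM.
  - by apply/aeW => t _; apply: cvg_EFin; [exact: nearW|apply: cvgM; [exact: Gl|exact: cvg_cst]].
  - exact: finite_measure_integrable_cst.
  - by apply/aeW => t n _; rewrite lee_fin; exact: Gcos.
  by [].
have h1 := dc _ _ P Y (fun n => let: And4 _ m _ _ := cG n in m) mG (mlin s b).
have h2 := dc _ _ P' Y' (fun n => let: And4 _ _ m _ := cG n in m) mG' (mlin' s b).
rewrite -(cvg_lim _ h1) // -(cvg_lim _ h2) //; congr (lim (_ @ \oo)%classic); apply/funext => n.
by have [_ _ _] := cG n.
Qed.

Lemma cwc_gt G i a : cwc G -> cwc (fun y => G y * (a < y i)%R%:R).
Proof.
(* [E psi] demands that multiplication by psi (y i) preserve the class for every G. In this form a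
   product of two such functions is a composition, and [trig_class_gt] applies. *)
move: G; pose E (psi : R -> R) := (exists M : R, forall x, `|psi x| <= M) /\
   forall G, cwc G -> cwc (fun y => G y * psi (y i)).
suff : E (fun x => (a < x)%R%:R) by move=> [_].
apply: trig_class_gt.
- move=> c b; split; first by exists 1 => x; exact: cos_max.
  move=> G cG; have := cwc_cos [:: (c, i)] b cG.
  by rewrite /lin; under eq_fun do rewrite big_seq1.
- move=> f g [[M fM] Ef] [[N gN] Eg]; split.
    by exists (M + N) => x; rewrite (le_trans (ler_normD _ _)) // lerD.
  by move=> G cG; under eq_fun do rewrite mulrDr; apply: cwcD; [exact: Ef|exact: Eg].
- move=> k f [[M fM] Ef]; split; first by exists (`|k| * M) => x; rewrite normrM ler_wpM2l.
  by move=> G cG; under eq_fun do rewrite mulrCA; exact/cwcZ/Ef.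
- move=> f g [[M fM] Ef] [[N gN] Eg]; split.
    by exists (M * N) => x; rewrite normrM ler_pM.
  by move=> G cG; under eq_fun do rewrite mulrA; exact/Eg/Ef.
- move=> f_ f M Ef fM fl; split.
    exists M => x; have h : `|f_ n x| @[n --> \oo] --> `|f x| by apply: cvg_norm; exact: fl.
    by rewrite -(cvg_lim _ h) //; apply: limr_le; [exact: cvgP h|exact: nearW].
  move=> G cG; have [[N GN] _ _ _] := cG.
  apply: (@cwc_lim (fun n y => G y * f_ n (y i)) _ (N * M)) => [n|n y|y].
  + exact: (Ef n).2.
  + by rewrite normrM ler_pM.
  + by apply: cvgM; [exact: cvg_cst|exact: fl].
Qed.

(** The indicator of a cylinder is a product of half-line indicators, so it lies in the class;
    finite measures that agree on a pi-system agree. *)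
Lemma path_measureE (A : set (path I)) : measurable A ->
  P [set t | A (Y^~ t)] = P' [set t | A (Y'^~ t)].
Proof.
have mp := measurable_to_path mY; have mp' := measurable_to_path mY'.
pose cm := isMeasurableFun.Build _ _ _ _ _ mp.
pose cm' := isMeasurableFun.Build _ _ _ _ _ mp'.
pose cf : {mfun T >-> path I} := HB.pack (fun t => Y^~ t : path I) cm.
pose cf' : {mfun T' >-> path I} := HB.pack (fun t => Y'^~ t : path I) cm'.
have [m1 m1E] : exists m1 : {measure set (path I) -> \bar R}, forall A, m1 A = P [set t | A (Y^~ t)].
  by unshelve refine (ex_intro _ (pushforward P cf : {measure set (path I) -> \bar R}) _).
have [m2 m2E] : exists m2 : {measure set (path I) -> \bar R}, forall A, m2 A = P' [set t | A (Y'^~ t)].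
  by unshelve refine (ex_intro _ (pushforward P' cf' : {measure set (path I) -> \bar R}) _).
move=> mA; rewrite -m1E -m2E.
have H := @g_sigma_algebra_measure_unique _ R (path I) (@cyl R I) (@sub_sigma_algebra _ _ _) (fun=> setT) _ _ m1 m2 _ _ _ A mA.
apply: H.
- by move=> _; exists [::]; apply/seteqP; split.
- by rewrite bigcup_const //; exists 0%N.
- move=> _ _ [s ->] [s' ->]; exists (s ++ s'); apply/seteqP; split => y /=; rewrite all_cat; last by move=> /andP.
  by move=> [-> ->].
- move=> _ [s ->]; rewrite m1E m2E.
  have cs : cwc (fun y => \1_[set y | all (fun x => x.2 < y x.1) s] y).
    elim: s => [|[i a] s IH] /=.
      have := cwc1; congr cwc; apply/funext => y; by rewrite indicE mem_set.
    have := cwc_gt i a IH; congr cwc; apply/funext => y; rewrite !indicE.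
    have mI (Q : (I -> R) -> bool) : (y \in [set y0 | Q y0]) = Q y by apply/idP/idP; rewrite inE.
    by rewrite !mI -natrM mulnb andbC.
  have mA' : measurable ([set y | all (fun x => x.2 < y x.1) s] : set (path I)) by apply: sub_sigma_algebra; exists s.
  have [_ _ _ /(_ [::] 0)] := cs.
  rewrite /lin; under eq_integral do rewrite big_nil addr0 cos0 mulr1.
  under [RHS]eq_integral do rewrite big_nil addr0 cos0 mulr1.
  rewrite -[X in X = _ -> _]/(\int[P]_t (\1_(cf @^-1` [set y | all (fun x => x.2 < y x.1) s]) t)%:E)%E.
  rewrite -[X in _ = X -> _]/(\int[P']_t (\1_(cf' @^-1` [set y | all (fun x => x.2 < y x.1) s]) t)%:E)%E.
  rewrite !integral_indic //; first by rewrite !setIT.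
  + by rewrite -[X in measurable X]setTI; apply: (measurable_to_path mY').
  + by rewrite -[X in measurable X]setTI; apply: (measurable_to_path mY).
- by move=> _; rewrite m1E; apply: (le_lt_trans (probability_le1 P _) (ltry _)); exact: measurableT.
Qed.

Theorem path_integralE (f : path I -> \bar R) : measurable_fun setT f -> (forall y, 0 <= f y)%E ->
  (\int[P]_t f (Y^~ t) = \int[P']_t f (Y'^~ t))%E.
Proof.
move=> mf f0.
apply: (@ge0_integral_law _ _ _ _ _ _ (path I) P P' (fun t => Y^~ t : path I) (fun t => Y'^~ t : path I)) => //.
- exact: measurable_to_path.
- exact: measurable_to_path.
- exact: path_measureE.
Qed.
End cramer_wold.

(** * Linear Gaussian fields: isometry, decoupling, tilting *)

Section gaussian_fields.
Context {R : realType} (V : lmodType R) d (T : measurableType d) (P : probability T R).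

(** The field is linear in its index for every sample, so all joint laws are encoded in the laws of
    the single variables [X v]. The covariance [gip] is only semidefinite. *)
Record gfield := GField {
  gX :> V -> T -> R ;
  gip : V -> V -> R ;
  gX_meas : forall v, measurable_fun setT (gX v) ;
  gX_lin : forall a u v t, gX (a *: u + v) t = a * gX u t + gX v t ;
  gip_sym : forall u v, gip u v = gip v u ;
  gip_lin : forall a u v w, gip (a *: u + v) w = a * gip u w + gip v w ;
  gip_ge0 : forall v, 0 <= gip v v ;
  gX_law : forall v A, measurable A -> P [set t | A (gX v t)] = gm (gip v v) A }.

Variable X : gfield.
Local Notation ip := (gip X).

Lemma gX0 t : X 0 t = 0.
Proof. by have := gX_lin X 1 0 0 t; rewrite scaler0 addr0 mul1r => h; lra. Qed.
Lemma gXD u v t : X (u + v) t = X u t + X v t.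
Proof. by rewrite -[u in LHS]scale1r gX_lin mul1r. Qed.
Lemma gXZ a u t : X (a *: u) t = a * X u t.
Proof. by rewrite -[_ *: _]addr0 gX_lin gX0 addr0. Qed.
Lemma gXN u t : X (- u) t = - X u t.
Proof. by rewrite -scaleN1r gXZ mulN1r. Qed.
Lemma gXB u v t : X (u - v) t = X u t - X v t.
Proof. by rewrite gXD gXN. Qed.
Lemma gXsum (I : Type) (s : seq I) (p : pred I) (F : I -> V) t :
  X (\sum_(i <- s | p i) F i) t = \sum_(i <- s | p i) X (F i) t.
Proof.
elim/big_rec2: _ => [|i y1 y2 _ <-]; first exact: gX0.
by rewrite gXD.
Qed.
Lemma gip0l w : ip 0 w = 0.
Proof. by have := gip_lin X 1 0 0 w; rewrite scaler0 addr0 mul1r => h; lra. Qed.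
Lemma gipDl u v w : ip (u + v) w = ip u w + ip v w.
Proof. by rewrite -[u in LHS]scale1r gip_lin mul1r. Qed.
Lemma gipZl a u w : ip (a *: u) w = a * ip u w.
Proof. by rewrite -[_ *: _]addr0 gip_lin gip0l addr0. Qed.
Lemma gipNl u w : ip (- u) w = - ip u w.
Proof. by rewrite -scaleN1r gipZl mulN1r. Qed.
Lemma gipBl u v w : ip (u - v) w = ip u w - ip v w.
Proof. by rewrite gipDl gipNl. Qed.
Lemma gip0r w : ip w 0 = 0. Proof. by rewrite gip_sym gip0l. Qed.
Lemma gipDr u v w : ip w (u + v) = ip w u + ip w v.
Proof. by rewrite !(gip_sym _ w) gipDl. Qed.
Lemma gipZr a u w : ip w (a *: u) = a * ip w u.
Proof. by rewrite !(gip_sym _ w) gipZl. Qed.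
Lemma gipNr u w : ip w (- u) = - ip w u.
Proof. by rewrite !(gip_sym _ w) gipNl. Qed.
Lemma gipBr u v w : ip w (u - v) = ip w u - ip w v.
Proof. by rewrite !(gip_sym _ w) gipBl. Qed.
Lemma gipsuml (I : Type) (s : seq I) (p : pred I) (F : I -> V) w :
  ip (\sum_(i <- s | p i) F i) w = \sum_(i <- s | p i) ip (F i) w.
Proof.
elim/big_rec2: _ => [|i y1 y2 _ <-]; first exact: gip0l.
by rewrite gipDl.
Qed.
Lemma gipsumr (I : Type) (s : seq I) (p : pred I) (F : I -> V) w :
  ip w (\sum_(i <- s | p i) F i) = \sum_(i <- s | p i) ip w (F i).
Proof. by rewrite gip_sym gipsuml; apply: eq_bigr => i _; rewrite gip_sym. Qed.

Definition gipE := (gipDl, gipDr, gipBl, gipBr, gipNl, gipNr, gipZl, gipZr).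
Definition gXE := (gXD, gXB, gXN, gXZ).

Lemma gip_norm0 e v : ip e e = 0 -> ip v e = 0.
Proof.
move=> e0; have [->//|n0] := eqVneq (ip v e) 0.
(* The multiple of e is chosen so that this vector would have squared norm ip v v - (ip v v + 1) =
   -1. *)
have := gip_ge0 X (v - ((ip v v + 1) / (2 * ip v e)) *: e).
rewrite !gipE e0 (gip_sym _ e v) !mulr0; move: (ip v v) (ip v e) n0 => a b b0.
have -> : (a + 1) / (2 * b) * b = (a + 1) / 2 by field.
by move=> h; exfalso; lra.
Qed.

Lemma gX_int v (f : R -> \bar R) : measurable_fun setT f -> (forall x, 0 <= f x)%E ->
  (\int[P]_t f (X v t) = \int[gm (ip v v)]_x f x)%E.
Proof.
move=> mf f0; apply: (@ge0_integral_law _ _ _ _ _ _ _ P (gm (ip v v)) (X v) id) => //.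
- exact: gX_meas.
- by move=> A mA; exact: gX_law.
Qed.

Lemma gX_path (I : Type) (phi : I -> V) : measurable_fun setT (fun t => (fun i => X (phi i) t) : path I).
Proof. by apply: measurable_to_path => i; exact: gX_meas. Qed.

(** Linear combinations with the same coefficients have equal norms, hence equal laws, and the
    projections determine the law of the path. *)
Lemma gX_isometry (I : Type) (phi psi : I -> V) (f : path I -> \bar R) :
  (forall i j, ip (phi i) (phi j) = ip (psi i) (psi j)) ->
  measurable_fun setT f -> (forall y, 0 <= f y)%E ->
  (\int[P]_t f (fun i => X (phi i) t) = \int[P]_t f (fun i => X (psi i) t))%E.
Proof.
move=> E mf f0.
apply: (@path_integralE R I _ _ T T P P (fun i => X (phi i)) (fun i => X (psi i))) => //.
- by move=> i; exact: gX_meas.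
- by move=> i; exact: gX_meas.
move=> s A mA.
have sE ch : (fun t => \sum_(x <- s) x.1 * X (ch x.2) t) = X (\sum_(x <- s) x.1 *: (ch x.2 : V)).
  by apply/funext => t; rewrite gXsum; apply: eq_bigr => x _; rewrite gXZ.
have := sE phi; have := sE psi => E1 E2.
rewrite -[X in P X = _]/[set t | A ((fun t => \sum_(x <- s) x.1 * X (phi x.2) t) t)] E2.
rewrite -[X in _ = P X]/[set t | A ((fun t => \sum_(x <- s) x.1 * X (psi x.2) t) t)] E1.
rewrite (gX_law X _ mA) (gX_law X _ mA); congr (gm _ A).
rewrite !gipsuml; apply: eq_bigr => x _; rewrite !gipsumr; apply: eq_bigr => y _.
by rewrite !gipZl !gipZr E.
Qed.

(** Orthogonal families are independent, so the second may be read on a second copy of the sample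
    space: on the product every linear combination keeps its law, by [gm_conv]. *)
Lemma gX_decouple (I : Type) (phi psi : I -> V) (f : path I -> \bar R) :
  (forall i j, ip (phi i) (psi j) = 0) ->
  measurable_fun setT f -> (forall y, 0 <= f y)%E ->
  (\int[P]_t f (fun i => X (phi i + psi i)%R t) =
   \int[P]_t \int[P]_t' f (fun i => (X (phi i) t + X (psi i) t')%R))%E.
Proof.
move=> E mf f0.
have mY i : measurable_fun setT (fun z : T * T => X (phi i) z.1 + X (psi i) z.2).
  by apply: measurable_funD; apply: (measurableT_comp (gX_meas X _)).
transitivity (\int[(P \x P)%E]_z f (fun i => (X (phi i) z.1 + X (psi i) z.2)%R))%E; last first.
  rewrite fubini_tonelli1 //; apply: (measurableT_comp mf).
  exact: (measurable_to_path mY).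
apply: (@path_integralE R I _ _ T _ P (P \x P)%E (fun i => X (phi i + psi i)) (fun i z => X (phi i) z.1 + X (psi i) z.2)) => //.
  by move=> i; exact: gX_meas.
move=> s A mA.
pose a := \sum_(x <- s) x.1 *: phi x.2; pose b := \sum_(x <- s) x.1 *: psi x.2.
have Ea t : X a t = \sum_(x <- s) x.1 * X (phi x.2) t.
  by rewrite gXsum; apply: eq_bigr => x _; rewrite gXZ.
have Eb t : X b t = \sum_(x <- s) x.1 * X (psi x.2) t.
  by rewrite gXsum; apply: eq_bigr => x _; rewrite gXZ.
have -> : [set t | A (\sum_(x <- s) x.1 * X (phi x.2 + psi x.2) t)] = [set t | A (X (a + b) t)].
  have Es t : X (a + b) t = \sum_(x <- s) x.1 * X (phi x.2 + psi x.2) t.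
    by rewrite gXD Ea Eb -big_split /=; apply: eq_bigr => x _; rewrite gXD mulrDr.
  by apply/seteqP; split => t /=; rewrite Es.
have -> : [set z : T * T | A (\sum_(x <- s) x.1 * (X (phi x.2) z.1 + X (psi x.2) z.2))] = [set z | A (X a z.1 + X b z.2)].
  have Es (z : T * T) : X a z.1 + X b z.2 = \sum_(x <- s) x.1 * (X (phi x.2) z.1 + X (psi x.2) z.2).
    by rewrite Ea Eb -big_split /=; apply: eq_bigr => x _; rewrite mulrDr.
  by apply/seteqP; split => z /=; rewrite Es.
have mab : measurable_fun setT (fun z : T * T => X a z.1 + X b z.2).
  by apply: measurable_funD; apply: (measurableT_comp (gX_meas X _)).
have mfA : measurable_fun setT (fun x : R => (\1_A x)%:E : \bar R).
  by apply/measurable_EFinP; exact: measurable_indic.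
rewrite (gX_law X _ mA).
have mS : measurable [set z : T * T | A (X a z.1 + X b z.2)].
  by rewrite -[X in measurable X]setTI; exact: mab.
transitivity (\int[(P \x P)%E]_z ((\1_A (X a z.1 + X b z.2))%:E : \bar R))%E; last first.
  transitivity ((P \x P)%E ([set z : T * T | A (X a z.1 + X b z.2)] `&` setT)); last by rewrite setIT.
  by rewrite -integral_indic.
rewrite fubini_tonelli1 /fubini_F //=; last exact: (measurableT_comp mfA mab).
have -> : ip (a + b) (a + b) = ip a a + ip b b.
  have ab0 : ip a b = 0.
    rewrite gipsuml big1 // => x _; rewrite gipsumr big1 // => y _.
    by rewrite gipZl gipZr E !mulr0.
  by rewrite !gipE (gip_sym _ b a) ab0; ring.
have m2 (x : R) : measurable_fun setT (fun y : R => (\1_A (x + y))%:E : \bar R).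
  by apply: (measurableT_comp mfA); exact: measurable_funD.
transitivity (\int[P]_t \int[gm (ip b b)]_y ((\1_A ((X a t : R) + y)%R)%:E : \bar R))%E; last first.
  apply: eq_integral => t _.
  by apply: esym; apply: (@gX_int b (fun y => (\1_A (X a t + y)%R)%:E)) => [|x]; [exact: m2|rewrite lee_fin].
rewrite (@gX_int a (fun x => \int[gm (ip b b)]_y ((\1_A (x + y)%R)%:E : \bar R))%E); last 2 first.
- apply: (@measurable_fun_fubini_tonelli_F _ _ _ _ _ (gm (ip b b)) (fun z : R * R => (\1_A (z.1 + z.2)%R)%:E)) => //.
  + by apply: (measurableT_comp mfA); exact: measurable_funD.
- by move=> x; apply: integral_ge0 => y _; rewrite lee_fin.
have A0 (x : R) : (0 <= (\1_A x)%:E :> \bar R)%E by rewrite lee_fin.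
apply: (etrans _ (esym (gm_conv (gip_ge0 X a) (gip_ge0 X b) mfA A0))).
by rewrite integral_indic // setIT.
Qed.

Lemma gX_tilt (I : Type) (phi : I -> V) (e : V) (f : path I -> \bar R) :
  measurable_fun setT f -> (forall y, 0 <= f y)%E ->
  (\int[P]_t f (fun i => (X (phi i) t + ip (phi i) e)%R) =
   \int[P]_t ((expR (X e t - ip e e / 2))%:E * f (fun i => X (phi i) t)))%E.
Proof.
move=> mf f0.
(* [None] indexes e itself, so that the density becomes a functional of the path. Each vector is
   split into its part along e, with coefficient [al], and the orthogonal rest [ps]; the tilt moves
   only the former. *)
pose J := option I.
pose al (j : J) : R := ip (if j is Some i then phi i else e) e / ip e e.
pose ps (j : J) : V := (if j is Some i then phi i else e) - al j *: e.
have [e0|e0] := eqVneq (ip e e) 0.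
  (* If e has norm zero, X e vanishes almost surely and the density is 1. *)
  have Xe : (\int[P]_t ((expR (X e t - ip e e / 2))%:E * f (fun i => X (phi i) t)) = \int[P]_t f (fun i => X (phi i) t))%E.
    apply: ge0_ae_eq_integral => //.
    - apply: emeasurable_funM; last exact: (measurableT_comp mf (gX_path phi)).
      apply/measurable_EFinP; apply: measurableT_comp => //.
      by apply: measurable_funB => //; exact: gX_meas.
    - exact: (measurableT_comp mf (gX_path phi)).
    - by move=> t _; rewrite mule_ge0 // lee_fin expR_ge0.
    exists [set t | (~` [set 0]) (X e t)]; split.
    - rewrite -[X in measurable X]setTI; apply: gX_meas => //; exact: measurableC.
    - have mC : measurable (~` [set (0 : R)]) by exact: measurableC.
      apply: (etrans (gX_law X e mC)).
      by rewrite e0 gm0E diracE memNset //=; apply.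
    - move=> t /= h Xt0; apply: h => _; rewrite Xt0 e0 mul0r subr0 expR0 mul1e //.
  rewrite Xe; apply: eq_integral => t _; congr f; apply/funext => i.
  by rewrite (gip_norm0 _ e0) addr0.
have psE j : ip e (ps j) = 0.
  by rewrite /ps gipBr gipZr (gip_sym _ e) /al divfK ?subrr.
have gE (c : R) (G : path J -> \bar R) : measurable_fun setT G -> (forall y, 0 <= G y)%E ->
   (\int[P]_t G (fun j => X (if j is Some i then phi i else e) t) =
    \int[P]_t \int[P]_t' G (fun j => (X (al j *: e) t + X (ps j) t')%R))%E.
  move=> mG G0; rewrite -gX_decouple //.
    by apply: eq_integral => t _; congr G; apply/funext => j; rewrite /ps addrC subrK.
  by move=> i j; rewrite gipZl psE mulr0.
have m0 : measurable_fun setT (fun y : @path R J => (fun i => y (Some i)) : @path R I).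
  by apply: (measurable_to_path (Y := fun i (y : @path R J) => y (Some i))) => i; exact: measurable_coord.
have mX1 (G : path J -> \bar R) : measurable_fun setT G -> (forall y, 0 <= G y)%E ->
   (\int[P]_t \int[P]_t' G (fun j => (X (al j *: e) t + X (ps j) t')%R) =
    \int[gm (ip e e)]_x \int[P]_t' G (fun j => (al j * x + X (ps j) t')%R))%E.
  move=> mG G0.
  have mGG : measurable_fun setT (fun x : R => \int[P]_t' G (fun j => (al j * x + X (ps j) t')%R))%E.
    apply: (@measurable_fun_fubini_tonelli_F _ _ _ _ _ P (fun z : R * T => G (fun j => (al j * z.1 + X (ps j) z.2)%R))) => //.
    apply: (measurableT_comp mG); apply: (measurable_to_path (Y := fun j (z : R * T) => (al j * z.1 + X (ps j) z.2)%R)) => j.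
    by apply: measurable_funD; [exact: measurable_funM|apply: (measurableT_comp (gX_meas X _))].
  have GG0 (x : R) : (0 <= \int[P]_t' G (fun j => (al j * x + X (ps j) t')%R))%E by apply: integral_ge0.
  apply: (etrans _ (gX_int e mGG GG0)).
  by apply: eq_integral => t _; apply: eq_integral => t' _; congr G; apply/funext => j; rewrite gXZ.
(* G1 is the shifted functional and G2 the tilted one. Once decoupled, they are related by
   [gm_shift] with c = 1 in the variable X e, the rest being fixed. *)
pose G1 (y : path J) := f (fun i => (y (Some i) + ip (phi i) e)%R).
pose G2 (y : path J) := ((expR (y None - ip e e / 2))%:E * f (fun i => y (Some i)))%E.
have mG1 : measurable_fun setT G1.
  apply: (measurableT_comp mf).
  apply: (measurable_to_path (Y := fun i (y : @path R J) => (y (Some i) + ip (phi i) e)%R)) => i.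
  by apply: measurable_funD => //; exact: measurable_coord.
have mG2 : measurable_fun setT G2.
  apply: emeasurable_funM; last exact: (measurableT_comp mf m0).
  apply/measurable_EFinP; apply: measurableT_comp => //.
  by apply: measurable_funB => //; exact: measurable_coord.
have G10 y : (0 <= G1 y)%E by exact: f0.
have G20 y : (0 <= G2 y)%E by rewrite mule_ge0 // lee_fin expR_ge0.
have E1 := gE 0 G1 mG1 G10; have E2 := gE 0 G2 mG2 G20.
rewrite (etrans E1 (mX1 _ mG1 G10)) (etrans E2 (mX1 _ mG2 G20)) /G1 /G2.
have mH : measurable_fun setT (fun x : R => \int[P]_t' f (fun i => (al (Some i) * x + X (ps (Some i)) t')%R))%E.
  apply: (@measurable_fun_fubini_tonelli_F _ _ _ _ _ P (fun z : R * T => f (fun j => (al (Some j) * z.1 + X (ps (Some j)) z.2)%R))) => //.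
  apply: (measurableT_comp mf); apply: (measurable_to_path (Y := fun j (z : R * T) => (al (Some j) * z.1 + X (ps (Some j)) z.2)%R)) => j.
  by apply: measurable_funD; [exact: measurable_funM|apply: (measurableT_comp (gX_meas X _))].
have H0 (x : R) : (0 <= \int[P]_t' f (fun i => (al (Some i) * x + X (ps (Some i)) t')%R))%E by apply: integral_ge0.
have := @gm_shift _ (ip e e) 1 _ (gip_ge0 X e) mH H0.
under eq_integral => x _.
  rewrite (_ : (\int[P]_t' _)%E = \int[P]_t' f (fun i => (al (Some i) * x + X (ps (Some i)) t' + ip (phi i) e)%R))%E; first over.
  apply: eq_integral => t' _; congr f; apply/funext => i.
  by rewrite mul1r mulrDr addrAC /al divfK.
move=> ->; apply: eq_integral => x _.
have mf2 : measurable_fun setT (fun t' : T => f (fun i => (al (Some i) * x + X (ps (Some i)) t')%R)).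
  apply: (measurableT_comp mf); apply: (measurable_to_path (Y := fun j (t : T) => (al (Some j) * x + X (ps (Some j)) t)%R)) => j.
  by apply: measurable_funD => //; exact: gX_meas.
have k0 : (0 <= (expR (1 * x - 1 ^+ 2 * ip e e / 2))%:E :> \bar R)%E by rewrite lee_fin expR_ge0.
rewrite -(@ge0_integralZr _ _ _ P setT measurableT _ mf2 _ (fun t _ => f0 _) k0).
apply: eq_integral => t' _; rewrite muleC; congr ((expR _)%:E * _)%E.
rewrite /ps /al divff // scale1r subrr gX0; ring.
Qed.
End gaussian_fields.

(** * Nonnegative integrals; level crossings and maxima of finite sequences *)

Section integral_wrappers.
Context {R : realType} d (T : measurableType d) (P : {measure set T -> \bar R}).
Implicit Types f g : T -> \bar R.
Local Open Scope ereal_scope.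

Lemma int_le f g : measurable_fun setT f -> measurable_fun setT g ->
  (forall t, 0 <= f t) -> (forall t, f t <= g t) -> \int[P]_t f t <= \int[P]_t g t.
Proof.
move=> mf mg f0 fg; apply: ge0_le_integral => // t _; exact: fg.
Qed.

Lemma int_Zl (k : R) f : (0 <= k)%R -> measurable_fun setT f -> (forall t, 0 <= f t) ->
  \int[P]_t (k%:E * f t) = k%:E * \int[P]_t f t.
Proof. by move=> k0 mf f0; exact: ge0_integralZl_EFin. Qed.

Lemma int_D f g : measurable_fun setT f -> measurable_fun setT g ->
  (forall t, 0 <= f t) -> (forall t, 0 <= g t) ->
  \int[P]_t (f t + g t) = \int[P]_t f t + \int[P]_t g t.
Proof. by move=> mf mg f0 g0; exact: ge0_integralD. Qed.

Lemma int_sum N (F : nat -> T -> \bar R) : (forall k, measurable_fun setT (F k)) ->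
  (forall k t, 0 <= F k t) ->
  \int[P]_t (\sum_(k < N) F k t) = \sum_(k < N) \int[P]_t F k t.
Proof. by move=> mF F0; exact: ge0_integral_sum. Qed.

Lemma measurable_bigsum N (F : nat -> T -> \bar R) : (forall k, measurable_fun setT (F k)) ->
  measurable_fun setT (fun t => \sum_(k < N) F k t).
Proof. by move=> mF; apply: emeasurable_sum. Qed.

Lemma sum_nonneg N (F : nat -> \bar R) : (forall k, 0 <= F k) -> 0 <= \sum_(k < N) F k.
Proof. by move=> F0; apply: sume_ge0. Qed.
End integral_wrappers.

Lemma int_cst1 {R : realType} d (T : measurableType d) (P : probability T R) (k : \bar R) :
  (\int[P]_t k = k)%E.
Proof. by rewrite integral_cst // -[RHS]mule1; congr (_ * _)%E; exact: probability_setT. Qed.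

Ltac mreal := repeat first [ assumption | exact: measurable_cst | exact: gX_meas | exact: measurable_coord
  | exact: measurable_id
  | apply: measurable_funB | apply: measurable_funD | apply: measurable_funM
  | (apply: measurable_expRf)
  | apply: measurable_maxr | apply: measurable_fun_ltr | apply: measurable_fun_ler
  | apply: measurable_and | apply: measurable_or ].

Section bool_events.
Context {R : realType}.

Lemma measurable_set_bool d (T : measurableType d) (b : T -> bool) :
  measurable_fun setT b -> measurable [set t | b t].
Proof.
move=> mb; have := mb measurableT [set true] I; rewrite setTI; congr measurable.
Qed.

Lemma measurable_nat_bool d (T : measurableType d) (b : T -> bool) :
  measurable_fun setT b -> measurable_fun setT (fun t => (b t)%:R%:E : \bar R).
Proof.
move=> mb; apply/measurable_EFinP.
have -> : (fun t => (b t)%:R) = \1_[set t | b t] :> (T -> R).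
  by apply/funext => t; rewrite indicE; congr (_%:R); congr nat_of_bool; apply/idP/idP; rewrite inE.
by apply: measurable_indic; exact: measurable_set_bool.
Qed.

Lemma integral_bool d (T : measurableType d) (P : probability T R) (b : T -> bool) :
  measurable_fun setT b -> (\int[P]_t (b t)%:R%:E = P [set t | b t])%E.
Proof.
move=> mb; have mB := measurable_set_bool mb.
transitivity (P ([set t | b t] `&` setT)); last by rewrite setIT.
rewrite -integral_indic //; apply: eq_integral => t _; rewrite indicE; congr (_%:R%:E); congr nat_of_bool.
by apply/idP/idP; rewrite inE.
Qed.

(** Boolean-valued, so that a crossing splits by first passage into a sum of zeros and ones. *)
Fixpoint hits N (a : R) (y : nat -> R) : bool :=
  if N is k.+1 then hits k a y || (a < y k) else false.

Definition fhit (a : R) (y : nat -> R) k : bool := ~~ hits k a y && (a < y k).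

(** The floor 0 makes [rmax] nonnegative even for the empty sequence; for levels a >= 0 passing the
    maximum is the same as [hits]. *)
Fixpoint rmax N (y : nat -> R) : R :=
  if N is k.+1 then Num.max (rmax k y) (y k) else 0.

Lemma hitsP N a y : reflect (exists2 k, (k < N)%N & a < y k) (hits N a y).
Proof.
elim: N => [|N IH] /=; first by constructor => -[].
apply: (iffP orP) => [[/IH[k kN ak]|aN]|[k]].
- by exists k => //; rewrite ltnS ltnW.
- by exists N.
- rewrite ltnS leq_eqVlt => /predU1P[->|kN] ak; [by right|].
  by left; apply/IH; exists k.
Qed.

Lemma hits_sum N a y : (hits N a y)%:R = \sum_(k < N) (fhit a y k)%:R :> R.
Proof.
elim: N => [|N IH] /=; first by rewrite big_ord0.
rewrite big_ord_recr /= -IH /fhit.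
by case: (hits N a y) => //=; rewrite ?addr0 ?add0r.
Qed.

Lemma hits_ext N a y y' : (forall k, (k < N)%N -> y k = y' k) -> hits N a y = hits N a y'.
Proof.
move=> E; apply/hitsP/hitsP => -[k kN ak]; exists k => //; first by rewrite -E.
by rewrite E.
Qed.

Lemma fhit_ext a y y' k : (forall j, (j <= k)%N -> y j = y' j) -> fhit a y k = fhit a y' k.
Proof. by move=> E; rewrite /fhit (@hits_ext _ _ y y') ?E // => j /ltnW/E. Qed.

Lemma rmax_ext N y y' : (forall k, (k < N)%N -> y k = y' k) -> rmax N y = rmax N y'.
Proof.
elim: N => [//|N IH] E /=; rewrite IH ?E // => k kN; apply: E.
by rewrite ltnS ltnW.
Qed.

Lemma rmax_ge0 N y : 0 <= rmax N y.
Proof. by elim: N => [//|N IH] /=; rewrite le_max IH. Qed.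

Lemma rmax_ge N y k : (k < N)%N -> y k <= rmax N y.
Proof.
elim: N => [//|N IH]; rewrite ltnS leq_eqVlt => /predU1P[->|kN] /=.
  by rewrite le_max lexx orbT.
by rewrite le_max IH.
Qed.

Lemma rmax_le N y b : 0 <= b -> (forall k, (k < N)%N -> y k <= b) -> rmax N y <= b.
Proof.
move=> b0; elim: N => [//|N IH] E /=; rewrite ge_max IH ?E // => k kN.
by apply: E; rewrite ltnS ltnW.
Qed.

Lemma rmax_hits N a y : 0 <= a -> (a < rmax N y) = hits N a y.
Proof.
move=> a0; elim: N => [|N IH] /=; first by rewrite ltNge a0.
by rewrite lt_max IH.
Qed.

Lemma measurable_hits d (T : measurableType d) N a (Y : nat -> T -> R) :
  (forall k, measurable_fun setT (Y k)) -> measurable_fun setT (fun t => hits N a (Y^~ t)).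
Proof.
move=> mY; elim: N => [|N IH] /=; first exact: measurable_cst.
by apply: measurable_or => //; exact: measurable_fun_ltr.
Qed.

Lemma measurable_fhit d (T : measurableType d) k a (Y : nat -> T -> R) :
  (forall k, measurable_fun setT (Y k)) -> measurable_fun setT (fun t => fhit a (Y^~ t) k).
Proof.
move=> mY; apply: measurable_and; last exact: measurable_fun_ltr.
by apply: measurable_neg; exact: measurable_hits.
Qed.

Lemma measurable_rmax d (T : measurableType d) N (Y : nat -> T -> R) :
  (forall k, measurable_fun setT (Y k)) -> measurable_fun setT (fun t => rmax N (Y^~ t)).
Proof.
move=> mY; elim: N => [|N IH] /=; first exact: measurable_cst.
exact: measurable_maxr.
Qed.

(** Layer cake: the expectation of a nonnegative variable is the integral of its tail over the
    positive levels. *)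
Lemma le_integral_tail d (T : measurableType d) d' (T' : measurableType d')
    (P : probability T R) (P' : probability T' R) (f : T -> R) (g : T' -> R) (C : R) :
  measurable_fun setT f -> measurable_fun setT g -> (forall t, 0 <= f t) -> (forall t, 0 <= g t) -> 0 <= C ->
  (forall y, 0 <= y -> (P [set t | y < f t]%R <= C%:E * P' [set t | y < g t]%R)%E) ->
  (\int[P]_t (f t)%:E <= C%:E * \int[P']_t (g t)%:E)%E.
Proof.
move=> mf mg f0 g0 C0 H.
pose cf := isMeasurableFun.Build _ _ _ _ _ mf.
pose cg := isMeasurableFun.Build _ _ _ _ _ mg.
pose F : {RV P >-> R} := HB.pack f cf.
pose G : {RV P' >-> R} := HB.pack g cg.
have -> : (\int[P]_t (f t)%:E = 'E_P[F])%E by rewrite expectation_def.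
have -> : (\int[P']_t (g t)%:E = 'E_P'[G])%E by rewrite expectation_def.
rewrite !ge0_expectation_ccdf //.
rewrite -ge0_integralZl_EFin //; last by apply: measurable_funTS; exact: ccdf_measurable.
apply: ge0_le_integral => //.
- by apply: measurable_funTS; exact: ccdf_measurable.
- by apply: measurable_funeM; apply: measurable_funTS; exact: ccdf_measurable.
- move=> y; rewrite /= in_itv /= andbT => y0; have := H y y0; congr (_ <= _)%E.
    by rewrite /ccdf /distribution /pushforward; congr (P _); apply/seteqP; split => t /=; rewrite in_itv /= andbT.
  by congr (_ * _)%E; rewrite /ccdf /distribution /pushforward; congr (P' _); apply/seteqP; split => t /=; rewrite in_itv /= andbT.
Qed.
End bool_events.
Arguments hits {R} N%_nat_scope a%_ring_scope y%ring_scope.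
Arguments fhit {R} a%_ring_scope y%ring_scope k%_nat_scope.
Arguments rmax {R} N%_nat_scope y%ring_scope.
Arguments measurable_hits {R d T} N a Y.
Arguments measurable_fhit {R d T} k a Y.
Arguments measurable_rmax {R d T} N Y.

(** * Exponential moments and the reflection inequality *)

Section levy_chernoff.
Context {R : realType} (V : lmodType R) d (T : measurableType d) (P : probability T R).
Variable X : gfield V P.
Local Notation ip := (gip X).

Lemma gX_exp1 v : (\int[P]_t (expR (X v t - ip v v / 2))%:E = 1)%E.
Proof.
have mc : measurable_fun setT (fun=> 1%E : \bar R) by move=> *; exact: measurable_cst.
have := @gX_tilt _ _ _ _ _ X unit (fun=> v) v _ (mc _ _) (fun=> lee01).
rewrite int_cst1 => ->.
by apply: eq_integral => t _; rewrite mule1.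
Qed.

Lemma gX_expE l v : (\int[P]_t (expR (l * X v t))%:E = (expR (l ^+ 2 * ip v v / 2))%:E)%E.
Proof.
have := gX_exp1 (l *: v).
under eq_integral => t _.
  rewrite gXZ gipZl gipZr expRD EFinM muleC; over.
rewrite int_Zl ?expR_ge0 //; last 1 first.
- by apply/measurable_EFinP; mreal.
set J := (\int[P]__ _)%E => E.
transitivity ((expR (l ^+ 2 * ip v v / 2))%:E * ((expR (- (l * (l * ip v v) / 2)))%:E * J))%E.
  rewrite muleA -EFinM -expRD (_ : _ - _ = 0); last by field.
  by rewrite expR0 mul1e.
by rewrite E mule1.
Qed.

(** Exponential Markov inequality at the parameter y / s, which is optimal for variance s. *)
Lemma chernoff v (s y : R) : 0 < s -> ip v v <= s -> 0 <= y ->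
  (P [set t | y < X v t]%R <= (expR (- y ^+ 2 / (2 * s)))%:E)%E.
Proof.
move=> s0 vs y0.
have mb : measurable_fun setT (fun t => y < X v t).
  by apply: measurable_fun_ltr => //; exact: gX_meas.
rewrite -(integral_bool P mb).
apply: (@le_trans _ _ (\int[P]_t ((expR (- y / s * y))%:E * (expR (y / s * X v t))%:E))%E).
  apply: int_le.
  - exact: measurable_nat_bool.
  - by apply: measurable_funeM; apply/measurable_EFinP; mreal.
  - by move=> t; rewrite lee_fin.
  - move=> t; rewrite -EFinM lee_fin -expRD.
    have [yX|_] := ltP; last exact: expR_ge0.
    rewrite -expR0 ler_expR.
    have -> : - y / s * y + y / s * X v t = y / s * (X v t - y) by ring.
    by rewrite mulr_ge0 ?divr_ge0 ?subr_ge0 // ltW.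
rewrite int_Zl ?expR_ge0 //; last by apply/measurable_EFinP; mreal.
rewrite gX_expE -EFinM lee_fin -expRD ler_expR.
have : (y / s) ^+ 2 * ip v v <= (y / s) ^+ 2 * s by rewrite ler_wpM2l ?sqr_ge0.
have -> : (y / s) ^+ 2 * s = y ^+ 2 / s by field; rewrite gt_eqF.
have -> : - y / s * y = - (y ^+ 2 / s) by ring.
have -> : - y ^+ 2 / (2 * s) = - (y ^+ 2 / s) / 2 by field; rewrite gt_eqF.
by move=> ?; lra.
Qed.

(* Reflection at the first passage: the increment X (ts k - vs k) is symmetric given the past. *)
Lemma levy (vs ts : nat -> V) N (a : R) :
  (forall j k, (j <= k < N)%N -> ip (ts k - vs k) (vs j) = 0) ->
  (P [set t | hits N a (fun k => X (vs k) t)] <= 2%:E * P [set t | hits N a (fun k => X (ts k) t)])%E.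
Proof.
move=> H.
have mvs k : measurable_fun setT (X (vs k)) by exact: gX_meas.
have mts k : measurable_fun setT (X (ts k)) by exact: gX_meas.
rewrite -!integral_bool; try exact: (measurable_hits _ _ (fun k => X (_ k))).
pose F k t : R := (fhit a (fun k => X (vs k) t) k)%:R.
pose G k t : R := (fhit a (fun k => X (vs k) t) k && (0 <= X (ts k - vs k) t))%:R.
have mF k : measurable_fun setT (fun t => (F k t)%:E) by apply: measurable_nat_bool; exact: (measurable_fhit k a (fun k => X (vs k))).
have mG k : measurable_fun setT (fun t => (G k t)%:E).
  apply: measurable_nat_bool; apply: measurable_and; first exact: (measurable_fhit k a (fun k => X (vs k))).
  by mreal.
have half k : (k < N)%N -> (\int[P]_t (F k t)%:E <= 2%:E * \int[P]_t (G k t)%:E)%E.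
  move=> kN; set e := ts k - vs k.
  (* [phi] shows the walk up to time k, the index being frozen there by [minn], together with plus
     or minus the remaining increment e. Both signs give the same Gram matrix, and on every sample e
     or its opposite is nonnegative. *)
  pose phi s (o : option nat) := if o is Some j then vs (minn j k) else (if s then e else - e).
  pose f (y : @path R (option nat)) : \bar R := ((fhit a (fun j => y (Some j)) k && (0 <= y None)%R)%:R)%:E.
  have mf : measurable_fun setT f.
    apply: measurable_nat_bool; apply: measurable_and.
      by apply: (measurable_fhit k a (fun j (y : @path R (option nat)) => y (Some j))) => j; exact: measurable_coord.
    by mreal.
  have fE s t : f (fun o => X (phi s o) t) = ((fhit a (fun j => X (vs j) t) k && (0 <= if s then X e t else - X e t)%R)%:R)%:E.
    rewrite /f /phi; congr ((_ && _)%:R%:E).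
      by apply: fhit_ext => j jk; rewrite (minn_idPl jk).
    by case: s; rewrite ?gXN.
  have E : (\int[P]_t f (fun o => X (phi true o) t) = \int[P]_t f (fun o => X (phi false o) t))%E.
    apply: gX_isometry => //; last by move=> y; rewrite lee_fin.
    have h j : ip e (vs (minn j k)) = 0 by apply: H; rewrite geq_minr kN.
    by move=> [i|] [j|] //=; rewrite ?gipNl ?gipNr ?(gip_sym X (vs _) e) ?h ?oppr0 ?opprK.
  have -> : (2%:E * \int[P]_t (G k t)%:E = \int[P]_t f (fun o => X (phi true o) t) + \int[P]_t f (fun o => X (phi false o) t))%E.
    rewrite -E -(_ : (\int[P]_t (G k t)%:E)%E = (\int[P]_t f (fun o => X (phi true o) t))%E); last first.
      by apply: eq_integral => t _; rewrite fE.
    by rewrite mule_natl mule2n.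
  have mfX s : measurable_fun setT (fun t => f (fun o => X (phi s o) t)) by apply: (measurableT_comp mf); exact: gX_path.
  have f0 y : (0 <= f y)%E by rewrite lee_fin.
  rewrite -int_D //.
  apply: int_le => //.
  - exact: emeasurable_funD.
  - by move=> t; rewrite lee_fin.
  - move=> t; rewrite !fE -EFinD lee_fin /F; case: fhit => //=; rewrite ?addr0 //.
    case: (lerP 0 (X e t)) => Xe; first by rewrite lerDl.
    by rewrite oppr_ge0 (ltW Xe) add0r.
apply: (@le_trans _ _ (\sum_(k < N) \int[P]_t (F k t)%:E)%E).
  rewrite -(@int_sum _ _ _ P N (fun k t => (F k t)%:E)) //; try by move=> k t; rewrite lee_fin.
  apply: int_le.
  - by apply: measurable_nat_bool; exact: (measurable_hits N a (fun k => X (vs k))).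
  - exact: (@measurable_bigsum _ _ _ _ (fun k t => (F k t)%:E)).
  - by move=> t; rewrite lee_fin.
  - by move=> t; rewrite sumEFin lee_fin hits_sum.
apply: (@le_trans _ _ (\sum_(k < N) 2%:E * \int[P]_t (G k t)%:E)%E).
  by apply: lee_sum => k _; exact: half.
rewrite -ge0_sume_distrr; last by move=> k _; apply: integral_ge0 => t _; rewrite lee_fin.
apply: lee_wpmul2l; first by rewrite lee_fin.
rewrite -(@int_sum _ _ _ P N (fun k t => (G k t)%:E)) //; try by move=> k t; rewrite lee_fin.
apply: int_le.
- exact: (@measurable_bigsum _ _ _ _ (fun k t => (G k t)%:E)).
- by apply: measurable_nat_bool; exact: (measurable_hits N a (fun k => X (ts k))).
- by move=> t; apply: (@sum_nonneg R N (fun k => (G k t)%:E)) => k; rewrite lee_fin.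
move=> t; rewrite sumEFin lee_fin.
(* At most one [G k] is 1, and it forces X (ts k) above a. *)
have [h|nh] := boolP (hits N a (fun k => X (ts k) t)).
  apply: (@le_trans _ _ (\sum_(k < N) (fhit a (fun k => X (vs k) t) k)%:R)).
    by apply: ler_sum => k _; rewrite /G ler_nat; case: (fhit _ _ _) => //=; exact: leq_b1.
  by rewrite -hits_sum; case: hits.
rewrite big1 // => k _; rewrite /G; case: andP => // -[/andP[_ ak] e0].
case/negP: nh; apply/hitsP; exists k => //.
by move: e0; rewrite gXB subr_ge0; exact: lt_le_trans.
Qed.
End levy_chernoff.

(** * Walks with independent increments: crossings and exponential maxima *)

Section walk.
Context {R : realType} (V : lmodType R) d (T : measurableType d) (P : probability T R).
Variable X : gfield V P.
Local Notation ip := (gip X).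
Variables (u : nat -> V) (tau : nat -> R).
Hypothesis ipu : forall j k, (j <= k)%N -> ip (u j) (u k) = tau j.

Lemma walk_tilt (l : R) k (G : @path R nat -> \bar R) :
  measurable_fun setT G -> (forall y, 0 <= G y)%E ->
  (forall y y' : nat -> R, (forall j, (j <= k)%N -> y j = y' j) -> G y = G y') ->
  (\int[P]_t ((expR (l * X (u k) t - l ^+ 2 * tau k / 2))%:E * G (fun j => X (u j) t)) =
   \int[P]_t G (fun j => (X (u j) t + l * tau j)%R))%E.
Proof.
move=> mG G0 GE.
have := @gX_tilt _ _ _ _ _ X nat u (l *: u k) G mG G0.
rewrite gipZl gipZr (ipu (leqnn k)) mulrA -expr2.
under [in X in _ = X -> _]eq_integral do rewrite gXZ.
move=> <-; apply: eq_integral => t _; apply: GE => j jk.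
by rewrite gipZr ipu.
Qed.

(** The logarithm z of the exponential martingale drifts down; under the tilt by [l *: u k] it
    becomes z', which drifts up, at all times up to k. *)
Let z (l : R) (y : nat -> R) k : R := l * y k - l ^+ 2 * tau k / 2.
Let z' (l : R) (y : nat -> R) k : R := l * y k + l ^+ 2 * tau k / 2.

Let zz l y : z l (fun j => y j + l * tau j) = z' l y.
Proof. by apply/funext => k; rewrite /z /z'; field. Qed.

Let mz l k : measurable_fun setT (fun y : @path R nat => z l y k).
Proof. by rewrite /z; mreal. Qed.
Let mX : measurable_fun setT (fun t => (fun j => X (u j) t) : @path R nat).
Proof. exact: gX_path. Qed.

(** The tilt by [l *: u k] multiplies the probability of a first passage of z at time k by at least
    exp a and turns it into a first passage of z'. First passages at different times are disjoint,
    so the tilted probabilities add up to at most 1. *)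
Lemma ville (l a : R) N :
  (P [set t | hits N a (fun k => l * X (u k) t - l ^+ 2 * tau k / 2)%R] <= (expR (- a))%:E)%E.
Proof.
pose Z k t := l * X (u k) t - l ^+ 2 * tau k / 2.
have mZ k : measurable_fun setT (Z k) by rewrite /Z; mreal.
pose Z' k t := l * X (u k) t + l ^+ 2 * tau k / 2.
have mZ' k : measurable_fun setT (Z' k) by rewrite /Z'; mreal.
have mhZ k : measurable_fun setT (fun t => (fhit a (Z^~ t) k)%:R%:E : \bar R).
  by apply: measurable_nat_bool; exact: measurable_fhit.
have mhZ' k : measurable_fun setT (fun t => (fhit a (Z'^~ t) k)%:R%:E : \bar R).
  by apply: measurable_nat_bool; exact: measurable_fhit.
rewrite -integral_bool; last exact: (measurable_hits N a Z).
apply: (@le_trans _ _ (\sum_(k < N) \int[P]_t (fhit a (Z^~ t) k)%:R%:E)%E).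
  rewrite -(@int_sum _ _ _ P N (fun k t => (fhit a (Z^~ t) k)%:R%:E)) //; try by move=> k t; rewrite lee_fin.
  apply: int_le.
  - by apply: measurable_nat_bool; exact: (measurable_hits N a Z).
  - exact: (@measurable_bigsum _ _ _ _ (fun k t => (fhit a (Z^~ t) k)%:R%:E)).
  - by move=> t; rewrite lee_fin.
  - by move=> t; rewrite sumEFin lee_fin hits_sum.
apply: (@le_trans _ _ (\sum_(k < N) (expR (- a))%:E * \int[P]_t (fhit a (Z'^~ t) k)%:R%:E)%E).
  apply: lee_sum => k _.
  pose G (y : @path R nat) : \bar R := (fhit a (z l y) k)%:R%:E.
  have mG : measurable_fun setT G.
    by apply: measurable_nat_bool; exact: (measurable_fhit k a (fun k (y : @path R nat) => z l y k)).
  have -> : (\int[P]_t (fhit a (Z'^~ t) k)%:R%:E = \int[P]_t G (fun j => (X (u j) t + l * tau j)%R))%E.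
    by apply: eq_integral => t _; rewrite /G zz.
  rewrite -(@walk_tilt l k G) //; last 2 first.
  - by move=> y; rewrite lee_fin.
  - by move=> y y' E; rewrite /G (@fhit_ext _ _ (z l y) (z l y')) // => j /E; rewrite /z => ->.
  have mI : measurable_fun setT (fun t => ((expR (l * X (u k) t - l ^+ 2 * tau k / 2))%:E * G (fun j => X (u j) t))%E).
    apply: emeasurable_funM; last exact: (measurableT_comp mG mX).
    by apply/measurable_EFinP; mreal.
  rewrite -int_Zl ?expR_ge0 //; last by move=> t; rewrite mule_ge0 // lee_fin ?expR_ge0.
  apply: int_le => //.
  - exact: measurable_funeM.
  - move=> t; have -> : G (fun j => X (u j) t) = (fhit a (Z^~ t) k)%:R%:E by [].
    rewrite -EFinM lee_fin mulrA -expRD -/(Z k t).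
    case: (boolP (fhit _ _ _)) => [/andP[_ ah]|_]; last by rewrite mulr0.
    by rewrite mulr1 -expR0 ler_expR; lra.
rewrite -ge0_sume_distrr; last by move=> k _; apply: integral_ge0 => t _; rewrite lee_fin.
rewrite -[leRHS]mule1; apply: lee_wpmul2l; first by rewrite lee_fin expR_ge0.
rewrite -(@int_sum _ _ _ P N (fun k t => (fhit a (Z'^~ t) k)%:R%:E)) //; try by move=> k t; rewrite lee_fin.
rewrite -[leRHS](int_cst1 P); apply: int_le => //.
- exact: (@measurable_bigsum _ _ _ _ (fun k t => (fhit a (Z'^~ t) k)%:R%:E)).
- by move=> t; apply: sume_ge0 => k _; rewrite lee_fin.
- by move=> t; rewrite sumEFin lee_fin -hits_sum; case: hits.
Qed.

(** Converse of [ville]: a first passage that overshoots by at most kp loses no more than exp (-kp).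
    Such a passage of z' is missed only if z' starts above a, makes a step larger than kp, or is not
    above a at time N; eta bounds these three. *)
Lemma walk_hits_ge (l a kp eta : R) N : 0 <= kp ->
  (P [set t | a < l * X (u 0) t + l ^+ 2 * tau 0 / 2]%R +
   \sum_(k < N) P [set t | kp < l * (X (u k.+1) t - X (u k) t) + l ^+ 2 * (tau k.+1 - tau k) / 2]%R +
   P [set t | l * X (u N) t + l ^+ 2 * tau N / 2 <= a]%R <= eta%:E)%E ->
  ((expR (- a - kp) * (1 - eta))%:E <= P [set t | hits N.+1 a (fun k => l * X (u k) t - l ^+ 2 * tau k / 2)%R])%E.
Proof.
move=> kp0 Heta.
pose Y k t := l * X (u k) t - l ^+ 2 * tau k / 2.
pose Y' k t := l * X (u k) t + l ^+ 2 * tau k / 2.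
have mY k : measurable_fun setT (Y k) by rewrite /Y; mreal.
have mY' k : measurable_fun setT (Y' k) by rewrite /Y'; mreal.
have mG0 k : measurable_fun setT (fun y : @path R nat => (fhit a (z l y) k && (z l y k <= a + kp))%:R%:E : \bar R).
  apply: measurable_nat_bool; apply: measurable_and.
    exact: (measurable_fhit k a (fun k (y : @path R nat) => z l y k)).
  by apply: measurable_fun_ler => //; exact: measurable_cst.
have mf' k : measurable_fun setT (fun t => fhit a (Y'^~ t) k) by exact: measurable_fhit.
have mf k : measurable_fun setT (fun t => fhit a (Y^~ t) k) by exact: measurable_fhit.
rewrite -integral_bool; last exact: (measurable_hits N.+1 a Y).
have step k : ((expR (- a - kp))%:E * \int[P]_t (fhit a (Y'^~ t) k && (Y' k t <= a + kp))%:R%:E <=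
   \int[P]_t (fhit a (Y^~ t) k)%:R%:E)%E.
  pose G (y : @path R nat) : \bar R := (fhit a (z l y) k && (z l y k <= a + kp))%:R%:E.
  have mG : measurable_fun setT G by exact: mG0.
  have -> : (\int[P]_t (fhit a (Y'^~ t) k && (Y' k t <= a + kp))%:R%:E = \int[P]_t G (fun j => (X (u j) t + l * tau j)%R))%E.
    by apply: eq_integral => t _; rewrite /G zz.
  rewrite -(@walk_tilt l k G) //; last 2 first.
  - by move=> y; rewrite lee_fin.
  - move=> y y' E; rewrite /G (@fhit_ext _ _ (z l y) (z l y')) => [|j /E]; last by rewrite /z => ->.
    by rewrite /z E.
  have mI : measurable_fun setT (fun t => ((expR (l * X (u k) t - l ^+ 2 * tau k / 2))%:E * G (fun j => X (u j) t))%E).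
    apply: emeasurable_funM; last exact: (measurableT_comp mG mX).
    by apply/measurable_EFinP; mreal.
  rewrite -int_Zl ?expR_ge0 //; last by move=> t; rewrite mule_ge0 // lee_fin ?expR_ge0.
  apply: int_le.
  - exact: measurable_funeM.
  - exact: measurable_nat_bool.
  - by move=> t; rewrite !mule_ge0 // lee_fin ?expR_ge0.
  - move=> t; have -> : G (fun j => X (u j) t) = (fhit a (Y^~ t) k && (Y k t <= a + kp))%:R%:E by [].
    rewrite -EFinM lee_fin mulrA -expRD -/(Y k t).
    case: (fhit a (Y^~ t) k) => /=; rewrite ?mulr0 //.
    case: (leP (Y k t) (a + kp)) => h; rewrite ?mulr0 // mulr1 -expR0 ler_expR; lra.
have sumE (f : nat -> T -> bool) : (forall k, measurable_fun setT (f k)) ->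
   (\sum_(k < N.+1) \int[P]_t (f k t)%:R%:E = \int[P]_t (\sum_(k < N.+1) (f k t)%:R)%:E)%E.
  move=> mff; rewrite -(@int_sum _ _ _ P N.+1 (fun k t => (f k t)%:R%:E)).
  - by apply: eq_integral => t _; rewrite sumEFin.
  - by move=> k; exact: measurable_nat_bool.
  - by move=> k t; rewrite lee_fin.
have -> : (\int[P]_t (hits N.+1 a (Y^~ t))%:R%:E = \sum_(k < N.+1) \int[P]_t (fhit a (Y^~ t) k)%:R%:E)%E.
  rewrite (sumE (fun k t => fhit a (Y^~ t) k)) //.
  by apply: eq_integral => t _; rewrite hits_sum.
apply: (le_trans _ (lee_sum _ (fun (k : 'I_N.+1) _ => step k))).
rewrite -ge0_sume_distrr; last by move=> k _; apply: integral_ge0 => t _; rewrite lee_fin.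
have mg k : measurable_fun setT (fun t => fhit a (Y'^~ t) k && (Y' k t <= a + kp)).
  by apply: measurable_and => //; apply: measurable_fun_ler => //; exact: measurable_cst.
rewrite EFinM; apply: lee_wpmul2l; first by rewrite lee_fin expR_ge0.
rewrite (sumE (fun k t => fhit a (Y'^~ t) k && (Y' k t <= a + kp))) //.
pose b0 t := a < Y' 0 t; pose bi k t := kp < l * (X (u k.+1) t - X (u k) t) + l ^+ 2 * (tau k.+1 - tau k) / 2.
pose bN t := Y' N t <= a.
have mb0 : measurable_fun setT b0 by apply: measurable_fun_ltr => //; exact: measurable_cst.
have mbN : measurable_fun setT bN by apply: measurable_fun_ler => //; exact: measurable_cst.
have mbi k : measurable_fun setT (bi k).
  apply: measurable_fun_ltr; first exact: measurable_cst.
  apply: measurable_funD; last exact: measurable_cst.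
  by apply: measurable_funM; [exact: measurable_cst|apply: measurable_funB; exact: gX_meas].
have mnb (b : T -> bool) : measurable_fun setT b -> measurable_fun setT (fun t => (b t)%:R : R).
  by move=> mb; apply/measurable_EFinP; exact: measurable_nat_bool.
pose good t : R := \sum_(k < N.+1) (fhit a (Y'^~ t) k && (Y' k t <= a + kp))%:R.
pose bad t : R := (b0 t)%:R + \sum_(k < N) (bi k t)%:R + (bN t)%:R.
have mgood : measurable_fun setT (EFin \o good).
  by apply/measurable_EFinP/measurable_sum => k; exact: mnb.
have ibad : (\int[P]_t (bad t)%:E <= eta%:E)%E.
  apply: le_trans Heta.
  have E t : ((bad t)%:E = (b0 t)%:R%:E + \sum_(k < N) (bi k t)%:R%:E + (bN t)%:R%:E)%E by rewrite sumEFin.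
  under eq_integral do rewrite E.
  have h1 (b : T -> bool) t : (0 <= (b t)%:R%:E :> \bar R)%E by rewrite lee_fin.
  have ms : measurable_fun setT (fun t => \sum_(k < N) (bi k t)%:R%:E : \bar R)%E.
    by apply: (@measurable_bigsum _ _ _ _ (fun k t => (bi k t)%:R%:E)) => k; exact: measurable_nat_bool.
  have m0 := measurable_nat_bool (R := R) mb0.
  have mN := measurable_nat_bool (R := R) mbN.
  rewrite (int_D P (emeasurable_funD m0 ms) mN); last 2 first.
  - by move=> t; rewrite adde_ge0 // sume_ge0.
  - by move=> t; exact: h1.
  rewrite (int_D P m0 ms); last 2 first.
  - by move=> t; exact: h1.
  - by move=> t; apply: sume_ge0 => k _; exact: h1.
  rewrite (@int_sum _ _ _ P N (fun k t => (bi k t)%:R%:E)); last 2 first.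
  - by move=> k; exact: measurable_nat_bool.
  - by move=> k t; exact: h1.
  rewrite !integral_bool //; apply: leeD => //; apply: leeD => //.
  by apply: lee_sum => k _; rewrite integral_bool.
have mbad : measurable_fun setT (EFin \o bad).
  apply/measurable_EFinP; apply: measurable_funD; first apply: measurable_funD.
  - exact: mnb.
  - by apply: measurable_sum => k; exact: mnb.
  - exact: mnb.
have good0 t : 0 <= good t by apply: sumr_ge0.
have bad0 t : 0 <= bad t by rewrite !addr_ge0 ?sumr_ge0.
have pt t : 1 <= good t + bad t.
  have S0 : 0 <= \sum_(k < N) (bi k t)%:R :> R by apply: sumr_ge0.
  have bN0 : 0 <= (bN t)%:R :> R by [].
  have b00 : 0 <= (b0 t)%:R :> R by [].
  have := good0 t; move: S0 bN0 b00; rewrite /bad.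
  have [hb0|nb0] := boolP (b0 t); first by rewrite /= => ? ? ? ?; lra.
  have [hbN|nbN] := boolP (bN t); first by rewrite /= => ? ? ? ?; lra.
  have [/existsP[k hk]|/existsPn nbi] := boolP [exists k : 'I_N, bi k t].
    rewrite (bigD1 k) //= hk => _ _ _.
    have : 0 <= \sum_(i < N | i != k) (bi i t)%:R :> R by apply: sumr_ge0.
    by rewrite /= => ? ?; lra.
  move=> S0 _ _ _.
  suff : 1 <= good t by move=> h; rewrite /=; lra.
  have hN : hits N.+1 a (Y'^~ t) by apply/hitsP; exists N => //; rewrite ltNge.
  have -> : good t = (hits N.+1 a (Y'^~ t))%:R; last by rewrite hN.
  rewrite hits_sum; apply: eq_bigr => -[k kN] _ /=; congr (_%:R); congr nat_of_bool.
  case: (boolP (fhit _ _ _)) => //= /andP[nh ak].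
  case: k kN nh ak => [|k] kN nh ak; first by move: nb0; rewrite /b0 ak.
  have := nbi (@Ordinal N k kN); rewrite /bi /= -leNgt => h.
  have : ~~ (a < Y' k t) by apply: contra nh => ?; apply/hitsP; exists k.
  rewrite -leNgt => h2.
  have E : Y' k.+1 t - Y' k t = l * (X (u k.+1) t - X (u k) t) + l ^+ 2 * (tau k.+1 - tau k) / 2.
    by rewrite /Y'; field.
  by lra.
have : (1 <= \int[P]_t (good t)%:E + \int[P]_t (bad t)%:E)%E.
  rewrite -int_D //; try by move=> t; rewrite lee_fin.
  rewrite -[leLHS](int_cst1 P); apply: int_le => //.
  exact: emeasurable_funD.
move=> h; rewrite EFinB leeBlDr //; apply: (le_trans h); exact: leeD.
Qed.

(** When the running maximum m rises at time k, its exponential grows by exp (z k) (1 - exp (m k - m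
    (k+1))). The tilt removes the factor exp (z k) and leaves the same expression for z'. Finally 1
    - exp (-x) is at most x, and the rises of the maximum of z' telescope. *)
Lemma E_exp_rmax (l : R) N :
  (\int[P]_t (expR (rmax N (fun k => l * X (u k) t - l ^+ 2 * tau k / 2)%R))%:E <=
   1 + \int[P]_t (rmax N (fun k => l * X (u k) t + l ^+ 2 * tau k / 2)%R)%:E)%E.
Proof.
pose m k (y : @path R nat) := rmax k (z l y).
have mm k : measurable_fun setT (m k) by exact: (measurable_rmax k (fun k (y : @path R nat) => z l y k)).
pose G k (y : @path R nat) : \bar R := (1 - expR (m k y - m k.+1 y))%:E.
have mle k y : m k y <= m k.+1 y by rewrite /m /= le_max lexx.
have G0 k y : (0 <= G k y)%E by rewrite lee_fin subr_ge0 -expR0 ler_expR subr_le0.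
have mG k : measurable_fun setT (G k).
  by apply/measurable_EFinP; apply: measurable_funB => //; apply: measurableT_comp => //; exact: measurable_funB.
have mI k : measurable_fun setT (fun t => ((expR (l * X (u k) t - l ^+ 2 * tau k / 2))%:E * G k (fun j => X (u j) t))%E).
  apply: emeasurable_funM; last exact: (measurableT_comp (mG k) mX).
  by apply/measurable_EFinP; mreal.
have I0 k t : (0 <= (expR (l * X (u k) t - l ^+ 2 * tau k / 2))%:E * G k (fun j => X (u j) t))%E.
  by rewrite mule_ge0 // lee_fin expR_ge0.
have mY' k : measurable_fun setT (fun t => l * X (u k) t + l ^+ 2 * tau k / 2) by mreal.
have tele t : (expR (m N (fun j => X (u j) t)))%:E =
   (1 + \sum_(k < N) (expR (l * X (u k) t - l ^+ 2 * tau k / 2))%:E * G k (fun j => X (u j) t))%E.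
  elim: N => [|N IH]; first by rewrite big_ord0 adde0 /m /= expR0.
  rewrite big_ord_recr /= addeA -IH -EFinM -EFinD; congr EFin.
  set y := fun j => _; rewrite -/(z l y N) mulrBr mulr1 -expRD.
  rewrite /m /=; case: (leP (rmax N (z l y)) (z l y N)) => h.
    have -> : z l y N + (rmax N (z l y) - z l y N) = rmax N (z l y) by ring.
    by rewrite addrC subrK.
  by rewrite subrr addr0 subrr addr0.
have -> : (\int[P]_t (expR (rmax N (fun k => l * X (u k) t - l ^+ 2 * tau k / 2)%R))%:E =
  1 + \sum_(k < N) \int[P]_t G k (fun j => (X (u j) t + l * tau j)%R))%E.
  under eq_integral => t _ do rewrite -[rmax _ _]/(m N (fun j => X (u j) t)) tele.
  rewrite int_D //; last 2 first.
  - exact: (@measurable_bigsum _ _ _ _ (fun k t => ((expR (l * X (u k) t - l ^+ 2 * tau k / 2))%:E * G k (fun j => X (u j) t))%E)).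
  - by move=> t; apply: sume_ge0 => k _.
  rewrite int_cst1; congr (_ + _)%E.
  rewrite (@int_sum _ _ _ P N (fun k t => ((expR (l * X (u k) t - l ^+ 2 * tau k / 2))%:E * G k (fun j => X (u j) t))%E)) //.
  apply: eq_bigr => k _; apply: walk_tilt => // y y' E.
  have E1 : rmax k (z l y) = rmax k (z l y') by apply: rmax_ext => j /ltnW /E; rewrite /z => ->.
  by rewrite /G /m /= E1 /z E.
apply: leeD => //.
have mpath : measurable_fun setT (fun t => (fun j => (X (u j) t + l * tau j)%R) : @path R nat).
  by apply: (measurable_to_path (Y := fun j t => (X (u j) t + l * tau j)%R)) => j; mreal.
have mGs k : measurable_fun setT (fun t => G k (fun j => (X (u j) t + l * tau j)%R)) by exact: (measurableT_comp (mG k) mpath).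
rewrite -(@int_sum _ _ _ P N (fun k t => G k (fun j => (X (u j) t + l * tau j)%R))) //.
apply: int_le.
- exact: (@measurable_bigsum _ _ _ _ (fun k t => G k (fun j => (X (u j) t + l * tau j)%R))).
- by apply/measurable_EFinP; exact: (measurable_rmax N (fun k t => l * X (u k) t + l ^+ 2 * tau k / 2)).
- by move=> t; apply: sume_ge0 => k _.
move=> t; rewrite sumEFin lee_fin /m zz -/(z' l (fun j => X (u j) t)).
elim: {mm mle G0 mG mI tele mGs} N => [|N IH]; first by rewrite big_ord0.
rewrite big_ord_recr /=; have := expR_ge1Dx (rmax N (z' l (fun j => X (u j) t)) - Num.max (rmax N (z' l (fun j => X (u j) t))) (z' l (fun j => X (u j) t) N)).
move: IH; set S := \sum_(i < N) _; lra.
Qed.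

(** The drift of z' is at most (l s)^2 / 2, which is the main term; the expected maximum of the
    driftless walk is at most 2 s by [levy]. *)
Lemma E_exp_rmax_le (l s : R) N : 0 <= l -> 0 < s -> (forall k, (k < N)%N -> tau k <= s ^+ 2) ->
  (\int[P]_t (expR (rmax N (fun k => l * X (u k) t - l ^+ 2 * tau k / 2)%R))%:E <=
   (1 + (l * s) ^+ 2 / 2 + 2 * (l * s))%:E)%E.
Proof.
move=> l0 s0 tauV; apply: (le_trans (E_exp_rmax l N)).
have mu k : measurable_fun setT (X (u k)) by exact: gX_meas.
have mr : measurable_fun setT (fun t => rmax N (fun k => X (u k) t)%R) by exact: (measurable_rmax N (fun k t => X (u k) t)).
have tau0 k : 0 <= tau k by rewrite -(ipu (leqnn k)) gip_ge0.
have ER : (\int[P]_t (rmax N (fun k => X (u k) t)%R)%:E <= (2 * s)%:E)%E.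
  case: N tauV {mr} => [|N] tauV; first by rewrite /= int_cst1 lee_fin mulr_ge0 // ltW.
  have mp : measurable_fun setT (fun t => Num.max 0 (X (u N) t)) by mreal.
  apply: (@le_trans _ _ (2%:E * \int[P]_t (Num.max 0 (X (u N) t))%:E)%E).
    apply: le_integral_tail => //.
    - exact: (measurable_rmax N.+1 (fun k t => X (u k) t)).
    - by move=> t; exact: rmax_ge0.
    - by move=> t; rewrite le_max lexx.
    move=> y y0.
    have -> : [set t | y < rmax N.+1 (fun k => X (u k) t)] = [set t | hits N.+1 y (fun k => X (u k) t)].
      by apply/funext => t; rewrite /mkset (rmax_hits N.+1 (fun k => X (u k) t) y0).
    apply: (le_trans (@levy _ _ _ _ _ X u (fun=> u N) N.+1 y _)).
      move=> j k /andP[jk kN]; rewrite gipBl gip_sym ipu ?(leq_trans jk) // gip_sym ipu // subrr //.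
    apply: lee_wpmul2l; first by rewrite lee_fin.
    apply: le_measure; rewrite ?inE.
    - by apply: measurable_set_bool; exact: (measurable_hits N.+1 y (fun k => X (u N))).
    - by apply: (measurable_set_bool (b := fun t => y < Num.max 0 (X (u N) t))); mreal.
    - by move=> t /hitsP[k _ h]; rewrite /mkset lt_max h orbT.
  rewrite EFinM; apply: lee_wpmul2l; first by rewrite lee_fin.
  (* From x / s <= exp (x / s - 1); the exponential moment at 1 / s is at most exp (1/2). *)
  apply: (@le_trans _ _ (\int[P]_t ((s * expR (- 1))%:E * (expR (s^-1 * X (u N) t))%:E))%E).
    apply: int_le.
    - exact/measurable_EFinP.
    - by apply: measurable_funeM; apply/measurable_EFinP; mreal.
    - by move=> t; rewrite lee_fin le_max lexx.
    - move=> t; rewrite -EFinM lee_fin -mulrA -expRD ge_max mulr_ge0 ?expR_ge0 ?(ltW s0) //=.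
      rewrite -ler_pdivrMl //; apply: le_trans (expR_ge1Dx _); lra.
  rewrite int_Zl; last 3 first.
  - by rewrite mulr_ge0 ?expR_ge0 // ltW.
  - by apply/measurable_EFinP; mreal.
  - by move=> t; rewrite lee_fin expR_ge0.
  rewrite gX_expE -EFinM lee_fin -(mulrA s) ger_pMr // -expRD -[leRHS]expR0 ler_expR ipu //.
  have : s^-1 ^+ 2 * tau N <= s^-1 ^+ 2 * s ^+ 2 by rewrite ler_wpM2l ?sqr_ge0 ?tauV.
  by rewrite -exprMn mulVf ?expr1n ?gt_eqF //; lra.
have -> : 1 + (l * s) ^+ 2 / 2 + 2 * (l * s) = 1 + ((l * s) ^+ 2 / 2 + l * (2 * s)) by ring.
rewrite [in leRHS]EFinD; apply: leeD => //.
apply: (@le_trans _ _ (\int[P]_t (((l * s) ^+ 2 / 2)%:E + l%:E * (rmax N (fun k => X (u k) t)%R)%:E))%E).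
  apply: int_le.
  - by apply/measurable_EFinP; apply: (measurable_rmax N (fun k t => l * X (u k) t + l ^+ 2 * tau k / 2)) => k; mreal.
  - by apply: emeasurable_funD => //; apply: measurable_funeM; exact/measurable_EFinP.
  - by move=> t; rewrite lee_fin rmax_ge0.
  - move=> t; rewrite -EFinM -EFinD lee_fin; apply: rmax_le.
      apply: addr_ge0; [by rewrite mulr_ge0 ?sqr_ge0|exact: (mulr_ge0 l0 (rmax_ge0 _ _))].
    move=> k kN; rewrite addrC; apply: lerD.
      by rewrite exprMn ler_wpM2r // ler_wpM2l ?sqr_ge0 ?tauV.
    by rewrite ler_wpM2l // (@rmax_ge _ N (fun k => X (u k) t)).
have r0 t : (0 <= (rmax N (fun k => X (u k) t)%R)%:E :> \bar R)%E by rewrite lee_fin rmax_ge0.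
have mrE : measurable_fun setT (fun t => (rmax N (fun k => X (u k) t)%R)%:E) by exact/measurable_EFinP.
rewrite int_D; last 4 first.
- exact: measurable_cst.
- exact: measurable_funeM.
- by move=> t; rewrite lee_fin mulr_ge0 ?sqr_ge0.
- by move=> t; rewrite mule_ge0.
rewrite int_cst1 EFinD; apply: leeD => //.
by rewrite int_Zl // EFinM; apply: lee_wpmul2l.
Qed.
End walk.

(** * Quantitative lower bounds for crossings and exponential maxima *)

Section walk_fine.
Context {R : realType} (V : lmodType R) d (T : measurableType d) (P : probability T R).
Variable X : gfield V P.
Local Notation ip := (gip X).

Lemma expRN_le_sqr (z : R) : 0 < z -> expR (- z) <= 2 / z ^+ 2.
Proof.
move=> z0; have z2 : 0 < z ^+ 2 / 2 by rewrite divr_gt0 ?exprn_gt0.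
have -> : 2 / z ^+ 2 = (z ^+ 2 / 2)^-1 by rewrite invf_div.
rewrite expRN lef_pV2 ?posrE ?expR_gt0 //.
have := expR_ge1Dxn 1 (ltW z0); rewrite (_ : 2`! = 2)%N //.
have : 0 <= z ^+ 2 by exact: sqr_ge0.
by move=> ? ?; lra.
Qed.

Lemma chernoff_le v (s y : R) (f : T -> R) (L : R) :
  0 < s -> ip v v <= s -> 0 <= y -> measurable_fun setT f ->
  (forall t, L < f t -> y < X v t) ->
  (P [set t | L < f t]%R <= (expR (- y ^+ 2 / (2 * s)))%:E)%E.
Proof.
move=> s0 vs yy mf H; apply: le_trans (chernoff s0 vs yy).
apply: le_measure; rewrite ?inE.
- by apply: (measurable_set_bool (b := fun t => L < f t)); apply: measurable_fun_ltr => //; exact: measurable_cst.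
- by apply: (measurable_set_bool (b := fun t => y < X v t)); apply: measurable_fun_ltr; [exact: measurable_cst|exact: gX_meas].
- by move=> t; exact: H.
Qed.

Variables (u : nat -> V) (tau : nat -> R).
Hypothesis ipu : forall j k, (j <= k)%N -> ip (u j) (u k) = tau j.

(** Chernoff bounds for the three failures of [walk_hits_ge]. A step of variance dk drifts by at
    most kp / 2, so its bound is exp (- kp^2 / (8 L^2 dk)); [expRN_le_sqr] makes it 128 L^4 dk^2 /
    kp^4. One factor dk is bounded by h and the other sums to the total time, at most S. *)
Lemma walk_hits_fine (l L a kp h s0 D0 D1 S : R) N :
  0 < l -> l <= L -> 0 < kp -> 0 <= h -> L ^+ 2 * h <= kp ->
  0 < s0 -> tau 0 <= s0 -> 0 <= D0 -> D0 <= a - l ^+ 2 * tau 0 / 2 ->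
  0 <= D1 -> D1 < l ^+ 2 * tau N / 2 - a -> 0 < S -> tau N <= S ->
  (forall k, (k < N)%N -> 0 < tau k.+1 - tau k <= h) ->
  ((expR (- a - kp) * (1 - (expR (- D0 ^+ 2 / (2 * (L ^+ 2 * s0)))
      + 128 * L ^+ 4 * h * S / kp ^+ 4 + expR (- D1 ^+ 2 / (2 * (L ^+ 2 * S))))))%:E <=
   P [set t | hits N.+1 a (fun k => l * X (u k) t - l ^+ 2 * tau k / 2)%R])%E.
Proof.
move=> l0 lL kp0 h0 hkp s00 ts0 D00 D0a D10 D1a S0 tS dt.
have tau0 k : 0 <= tau k by rewrite -(ipu (leqnn k)) gip_ge0.
have L0 : 0 < L by exact: lt_le_trans lL.
have l2 : l ^+ 2 <= L ^+ 2 by rewrite ler_sqr // nnegrE ltW.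
have lL2 x y : 0 <= x -> x <= y -> l ^+ 2 * x <= L ^+ 2 * y.
  by move=> x0 xy; apply: ler_pM => //; exact: sqr_ge0.
have mXu k : measurable_fun setT (X (u k)) by exact: gX_meas.
apply: walk_hits_ge => //; first exact: ltW.
rewrite 2!EFinD; apply: leeD; first apply: leeD.
- apply: (@chernoff_le (l *: u 0)) => //.
  + by rewrite mulr_gt0 // exprn_gt0.
  + by rewrite gipZl gipZr ipu // mulrA -expr2; apply: lL2.
  + by apply: measurable_funD; [apply: measurable_funM => //; exact: measurable_cst|exact: measurable_cst].
  + by move=> t; rewrite gXZ => ?; lra.
- apply: (@le_trans _ _ (\sum_(k < N) (128 * L ^+ 4 * h / kp ^+ 4 * (tau k.+1 - tau k))%:E)%E).
    apply: lee_sum => k _; have /andP[d0 dh] := dt k (ltn_ord k).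
    set dk := tau k.+1 - tau k in d0 dh *.
    have Ldk : L ^+ 2 * dk <= kp by apply: le_trans hkp; rewrite ler_wpM2l ?sqr_ge0.
    have ldk : l ^+ 2 * dk <= L ^+ 2 * dk by rewrite ler_wpM2r // ltW.
    have s1 : 0 < L ^+ 2 * dk by rewrite mulr_gt0 ?exprn_gt0.
    apply: (@le_trans _ _ (expR (- (kp / 2) ^+ 2 / (2 * (L ^+ 2 * dk))))%:E).
      apply: (@chernoff_le (l *: (u k.+1 - u k))) => //.
      + rewrite gipZl gipZr mulrA -expr2 gipBl !gipBr (gip_sym X (u k.+1) (u k)) !ipu //.
        by apply: le_trans ldk; rewrite ler_wpM2l ?sqr_ge0 // /dk; lra.
      + by rewrite divr_ge0 // ltW.
      + by apply: measurable_funD; [apply: measurable_funM; [exact: measurable_cst|exact: measurable_funB]|exact: measurable_cst].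
      + by move=> t; rewrite gXZ gXB => ?; lra.
    rewrite lee_fin.
    have -> : - (kp / 2) ^+ 2 / (2 * (L ^+ 2 * dk)) = - (kp ^+ 2 / (8 * (L ^+ 2 * dk))) by field; rewrite !gt_eqF.
    apply: (le_trans (expRN_le_sqr _)); first by rewrite divr_gt0 ?exprn_gt0 ?mulr_gt0.
    have -> : 2 / (kp ^+ 2 / (8 * (L ^+ 2 * dk))) ^+ 2 = 128 * L ^+ 4 * dk / kp ^+ 4 * dk by field; rewrite !gt_eqF.
    apply: ler_wpM2r; first exact: ltW.
    apply: ler_wpM2r; first by rewrite invr_ge0 exprn_ge0 // ltW.
    by apply: ler_wpM2l => //; rewrite mulr_ge0 // exprn_ge0 // ltW.
  have -> : (\sum_(k < N) (128 * L ^+ 4 * h / kp ^+ 4 * (tau k.+1 - tau k))%:E)%E = (128 * L ^+ 4 * h / kp ^+ 4 * (tau N - tau 0))%:E.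
    rewrite sumEFin -mulr_sumr; congr (_ * _)%:E.
    by rewrite -(big_mkord xpredT (fun k => tau k.+1 - tau k)) telescope_sumr.
  rewrite lee_fin (_ : 128 * L ^+ 4 * h * S / kp ^+ 4 = 128 * L ^+ 4 * h / kp ^+ 4 * S); last by ring.
  rewrite ler_wpM2l ?mulr_ge0 ?invr_ge0 ?exprn_ge0 ?(ltW kp0) ?(ltW L0) //.
  by have := tau0 0; lra.
- have ml : measurable_fun setT (fun t => l * X (u N) t + l ^+ 2 * tau N / 2).
    by apply: measurable_funD; [apply: measurable_funM => //; exact: measurable_cst|exact: measurable_cst].
  apply: (@le_trans _ _ (P [set t | D1 < X (- (l *: u N)) t]%R)).
    apply: le_measure; rewrite ?inE.
    + by apply: (measurable_set_bool (b := fun t => l * X (u N) t + l ^+ 2 * tau N / 2 <= a)); apply: measurable_fun_ler => //; exact: measurable_cst.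
    + by apply: (measurable_set_bool (b := fun t => D1 < X (- (l *: u N)) t)); apply: measurable_fun_ltr; [exact: measurable_cst|exact: gX_meas].
    + by move=> t /=; rewrite gXN gXZ => ?; lra.
  apply: chernoff => //; first by rewrite mulr_gt0 ?exprn_gt0.
  by rewrite gipNl gipNr opprK gipZl gipZr ipu // mulrA -expr2; apply: lL2.
Qed.

(** A staircase below the exponential with steps at the multiples of kp: it expresses an exponential
    through the crossings of finitely many levels. *)
Lemma exp_min_steps (m kp : R) J : 0 < kp ->
  \sum_(j < J) (expR (j.+1%:R * kp) - expR (j%:R * kp)) * (j.+1%:R * kp < m)%R%:R <= expR (Num.min m (J%:R * kp)).
Proof.
move=> kp0.
suff : 0 <= m -> 1 + \sum_(j < J) (expR (j.+1%:R * kp) - expR (j%:R * kp)) * (j.+1%:R * kp < m)%R%:R <= expR (Num.min m (J%:R * kp)).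
  have [m0 h|m0 _] := leP 0 m; first by apply: le_trans (h isT); rewrite lerDr.
  rewrite big1 ?expR_ge0 // => j _; rewrite ltNge (ltW (lt_le_trans m0 _)) ?mulr0 //.
  by rewrite mulr_ge0 // ltW.
move=> m0; elim: J => [|J IH]; first by rewrite big_ord0 mul0r addr0 (min_idPr m0) expR0.
rewrite big_ord_recr /= addrA.
have JJ : J%:R * kp <= J.+1%:R * kp by rewrite ler_wpM2r ?ler_nat // ltW.
have [h|h] := ltP (J.+1%:R * kp) m; last first.
  by rewrite mulr0 addr0; apply: (le_trans IH); rewrite ler_expR ge_min lexx.
move: IH; rewrite (min_idPr (ltW (le_lt_trans JJ h))) mulr1 => IH.
by lra.
Qed.

(** The level (j+1) kp is crossed with probability about exp (- (j+1) kp) and adds exp ((j+1) kp) -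
    exp (j kp), hence about kp; J levels give J kp. They must stay below l^2 tau N / 2, the drift
    accumulated by z'. With J kp close to that value the bound matches the main term of
    [E_exp_rmax_le]. *)
Lemma walk_exp_ge (l L kp h s0 D1 S : R) N J :
  0 < l -> l <= L -> 0 < kp -> 0 <= h -> L ^+ 2 * h <= kp ->
  0 < s0 -> tau 0 = 0 ->
  0 <= D1 -> D1 < l ^+ 2 * tau N / 2 - J%:R * kp -> 0 < S -> tau N <= S ->
  (forall k, (k < N)%N -> 0 < tau k.+1 - tau k <= h) ->
  expR (- kp ^+ 2 / (2 * (L ^+ 2 * s0))) + 128 * L ^+ 4 * h * S / kp ^+ 4
      + expR (- D1 ^+ 2 / (2 * (L ^+ 2 * S))) <= kp -> kp <= 1 ->
  ((J%:R * kp * expR (- (2 * kp)) * (1 - kp))%:E <=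
   \int[P]_t (expR (Num.min (rmax N.+1 (fun k => l * X (u k) t - l ^+ 2 * tau k / 2)%R) (J%:R * kp)))%:E)%E.
Proof.
move=> l0 lL kp0 h0 hkp s00 t0 D10 D1a S0 tS dt Heta kp1.
set eta := (X in X <= kp) in Heta.
have mZ k : measurable_fun setT (fun t => l * X (u k) t - l ^+ 2 * tau k / 2).
  by apply: measurable_funB; [apply: measurable_funM; [exact: measurable_cst|exact: gX_meas]|exact: measurable_cst].
set Z := fun t k => l * X (u k) t - l ^+ 2 * tau k / 2.
have mr : measurable_fun setT (fun t => rmax N.+1 (Z t)) by exact: (measurable_rmax N.+1 (fun k t => Z t k)).
pose c (j : nat) := expR (j.+1%:R * kp) - expR (j%:R * kp).
have c0 j : 0 <= c j by rewrite subr_ge0 ler_expR ler_wpM2r ?ler_nat // ltW.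
have mh j : measurable_fun setT (fun t => (hits N.+1 (j.+1%:R * kp) (Z t))%:R%:E : \bar R).
  by apply: measurable_nat_bool; exact: (measurable_hits N.+1 _ (fun k t => Z t k)).
have mch (j : nat) : measurable_fun setT (fun t => (c j)%:E * (hits N.+1 (j.+1%:R * kp) (Z t))%:R%:E : \bar R)%E.
  exact: measurable_funeM.
apply: (@le_trans _ _ (\int[P]_t (\sum_(j < J) (c j)%:E * (hits N.+1 (j.+1%:R * kp) (Z t))%:R%:E))%E); last first.
  apply: int_le.
  - exact: (@measurable_bigsum _ _ _ _ (fun j t => (c j)%:E * (hits N.+1 (j.+1%:R * kp) (Z t))%:R%:E)%E).
  - apply/measurable_EFinP; apply: measurable_expRf.
    by apply: measurable_minr => //; exact: measurable_cst.
  - by move=> t; apply: sume_ge0 => j _; rewrite mule_ge0 // lee_fin.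
  - move=> t; rewrite sumEFin lee_fin; apply: le_trans (exp_min_steps _ _ kp0).
    apply: ler_sum => j _; rewrite (rmax_hits N.+1 (Z t)) //.
    by rewrite mulr_ge0 // ltW.
rewrite (@int_sum _ _ _ P J (fun j t => (c j)%:E * (hits N.+1 (j.+1%:R * kp) (Z t))%:R%:E)%E) //; last first.
  by move=> k t; rewrite mule_ge0 // lee_fin.
apply: (@le_trans _ _ (\sum_(j < J) (kp * expR (- (2 * kp)) * (1 - kp))%:E)%E).
  by rewrite sumEFin lee_fin sumr_const card_ord -[leRHS]mulr_natl !mulrA.
apply: lee_sum => j _.
rewrite (int_Zl P (c0 j) (mh j)); last by move=> t; rewrite lee_fin.
rewrite integral_bool; last exact: (measurable_hits N.+1 _ (fun k t => Z t k)).
have jJ : j.+1%:R * kp <= J%:R * kp by rewrite ler_wpM2r ?ler_nat // ltW.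
have kj : kp <= j.+1%:R * kp by rewrite -[leLHS]mul1r ler_wpM2r ?ler1n // ltW.
have := @walk_hits_fine l L (j.+1%:R * kp) kp h s0 kp D1 S N l0 lL kp0 h0 hkp s00.
rewrite t0 !mulr0 mul0r subr0 => /(_ (ltW s00) (ltW kp0) kj D10).
move=> /(_ (lt_le_trans D1a (lerB (lexx _) jJ)) S0 tS dt) H.
apply: le_trans (lee_wpmul2l _ H); last by rewrite lee_fin.
rewrite -EFinM lee_fin (mulrA (c j)); apply: ler_pM.
- by rewrite mulr_ge0 ?expR_ge0 // ltW.
- by lra.
- rewrite /c mulrBl -!expRD.
  have -> : j.+1%:R * kp + (- (j.+1%:R * kp) - kp) = - kp by ring.
  have -> : j%:R * kp + (- (j.+1%:R * kp) - kp) = - (2 * kp) by rewrite -[j.+1%:R]/((1 + j)%:R) natrD; ring.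
  have -> : expR (- kp) = expR (- (2 * kp)) * expR kp by rewrite -expRD; congr expR; ring.
  rewrite -[X in _ <= _ - X]mulr1 -mulrBr mulrC ler_wpM2l ?expR_ge0 //.
  by have := expR_ge1Dx kp; lra.
- by rewrite -/eta; lra.
Qed.
End walk_fine.

(** * Brownian bridges as walks in another clock *)

Section bridge.
Context {R : realType} (V : lmodType R) d (T : measurableType d) (P : probability T R).
Variable X : gfield V P.
Local Notation ip := (gip X).
Variables (l : nat -> V) (lt : V) (th : nat -> R) (theta : R).
Hypothesis theta0 : 0 < theta.
Hypothesis ipl : forall j k, (j <= k)%N -> ip (l j) (l k) = th j.
Hypothesis iplt : forall k, ip (l k) lt = th k.
Hypothesis iptt : ip lt lt = theta.
Hypothesis th_lt : forall k, th k < theta.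

(** [gbr] removes from l its regression on the end value lt. Divided by theta - th it has
    independent increments, with clock [taubr]: Doob's change of time. *)
Definition gbr k : V := l k - (th k / theta) *: lt.
Definition ubr k : V := (theta - th k)^-1 *: gbr k.
Definition taubr k := th k / (theta * (theta - th k)).

Lemma ip_gbr j k : (j <= k)%N -> ip (gbr j) (gbr k) = th j - th j * th k / theta.
Proof.
move=> jk; rewrite /gbr !gipE ipl // iplt iptt gip_sym iplt.
by field; rewrite gt_eqF.
Qed.

Lemma ip_ubr j k : (j <= k)%N -> ip (ubr j) (ubr k) = taubr j.
Proof.
move=> jk; rewrite /ubr gipZl gipZr ip_gbr // /taubr.
have jt : 0 < theta - th j by rewrite subr_gt0.
have kt : 0 < theta - th k by rewrite subr_gt0.
by field; rewrite !gt_eqF.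
Qed.

(** A constant level for the bridge is a line for the walk. Scaled by 2 (y - b) it is the line of
    the exponential martingale, at level 2 y (y - b) / theta, the exponent of the reflection
    principle; the equivalence is exact. *)
Lemma hits_bridge (y b : R) N t : b < y ->
  hits N y (fun k => X (gbr k) t + th k / theta * b) =
  hits N (2 * y * (y - b) / theta) (fun k => (2 * (y - b)) * X (ubr k) t - (2 * (y - b)) ^+ 2 * taubr k / 2).
Proof.
move=> yb.
have E k : (y < X (gbr k) t + th k / theta * b) =
  (2 * y * (y - b) / theta < (2 * (y - b)) * X (ubr k) t - (2 * (y - b)) ^+ 2 * taubr k / 2).
  have tk : 0 < theta - th k by rewrite subr_gt0.
  rewrite -subr_gt0 -[in RHS]subr_gt0.
  have -> : (2 * (y - b)) * X (ubr k) t - (2 * (y - b)) ^+ 2 * taubr k / 2 - 2 * y * (y - b) / theta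
     = (2 * (y - b) / (theta - th k)) * (X (gbr k) t + th k / theta * b - y).
    by rewrite /ubr gXZ /taubr; field; rewrite !gt_eqF.
  by rewrite pmulr_rgt0 // divr_gt0 // mulr_gt0 // subr_gt0.
by elim: N => [//|N IH] /=; rewrite IH E.
Qed.

Lemma measurable_hits_bridge (y b : R) N :
  measurable_fun setT (fun t => hits N y (fun k => X (gbr k) t + th k / theta * b)).
Proof.
apply: (measurable_hits N y (fun k t => X (gbr k) t + th k / theta * b)) => k.
by apply: measurable_funD; [exact: gX_meas|exact: measurable_cst].
Qed.

Lemma bridge_le (y b : R) N : 0 <= y ->
  (P [set t | hits N y (fun k => X (gbr k) t + th k / theta * b)%R] <= (expR (- (2 * y * (y - b) / theta)))%:E)%E.
Proof.
move=> y0; have [yb|by_] := leP y b.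
  apply: (@le_trans _ _ 1%E); first exact: probability_le1 (measurable_set_bool (measurable_hits_bridge _ _ _)).
  rewrite lee_fin -[leLHS]expR0 ler_expR oppr_ge0 mulr_le0_ge0 ?invr_ge0 ?(ltW theta0) //.
  by rewrite mulr_ge0_le0 ?mulr_ge0 // subr_le0.
have -> : [set t | hits N y (fun k => X (gbr k) t + th k / theta * b)] =
  [set t | hits N (2 * y * (y - b) / theta) (fun k => (2 * (y - b)) * X (ubr k) t - (2 * (y - b)) ^+ 2 * taubr k / 2)].
  by apply/funext => t; rewrite /mkset hits_bridge.
exact: ville ip_ubr _ _ _.
Qed.

Lemma bridge_ge (y b L kp h D0 D1 S : R) N :
  b < y -> 2 * (y - b) <= L -> 0 < kp -> 0 <= h -> L ^+ 2 * h <= kp -> 0 < S ->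
  0 <= D0 -> D0 <= 2 * y * (y - b) / theta - (2 * (y - b)) ^+ 2 * taubr 0 / 2 ->
  0 <= D1 -> D1 < (2 * (y - b)) ^+ 2 * taubr N / 2 - 2 * y * (y - b) / theta ->
  taubr 0 <= S -> taubr N <= S ->
  (forall k, (k < N)%N -> 0 < taubr k.+1 - taubr k <= h) ->
  ((expR (- (2 * y * (y - b) / theta) - kp) * (1 - (expR (- D0 ^+ 2 / (2 * (L ^+ 2 * S)))
      + 128 * L ^+ 4 * h * S / kp ^+ 4 + expR (- D1 ^+ 2 / (2 * (L ^+ 2 * S))))))%:E <=
   P [set t | hits N.+1 y (fun k => X (gbr k) t + th k / theta * b)%R])%E.
Proof.
move=> yb lL kp0 h0 hkp S0 D00 D0a D10 D1a t0S tNS dt.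
have -> : [set t | hits N.+1 y (fun k => X (gbr k) t + th k / theta * b)] =
  [set t | hits N.+1 (2 * y * (y - b) / theta) (fun k => (2 * (y - b)) * X (ubr k) t - (2 * (y - b)) ^+ 2 * taubr k / 2)].
  by apply/funext => t; rewrite /mkset hits_bridge.
apply: (walk_hits_fine ip_ubr) => //.
by rewrite mulr_gt0 // subr_gt0.
Qed.
End bridge.

(** * A line plus off-line noise, given the value at the corner [one] *)

Section column.
Context {R : realType} (V : lmodType R) d (T : measurableType d) (P : probability T R).
Variable X : gfield V P.
Local Notation ip := (gip X).
Variables (one o : V) (v : R).
Local Notation theta := (1 - v).
Hypothesis v01 : 0 < v < 1.
Hypothesis ip11 : ip one one = 1.
Hypothesis ipo1 : ip o one = v.
Hypothesis ipoo : ip o o = v.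
Variables (l : nat -> V) (th : nat -> R).
Hypothesis ipl : forall j k, (j <= k)%N -> ip (l j) (l k) = th j.
Hypothesis ipl1 : forall k, ip (l k) one = th k.
Hypothesis iplo : forall k, ip (l k) o = 0.
Hypothesis th_lt : forall k, th k < theta.
Variables (kap : nat -> nat) (e : nat -> V) (mu : nat -> R).
Hypothesis ipe1 : forall j, ip (e j) one = mu j.
Hypothesis ipeo : forall j, ip (e j) o = mu j.
Hypothesis iple : forall j k, ip (l j) (e k) = 0.

Let v0 : 0 < v. Proof. by case/andP: v01. Qed.
Let t0 : 0 < theta. Proof. by rewrite subr_gt0; case/andP: v01. Qed.
Let lt := one - o.

Lemma col_iplt k : ip (l k) lt = th k.
Proof. by rewrite gipBr ipl1 iplo subr0. Qed.

Lemma col_iptt : ip lt lt = theta.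
Proof. by rewrite !gipE ip11 ipoo (gip_sym X one) ipo1; ring. Qed.

Definition colden (w x : R) : R :=
  (Num.sqrt theta)^-1 * expR (x ^+ 2 / (v *+ 2) - (x - v * w) ^+ 2 / (v * theta *+ 2)).

Definition colg k := gbr l lt th theta k.

(* Off the line, (e j) splits into its part along o and an orthogonal rest; conditioning on
   X one = w turns X o into a N (v w, v theta) variable, of density colden w against its law. *)
Lemma column_repr (u w : R) N :
  P [set t | hits N u (fun j => X (l (kap j) + e j) t - (th (kap j) + mu j) * (X one t - w))]%R =
  (\int[P]_t ((colden w (X o t))%:E *
     P [set t' | hits N u (fun j => (X (colg (kap j)) t' + th (kap j) / theta * (w - X o t)) + X (e j) t)]%R))%E.
Proof.
pose ep j := e j - (mu j / v) *: o.
pose o' := o - v *: one.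
pose al (i : option nat) : V := if i is Some j then ep j else o'.
have epo j : ip (ep j) o = 0 by rewrite !gipE ipeo ipoo divfK ?gt_eqF // subrr.
have ep1 j : ip (ep j) one = 0 by rewrite !gipE ipe1 ipo1 divfK ?gt_eqF // subrr.
have ipg1 k : ip (colg k) one = th k - th k / theta * theta.
  by rewrite /colg /gbr !gipE ipl1 ip11 ipo1.
have ipg1' k : ip (colg k) one = 0 by rewrite ipg1 divfK ?gt_eqF // subrr.
have ipgo k : ip (colg k) o = 0.
  by rewrite /colg /gbr !gipE iplo ipoo (gip_sym X one) ipo1 subrr mulr0 subr0.
have ipge k j : ip (colg k) (e j) = 0.
  by rewrite /colg /gbr !gipE iple (gip_sym X one) ipe1 (gip_sym X o) ipeo subrr mulr0 subr0.
have alg i k : ip (al i) (colg k) = 0.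
  by rewrite gip_sym; case: i => [j|]; rewrite /al /ep /o' gipBr ?gipZr ?ipgo ?ipge ?ipg1' mulr0 subr0.
have o'ep j : ip (ep j) o' = 0 by rewrite gipBr gipZr epo ep1 mulr0 subrr.
have o'o' : ip o' o' = v * theta.
  by rewrite !gipE ipoo ip11 (gip_sym X one) ipo1; ring.
(* index None: o', Some (inl j): ep j, Some (inr k): colg k *)
pose K := (option nat + nat)%type.
pose phi (i : K) : V := match i with inl a => al a | inr _ => 0 end.
pose psi (i : K) : V := match i with inl _ => 0 | inr k => colg k end.
pose Yf (x : R) (ye : nat -> R) (yg : nat -> R) (j : nat) : R :=
  yg (kap j) + th (kap j) / theta * (w - x) + (ye j + mu j / v * x).
pose f (y : @path R K) : \bar R :=
  (hits N u (Yf (y (inl None) + v * w) (fun j => y (inl (Some j))) (fun k => y (inr k))))%:R%:E.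
have mf : measurable_fun setT f.
  apply: measurable_nat_bool.
  apply: (measurable_hits N u (fun j (y : @path R K) => Yf (y (inl None) + v * w) (fun j => y (inl (Some j))) (fun k => y (inr k)) j)) => j.
  by rewrite /Yf; mreal.

have f0 y : (0 <= f y)%E by rewrite lee_fin.
have mh0 : measurable_fun setT (fun t => hits N u (fun j => X (l (kap j) + e j) t - (th (kap j) + mu j) * (X one t - w))).
  apply: (measurable_hits N u (fun j t => X (l (kap j) + e j) t - (th (kap j) + mu j) * (X one t - w))) => j.
  by mreal.
rewrite -(integral_bool P mh0).
(* The conditional field is written through o', ep and colg, all orthogonal to [one], so X one
   cancels. colg is orthogonal to the other two and moves to a second sample. *)
transitivity (\int[P]_t f (fun i => X (phi i + psi i)%R t))%E.
  apply: eq_integral => t _; rewrite /f; congr (_%:R%:E); congr nat_of_bool.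
  apply: hits_ext => j _; rewrite /Yf /= !(addr0, add0r) /colg /gbr /ep /o' /lt !gXE.
  by field; rewrite !gt_eqF.
rewrite gX_decouple //; last first.
  by move=> [i|i] [j|k] /=; rewrite ?gip0l ?gip0r ?alg.
pose H (x : R) (ye : nat -> R) : \bar R :=
  P [set t' | hits N u (fun j => Yf (x + v * w) ye (fun k => X (colg k) t') j)]%R.
have mhY x ye : measurable_fun setT (fun t' => hits N u (fun j => Yf x ye (fun k => X (colg k) t') j)).
  by apply: (measurable_hits N u (fun j t' => Yf x ye (fun k => X (colg k) t') j)) => j; rewrite /Yf; mreal.
have HE t : (\int[P]_t' f (fun i => (X (phi i) t + X (psi i) t')%R) = H (X o' t) (fun j => X (ep j) t))%E.
  rewrite /H -(integral_bool P (mhY _ _)); apply: eq_integral => t' _; rewrite /f.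
  congr (_%:R%:E); congr nat_of_bool; apply: hits_ext => j _; rewrite /Yf /= !gX0 !(addr0, add0r) //.
under eq_integral => t _ do rewrite HE.
pose G (y : @path R (option nat)) : \bar R := H (y None) (fun j => y (Some j)).
have mG (a : R) : measurable_fun setT (fun y : @path R (option nat) => H (y None - a) (fun j => y (Some j))).
  have -> : (fun y : @path R (option nat) => H (y None - a) (fun j => y (Some j))) =
     (fun y => \int[P]_t' (hits N u (fun j => Yf (y None - a + v * w) (fun j => y (Some j)) (fun k => X (colg k) t') j))%:R%:E)%E.
    by apply/funext => y; rewrite integral_bool.
  apply: (@measurable_fun_fubini_tonelli_F _ _ _ _ _ P (fun zt : @path R (option nat) * T =>
    (hits N u (fun j => Yf (zt.1 None - a + v * w) (fun j => zt.1 (Some j)) (fun k => X (colg k) zt.2) j))%:R%:E)) => //.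
  apply: measurable_nat_bool.
  apply: (measurable_hits N u (fun j (zt : @path R (option nat) * T) => Yf (zt.1 None - a + v * w) (fun j => zt.1 (Some j)) (fun k => X (colg k) zt.2) j)) => j.
  have m2 i : measurable_fun setT (fun zt : @path R (option nat) * T => zt.1 i : R).
    exact: (measurableT_comp (measurable_coord i) measurable_fst).
  have m3 k : measurable_fun setT (fun zt : @path R (option nat) * T => X (colg k) zt.2 : R).
    by apply: (measurableT_comp (gX_meas X _)).
  by rewrite /Yf; repeat first [exact: m2|exact: m3|exact: measurable_cst|apply: measurable_funB|apply: measurable_funD|apply: measurable_funM].
have mGH (c : path (option nat) -> \bar R) (g : V) : measurable_fun setT c -> (forall y, 0 <= c y)%E ->
    (forall j, ip (ep j) g = 0) ->
    (\int[P]_t c (fun i => X (if i is Some j then ep j else g) t) =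
     \int[P]_t \int[gm (ip g g)]_x c (fun i => if i is Some j then X (ep j) t else x))%E.
  move=> mc c0 epg.
  pose ph (i : option nat) := if i is Some j then ep j else 0.
  pose ps (i : option nat) := if i is Some j then 0 else g.
  transitivity (\int[P]_t c (fun i => X (ph i + ps i)%R t))%E.
    apply: eq_integral => t _; congr c; apply/funext => -[j|] /=; by rewrite ?addr0 ?add0r.
  rewrite gX_decouple //; last by move=> [i|] [j|]; rewrite /= ?gip0l ?gip0r.
  apply: eq_integral => t _.
  have mc2 : measurable_fun setT (fun x : R => c (fun i => if i is Some j then X (ep j) t else x)).
    apply: (measurableT_comp mc); apply: (measurable_to_path (Y := fun i (x : R) => if i is Some j then X (ep j) t else x)).
    by case=> [j|]; [exact: measurable_cst|exact: measurable_id].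
  apply: (etrans _ (gX_int X g mc2 (fun x => c0 _))).
  apply: eq_integral => t' _; congr c; apply/funext => -[j|] /=; by rewrite gX0 ?addr0 ?add0r.
have H0 x ye : (0 <= H x ye)%E by exact: measure_ge0.
have mden (w' : R) : measurable_fun setT (colden w').
  apply: measurable_funM; first exact: measurable_cst.
  apply: measurable_expRf.
  by rewrite /=; apply: measurable_funB; apply: measurable_funM; rewrite /=; try exact: measurable_cst;
    apply: measurable_funX => //; exact: measurable_funB.
have den0 x : 0 <= colden w x by rewrite mulr_ge0 ?invr_ge0 ?sqrtr_ge0 ?expR_ge0.
pose c2 (y : @path R (option nat)) : \bar R := ((colden w (y None))%:E * H (y None - v * w)%R (fun j => y (Some j)))%E.
have mc2 : measurable_fun setT c2.
  apply: emeasurable_funM; last exact: mG.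
  by apply/measurable_EFinP; apply: (measurableT_comp (mden w)); exact: measurable_coord.
have m0 := mG 0.
transitivity (\int[P]_t (fun y : @path R (option nat) => H (y None - 0)%R (fun j => y (Some j))) (fun i => X (if i is Some j then ep j else o') t))%E.
  by apply: eq_integral => t _ /=; rewrite subr0.
transitivity (\int[P]_t c2 (fun i => X (if i is Some j then ep j else o) t))%E; last first.
  apply: eq_integral => t _; rewrite /c2; congr (_ * _)%E; rewrite /H; congr (P _).
  apply/funext => t'; rewrite /mkset; congr (is_true _); apply: hits_ext => j _.
  rewrite /Yf subrK; congr (_ + _).
  by rewrite /ep gXB gXZ subrK.
have c20 y : (0 <= c2 y)%E by apply: mule_ge0; [rewrite lee_fin|exact: H0].
(* It remains to replace o', of variance v theta and shifted by v w, by o, of variance v: this is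
   [gm_ratio], and its factor is [colden]. *)
apply: (etrans (mGH _ o' m0 (fun y => H0 _ _) o'ep)).
apply: (etrans _ (esym (mGH _ o mc2 c20 epo))).
apply: eq_integral => t _; rewrite o'o' ipoo /c2.
have mp : measurable_fun setT (fun x : R => (fun i => if i is Some j then X (ep j) t else x) : @path R (option nat)).
  apply: (measurable_to_path (Y := fun i (x : R) => if i is Some j then X (ep j) t else x)).
  by case=> [j|]; [exact: measurable_cst|exact: measurable_id].
have mf' : measurable_fun setT (fun x : R => H (x - v * w) (fun j => X (ep j) t)) by exact: (measurableT_comp (mG (v * w)) mp).
apply: (etrans _ (etrans (gm_ratio (v * w) v0 t0 mf' (fun x => H0 _ _)) _)).
  apply: eq_integral => x _.
  have -> : x - 0 = x + v * w - v * w by ring.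
  reflexivity.
by apply: eq_integral => x _; apply: muleC.
Qed.

Lemma colden_ge0 w x : 0 <= colden w x.
Proof. by rewrite mulr_ge0 ?invr_ge0 ?sqrtr_ge0 ?expR_ge0. Qed.

Lemma measurable_colden w : measurable_fun setT (colden w).
Proof.
apply: measurable_funM; first exact: measurable_cst.
apply: measurable_expRf.
by rewrite /=; apply: measurable_funB; apply: measurable_funM; rewrite /=; try exact: measurable_cst;
  apply: measurable_funX => //; exact: measurable_funB.
Qed.

(** The exponent of [colden] times the bridge bound is affine in x and M up to a square. Minus
    [colc] is its slope in x and twice [colc] its slope in M; [colC] collects the rest, except for
    the term - c^2 v / 2 that normalizes a tilt along o. *)
Definition colc (u w : R) : R := (2 * u - w) / theta.
Definition colC (u w : R) : R :=
  (Num.sqrt theta)^-1 * expR (- 2 * u ^+ 2 + 2 * u * w + colc u w ^+ 2 * v ^+ 2 / 2).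

Lemma colden_bridge (u w x M : R) :
  colden w x * expR (- (2 * (u - M) * (u - M - (w - x)) / theta)) =
  colC u w * expR (- colc u w * x - colc u w ^+ 2 * v / 2 + 2 * colc u w * M - (x - 2 * M) ^+ 2 / (2 * theta)).
Proof.
rewrite /colden /colC -!mulrA -!expRD; congr (_ * expR _).
by rewrite /colc; field; rewrite !gt_eqF.
Qed.

(** Once M exceeds u the bridge has nothing left to climb. The bound then holds for [colden] alone,
    because the difference of exponents is a sum of nonnegative terms. *)
Lemma colden_le (u w x M : R) : 0 < 2 * u - w -> u <= M ->
  colden w x <= colC u w * expR (- colc u w * x - colc u w ^+ 2 * v / 2 + 2 * colc u w * M).
Proof.
move=> uw uM.
rewrite /colden /colC -[leRHS]mulrA ler_wpM2l ?invr_ge0 ?sqrtr_ge0 // -expRD ler_expR.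
rewrite -subr_ge0.
have -> : - 2 * u ^+ 2 + 2 * u * w + colc u w ^+ 2 * v ^+ 2 / 2 +
  (- colc u w * x - colc u w ^+ 2 * v / 2 + 2 * colc u w * M) - (x ^+ 2 / (v *+ 2) - (x - v * w) ^+ 2 / (v * theta *+ 2))
  = ((x - 2 * u) ^+ 2 + 4 * (M - u) * (2 * u - w)) / (2 * theta).
  by rewrite /colc; field; rewrite !gt_eqF.
apply: divr_ge0; last by rewrite mulr_ge0 // ltW.
apply: addr_ge0; first exact: sqr_ge0.
by apply: mulr_ge0; [rewrite mulr_ge0 ?subr_ge0|exact: ltW].
Qed.

Lemma colC_ge0 u w : 0 <= colC u w.
Proof. by rewrite mulr_ge0 ?invr_ge0 ?sqrtr_ge0 ?expR_ge0. Qed.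

Lemma colden_ge (u w x M kp : R) : kp <= 1 -> (x - 2 * M) ^+ 2 / (2 * theta) <= kp ->
  colC u w * expR (- (2 * kp)) * (1 - kp) *
    (expR (- colc u w * x - colc u w ^+ 2 * v / 2) * expR (2 * colc u w * M)) <=
  colden w x * (expR (- (2 * (u - M) * (u - M - (w - x)) / theta) - kp) * (1 - kp)).
Proof.
move=> kp1 hq; have := colden_bridge u w x M; have := colC_ge0 u w.
move: (colC u w) (colden w x) (colc u w) => C D c C0 B.
rewrite [X in D * (X * _)]expRD -[X in D * X]mulrA [leRHS]mulrA B.
set p := expR (- c * x - _); set q := expR (2 * c * M); set Q := expR (_ - (x - 2 * M) ^+ 2 / (2 * theta)); set k := expR (- kp).
have E : expR (- (2 * kp)) * (p * q) <= Q * k by rewrite -!expRD ler_expR; lra.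
have kC : 0 <= C * (1 - kp) by rewrite mulr_ge0 // subr_ge0.
have := ler_wpM2l kC E.
have -> : C * (1 - kp) * (expR (- (2 * kp)) * (p * q)) = C * expR (- (2 * kp)) * (1 - kp) * (p * q) by ring.
have -> : C * (1 - kp) * (Q * k) = C * Q * (k * (1 - kp)) by ring.
by [].
Qed.

Lemma col_tilt (u w : R) (f : @path R (option nat) -> \bar R) :
  measurable_fun setT f -> (forall y, 0 <= f y)%E ->
  (\int[P]_t ((expR (- colc u w * X o t - colc u w ^+ 2 * v / 2))%:E * f (fun i => X (if i is Some j then e j else o) t)) =
   \int[P]_t f (fun i => (if i is Some j then X (e j) t - colc u w * mu j else X o t - colc u w * v)%R))%E.
Proof.
move=> mf f0; set c := colc u w.
have := @gX_tilt _ _ _ _ _ X (option nat) (fun i => if i is Some j then e j else o) (- c *: o) f mf f0.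
rewrite gipZl gipZr ipoo => E.
have -> : (\int[P]_t ((expR (- c * X o t - c ^+ 2 * v / 2))%:E * f (fun i => X (if i is Some j then e j else o) t)) =
  \int[P]_t ((expR (X (- c *: o) t - - c * (- c * v) / 2))%:E * f (fun i => X (if i is Some j then e j else o) t)))%E.
  apply: eq_integral => t _; congr ((expR _)%:E * _)%E.
  by rewrite gXZ; field.
rewrite -E; apply: eq_integral => t _; congr f; apply/funext => -[j|] /=.
  by rewrite gipZr ipeo mulNr.
by rewrite gipZr ipoo mulNr.
Qed.

Let mZ u w N : measurable_fun setT (fun t => P [set t' | hits N u (fun j => (X (colg (kap j)) t' + th (kap j) / theta * (w - X o t)) + X (e j) t)]%R).
Proof.
have mh (x : R) (ye : nat -> R) : measurable_fun setT (fun t' => hits N u (fun j => (X (colg (kap j)) t' + th (kap j) / theta * (w - x)) + ye j)).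
  apply: (measurable_hits N u (fun j t' => (X (colg (kap j)) t' + th (kap j) / theta * (w - x)) + ye j)) => j; mreal.
have -> : (fun t => P [set t' | hits N u (fun j => (X (colg (kap j)) t' + th (kap j) / theta * (w - X o t)) + X (e j) t)]%R) =
   (fun t => \int[P]_t' (hits N u (fun j => (X (colg (kap j)) t' + th (kap j) / theta * (w - X o t)) + X (e j) t))%:R%:E)%E.
  by apply/funext => t; rewrite integral_bool.
apply: (@measurable_fun_fubini_tonelli_F _ _ _ _ _ P (fun zt : T * T =>
    (hits N u (fun j => (X (colg (kap j)) zt.2 + th (kap j) / theta * (w - X o zt.1)) + X (e j) zt.1))%:R%:E)) => //.
apply: measurable_nat_bool.
apply: (measurable_hits N u (fun j (zt : T * T) => (X (colg (kap j)) zt.2 + th (kap j) / theta * (w - X o zt.1)) + X (e j) zt.1)) => j.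
have m1 g : measurable_fun setT (fun zt : T * T => X g zt.1 : R) by apply: (measurableT_comp (gX_meas X _)).
have m2 g : measurable_fun setT (fun zt : T * T => X g zt.2 : R) by apply: (measurableT_comp (gX_meas X _)).
by repeat first [exact: m1|exact: m2|exact: measurable_cst|apply: measurable_funB|apply: measurable_funD|apply: measurable_funM].
Qed.

(** If M is the maximum of the off-line noise, the bridge still has to reach u - M, at the price
    given by [bridge_le]. By [colden_bridge] the dependence on X o becomes linear, and the tilt by -
    c o absorbs it, lowering each e j by c mu j. Of the line only the constant [colC] remains. *)
Lemma column_upper (u w : R) N : 0 < 2 * u - w ->
  (P [set t | hits N u (fun j => X (l (kap j) + e j) t - (th (kap j) + mu j) * (X one t - w))]%R <=
   (colC u w)%:E * \int[P]_t (expR (2 * colc u w * rmax N (fun j => X (e j) t - colc u w * mu j)%R))%:E)%E.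
Proof.
move=> uw; rewrite column_repr.
pose f (y : @path R (option nat)) : \bar R := (expR (2 * colc u w * rmax N (fun j => y (Some j))))%:E.
have mr : measurable_fun setT (fun y : @path R (option nat) => rmax N (fun j => y (Some j))).
  by apply: (measurable_rmax N (fun j (y : @path R (option nat)) => y (Some j))) => j; exact: measurable_coord.
have mf : measurable_fun setT f.
  by apply/measurable_EFinP; apply: (measurableT_comp (f := expR)); [exact: measurable_expR|apply: measurable_funM => //; exact: measurable_cst].
have f0 y : (0 <= f y)%E by rewrite lee_fin expR_ge0.
have -> : (\int[P]_t (expR (2 * colc u w * rmax N (fun j => X (e j) t - colc u w * mu j)%R))%:E =
  \int[P]_t f (fun i => (if i is Some j then X (e j) t - colc u w * mu j else X o t - colc u w * v)%R))%E by [].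
rewrite -(col_tilt u w mf f0).
have mI : measurable_fun setT (fun t => (expR (- colc u w * X o t - colc u w ^+ 2 * v / 2))%:E * f (fun i => X (if i is Some j then e j else o) t))%E.
  apply: emeasurable_funM; last exact: (measurableT_comp mf (gX_path X _)).
  by apply/measurable_EFinP; mreal.
rewrite -int_Zl ?colC_ge0 //; last by move=> t; rewrite mule_ge0 // lee_fin expR_ge0.
have den0 := colden_ge0 w.
apply: int_le.
- apply: emeasurable_funM => //; apply/measurable_EFinP.
  by apply: (measurableT_comp (measurable_colden w)); exact: gX_meas.
- exact: measurable_funeM.
- by move=> t; apply: mule_ge0; [rewrite lee_fin|exact: measure_ge0].
move=> t; rewrite /f -!EFinM mulrA -mulrA -expRD.
set M := rmax N _.
have [My|My] := leP u M.
  apply: (@le_trans _ _ ((colden w (X o t))%:E * 1)%E).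
    apply: lee_wpmul2l; first by rewrite lee_fin.
    apply: probability_le1; apply: measurable_set_bool.
    by apply: (measurable_hits N u (fun j t' => (X (colg (kap j)) t' + th (kap j) / theta * (w - X o t)) + X (e j) t)) => j; mreal.
  by rewrite mule1 lee_fin; exact: colden_le.
pose K := (\max_(j < N) kap j).+1.
apply: (@le_trans _ _ ((colden w (X o t))%:E * P [set t' | hits K (u - M) (fun k => X (colg k) t' + th k / theta * (w - X o t))]%R)%E).
  apply: lee_wpmul2l; first by rewrite lee_fin.
  apply: le_measure; rewrite ?inE.
  - apply: measurable_set_bool.
    by apply: (measurable_hits N u (fun j t' => (X (colg (kap j)) t' + th (kap j) / theta * (w - X o t)) + X (e j) t)) => j; mreal.
  - apply: measurable_set_bool.
    by apply: (measurable_hits K (u - M) (fun k t' => X (colg k) t' + th k / theta * (w - X o t))) => j; mreal.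
  - move=> t' /hitsP[j jN h]; apply/hitsP; exists (kap j).
      by rewrite ltnS; exact: (leq_bigmax (Ordinal jN)).
    have := @rmax_ge _ N (fun j => X (e j) t) j jN; rewrite -/M /=; lra.
have y0 : 0 <= u - M by rewrite subr_ge0 ltW.
have B := bridge_le t0 ipl col_iplt col_iptt th_lt (w - X o t) K y0.
apply: (@le_trans _ _ ((colden w (X o t))%:E * (expR (- (2 * (u - M) * (u - M - (w - X o t)) / theta)))%:E)%E).
  by apply: lee_wpmul2l => //; rewrite lee_fin.
rewrite -EFinM lee_fin colden_bridge ler_wpM2l ?colC_ge0 // ler_expR.
by rewrite gerBl divr_ge0 ?sqr_ge0 // mulr_ge0 // ltW.
Qed.

(** On the good event G both M and X o are at most r in absolute value, so the square (x - 2 M)^2 is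
    at most (3 r)^2 and costs at most exp (-kp). M may be any level such that a crossing of u - M by
    the line forces an exceedance in the block; it will be a sum of leg maxima less an allowance. *)
Lemma column_lower (u w kp r : R) N K (G : @path R (option nat) -> bool) (M : @path R (option nat) -> R) :
  0 <= kp <= 1 -> (3 * r) ^+ 2 / (2 * theta) <= kp ->
  measurable_fun setT G -> measurable_fun setT M ->
  (forall m x, `|m| <= r -> `|x| <= r ->
    ((expR (- (2 * (u - m) * (u - m - (w - x)) / theta) - kp) * (1 - kp))%:E <=
     P [set t | hits K (u - m) (fun k => X (colg k) t + th k / theta * (w - x))]%R)%E) ->
  (forall y, G y -> `|M y| <= r /\ `|y None| <= r) ->
  (forall y z, G y -> hits K (u - M y) z -> hits N u (fun j => z (kap j) + y (Some j))) ->
  ((colC u w * expR (- (2 * kp)) * (1 - kp))%:E *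
    \int[P]_t (let y := fun i => (if i is Some j then X (e j) t - colc u w * mu j else X o t - colc u w * v)%R in
       ((G y)%:R * expR (2 * colc u w * M y))%:E) <=
   P [set t | hits N u (fun j => X (l (kap j) + e j) t - (th (kap j) + mu j) * (X one t - w))]%R)%E.
Proof.
move=> /andP[kp0 kp1] rk mG mM Hb HG Hd; rewrite column_repr.
pose f (y : @path R (option nat)) : \bar R := ((G y)%:R * expR (2 * colc u w * M y))%:E.
have mf : measurable_fun setT f.
  apply/measurable_EFinP; apply: measurable_funM; first exact/measurable_EFinP/measurable_nat_bool.
  by apply: (measurableT_comp (f := expR)); [exact: measurable_expR|apply: measurable_funM => //; exact: measurable_cst].
have f0 y : (0 <= f y)%E by rewrite lee_fin mulr_ge0 ?expR_ge0.
rewrite -[X in (_ * X <= _)%E]/(\int[P]_t f (fun i => (if i is Some j then X (e j) t - colc u w * mu j else X o t - colc u w * v)%R))%E.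
rewrite -(col_tilt u w mf f0).
have mI : measurable_fun setT (fun t => (expR (- colc u w * X o t - colc u w ^+ 2 * v / 2))%:E * f (fun i => X (if i is Some j then e j else o) t))%E.
  apply: emeasurable_funM; last exact: (measurableT_comp mf (gX_path X _)).
  by apply/measurable_EFinP; mreal.
have C0 : 0 <= colC u w * expR (- (2 * kp)) * (1 - kp).
  by rewrite !mulr_ge0 ?colC_ge0 ?expR_ge0 // subr_ge0.
have I0 t : (0 <= (expR (- colc u w * X o t - colc u w ^+ 2 * v / 2))%:E * f (fun i => X (if i is Some j then e j else o) t))%E.
  by rewrite mule_ge0 // lee_fin expR_ge0.
rewrite -int_Zl //.
have den0 := colden_ge0 w.
apply: int_le.
- exact: measurable_funeM.
- apply: emeasurable_funM => //; apply/measurable_EFinP.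
  by apply: (measurableT_comp (measurable_colden w)); exact: gX_meas.
- by move=> t; rewrite mule_ge0 // lee_fin.
move=> t; rewrite /f; set y := fun i => _.
have [Gy|nGy] := boolP (G y); last first.
  by rewrite mul0r mule0 mule0; apply: mule_ge0; [rewrite lee_fin|exact: measure_ge0].
have [My oy] := HG y Gy.
rewrite mul1r -!EFinM.
apply: (@le_trans _ _ ((colden w (X o t))%:E * P [set t' | hits K (u - M y) (fun k => X (colg k) t' + th k / theta * (w - X o t))]%R)%E); last first.
  apply: lee_wpmul2l; first by rewrite lee_fin.
  apply: le_measure; rewrite ?inE.
  - apply: measurable_set_bool.
    by apply: (measurable_hits K (u - M y) (fun k t' => X (colg k) t' + th k / theta * (w - X o t))) => j; mreal.
  - apply: measurable_set_bool.
    by apply: (measurable_hits N u (fun j t' => (X (colg (kap j)) t' + th (kap j) / theta * (w - X o t)) + X (e j) t)) => j; mreal.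
  - by move=> t' /= h; exact: (Hd y (fun k => X (colg k) t' + th k / theta * (w - X o t)) Gy h).
apply: le_trans (lee_wpmul2l _ (Hb _ _ My oy)); last by rewrite lee_fin.
rewrite -EFinM lee_fin; apply: colden_ge => //.
apply: le_trans rk; rewrite ler_wpM2r ?invr_ge0 ?mulr_ge0 ?(ltW t0) //.
rewrite -real_normK ?num_real // -[leRHS]real_normK ?num_real // ler_sqr ?nnegrE //.
apply: (le_trans (ler_normB _ _)); rewrite normrM (ger0_norm (_ : 0 <= 2)) //.
have r0 : 0 <= r by apply: le_trans My.
by rewrite [leRHS]ger0_norm ?mulr_ge0 //; have : `|X o t| <= r := oy; lra.
Qed.
End column.

(** * Expectations of products over orthogonal families *)

Section independence.
Context {R : realType} (V : lmodType R) d (T : measurableType d) (P : probability T R).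
Variable X : gfield V P.
Local Notation ip := (gip X).
Local Open Scope ereal_scope.

Lemma gX_indep (I J : Type) (phi : I -> V) (psi : J -> V) (f : path I -> \bar R) (g : path J -> \bar R) :
  (forall i j, ip (phi i) (psi j) = 0%R) ->
  measurable_fun setT f -> measurable_fun setT g -> (forall y, 0 <= f y) -> (forall y, 0 <= g y) ->
  \int[P]_t (f (fun i => X (phi i) t) * g (fun j => X (psi j) t)) =
  (\int[P]_t f (fun i => X (phi i) t)) * (\int[P]_t g (fun j => X (psi j) t)).
Proof.
move=> E mf mg f0 g0.
pose ph (k : I + J) := if k is inl i then phi i else 0%R.
pose ps (k : I + J) := if k is inl i then 0%R else if k is inr j then psi j else 0%R.
pose h (y : @path R (I + J)) := f (fun i => y (inl i)) * g (fun j => y (inr j)).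
have m1 : measurable_fun setT (fun y : @path R (I + J) => (fun i => y (inl i)) : @path R I).
  by apply: (measurable_to_path (Y := fun i (y : @path R (I + J)) => y (inl i))) => i; exact: measurable_coord.
have m2 : measurable_fun setT (fun y : @path R (I + J) => (fun j => y (inr j)) : @path R J).
  by apply: (measurable_to_path (Y := fun j (y : @path R (I + J)) => y (inr j))) => j; exact: measurable_coord.
have mh : measurable_fun setT h by apply: emeasurable_funM; [exact: measurableT_comp mf m1|exact: measurableT_comp mg m2].
have h0 y : 0 <= h y by exact: mule_ge0.
have D := @gX_decouple _ _ _ _ _ X (I + J)%type ph ps h _ mh h0.
apply: (etrans (y := \int[P]_t h (fun i => X (ph i + ps i)%R t))).
  apply: eq_integral => t _; rewrite /h /ph /ps; congr (f _ * g _); apply/funext => k; by rewrite ?addr0 ?add0r.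
rewrite D; last by move=> [i|j] [i'|j'] /=; rewrite ?gip0l ?gip0r ?E.
have mgX : measurable_fun setT (fun t => g (fun j => X (psi j) t)) by exact: (measurableT_comp mg (gX_path X _)).
have mfX : measurable_fun setT (fun t => f (fun j => X (phi j) t)) by exact: (measurableT_comp mf (gX_path X _)).
have g1 : 0 <= \int[P]_t g (fun j => X (psi j) t) by exact: integral_ge0.
apply: (etrans (y := \int[P]_t (f (fun i => X (phi i) t) * \int[P]_t g (fun j => X (psi j) t)))); last first.
  by rewrite (@ge0_integralZr _ _ _ P setT measurableT _ mfX _ (fun t _ => f0 _) g1).
apply: eq_integral => t _.
rewrite -(@ge0_integralZl _ _ _ P setT measurableT _ mgX _ (fun t _ => g0 _) (f0 _)).
by apply: eq_integral => t' _; rewrite /h /ph /ps; congr (f _ * g _); apply/funext => k; rewrite gX0 ?addr0 ?add0r.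
Qed.

Lemma gX_indep_prod (J : Type) n (phi : nat -> J -> V) (f : nat -> path J -> R) :
  (forall i i' j j', i != i' -> ip (phi i j) (phi i' j') = 0%R) ->
  (forall i, measurable_fun setT (f i)) -> (forall i y, (0 <= f i y)%R) ->
  \int[P]_t (\prod_(i < n.+1) f i (fun j => X (phi i j) t))%:E =
  (\int[P]_t (\prod_(i < n) f i (fun j => X (phi i j) t))%:E) * (\int[P]_t (f n (fun j => X (phi n j) t))%:E).
Proof.
move=> E mf f0.
pose ph (k : nat * J) := if (k.1 < n)%N then phi k.1 k.2 else 0%R.
pose F (y : @path R (nat * J)) : \bar R := (\prod_(i < n) f i (fun j => y (i : nat, j)))%:E.
have mF : measurable_fun setT F.
  apply/measurable_EFinP; apply: measurable_prod => i _.
  apply: (measurableT_comp (mf i) (g := fun y : @path R (nat * J) => (fun j => y (i : nat, j)) : @path R J)).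
  by apply: (measurable_to_path (Y := fun j (y : @path R (nat * J)) => y (i : nat, j))) => j; exact: measurable_coord.
have F0 y : 0 <= F y by rewrite lee_fin prodr_ge0.
have FE t : F (fun k => X (ph k) t) = (\prod_(i < n) f i (fun j => X (phi i j) t))%:E.
  by rewrite /F /ph; congr EFin; apply: eq_bigr => i _ /=; rewrite ltn_ord.
have mfE : measurable_fun setT (fun y => (f n y)%:E) by exact/measurable_EFinP.
have fE0 y : 0 <= (f n y)%:E by rewrite lee_fin.
have phE i j : ip (ph i) (phi n j) = 0%R.
  by rewrite /ph; case: ifP => [h|_]; [rewrite E // ltn_eqF|rewrite gip0l].
have := gX_indep phE mF mfE F0 fE0.
under [in X in _ = X -> _]eq_integral do rewrite FE.
move=> <-; apply: eq_integral => t _.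
by rewrite FE big_ord_recr /= EFinM.
Qed.

Lemma gX_indep_prod_le (J : Type) n (phi : nat -> J -> V) (f : nat -> path J -> R) (b : nat -> R) :
  (forall i i' j j', i != i' -> ip (phi i j) (phi i' j') = 0%R) ->
  (forall i, measurable_fun setT (f i)) -> (forall i y, (0 <= f i y)%R) ->
  (forall i, (i < n)%N -> \int[P]_t (f i (fun j => X (phi i j) t))%:E <= (b i)%:E) ->
  \int[P]_t (\prod_(i < n) f i (fun j => X (phi i j) t))%:E <= (\prod_(i < n) b i)%:E.
Proof.
move=> E mf f0; elim: n => [|n IH] H.
  by under eq_integral do rewrite big_ord0; rewrite big_ord0 int_cst1.
rewrite (gX_indep_prod n E mf f0) big_ord_recr EFinM; apply: lee_pmul.
- by apply: integral_ge0 => t _; rewrite lee_fin prodr_ge0.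
- by apply: integral_ge0 => t _; rewrite lee_fin.
- by apply: IH => i h; apply: H; rewrite ltnW.
- exact: H.
Qed.

Lemma gX_indep_prod_ge (J : Type) n (phi : nat -> J -> V) (f : nat -> path J -> R) (b : nat -> R) :
  (forall i i' j j', i != i' -> ip (phi i j) (phi i' j') = 0%R) ->
  (forall i, measurable_fun setT (f i)) -> (forall i y, (0 <= f i y)%R) -> (forall i, 0 <= b i)%R ->
  (forall i, (i < n)%N -> (b i)%:E <= \int[P]_t (f i (fun j => X (phi i j) t))%:E) ->
  (\prod_(i < n) b i)%:E <= \int[P]_t (\prod_(i < n) f i (fun j => X (phi i j) t))%:E.
Proof.
move=> E mf f0 b0; elim: n => [|n IH] H.
  by under eq_integral do rewrite big_ord0; rewrite big_ord0 int_cst1.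
rewrite (gX_indep_prod n E mf f0) big_ord_recr EFinM; apply: lee_pmul.
- by rewrite lee_fin prodr_ge0.
- by rewrite lee_fin.
- by apply: IH => i h; apply: H; rewrite ltnW.
- exact: H.
Qed.
End independence.

(** * Maxima over several parameters *)

Section seq_max.
Context {R : realType} (D : Type).
Implicit Types (s : seq D) (f : D -> R).

Definition smax s f : R := foldr (fun x m => Num.max (f x) m) 0 s.

Lemma smax_ge0 s f : 0 <= smax s f.
Proof. by elim: s => [//|x s IH] /=; rewrite le_max IH orbT. Qed.

Lemma smax_le s f b : 0 <= b -> all (fun x => f x <= b) s -> smax s f <= b.
Proof. by move=> b0; elim: s => [//|x s IH] /= /andP[xb /IH]; rewrite ge_max xb. Qed.

Lemma smax_has s f a : 0 <= a -> (a < smax s f) = has (fun x => a < f x) s.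
Proof. by move=> a0; elim: s => [|x s IH] /=; [rewrite ltNge a0|rewrite lt_max IH]. Qed.

Lemma hits_has (x0 : D) s f a : hits (size s) a (fun k => f (nth x0 s k)) = has (fun x => a < f x) s.
Proof.
apply/hitsP/(has_nthP x0) => -[k kN h]; by exists k.
Qed.

Lemma measurable_has d (T : measurableType d) s (f : D -> T -> R) a :
  (forall x, measurable_fun setT (f x)) -> measurable_fun setT (fun t => has (fun x => a < f x t) s).
Proof.
move=> mf; elim: s => [|x s IH] /=; first exact: measurable_cst.
by apply: measurable_or => //; apply: measurable_fun_ltr => //; exact: measurable_cst.
Qed.

Lemma measurable_smax d (T : measurableType d) s (f : D -> T -> R) :
  (forall x, measurable_fun setT (f x)) -> measurable_fun setT (fun t => smax s (f^~ t)).
Proof.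
move=> mf; elim: s => [|x s IH] /=; first exact: measurable_cst.
exact: measurable_maxr.
Qed.
End seq_max.

Lemma smax_ge {R : realType} (D : eqType) (s : seq D) (f : D -> R) x : x \in s -> f x <= smax s f.
Proof.
elim: s => [//|y s IH]; rewrite in_cons => /predU1P[->|/IH h] /=.
  by rewrite le_max lexx.
by rewrite le_max h orbT.
Qed.

Section multi_levy.
Context {R : realType} (V : lmodType R) d (T : measurableType d) (P : probability T R).
Variable X : gfield V P.
Local Notation ip := (gip X).
Variables (k : nat) (v : 'rV[R]_k -> V) (top : 'rV[R]_k) (B : set 'rV[R]_k).

Definition upd i (x : 'rV[R]_k) : 'rV[R]_k := \row_j (if j == i then top 0 j else x 0 j).

Hypothesis Bupd : forall i x, B x -> B (upd i x).
Hypothesis Hip : forall i x y, B x -> B y -> y 0 i <= x 0 i -> ip (v (upd i x) - v x) (v y) = 0.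

(** Once the points are sorted by coordinate i, raising that coordinate to the top adds noise
    orthogonal to all earlier points, so [levy] applies. *)
Lemma levy_coord i (s : seq 'rV[R]_k) a : (forall x, x \in s -> B x) ->
  (P [set t | has (fun x => a < X (v x) t)%R s] <= 2%:E * P [set t | has (fun x => a < X (v x) t)%R (map (upd i) s)])%E.
Proof.
move=> sB; pose le_i (x y : 'rV[R]_k) := x 0 i <= y 0 i.
pose s' := sort le_i s.
have ss' : sorted le_i s' by apply: sort_sorted => x y; exact: le_total.
have mem' x : (x \in s') = (x \in s) by rewrite mem_sort.
have hasE p : has p s = has p s' by apply: eq_has_r => x; rewrite mem'.
have -> : [set t | has (fun x => a < X (v x) t)%R s] = [set t | hits (size s') a (fun j => X (v (nth 0 s' j)) t)].
  by apply/funext => t; rewrite /mkset hasE (hits_has 0 s' (fun x => X (v x) t)).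
have -> : [set t | has (fun x => a < X (v x) t)%R (map (upd i) s)] = [set t | hits (size s') a (fun j => X (v (upd i (nth 0 s' j))) t)].
  by apply/funext => t; rewrite /mkset has_map hasE (hits_has 0 s' (fun x => X (v (upd i x)) t)).
apply: (@levy _ _ _ _ _ X (fun j => v (nth 0 s' j)) (fun j => v (upd i (nth 0 s' j)))) => j l /andP[jl lN].
have jN : (j < size s')%N by exact: leq_ltn_trans lN.
have Bn n : (n < size s')%N -> B (nth 0 s' n) by move=> h; apply: sB; rewrite -mem' mem_nth.
apply: Hip; [exact: Bn|exact: Bn|].
have tr : transitive le_i by move=> y x z; exact: le_trans.
have rf : reflexive le_i by move=> x; exact: lexx.
exact: (@sorted_leq_nth _ _ tr rf 0 s' ss' j l jN lN jl).
Qed.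

Lemma levy_box (s : seq 'rV[R]_k) a : (forall x, x \in s -> B x) ->
  (P [set t | has (fun x => a < X (v x) t)%R s] <= (2 ^+ k)%:E * P [set t | a < X (v top) t]%R)%E.
Proof.
move=> sB.
suff H (l : seq 'I_k) (s' : seq 'rV[R]_k) : (forall x, x \in s' -> B x) ->
   (P [set t | has (fun x => a < X (v x) t)%R s'] <=
   (2 ^+ size l)%:E * P [set t | has (fun x => a < X (v x) t)%R (map (fun x => foldl (fun x i => upd i x) x l) s')])%E.
  apply: (le_trans (H (enum 'I_k) s sB)); rewrite size_enum_ord; apply: lee_wpmul2l; first by rewrite lee_fin exprn_ge0.
  apply: le_measure; rewrite ?inE.
  - apply: measurable_set_bool; apply: (measurable_has _ a (f := fun x t => X (v x) t)) => x; exact: gX_meas.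
  - by apply: (measurable_set_bool (b := fun t => a < X (v top) t)); apply: measurable_fun_ltr; [exact: measurable_cst|exact: gX_meas].
  move=> t /hasP[y /mapP[x _ ->]].
  suff -> : foldl (fun x i => upd i x) x (enum 'I_k) = top by [].
  apply/rowP => j.
  have : j \in enum 'I_k by rewrite mem_enum.
  elim/last_ind: (enum 'I_k) => [//|l i IH]; rewrite mem_rcons in_cons foldl_rcons mxE.
  by case: eqP => [->//|_] /= /IH.
elim: l s' => [|i l IH] s' sB'; first by rewrite expr0 mul1e map_id.
apply: (le_trans (levy_coord i a sB')).
have sB2 x : x \in map (upd i) s' -> B x by move=> /mapP[y /sB' ? ->]; exact: Bupd.
rewrite exprS EFinM -muleA; apply: lee_wpmul2l; first by rewrite lee_fin.
apply: (le_trans (IH _ sB2)); rewrite -map_comp; exact: lexx.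
Qed.

(** Meant for noise negligible at scale 1 / La: when exp (2 La^2 s0) - 1 is at most kp^2 the bound
    is 1 + 2^k kp. The tail of the maximum is compared with that at [top], where two exponential
    moments suffice. *)
Lemma exp_smax_le (s : seq 'rV[R]_k) (La s0 kp : R) : (forall x, x \in s -> B x) ->
  0 < La -> 0 < kp -> ip (v top) (v top) <= s0 ->
  (\int[P]_t (expR (La * smax s (fun x => X (v x) t)))%:E <=
   (1 + 2 ^+ k * (kp / 2 + (expR (2 * (La ^+ 2 * s0)) - 1) / (2 * kp)))%:E)%E.
Proof.
move=> sB La0 kp0 vs0.
pose f t := expR (La * smax s (fun x => X (v x) t)) - 1.
pose g t := expR (La * Num.max 0 (X (v top) t)) - 1.
have msm : measurable_fun setT (fun t => smax s (fun x => X (v x) t)).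
  by apply: (measurable_smax s (f := fun x t => X (v x) t)) => x; exact: gX_meas.
have mexp (h : T -> R) : measurable_fun setT h -> measurable_fun setT (fun t => expR (La * h t) : R).
  move=> mh; apply: measurable_expRf.
  by apply: measurable_funM => //; exact: measurable_cst.
have mf : measurable_fun setT f by apply: measurable_funB; [exact: mexp|exact: measurable_cst].
have mmax : measurable_fun setT (fun t => Num.max 0 (X (v top) t)) by mreal.
have mg : measurable_fun setT g by apply: measurable_funB; [exact: mexp|exact: measurable_cst].
have ge1 x : 0 <= x -> 0 <= expR (La * x) - 1.
  by move=> x0; rewrite subr_ge0 -[leLHS]expR0 ler_expR mulr_ge0 // ltW.
have f0 t : 0 <= f t by apply: ge1; exact: smax_ge0.
have g0 t : 0 <= g t by apply: ge1; rewrite le_max lexx.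
have tail x y : 0 <= y -> (y < expR (La * x) - 1) = (ln (1 + y) / La < x).
  move=> y0; rewrite ltrBrDl ltr_pdivrMr // (mulrC x) -[in RHS]ltr_expR lnK // posrE.
  by rewrite ltr_pwDl.
have fg : (\int[P]_t (f t)%:E <= (2 ^+ k)%:E * \int[P]_t (g t)%:E)%E.
  apply: (le_integral_tail mf mg f0 g0); first exact: exprn_ge0.
  move=> y y0; have a0 : 0 <= ln (1 + y) / La by apply: divr_ge0; [apply: ln_ge0; rewrite lerDl|exact: ltW].
  have -> : [set t | y < f t] = [set t | has (fun x => ln (1 + y) / La < X (v x) t)%R s].
    by apply/funext => t; rewrite /mkset /f tail // smax_has.
  apply: (le_trans (levy_box _ sB)); apply: lee_wpmul2l; first by rewrite lee_fin exprn_ge0.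
  apply: le_measure; rewrite ?inE.
  - by apply: (measurable_set_bool (b := fun t => ln (1 + y) / La < X (v top) t)); apply: measurable_fun_ltr; [exact: measurable_cst|exact: gX_meas].
  - by apply: (measurable_set_bool (b := fun t => y < g t)); apply: measurable_fun_ltr; [exact: measurable_cst|exact: mg].
  - by move=> t; rewrite /mkset /g tail // lt_max => ->; rewrite orbT.
have Eg : (\int[P]_t (g t)%:E <= (kp / 2 + (expR (2 * (La ^+ 2 * s0)) - 1) / (2 * kp))%:E)%E.
  set x := fun t => X (La *: v top) t.
  have mx : measurable_fun setT x by exact: gX_meas.
  have me : measurable_fun setT (fun t => expR (x t)) by apply: (measurableT_comp (f := expR)); [exact: measurable_expR|exact: mx].
  have me2 : measurable_fun setT (fun t => expR (2 * x t)).
    by apply: (measurableT_comp (f := expR)); [exact: measurable_expR|apply: measurable_funM => //; exact: measurable_cst].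
  (* The inequality y <= kp / 2 + y^2 / (2 kp) for y = exp x - 1, arranged so that both sides are
     nonnegative and can be integrated. *)
  have pw t : g t + kp^-1 * expR (x t) <= (kp / 2 + 1 / (2 * kp)) + (1 / (2 * kp)) * expR (2 * x t).
    rewrite -subr_ge0.
    have -> : kp / 2 + 1 / (2 * kp) + 1 / (2 * kp) * expR (2 * x t) - (g t + kp^-1 * expR (x t)) =
       (kp ^+ 2 + (expR (x t) - 1) ^+ 2 - 2 * kp * g t) / (2 * kp).
      by rewrite (_ : 2 * x t = x t + x t) ?expRD; [field; rewrite gt_eqF|ring].
    apply: divr_ge0; last by rewrite mulr_ge0 // ltW.
    have [h|h] := leP 0 (X (v top) t).
      have -> : g t = expR (x t) - 1 by rewrite /g (max_idPr h) /x gXZ.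
      have -> : kp ^+ 2 + (expR (x t) - 1) ^+ 2 - 2 * kp * (expR (x t) - 1) = (kp - (expR (x t) - 1)) ^+ 2 by ring.
      exact: sqr_ge0.
    have -> : g t = 0 by rewrite /g (max_idPl (ltW h)) mulr0 expR0 subrr.
    by rewrite mulr0 subr0 addr_ge0 ?sqr_ge0.
  have E1 : (\int[P]_t (g t)%:E + (kp^-1)%:E * \int[P]_t (expR (x t))%:E <=
    (kp / 2 + 1 / (2 * kp))%:E + (1 / (2 * kp))%:E * \int[P]_t (expR (2 * x t))%:E)%E.
    have k1 : 0 <= kp^-1 by rewrite invr_ge0 ltW.
    have k2 : 0 <= 1 / (2 * kp) by rewrite divr_ge0 // mulr_ge0 // ltW.
    have m1 : measurable_fun setT (fun t => (expR (x t))%:E) by exact/measurable_EFinP.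
    have m2 : measurable_fun setT (fun t => (expR (2 * x t))%:E) by exact/measurable_EFinP.
    have mgE : measurable_fun setT (fun t => (g t)%:E) by exact/measurable_EFinP.
    have e0 t : (0 <= (expR (x t))%:E :> \bar R)%E by rewrite lee_fin expR_ge0.
    have e20 t : (0 <= (expR (2 * x t))%:E :> \bar R)%E by rewrite lee_fin expR_ge0.
    rewrite -(int_Zl P k1 m1 e0) -(int_Zl P k2 m2 e20).
    rewrite -[X in (_ <= X + _)%E](int_cst1 P).
    rewrite -int_D //; last 2 first.
    - exact: measurable_funeM.
    - by move=> t; rewrite mule_ge0 // lee_fin.
    rewrite -int_D; last 4 first.
    - exact: measurable_cst.
    - exact: measurable_funeM.
    - by move=> t; rewrite lee_fin addr_ge0 // divr_ge0 // ltW.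
    - by move=> t; rewrite mule_ge0 // lee_fin.
    apply: int_le.
    - by apply: emeasurable_funD => //; exact: measurable_funeM.
    - by apply: emeasurable_funD; [exact: measurable_cst|exact: measurable_funeM].
    - by move=> t; rewrite adde_ge0 ?mule_ge0 // lee_fin.
    - by move=> t; rewrite -!EFinM -!EFinD lee_fin.
  move: E1; have := gX_expE X 1 (La *: v top); under eq_integral do rewrite mul1r.
  move=> ->; rewrite gX_expE -!EFinM -!EFinD.
  set I := (\int[P]_t _)%E => E1.
  have Ifin : I \is a fin_num.
    rewrite ge0_fin_numE; last by apply: integral_ge0 => t _; rewrite lee_fin.
    apply: (@le_lt_trans _ _ (I + (kp^-1 * expR (1 ^+ 2 * ip (La *: v top) (La *: v top) / 2))%:E)%E).
      by rewrite leeDl // lee_fin mulr_ge0 ?expR_ge0 // invr_ge0 ltW.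
    by apply: le_lt_trans E1 _; rewrite ltry.
  move: E1; rewrite -(fineK Ifin) -EFinD !lee_fin.
  set q := ip _ _.
  have q0 : 0 <= q by exact: gip_ge0.
  have qs : q <= La ^+ 2 * s0 by rewrite /q gipZl gipZr mulrA -expr2 ler_wpM2l ?sqr_ge0.
  have e1 : 1 <= expR (1 ^+ 2 * q / 2) by rewrite -[leLHS]expR0 ler_expR; lra.
  have e2 : expR (2 ^+ 2 * q / 2) <= expR (2 * (La ^+ 2 * s0)) by rewrite ler_expR; lra.
  have k0 : 0 < kp^-1 by rewrite invr_gt0.
  move=> h.
  have h1 : kp^-1 * 1 <= kp^-1 * expR (1 ^+ 2 * q / 2) by rewrite ler_wpM2l // ltW.
  have h2 : kp^-1 * expR (2 ^+ 2 * q / 2) <= kp^-1 * expR (2 * (La ^+ 2 * s0)) by rewrite ler_wpM2l // ltW.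
  have E2 : 1 / (2 * kp) = kp^-1 / 2 by field; rewrite gt_eqF.
  have E3 : (expR (2 * (La ^+ 2 * s0)) - 1) / (2 * kp) = (kp^-1 * expR (2 * (La ^+ 2 * s0)) - kp^-1) / 2 by field; rewrite gt_eqF.
  by rewrite E3; move: h; rewrite E2; lra.
have mfE : measurable_fun setT (fun t => (f t)%:E) by exact/measurable_EFinP.
have -> : (\int[P]_t (expR (La * smax s (fun x => X (v x) t)))%:E = 1 + \int[P]_t (f t)%:E)%E.
  rewrite -[X in (_ = X + _)%E](int_cst1 P) -int_D //.
  by apply: eq_integral => t _; rewrite -EFinD /f addrC subrK.
rewrite EFinD; apply: leeD => //; apply: (le_trans fg).
by rewrite EFinM; apply: lee_wpmul2l => //; rewrite lee_fin exprn_ge0.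
Qed.
End multi_levy.

Section monotone_leg.
Context {R : realType} (V : lmodType R) d (T : measurableType d) (P : probability T R).
Variable X : gfield V P.
Local Notation ip := (gip X).
Variables (nu : R -> V) (Vf : R -> R) (b r : R).
Hypothesis ipnu : forall x y, b <= x -> x <= y -> y <= r -> ip (nu x) (nu y) = Vf x.

(** Sorting turns any list of points of the leg into a walk with clock [Vf]. *)
Lemma exp_leg_le (l s : R) (xs : seq R) : 0 <= l -> 0 < s ->
  (forall x, x \in xs -> b <= x <= r) -> (forall x, b <= x <= r -> Vf x <= s ^+ 2) ->
  (\int[P]_t (expR (smax xs (fun x => l * X (nu x) t - l ^+ 2 * Vf x / 2)))%:E <=
   (1 + (l * s) ^+ 2 / 2 + 2 * (l * s))%:E)%E.
Proof.
move=> l0 s0 xsb Vs.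
pose ss := sort <=%R xs.
have [->|xs0] := eqVneq xs [::].
  rewrite /= expR0 int_cst1 lee_fin -addrA lerDl; apply: addr_ge0; first by rewrite divr_ge0 ?sqr_ge0.
  by rewrite !mulr_ge0 // ltW.
have br : b <= r.
  case: xs xs0 xsb {ss} => // x ? _ /(_ x (mem_head _ _)) /andP[]; exact: le_trans.
have ssN k : b <= nth r ss k <= r.
  have [h|h] := ltnP k (size ss); last by rewrite nth_default ?lexx ?br.
  by apply: xsb; rewrite -(mem_sort <=%R) mem_nth.
have ssle j k : (j <= k)%N -> nth r ss j <= nth r ss k.
  move=> jk; have [h|h] := ltnP k (size ss); last by rewrite [leRHS]nth_default //; case/andP: (ssN j).
  apply: (@sorted_leq_nth _ _ le_trans lexx r ss) => //; first exact: (sort_sorted le_total).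
  by rewrite inE; exact: leq_ltn_trans h.
have ipu j k : (j <= k)%N -> ip (nu (nth r ss j)) (nu (nth r ss k)) = Vf (nth r ss j).
  by move=> jk; apply: ipnu; [case/andP: (ssN j)|exact: ssle|case/andP: (ssN k)].
have := @E_exp_rmax_le _ _ _ _ _ X (fun k => nu (nth r ss k)) (fun k => Vf (nth r ss k)) ipu l s (size ss) l0 s0.
move=> /(_ (fun k _ => Vs _ (ssN k))); apply: le_trans; apply: int_le.
- apply/measurable_EFinP; apply: measurable_expRf.
  by apply: (measurable_smax xs (f := fun x t => l * X (nu x) t - l ^+ 2 * Vf x / 2)) => x; mreal.
- apply/measurable_EFinP; apply: measurable_expRf.
  by apply: (measurable_rmax (size ss) (fun k t => l * X (nu (nth r ss k)) t - l ^+ 2 * Vf (nth r ss k) / 2)) => k; mreal.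
- by move=> t; rewrite lee_fin expR_ge0.
move=> t; rewrite lee_fin ler_expR; apply: smax_le; first exact: rmax_ge0.
apply/allP => x xs'; have /(nthP r)[k kN <-] : x \in ss by rewrite mem_sort.
exact: (@rmax_ge _ (size ss) (fun k => l * X (nu (nth r ss k)) t - l ^+ 2 * Vf (nth r ss k) / 2)).
Qed.
End monotone_leg.

(** * The Brownian sheet as a linear Gaussian field *)

Section free_module.
Import mathcomp.multinomials.freeg.
Context {R : realType} (K : choiceType).

(** Finite formal combinations of points. Every function on points extends linearly by [fev], so the
    sheet becomes linear for every sample, with no quotient by vectors of norm zero. *)
Definition fmod : lmodType R := {freeg K / R}.
Definition pt (x : K) : fmod := Freeg [:: (1, x)].
Definition fev (f : K -> R) (v : fmod) : R := fglift (f : K -> R^o) v.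

Lemma fevB f u v : fev f (u - v) = fev f u - fev f v.
Proof. exact: lift_is_additive. Qed.
Lemma fev0 f : fev f 0 = 0.
Proof. by have := fevB f 0 0; rewrite !subrr. Qed.
Lemma fevD f u v : fev f (u + v) = fev f u + fev f v.
Proof. by rewrite -[v in LHS]opprK fevB -[- v]sub0r fevB fev0 sub0r opprK. Qed.
Lemma fevsum f (I : Type) (s : seq I) (F : I -> fmod) : fev f (\sum_(i <- s) F i) = \sum_(i <- s) fev f (F i).
Proof. by elim: s => [|i s IH]; rewrite ?big_nil ?fev0 // !big_cons fevD IH. Qed.

Lemma fev_sum f v : fev f v = \sum_(x <- dom v) coeff x v * f x.
Proof.
rewrite -[in LHS](freeg_sumE v) fevsum; apply: eq_bigr => x _.
by rewrite /fev liftU.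
Qed.

Lemma fev_pt f x : fev f (pt x) = f x.
Proof. by rewrite /fev liftU scale1r. Qed.

Lemma fevZ f a v : fev f (a *: v) = a * fev f v.
Proof.
rewrite fev_sum [in RHS]fev_sum mulr_sumr.
have -> : a *: v = \sum_(x <- dom v) Freeg [:: (a * coeff x v, x)] by [].
rewrite -fev_sum fevsum; apply: eq_bigr => x _.
by rewrite /fev liftU mulrA.
Qed.

Lemma fev_lin f a u v : fev f (a *: u + v) = a * fev f u + fev f v.
Proof. by rewrite fevD fevZ. Qed.

Definition fbil (F : K -> K -> R) (u v : fmod) : R := fev (fun x => fev (F x) v) u.

Lemma fbilE F u v : fbil F u v = \sum_(x <- dom u) \sum_(y <- dom v) coeff x u * coeff y v * F x y.
Proof.
rewrite /fbil fev_sum; apply: eq_bigr => x _; rewrite fev_sum mulr_sumr.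
by apply: eq_bigr => y _; rewrite mulrA.
Qed.

Lemma fbil_sym F u v : (forall x y, F x y = F y x) -> fbil F u v = fbil F v u.
Proof.
move=> Fs; rewrite !fbilE exchange_big; apply: eq_bigr => y _; apply: eq_bigr => x _.
by rewrite Fs (mulrC (coeff x u)).
Qed.

Lemma fbil_pt F x y : fbil F (pt x) (pt y) = F x y.
Proof. by rewrite /fbil !fev_pt. Qed.
End free_module.

Section orthant_measure.
Context {R : realType} (k : nat).
Variables (mu : probability (g_sigma_algebraType (@orthants R k)) R) (F : 'rV[R]_k -> R).
Hypothesis HF : is_cdf_on_cube mu F.
Implicit Types x y : 'rV[R]_k.

Lemma measurable_orthant x : measurable (orthant x : set (g_sigma_algebraType (@orthants R k))).
Proof. by apply: sub_sigma_algebra; exists x. Qed.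

Lemma orthantI x y : orthant x `&` orthant y = orthant (rmin x y).
Proof.
apply/seteqP; split => z /=; rewrite /orthant /=.
  by move=> [hx hy] i; rewrite mxE le_min hx hy.
by move=> h; split=> i; have := h i; rewrite mxE le_min => /andP[].
Qed.

Lemma cube_rmin x y : cube k x -> cube k y -> cube k (rmin x y).
Proof.
move=> cx cy i; rewrite mxE; have /andP[x0 x1] := cx i; have /andP[y0 y1] := cy i.
by rewrite le_min x0 y0 ge_min x1.
Qed.

Lemma cdf_le x y : cube k x -> cube k y -> (forall i, x 0 i <= y 0 i) -> F x <= F y.
Proof.
move=> cx cy xy; rewrite -lee_fin (HF.2 _ cx) (HF.2 _ cy); apply: le_measure; rewrite ?inE.
- exact: measurable_orthant.
- exact: measurable_orthant.
- by move=> z /= h i; exact: le_trans (h i) (xy i).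
Qed.

Lemma cdf01 x : cube k x -> 0 <= F x <= 1.
Proof.
move=> cx; rewrite -!lee_fin (HF.2 _ cx) measure_ge0 /=.
by apply: probability_le1; exact: measurable_orthant.
Qed.

Lemma cube_ones : cube k (ones k : 'rV[R]_k).
Proof. by move=> i; rewrite mxE ler01 lexx. Qed.

(** The sigma-algebra is generated by lower orthants: the cube is the orthant at [ones] minus the
    countably many orthants in which some coordinate is at most - 1 / (i+1). *)
Lemma measurable_cube : measurable (cube k : set (g_sigma_algebraType (@orthants R k))).
Proof.
have -> : cube k = orthant (ones k) `\` \bigcup_i (\bigcup_(j in [set: 'I_k]) orthant (\row_l (if l == j then - (i.+1%:R)^-1 else 1) : 'rV[R]_k)).
  apply/seteqP; split => [x cx|x [xo nx] i].
    split; first by move=> i; rewrite mxE; case/andP: (cx i).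
    move=> [n _ [j _ /(_ j)]]; rewrite mxE eqxx leNgt; case/andP: (cx j) => x0 _ /negP; apply.
    by apply: lt_le_trans x0; rewrite oppr_lt0 invr_gt0.
  have := xo i; rewrite mxE => -> ; rewrite andbT leNgt; apply/negP => xi; apply: nx.
  have [n hn] : exists n, - x 0 i > (n.+1%:R)^-1.
    have : 0 < - x 0 i by rewrite oppr_gt0.
    move=> x0; exists (Num.bound (- x 0 i)^-1); rewrite invf_plt ?posrE //.
    apply: lt_trans (_ : (Num.bound (- x 0 i)^-1)%:R < _); last by rewrite ltr_nat.
    by apply: archi_boundP; rewrite invr_ge0 ltW.
  exists n => //; exists i => // j; rewrite mxE; case: eqP => [->|_]; last by have := xo j; rewrite mxE.
  by rewrite lerNr ltW.
apply: measurableD; first exact: measurable_orthant.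
apply: bigcupT_measurable => n; apply: fin_bigcup_measurable => // j _; exact: measurable_orthant.
Qed.

Lemma cdf_ones : F (ones k) = 1.
Proof.
have /andP[_ h1] := cdf01 cube_ones.
apply/eqP; rewrite eq_le h1 -lee_fin (HF.2 _ cube_ones) -HF.1.
apply: le_measure; rewrite ?inE; [exact: measurable_cube|exact: measurable_orthant|].
by move=> x cx i; rewrite mxE; case/andP: (cx i).
Qed.

(** [F (rmin x y)] is the measure of the intersection of two orthants, so the form is the integral
    of a square. *)
Lemma cdf_form_ge0 n (c : 'I_n -> R) (x : 'I_n -> 'rV[R]_k) : (forall i, cube k (x i)) ->
  0 <= \sum_i \sum_j c i * c j * F (rmin (x i) (x j)).
Proof.
move=> cx.
pose f (y : g_sigma_algebraType (@orthants R k)) : R := \sum_i c i * \1_(orthant (x i)) y.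
suff -> : \sum_i \sum_j c i * c j * F (rmin (x i) (x j)) = fine (\int[mu]_y (f y ^+ 2)%:E)%E.
  by apply: fine_ge0; apply: integral_ge0 => y _; rewrite lee_fin sqr_ge0.
have int1 i j : mu.-integrable setT (fun y => (c i * c j * \1_(orthant (rmin (x i) (x j))) y)%:E).
  apply: (@bounded_integrable _ _ _ mu _ `|c i * c j|).
    apply: measurable_funM; [exact: measurable_cst|apply: measurable_indic; exact: measurable_orthant].
  by move=> y; rewrite normrM ler_piMr // indicE; case: (_ \in _); rewrite ?normr0 ?normr1.
have E : (\int[mu]_y (f y ^+ 2)%:E = \sum_i \sum_j (c i * c j * F (rmin (x i) (x j)))%:E)%E.
  transitivity (\int[mu]_y (\sum_i \sum_j (c i * c j * \1_(orthant (rmin (x i) (x j))) y)%:E))%E.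
    apply: eq_integral => y _; under eq_bigr do rewrite sumEFin; rewrite sumEFin; congr EFin.
    rewrite expr2 /f mulr_suml; apply: eq_bigr => i _; rewrite mulr_sumr; apply: eq_bigr => j _.
    by rewrite -orthantI indicI mulrACA.
  rewrite (integral_sum measurableT); last first.
    by move=> i; apply: integrable_sum => // j _; exact: int1.
  apply: eq_bigr => i _; rewrite (integral_sum measurableT (int1 i)).
  apply: eq_bigr => j _.
  have -> : (fun y : g_sigma_algebraType (@orthants R k) => (c i * c j * \1_(orthant (rmin (x i) (x j))) y)%:E) = (fun y => (c i * c j)%:E * (\1_(orthant (rmin (x i) (x j))) y)%:E)%E by [].
  rewrite integralZl //; last first.
    apply: (@bounded_integrable _ _ _ mu _ 1); first by apply: measurable_indic; exact: measurable_orthant.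
    by move=> y; rewrite indicE; case: (_ \in _); rewrite ?normr0 ?normr1.
  rewrite integral_indic //; last exact: measurable_orthant.
  by rewrite [RHS]EFinM; congr (_ * _)%E; rewrite setIT; exact: (esym (HF.2 _ (cube_rmin (cx i) (cx j)))).
rewrite E; under [in RHS]eq_bigr do rewrite sumEFin; by rewrite sumEFin.
Qed.
End orthant_measure.

Section sheet.
Import mathcomp.multinomials.freeg.
Context {R : realType} (k : nat).
Variables (mu : probability (g_sigma_algebraType (@orthants R k)) R) (F : 'rV[R]_k -> R).
Hypothesis HF : is_cdf_on_cube mu F.
Context d (T : measurableType d) (P : probability T R) (W : T -> 'rV[R]_k -> R).
Hypothesis Wmeas : forall x, cube k x -> measurable_fun setT (fun om => W om x).
Hypothesis Wgauss : forall (p : nat) (xs : 'I_p -> 'rV[R]_k) (c : 'I_p -> R) (A : set R),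
     (forall j, cube k (xs j)) -> measurable A ->
     P [set om | A (\sum_(j < p) c j * W om (xs j))] =
       centered_gauss (\sum_(j < p) \sum_(l < p) c j * c l * F (rmin (xs j) (xs l))) A.

Let W0 om (x : 'rV[R]_k) : R := if `[< cube k x >] then W om x else 0.
Let F0 (x y : 'rV[R]_k) : R := if `[< cube k x /\ cube k y >] then F (rmin x y) else 0.
Let V := @fmod R 'rV[R]_k.

Lemma rminC (x y : 'rV[R]_k) : rmin x y = rmin y x.
Proof. by apply/rowP => i; rewrite !mxE minC. Qed.

Let F0_sym x y : F0 x y = F0 y x.
Proof.
rewrite /F0 (rminC y x); congr (if _ then _ else _).
by apply/asboolP/asboolP => -[].
Qed.

(* points outside the cube carry no noise: they are moved to a corner with weight 0 *)
Let proj (x : 'rV[R]_k) : 'rV[R]_k := if `[< cube k x >] then x else ones k.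
Let wt (x : 'rV[R]_k) : R := if `[< cube k x >] then 1 else 0.
Let proj_cube x : cube k (proj x).
Proof. by rewrite /proj; case: asboolP => // _; exact: cube_ones. Qed.
Let W0E om x : W0 om x = wt x * W om (proj x).
Proof. by rewrite /W0 /wt /proj; case: asboolP; rewrite ?mul1r ?mul0r. Qed.
Let F0E x y : F0 x y = wt x * wt y * F (rmin (proj x) (proj y)).
Proof.
rewrite /F0 /wt /proj.
case: (asboolP (cube k x)) => cx; case: (asboolP (cube k y)) => cy; rewrite ?mul1r ?mul0r ?mulr0 ?mul0r ?mulr1.
- by rewrite asboolT.
- by rewrite asboolF // => -[].
- by rewrite asboolF // => -[].
- by rewrite asboolF // => -[].
Qed.

Let sumE (v : V) om : fev (W0 om) v = \sum_(j < size (dom v)) coeff (nth 0 (dom v) j) v * wt (nth 0 (dom v) j) * W om (proj (nth 0 (dom v) j)).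
Proof. by rewrite fev_sum (big_nth 0) big_mkord; apply: eq_bigr => j _; rewrite W0E mulrA. Qed.

Let formE (v : V) : fbil F0 v v = \sum_(j < size (dom v)) \sum_(l < size (dom v))
  (coeff (nth 0 (dom v) j) v * wt (nth 0 (dom v) j)) * (coeff (nth 0 (dom v) l) v * wt (nth 0 (dom v) l))
   * F (rmin (proj (nth 0 (dom v) j)) (proj (nth 0 (dom v) l))).
Proof.
rewrite fbilE (big_nth 0) big_mkord; apply: eq_bigr => j _.
rewrite (big_nth 0) big_mkord; apply: eq_bigr => l _.
by rewrite F0E !mulrA; congr (_ * _); rewrite -!mulrA; congr (_ * _); rewrite mulrCA.
Qed.

Let sh_meas (v : V) : measurable_fun setT (fun om => fev (W0 om) v).
Proof.
rewrite (_ : (fun om => _) = fun om => \sum_(j < size (dom v)) coeff (nth 0 (dom v) j) v * wt (nth 0 (dom v) j) * W om (proj (nth 0 (dom v) j))); last first.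
  by apply/funext => om; exact: sumE.
apply: measurable_sum => j; apply: measurable_funM; [exact: measurable_cst|exact: Wmeas].
Qed.

Let sh_ge0 (v : V) : 0 <= fbil F0 v v.
Proof.
rewrite formE.
exact: (cdf_form_ge0 HF (fun j : 'I_(size (dom v)) => coeff (nth 0 (dom v) j) v * wt (nth 0 (dom v) j)) (x := fun j => proj (nth 0 (dom v) j))).
Qed.

Let sh_law (v : V) A : measurable A -> P [set t | A (fev (W0 t) v)] = gm (fbil F0 v v) A.
Proof.
move=> mA; rewrite -centered_gaussE formE -(Wgauss _ (fun j => proj_cube (nth 0 (dom v) j)) mA).
by congr (P _); apply/seteqP; split => om /=; rewrite sumE.
Qed.

Definition sheet : gfield V P := @GField R V d T P (fun v om => fev (W0 om) v) (fbil F0)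
  sh_meas (fun a u v om => fev_lin _ a u v) (fun u v => fbil_sym u v F0_sym)
  (fun a u v w => fev_lin _ a u v) sh_ge0 sh_law.

Lemma sheet_pt x om : cube k x -> sheet (pt x) om = W om x.
Proof. by move=> cx; rewrite /= fev_pt /W0 asboolT. Qed.

Lemma sheet_ip x y : cube k x -> cube k y -> gip sheet (pt x) (pt y) = F (rmin x y).
Proof. by move=> cx cy; rewrite /= fbil_pt /F0 asboolT. Qed.

End sheet.

Section union_bound.
Context {R : realType} d (T : measurableType d) (P : probability T R).

Lemma P_le (b c : T -> bool) : measurable_fun setT b -> measurable_fun setT c -> (forall t, b t -> c t) ->
  (P [set t | b t] <= P [set t | c t])%E.
Proof.
move=> mb mc bc; apply: le_measure; rewrite ?inE.
- exact: measurable_set_bool.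
- exact: measurable_set_bool.
- by move=> t; exact: bc.
Qed.

Lemma P_or (b c : T -> bool) : measurable_fun setT b -> measurable_fun setT c ->
  (P [set t | b t || c t] <= P [set t | b t] + P [set t | c t])%E.
Proof.
move=> mb mc; have -> : [set t | b t || c t] = [set t | b t] `|` [set t | c t].
  by apply/seteqP; split => t /=; [move/orP|move=> h; apply/orP].
by apply: measureU2; exact: measurable_set_bool.
Qed.

Lemma measurable_hasb (D : Type) (s : seq D) (b : D -> T -> bool) :
  (forall x, measurable_fun setT (b x)) -> measurable_fun setT (fun t => has (b^~ t) s).
Proof. by move=> mb; elim: s => [|x s IH] /=; [exact: measurable_cst|exact: measurable_or]. Qed.

Lemma P_has (D : Type) (s : seq D) (b : D -> T -> bool) : (forall x, measurable_fun setT (b x)) ->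
  (P [set t | has (b^~ t) s] <= \sum_(x <- s) P [set t | b x t])%E.
Proof.
move=> mb; elim: s => [|x s IH] /=.
  by rewrite big_nil (_ : [set t | false] = set0) ?measure0 //; apply/seteqP; split.
rewrite big_cons; apply: (le_trans (P_or (mb x) (measurable_hasb s mb))).
by apply: leeD.
Qed.
End union_bound.

(** * Grids adapted to a monotone function *)

Section mono_grid.
Context {R : realType}.

Lemma lip_ivt (f : R -> R) (a b C v : R) : a <= b ->
  (forall x y, a <= x -> x <= y -> y <= b -> 0 <= f y - f x <= C * (y - x)) ->
  f a <= v <= f b -> exists2 c, a <= c <= b & f c = v.
Proof.
move=> ab H /andP[av vb].
have fab : f a <= f b by exact: le_trans vb.
have lip x y : a <= x -> x <= b -> a <= y -> y <= b -> `|f x - f y| <= (`|C| + 1) * `|x - y|.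
  move=> ax xb ay yb.
  have Cl z : 0 <= z -> C * z <= (`|C| + 1) * z.
    by move=> z0; rewrite ler_wpM2r //; apply: le_trans (ler_norm _) _; rewrite lerDl.
  have [xy|/ltW yx] := leP x y.
    have /andP[h1 h2] := H x y ax xy yb.
    have yx0 : 0 <= y - x by rewrite subr_ge0.
    rewrite distrC (distrC x) (ger0_norm h1) (ger0_norm yx0).
    exact: le_trans h2 (Cl _ yx0).
  have /andP[h1 h2] := H y x ay yx xb.
  have yx0 : 0 <= x - y by rewrite subr_ge0.
  rewrite (ger0_norm h1) (ger0_norm yx0).
  exact: le_trans h2 (Cl _ yx0).
have cf : {within `[a, b], continuous f}.
  apply/subspace_continuousP => x; rewrite /= in_itv /= => /andP[ax xb].
  apply/cvgrPdist_le => e e0.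
  have D0 : 0 < e / (`|C| + 1) by rewrite divr_gt0 // ltr_wpDl.
  rewrite near_withinE; near=> y; rewrite /= in_itv /= => /andP[ay yb].
  have dxy : `|x - y| <= e / (`|C| + 1) by near: y; apply: (@cvgr_dist_le _ _ _ (nbhs x) _ id x); [exact: cvg_id|exact: D0].
  apply: (@le_trans _ _ ((`|C| + 1) * `|x - y|)); last by rewrite mulrC -ler_pdivlMr // ltr_wpDl.
  exact: lip.
have [|c cab fc] := IVT ab cf (v := v).
  by rewrite (min_idPl fab) (max_idPr fab) av vb.
by exists c => //; move: cab; rewrite in_itv.
Unshelve. all: by end_near.
Qed.

(** The values of f, not the points, are equally spaced: f is the clock of the walk carried by the
    grid, and the steps of that clock must be positive and small. *)
Lemma mono_grid (f : R -> R) (a b C : R) N : a <= b -> f a < f b -> (0 < N)%N ->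
  (forall x y, a <= x -> x <= y -> y <= b -> 0 <= f y - f x <= C * (y - x)) ->
  exists t : nat -> R, [/\ t 0%N = a, forall k, a <= t k <= b, forall j k, (j <= k)%N -> t j <= t k,
    forall k, (k <= N)%N -> f (t k) = f a + k%:R * ((f b - f a) / N%:R)
    & forall k, (N <= k)%N -> t k = t N].
Proof.
move=> ab fab N0 H; set h := (f b - f a) / N%:R.
have N0R : 0 < N%:R :> R by rewrite ltr0n.
have h0 : 0 < h by rewrite divr_gt0 // subr_gt0.
have ex k : exists c, a <= c <= b /\ ((k <= N)%N -> f c = f a + k%:R * h).
  have [kN|kN] := leqP k N; last by exists a; rewrite lexx ab.
  have [|c cab fc] := @lip_ivt f a b C (f a + k%:R * h) ab H; last by exists c.
  rewrite lerDl mulr_ge0 ?(ltW h0) //= -lerBrDl.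
  by rewrite /h mulrA ler_pdivrMr // mulrC ler_wpM2l ?ler_nat // subr_ge0 ltW.
pose t0 k := projT1 (cid (ex k)).
have t0P k : a <= t0 k <= b /\ ((k <= N)%N -> f (t0 k) = f a + k%:R * h) by exact: projT2 (cid (ex k)).
(* Index 0 is a itself: the intermediate value theorem could return another point with value
   [f a]. *)
pose t k := if k == 0%N then a else t0 (minn k N).
have tP k : a <= t k <= b /\ f (t k) = f a + (minn k N)%:R * h.
  rewrite /t; case: eqP => [->|_]; first by rewrite lexx ab min0n mul0r addr0.
  by have [h1 h2] := t0P (minn k N); rewrite h2 ?geq_minr.
have tmono j k : (j <= k)%N -> t j <= t k.
  move=> jk; have [/andP[aj jb] fj] := tP j; have [/andP[ak kb] fk] := tP k.
  have [E|NE] := eqVneq (minn j N) (minn k N).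
    have [j0|j0] := eqVneq j 0%N; first by rewrite {1}/t j0 eqxx.
    by rewrite /t (negbTE j0) E; case: eqP => // k0; move: jk; rewrite k0 leqn0 (negbTE j0).
  rewrite leNgt; apply/negP => tk.
  have /andP[h1 _] := H _ _ ak (ltW tk) jb.
  have : (minn j N < minn k N)%N.
    by rewrite ltn_neqAle NE leq_min geq_minr andbT; exact: leq_trans (geq_minl _ _) jk.
  rewrite -(ltr_nat R) => h2; have := ltr_pM2r h0 (minn j N)%:R (minn k N)%:R; rewrite h2 => h3.
  by move: h1; rewrite fj fk; lra.
exists t; split=> //.
- by move=> k; case: (tP k).
- by move=> k kN; case: (tP k) => _ ->; rewrite (minn_idPl kN).
- move=> k Nk; rewrite /t !gtn_eqF ?(leq_trans N0 Nk) // minnn (minn_idPr Nk) //.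
Qed.
End mono_grid.

Lemma bridge_time_diff {R : realType} (e x y : R) : 0 < e -> x < e -> y < e ->
  y / (e * (e - y)) - x / (e * (e - x)) = (y - x) / ((e - x) * (e - y)).
Proof.
rewrite -subr_gt0 => e0; rewrite -subr_gt0 => x0; rewrite -subr_gt0 => y0.
by field; rewrite !gt_eqF // -[e]subr0.
Qed.

Lemma rmax_scale {R : realType} (l : R) N (y : nat -> R) : 0 <= l -> rmax N (fun a => l * y a) = l * rmax N y.
Proof.
move=> l0; elim: N => [|N IH] /=; first by rewrite mulr0.
by rewrite IH maxr_pMr.
Qed.

Lemma rmax_attained {R : realType} N (y : nat -> R) : 0 <= y 0%N -> exists2 a, (a <= N)%N & rmax N.+1 y <= y a.
Proof.
move=> y0; elim: N => [|N [a aN h]]; first by exists 0%N => //=; rewrite (max_idPr y0).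
have [h2|h2] := leP (y N.+1) (rmax N.+1 y).
  exists a; first exact: leqW.
  by rewrite [rmax _ _]/= -/(rmax N.+1 y) (max_idPl h2).
by exists N.+1 => //; rewrite [rmax _ _]/= -/(rmax N.+1 y) (max_idPr (ltW h2)).
Qed.

(** * Elementary inequalities for one block *)

Section small_arithmetic.
Context {R : realType}.
Implicit Types u z y s k r e : R.

Lemma sub_between s k r : 0 <= s -> s <= r -> 0 <= k -> k <= r -> - r <= s - k <= r.
Proof. by move=> *; apply/andP; split; lra. Qed.

Lemma lt_through u s k z s' y : u - (s - k) < z -> s <= s' -> s' - y <= k -> u < z + y.
Proof. by move=> *; lra. Qed.

Lemma three_thirds e1 e2 e3 k : e1 <= k / 3 -> e2 <= k / 3 -> e3 <= k / 3 -> e1 + e2 + e3 <= k.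
Proof. by move=> *; lra. Qed.

Lemma lt_rem k s c s2 s3 b e : k < s - c * s2 - (s + s3 - c * b) -> c * (b - s2) <= e -> k - e < - s3.
Proof. by rewrite mulrBr => *; lra. Qed.
End small_arithmetic.

Section block_arithmetic.
Context {R : realType}.
Implicit Types x k a s c u v w y z : R.

(** The difference of the two sides is (k x - 2)^2 / (2 k): the linear term is absorbed by a
    fraction k of the square and a constant. *)
Lemma leg_factor_le x k : 0 < k -> 1 + x ^+ 2 / 2 + 2 * x <= (1 + k) * x ^+ 2 / 2 + 1 + 2 / k.
Proof.
move=> k0; rewrite -subr_ge0.
have -> : (1 + k) * x ^+ 2 / 2 + 1 + 2 / k - (1 + x ^+ 2 / 2 + 2 * x) = (k * x - 2) ^+ 2 / (2 * k).
  by field; rewrite gt_eqF.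
by rewrite divr_ge0 ?sqr_ge0 ?mulr_ge0 // ltW.
Qed.

Lemma sqrt_inv_le x k : 0 < x -> x <= 1 -> x^-1 <= k -> (Num.sqrt x)^-1 <= k.
Proof.
move=> x0 x1 xk; apply: le_trans xk; rewrite lef_pV2 ?posrE ?sqrtr_gt0 //.
have s1 : Num.sqrt x <= 1 by rewrite -[leRHS]sqrtr1 ler_sqrt.
apply: (@le_trans _ _ (Num.sqrt x * Num.sqrt x)); first by rewrite -expr2 sqr_sqrtr ?lexx // ltW.
by rewrite ler_piMl ?sqrtr_ge0.
Qed.

Lemma sqrt_inv_ge1 x : 0 < x -> x <= 1 -> 1 <= (Num.sqrt x)^-1.
Proof.
move=> x0 x1; rewrite -invr1 lef_pV2 ?posrE ?sqrtr_gt0 //.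
by rewrite -[leRHS]sqrtr1 ler_sqrt.
Qed.

Lemma expRN_ge k : k <= 1 -> (1 - k) <= expR (- k).
Proof. by move=> _; have := expR_ge1Dx (- k). Qed.

Lemma expRN2_ge k : 0 <= k -> k <= 1 -> (1 - k) ^+ 2 <= expR (- (2 * k)).
Proof.
move=> k0 k1; have -> : - (2 * k) = - k + - k by ring.
by rewrite expRD expr2; apply: ler_pM; rewrite ?subr_ge0 // expRN_ge.
Qed.

(* The two drift estimates: the bridge reaches its level well inside the window. *)
Lemma drift_low u y b v th s : 0 < v -> v <= s / 2 -> 0 < s -> s <= 4^-1 -> th <= 2^-1 - s -> 0 <= th ->
  0 < u -> u / 2 <= y - b -> - (u * s / 4) <= b ->
  u ^+ 2 * s / 4 <= 2 * y * (y - b) / (1 - v) - (2 * (y - b)) ^+ 2 * (th / ((1 - v) * (1 - v - th))) / 2.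
Proof.
move=> v0 vs s0 s1 hth th0 u0 g2 hb; set g := y - b in g2 *.
have -> : y = g + b by rewrite /g subrK.
have e0 : 0 < 1 - v by lra.
have et0 : 0 < 1 - v - th by lra.
have g0 : 0 < g by apply: lt_le_trans g2; rewrite divr_gt0.
have -> : 2 * (g + b) * g / (1 - v) - (2 * g) ^+ 2 * (th / ((1 - v) * (1 - v - th))) / 2 =
   2 * g / (1 - v) * (g * ((1 - v - 2 * th) / (1 - v - th)) + b).
  by field; rewrite !gt_eqF.
have r1 : s <= (1 - v - 2 * th) / (1 - v - th).
  rewrite ler_pdivlMr //; have : s * (1 - v - th) <= s * 1 by rewrite ler_wpM2l ?ltW //; lra.
  by lra.
have A : u <= 2 * g / (1 - v).
  rewrite ler_pdivlMr //; apply: (@le_trans _ _ (u * 1)); first by rewrite ler_wpM2l ?ltW //; lra.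
  by lra.
have B : u * s / 4 <= g * ((1 - v - 2 * th) / (1 - v - th)) + b.
  have : u / 2 * s <= g * ((1 - v - 2 * th) / (1 - v - th)) by apply: ler_pM => //; rewrite ?ltW // divr_gt0.
  by lra.
have -> : u ^+ 2 * s / 4 = u * (u * s / 4) by ring.
by apply: ler_pM => //; rewrite ?ltW // !divr_gt0 ?mulr_gt0.
Qed.

Lemma drift_high u y b v th s : 0 < v -> 0 < s -> 2^-1 + s <= th -> th < 1 - v ->
  0 < u -> u / 2 <= y - b -> b <= u * s / 4 ->
  u ^+ 2 * s / 4 < (2 * (y - b)) ^+ 2 * (th / ((1 - v) * (1 - v - th))) / 2 - 2 * y * (y - b) / (1 - v).
Proof.
move=> v0 s0 hth thv u0 g2 hb; set g := y - b in g2 *.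
have -> : y = g + b by rewrite /g subrK.
have e0 : 0 < 1 - v by lra.
have et0 : 0 < 1 - v - th by rewrite subr_gt0.
have g0 : 0 < g by apply: lt_le_trans g2; rewrite divr_gt0.
have -> : (2 * g) ^+ 2 * (th / ((1 - v) * (1 - v - th))) / 2 - 2 * (g + b) * g / (1 - v) =
   2 * g / (1 - v) * (g * ((2 * th - (1 - v)) / (1 - v - th)) - b).
  by field; rewrite !gt_eqF.
have r1 : 2 * s <= (2 * th - (1 - v)) / (1 - v - th).
  rewrite ler_pdivlMr //; have : 2 * s * (1 - v - th) <= 2 * s * 1 by rewrite ler_wpM2l ?mulr_ge0 ?ltW //; lra.
  by lra.
have A : u <= 2 * g / (1 - v).
  rewrite ler_pdivlMr //; apply: (@le_trans _ _ (u * 1)); first by rewrite ler_wpM2l ?ltW //; lra.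
  by lra.
have B : u * s / 4 < g * ((2 * th - (1 - v)) / (1 - v - th)) - b.
  have : u / 2 * (2 * s) <= g * ((2 * th - (1 - v)) / (1 - v - th)).
    by apply: ler_pM => //; rewrite ?divr_ge0 ?mulr_ge0 // ltW.
  by have := mulr_gt0 u0 s0; lra.
have -> : u ^+ 2 * s / 4 = u * (u * s / 4) by ring.
apply: (@le_lt_trans _ _ (2 * g / (1 - v) * (u * s / 4))).
  by apply: ler_wpM2r => //; rewrite ltW // !divr_gt0 ?mulr_gt0.
by rewrite ltr_pM2l // divr_gt0 // mulr_gt0.
Qed.

Lemma half_split_le x k : 0 < k -> x <= k ^+ 2 -> k / 2 + x / (2 * k) <= k.
Proof.
move=> k0 xk; have : x / (2 * k) <= k / 2; last by lra.
rewrite ler_pdivrMr ?mulr_gt0 //; apply: (le_trans xk).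
by apply: eqle; field.
Qed.

(** The quantity bounded is the slope of the legs, twice [colc]. The lower bound has the exact order
    4 u; 6 u is a crude bound for the error terms. *)
Lemma slope_bounds u w v k : 1 <= u -> `|w| <= k * u -> 0 < k -> k <= 2^-1 -> 0 < v -> v <= 20^-1 ->
  [/\ 0 < 2 * u - w, 4 * u * (1 - k) <= 2 * ((2 * u - w) / (1 - v)) & 2 * ((2 * u - w) / (1 - v)) <= 6 * u].
Proof.
move=> u1 wk k0 k2 v0 v20; have th0 : 0 < 1 - v by lra.
have ku : k * u <= 2^-1 * u by rewrite ler_wpM2r //; lra.
have ku0 : 0 <= k * u by rewrite mulr_ge0 //; lra.
have /andP[w1 w2] : - `|w| <= w <= `|w| by rewrite -ler_norml.
have a1 : 0 < 2 * u - w by lra.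
split => //.
  rewrite mulrA ler_pdivlMr //; apply: (@le_trans _ _ (4 * u * (1 - k) * 1)).
    by rewrite ler_wpM2l ?mulr_ge0 ?subr_ge0 //; lra.
  have -> : 4 * u * (1 - k) * 1 = 4 * u - 4 * (k * u) by ring.
  by lra.
rewrite mulrA ler_pdivrMr //; apply: (@le_trans _ _ (6 * u * (19 / 20))); first by lra.
by rewrite ler_wpM2l ?mulr_ge0 //; lra.
Qed.

Lemma bridge_window u w r M x s : 0 < u -> `|M| <= r -> `|x| <= r -> r <= 1 -> 4 * (`|w| + 1) <= u * s -> 4 * (`|w| + 2) <= u ->
  [/\ u / 2 <= u - M - (w - x), 2 * (u - M - (w - x)) <= 3 * u, w - x <= u * s / 4 & - (u * s / 4) <= w - x].
Proof.
move=> u0; rewrite !ler_norml => /andP[h1 h2] /andP[h3 h4] r1 us uw.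
have /andP[w1 w2] : - `|w| <= w <= `|w| by rewrite -ler_norml.
by split; lra.
Qed.

Lemma bridge_time_le v th : 0 <= th -> th <= 3 / 4 -> v <= 20^-1 -> th / ((1 - v) * (1 - v - th)) <= 4.
Proof.
move=> t0 t1 v1; have a1 : 19 / 20 <= 1 - v by lra.
have a2 : 4^-1 - 20^-1 <= 1 - v - th by lra.
have a3 : 19 / 20 * (4^-1 - 20^-1) <= (1 - v) * (1 - v - th) by apply: ler_pM => //; lra.
by rewrite ler_pdivrMr; [lra|apply: lt_le_trans a3; lra].
Qed.

Lemma expRN_le_third x k : 0 < k -> ln (3 / k) <= x -> expR (- x) <= k / 3.
Proof.
move=> k0 h; rewrite expRN -[leRHS]invrK lef_pV2 ?posrE ?invr_gt0 ?divr_gt0 ?expR_gt0 // invf_div.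
by rewrite -[leLHS]lnK ?posrE ?divr_gt0 // ler_expR.
Qed.

(* Z is half the squared slope times the variance of a leg, and J k the largest level that is used. *)
Lemma leg_levels Z A k : 0 < k -> k <= 2^-1 -> A * (1 - k) ^+ 3 <= Z -> 1 <= A * (1 - k) ^+ 8 ->
  16 * ln (3 / k) <= k ^+ 2 * (A * (1 - k) ^+ 3) ->
  exists J : nat, [/\ J%:R * k <= Z, A * (1 - k) ^+ 8 <= J%:R * k * expR (- (2 * k)) * (1 - k),
    0 <= k * Z / 2, k * Z / 2 < Z - J%:R * k & expR (- (k * Z / 2) ^+ 2 / (4 * Z)) <= k / 3].
Proof.
move=> k0 k2 AZ A1 H.
have e0 : 0 < 1 - k by lra.
have e1 : 1 - k <= 1 by lra.
have A0 : 0 < A by have := lt_le_trans ltr01 A1; rewrite pmulr_lgt0 // exprn_gt0.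
have A5 : 1 <= A * (1 - k) ^+ 4.
  apply: (le_trans A1); rewrite ler_wpM2l ?(ltW A0) //.
  have -> : (1 - k) ^+ 8 = (1 - k) ^+ 4 * (1 - k) ^+ 4 by rewrite -exprD.
  by rewrite ler_piMr ?exprn_ge0 ?(ltW e0) // exprn_ile1 // ltW.
have Z0 : 0 < Z by apply: lt_le_trans AZ; rewrite mulr_gt0 // exprn_gt0.
have Z1 : 1 <= (1 - k) * Z.
  apply: (le_trans A5); have -> : A * (1 - k) ^+ 4 = (1 - k) * (A * (1 - k) ^+ 3) by ring.
  by rewrite ler_wpM2l // ltW.
have z0 : 0 <= (1 - k) * Z / k by rewrite divr_ge0 ?mulr_ge0 // ltW.
exists (Num.truncn ((1 - k) * Z / k)).
have /andP[J1 J2] := truncn_itv z0.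
set J := Num.truncn _ in J1 J2 *.
have J1' : J%:R * k <= (1 - k) * Z by rewrite -ler_pdivlMr.
have J2' : (1 - k) * Z - k <= J%:R * k.
  by move: J2; rewrite ltr_pdivrMr // -[J.+1]addn1 natrD mulrDl mul1r => h; lra.
have kZ : 0 < k * Z by rewrite mulr_gt0.
split.
- by lra.
- have h1 : (1 - k) ^+ 2 * Z <= J%:R * k.
    apply: le_trans J2'.
    have : k * 1 <= k * ((1 - k) * Z) by rewrite ler_wpM2l // ltW.
    have -> : (1 - k) ^+ 2 * Z = (1 - k) * Z - k * ((1 - k) * Z) by ring.
    by lra.
  have -> : A * (1 - k) ^+ 8 = (1 - k) ^+ 2 * (A * (1 - k) ^+ 3) * (1 - k) ^+ 2 * (1 - k) by ring.
  rewrite ler_wpM2r ?(ltW e0) //; apply: ler_pM.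
  + by rewrite !mulr_ge0 ?exprn_ge0 ?(ltW A0) // ltW.
  + by rewrite exprn_ge0 // ltW.
  + by apply: le_trans h1; rewrite ler_wpM2l // exprn_ge0 // ltW.
  + by apply: expRN2_ge; lra.
- by lra.
- by lra.
- have -> : - (k * Z / 2) ^+ 2 / (4 * Z) = - (k ^+ 2 * Z / 16) by field; rewrite gt_eqF.
  apply: expRN_le_third => //; rewrite ler_pdivlMr // mulrC; apply: (le_trans H).
  by rewrite ler_wpM2l ?sqr_ge0.
Qed.

Lemma one_le_twice v : v <= 20^-1 -> 1 <= 2 * (1 - v).
Proof. by lra. Qed.

Lemma half_sub_le s : 0 < s -> 2^-1 - s <= 3 / 4.
Proof. by lra. Qed.

Lemma norm_shift_gt x c r r' : 0 <= c -> c <= r' -> r = r' + r' -> r < `|x - c| -> (r' < x) || (r' < - x).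
Proof.
move=> c0 cr ->; rewrite lter_normr => /orP[h|h]; apply/orP; [left|right]; lra.
Qed.

Lemma rho_small R0 u k v : 0 < u -> 0 <= k -> v <= 20^-1 -> 9 * R0 ^+ 2 <= k * u ^+ 2 -> (3 * (R0 / u)) ^+ 2 / (2 * (1 - v)) <= k.
Proof.
move=> u0 k0 v20 h; have v1 : 1 <= 2 * (1 - v) := one_le_twice v20.
have h2 : (3 * (R0 / u)) ^+ 2 <= k.
  have -> : (3 * (R0 / u)) ^+ 2 = 9 * R0 ^+ 2 / u ^+ 2 by field; rewrite gt_eqF.
  by rewrite ler_pdivrMr ?exprn_gt0.
rewrite ler_pdivrMr ?(lt_le_trans ltr01) //; apply: (le_trans h2); exact: ler_peMr.
Qed.

Lemma drift_tail u s k : 0 < k -> 1152 * ln (3 / k) <= u ^+ 2 * s ^+ 2 -> 0 < u ->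
  expR (- (u ^+ 2 * s / 4) ^+ 2 / (2 * ((3 * u) ^+ 2 * 4))) <= k / 3.
Proof.
move=> k0 h u0.
have -> : - (u ^+ 2 * s / 4) ^+ 2 / (2 * ((3 * u) ^+ 2 * 4)) = - (u ^+ 2 * s ^+ 2 / 1152) by field; rewrite gt_eqF.
have c0 : 0 < 1152 :> R by rewrite ltr0n.
by apply: (expRN_le_third k0); rewrite (ler_pdivlMr _ _ c0) mulrC.
Qed.

Lemma sub_lt_gt0 e c : 0 <= e -> e < c -> 0 < c. Proof. by lra. Qed.
Lemma sub_scale e k c : e <= k * c -> (1 - k) * c <= c - e. Proof. by rewrite mulrBl mul1r => ?; lra. Qed.

(** Of the five powers of 1 - k, two stand for exp (-2 kp), one for the factor 1 - kp, one for exp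
    (- l kap1) and one for the bad event; the other n come from the legs. *)
Lemma lower_combine k E B C p n (D : R) : 0 <= k -> k <= 1 -> 1 <= B -> C * p <= k -> 0 <= E -> 0 <= D -> D * (1 - k) ^+ n <= B ->
  (1 - k) ^+ (5 + n) * E * D <= E * (1 - k) ^+ 2 * (1 - k) * ((1 - k) * (B - C * p)).
Proof.
move=> k0 k1 B1 Cp E0 D0 DB; have e0 : 0 <= 1 - k by rewrite subr_ge0.
have h : (1 - k) * B <= B - C * p.
  rewrite mulrBl mul1r lerD2l lerN2; apply: (le_trans Cp); exact: ler_peMr.
have -> : (1 - k) ^+ (5 + n) * E * D = E * (1 - k) ^+ 4 * ((1 - k) * (D * (1 - k) ^+ n)) by rewrite exprD; ring.
have -> : E * (1 - k) ^+ 2 * (1 - k) * ((1 - k) * (B - C * p)) = E * (1 - k) ^+ 4 * (B - C * p) by ring.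
apply: ler_wpM2l; first by rewrite mulr_ge0 ?exprn_ge0.
by apply: le_trans h; rewrite ler_wpM2l.
Qed.
End block_arithmetic.

(** * Orthogonal decomposition of the sheet over a block *)

Section coordinates.
Context {R : realType} (m : nat).
Implicit Types (x y : 'rV[R]_m.+1) (q : 'rV[R]_m).

Lemma ext_lift q t i : ext q t 0 (lift ord_max i) = q 0 i.
Proof. by rewrite mxE liftK. Qed.
Lemma ext_max q t : ext q t 0 ord_max = t.
Proof. by rewrite mxE unlift_none. Qed.

Lemma sum_lift (f : 'I_m.+1 -> R) : \sum_(i < m.+1) f i = \sum_(i < m) f (lift ord_max i) + f ord_max.
Proof.
rewrite big_ord_recr /=; congr (_ + _); apply: eq_bigr => i _; congr (f _).
by apply: val_inj; rewrite /= /bump leqNgt ltn_ord.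
Qed.

Lemma row_lift_eq x y : (forall i : 'I_m, x 0 (lift ord_max i) = y 0 (lift ord_max i)) -> x 0 ord_max = y 0 ord_max -> x = y.
Proof. by move=> H1 H2; apply/rowP => j; case: (unliftP ord_max j) => [i|] ->. Qed.

Definition setc (j : 'I_m.+1) (s : R) x : 'rV[R]_m.+1 := \row_l (if l == j then s else x 0 l).
End coordinates.

Section block.
Context {R : realType} (m : nat).
Variables (mu : probability (g_sigma_algebraType (@orthants R m.+1)) R) (F : 'rV[R]_m.+1 -> R).
Hypothesis HF : is_cdf_on_cube mu F.
Context (V : lmodType R) d (T : measurableType d) (P : probability T R) (X : gfield V P) (dl : 'rV[R]_m.+1 -> V).
Hypothesis ipd : forall x y, cube m.+1 x -> cube m.+1 y -> gip X (dl x) (dl y) = F (rmin x y).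
Local Notation ip := (gip X).
Local Notation one := (dl (ones m.+1)).
Variables (q : 'rV[R]_m) (r t0 t1 : R).
Hypothesis r0 : 0 < r.
Hypothesis q01 : forall i, 0 <= q 0 i /\ q 0 i + r <= 1.
Hypothesis t01 : [/\ 0 <= t0, t0 <= t1 & t1 <= 1].

Definition bbox : set 'rV[R]_m.+1 :=
  [set x | (forall i, q 0 i <= x 0 (lift ord_max i) <= q 0 i + r) /\ t0 <= x 0 ord_max <= t1].
Definition btop : 'rV[R]_m.+1 := ext (q + const_mx r) t1.
Definition bcor : 'rV[R]_m.+1 := ext q t0.
(** The noise at x is [bline] at its last coordinate plus the legs plus [brem x], all mutually
    orthogonal. The line runs over the corner q, a leg leaves the bottom corner in one direction,
    and [brem] is the noise that several directions produce jointly. [bth], [bmu] and [blegV] are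
    the variances of the line, of [boff] and of a leg. *)
Definition bline (t : R) : V := dl (ext q t).
Definition boff (x : 'rV[R]_m.+1) : V := dl x - bline (x 0 ord_max).
Definition bleg (i : 'I_m) (s : R) : V := dl (setc (lift ord_max i) s bcor) - dl bcor.
Definition brem (x : 'rV[R]_m.+1) : V := boff x - \sum_(i < m) bleg i (x 0 (lift ord_max i)).
Definition bth (t : R) : R := F (ext q t).
Definition bmu (x : 'rV[R]_m.+1) : R := F x - bth (x 0 ord_max).
Definition blegV (i : 'I_m) (s : R) : R := F (setc (lift ord_max i) s bcor) - F bcor.

Implicit Types x y : 'rV[R]_m.+1.

Lemma bbox_cube x : bbox x -> cube m.+1 x.
Proof.
move=> [h1 h2] j; case: (unliftP ord_max j) => [i|] ->.
  by have := h1 i; have [? ?] := q01 i; move=> /andP[? ?]; apply/andP; split; lra.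
by case: t01 => ? ? ?; move/andP: h2 => [? ?]; apply/andP; split; lra.
Qed.

Lemma ext_cube t : t0 <= t <= t1 -> cube m.+1 (ext q t).
Proof.
move=> tt; apply: bbox_cube; split; last by rewrite ext_max.
by move=> i; rewrite ext_lift lexx lerDl ltW.
Qed.

Lemma bcor_box : bbox bcor.
Proof.
split=> [i|]; rewrite ?ext_lift ?ext_max; first by rewrite lexx lerDl ltW.
by rewrite lexx; case: t01.
Qed.

Lemma btop_box : bbox btop.
Proof.
split=> [i|]; rewrite ?ext_lift ?ext_max; last by rewrite lexx andbT; case: t01.
by rewrite !mxE lexx andbT lerDl ltW.
Qed.

Lemma bline_box t : t0 <= t <= t1 -> bbox (ext q t).
Proof. by move=> h; split=> [i|]; rewrite ?ext_lift ?ext_max // lexx lerDl ltW. Qed.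

Lemma bleg_box i s : q 0 i <= s <= q 0 i + r -> bbox (setc (lift ord_max i) s bcor).
Proof.
move=> h; split=> [j|]; rewrite mxE.
  case: eqP => [/lift_inj ->|_] //; by case: bcor_box.
by rewrite (negbTE (neq_lift _ _)) ; case: bcor_box.
Qed.

Lemma setc_box j x s : bbox x ->
  (if unlift ord_max j is Some i then q 0 i <= s <= q 0 i + r else t0 <= s <= t1) -> bbox (setc j s x).
Proof.
move=> [h1 h2] hs; split=> [i|]; rewrite mxE.
  by case: eqP => [E|_] //; move: hs; rewrite -E liftK.
by case: eqP => [E|_] //; move: hs; rewrite -E unlift_none.
Qed.

Lemma bipd x y : bbox x -> bbox y -> ip (dl x) (dl y) = F (rmin x y).
Proof. by move=> bx by_; apply: ipd; exact: bbox_cube. Qed.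

Lemma bip1 x : bbox x -> ip (dl x) one = F x.
Proof.
move=> bx; have cx := bbox_cube bx; rewrite ipd //; last exact: cube_ones.
congr F; apply/rowP => j; rewrite !mxE; apply/min_idPl; by case/andP: (cx j).
Qed.

Lemma rmin_id (x y : 'rV[R]_m.+1) : (forall j, x 0 j <= y 0 j) -> rmin x y = x.
Proof. by move=> h; apply/rowP => j; rewrite mxE; apply/min_idPl. Qed.

Lemma bip_le x y : bbox x -> bbox y -> (forall j, x 0 j <= y 0 j) -> ip (dl x) (dl y) = F x.
Proof. by move=> bx by_ h; rewrite bipd // rmin_id. Qed.

Lemma bl_min x y : bbox x -> bbox y -> rmin x (ext q (y 0 ord_max)) = ext q (Num.min (x 0 ord_max) (y 0 ord_max)).
Proof.
move=> [hx _] [hy _]; apply: row_lift_eq => [i|]; rewrite mxE ?ext_lift ?ext_max //.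
by apply/min_idPr; case/andP: (hx i).
Qed.

Lemma tbox x : bbox x -> t0 <= x 0 ord_max <= t1. Proof. by case. Qed.

Lemma bline_ip t t' : t0 <= t -> t <= t' -> t' <= t1 -> ip (bline t) (bline t') = bth t.
Proof.
move=> h0 h1 h2; apply: bip_le.
- by apply: bline_box; apply/andP; split; lra.
- by apply: bline_box; apply/andP; split; lra.
by move=> j; case: (unliftP ord_max j) => [i|] ->; rewrite ?ext_lift ?ext_max.
Qed.

Lemma bline_ip1 t : t0 <= t <= t1 -> ip (bline t) one = bth t.
Proof. by move=> /bline_box; exact: bip1. Qed.

Lemma bip_bl x y : bbox x -> bbox y -> ip (dl x) (bline (y 0 ord_max)) = bth (Num.min (x 0 ord_max) (y 0 ord_max)).
Proof. by move=> bx by_; rewrite /bline bipd ?bl_min //; exact/bline_box/tbox. Qed.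

Lemma bline_off t x : t0 <= t <= t1 -> bbox x -> ip (bline t) (boff x) = 0.
Proof.
move=> ht bx; rewrite /boff gipBr.
have E := bip_bl bx (bline_box ht); rewrite ext_max in E.
rewrite gip_sym E minC.
by have := bip_bl (bline_box ht) bx; rewrite ext_max => ->; rewrite subrr.
Qed.

Lemma boff_ip1 x : bbox x -> ip (boff x) one = bmu x.
Proof. by move=> bx; rewrite gipBl bip1 // bline_ip1 //; case: bx. Qed.

Lemma boff_le x y : bbox x -> bbox y -> (forall j, x 0 j <= y 0 j) -> ip (boff x) (boff y) = bmu x.
Proof.
move=> bx by_ xy; rewrite /boff gipBl bline_off // ?subr0; last exact: tbox.
by rewrite gipBr bip_le // bip_bl // (min_idPl (xy _)).
Qed.

Lemma box_le_top x : bbox x -> forall j, x 0 j <= btop 0 j.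
Proof.
move=> [h1 /andP[_ h2]] j; case: (unliftP ord_max j) => [i|] ->; rewrite ?ext_lift ?ext_max //.
by rewrite !mxE; case/andP: (h1 i).
Qed.

Lemma box_ge_cor x : bbox x -> forall j, bcor 0 j <= x 0 j.
Proof.
move=> [h1 /andP[h2 _]] j; case: (unliftP ord_max j) => [i|] ->; rewrite ?ext_lift ?ext_max //.
by case/andP: (h1 i).
Qed.

Lemma leg_min i s y : bbox y ->
  rmin (setc (lift ord_max i) s bcor) y = setc (lift ord_max i) (Num.min s (y 0 (lift ord_max i))) bcor.
Proof.
move=> by_; apply/rowP => j; rewrite !mxE; case: eqP => [->//|_].
by apply/min_idPl; have := box_ge_cor by_ j; rewrite mxE.
Qed.

Lemma setc_cor i : setc (lift ord_max i) (q 0 i) bcor = bcor.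
Proof. by apply/rowP => j; rewrite mxE; case: eqP => [->|_] //; rewrite ext_lift. Qed.

Lemma cor_ip y : bbox y -> ip (dl bcor) (dl y) = F bcor.
Proof. by move=> by_; apply: bip_le => //; [exact: bcor_box|exact: box_ge_cor]. Qed.

(** The leg starts at the bottom corner, which lies below y, so y sees it only through its own i-th
    coordinate. *)
Lemma leg_ip i s y : q 0 i <= s <= q 0 i + r -> bbox y ->
  ip (bleg i s) (dl y) = blegV i (Num.min s (y 0 (lift ord_max i))).
Proof.
move=> hs by_; rewrite /bleg gipBl cor_ip // bipd //; last exact: bleg_box.
by rewrite leg_min.
Qed.

Lemma blegV0 i : blegV i (q 0 i) = 0.
Proof. by rewrite /blegV setc_cor subrr. Qed.

Lemma leg_bl i s t : q 0 i <= s <= q 0 i + r -> t0 <= t <= t1 -> ip (bleg i s) (bline t) = 0.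
Proof.
move=> hs ht; rewrite leg_ip //; last exact: bline_box.
by rewrite ext_lift (min_idPr _) ?blegV0 //; case/andP: hs.
Qed.

Lemma leg_off i s y : q 0 i <= s <= q 0 i + r -> bbox y ->
  ip (bleg i s) (boff y) = blegV i (Num.min s (y 0 (lift ord_max i))).
Proof. by move=> hs by_; rewrite /boff gipBr leg_ip // leg_bl ?subr0 //; exact: tbox. Qed.

Lemma leg_leg i j s s' : q 0 i <= s <= q 0 i + r -> q 0 j <= s' <= q 0 j + r ->
  ip (bleg i s) (bleg j s') = if i == j then blegV i (Num.min s s') else 0.
Proof.
move=> hs hs'; rewrite {2}/bleg gipBr leg_ip //; last exact: bleg_box.
rewrite leg_ip //; last exact: bcor_box.
rewrite ext_lift (min_idPr _ : Num.min s (q 0 i) = _); last by case/andP: hs.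
rewrite blegV0 subr0 mxE; have [->|ij] := eqVneq i j; first by rewrite eqxx.
rewrite (inj_eq lift_inj) (negbTE ij) ext_lift (min_idPr _) ?blegV0 //; by case/andP: hs.
Qed.

Lemma bbox_lift x i : bbox x -> q 0 i <= x 0 (lift ord_max i) <= q 0 i + r.
Proof. by case. Qed.

Lemma leg_rem i s y : q 0 i <= s <= q 0 i + r -> bbox y -> ip (bleg i s) (brem y) = 0.
Proof.
move=> hs by_; rewrite /brem gipBr leg_off // gipsumr (bigD1 i) //= leg_leg ?eqxx //; last exact: bbox_lift.
rewrite big1 ?addr0 ?subrr // => j ji; rewrite leg_leg ?(eq_sym i) ?(negbTE ji) //; exact: bbox_lift.
Qed.

Lemma rem_ip x : bbox x -> ip (brem x) (brem x) = bmu x - \sum_(i < m) blegV i (x 0 (lift ord_max i)).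
Proof.
move=> bx; rewrite {1}/brem gipBl gipsuml big1 ?subr0; last by move=> i _; apply: leg_rem => //; exact: bbox_lift.
rewrite /brem gipBr boff_le // gipsumr; congr (_ - _); apply: eq_bigr => i _.
by rewrite gip_sym leg_off ?minxx //; exact: bbox_lift.
Qed.

(* Raising coordinate j of x adds a noise that no point of smaller j-coordinate sees. *)
Lemma rem_upd j x y : bbox x -> bbox y -> y 0 j <= x 0 j ->
  ip (brem (upd btop j x) - brem x) (brem y) = 0.
Proof.
move=> bx by_ yx.
have updE : upd btop j x = setc j (btop 0 j) x by apply/rowP => l; rewrite !mxE; case: eqP => [->|].
have bux : bbox (upd btop j x).
  rewrite updE; apply: setc_box => //.
  by have := btop_box; case: (unliftP ord_max j) => [i|] -> [h1 h2]; [exact: h1|exact: h2].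
have key z z' y' : bbox z -> bbox z' -> bbox y' -> y' 0 j <= z 0 j -> y' 0 j <= z' 0 j ->
    (forall l, l != j -> z 0 l = z' 0 l) -> ip (dl z - dl z') (dl y') = 0.
  move=> bz bz' byy' h h' zz; rewrite gipBl !bipd //.
  rewrite (_ : rmin z y' = rmin z' y') ?subrr //; apply/rowP => l; rewrite !mxE.
  have [->|lj] := eqVneq l j; last by rewrite zz.
  by rewrite (min_idPr h) (min_idPr h').
have xt := box_le_top bx.
(* [Q w]: w is invisible from every point whose j-coordinate is at most that of x. Such a w is
   orthogonal to [brem y], and the difference of the remainders is shown to satisfy [Q]. *)
pose Q (w : V) := forall y', bbox y' -> y' 0 j <= x 0 j -> ip w (dl y') = 0.
have remQ w : Q w -> ip w (brem y) = 0.
  move=> Qw; rewrite /brem /boff /bline !gipBr gipsumr Qw // Qw; last first.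
  - move: yx; case: (unliftP ord_max j) => [i|] -> yx; rewrite ?ext_lift ?ext_max //.
    by case/andP: (bbox_lift i bx).
  - exact/bline_box/tbox.
  rewrite subrr sub0r big1 ?oppr0 // => i _; rewrite /bleg gipBr !Qw ?subrr //.
  - exact: bcor_box.
  - exact: box_ge_cor bx _.
  - by apply: bleg_box; exact: bbox_lift.
  - by rewrite mxE; case: eqP => [ji|_]; [rewrite -ji|exact: box_ge_cor bx _].
apply: remQ => y' by' y'x.
have y't : y' 0 j <= upd btop j x 0 j by rewrite mxE eqxx; exact: box_le_top by' _.
have upd_ne l : l != j -> upd btop j x 0 l = x 0 l by rewrite mxE => /negbTE->.
rewrite /brem; set S1 := \sum_(i < m) _; set S2 := \sum_(i < m) bleg i (x 0 _).
have -> : boff (upd btop j x) - S1 - (boff x - S2) =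
   (dl (upd btop j x) - dl x) - (bline (upd btop j x 0 ord_max) - bline (x 0 ord_max)) - (S1 - S2).
  have sub4 (a b c e : V) : (a - b) - (c - e) = (a - c) - (b - e) by rewrite !opprD !opprK addrACA.
  by rewrite sub4; congr (_ - _); exact: sub4.
rewrite gipBl [ip (_ - _ - _) _]gipBl (key _ _ y') // sub0r.
have [jm|jm] := eqVneq ord_max j.
  have -> : S1 - S2 = 0.
    rewrite -sumrB big1 // => i _; rewrite upd_ne ?subrr //; by rewrite -jm eq_sym neq_lift.
  rewrite gip0l subr0 (key _ _ y') ?oppr0 //.
  - exact/bline_box/tbox.
  - exact/bline_box/tbox.
  - by rewrite -jm ext_max; move: y't; rewrite -jm.
  - by rewrite -jm ext_max; move: y'x; rewrite -jm.
  - by move=> l; rewrite -jm; case: (unliftP ord_max l) => [i|] ->; rewrite ?ext_lift ?eqxx.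
have -> : upd btop j x 0 ord_max = x 0 ord_max by apply: upd_ne.
rewrite subrr gip0l oppr0 sub0r; case: (unliftP ord_max j) => [i|] ji; last by rewrite ji eqxx in jm.
have -> : S1 - S2 = bleg i (upd btop j x 0 j) - bleg i (x 0 j).
  rewrite -sumrB (bigD1 i) //= -ji big1 ?addr0 // => i' i'i.
  by rewrite upd_ne ?subrr // ji (inj_eq lift_inj).
rewrite /bleg opprB addrA subrK (key _ _ y') ?oppr0 //.
- by apply: bleg_box; have := bbox_lift i bux; rewrite -ji.
- by apply: bleg_box; have := bbox_lift i bx; rewrite -ji.
- by rewrite [leRHS]mxE -ji eqxx.
- by rewrite [leRHS]mxE -ji eqxx.
- by move=> l lj; rewrite [LHS]mxE [RHS]mxE -ji (negbTE lj).
Qed.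

Variables (a : 'I_m.+1 -> R) (eps : R).
Hypothesis eps0 : 0 <= eps.
Hypothesis lin : forall x y, bbox x -> bbox y ->
  `|F x - F y - \sum_i a i * (x 0 i - y 0 i)| <= eps * \sum_i `|x 0 i - y 0 i|.
Local Notation al i := (a (lift ord_max i)).

(** For ordered points the error can be merged into the coefficients. *)
Lemma lin_mono x y : bbox x -> bbox y -> (forall i, y 0 i <= x 0 i) ->
  \sum_i (a i - eps) * (x 0 i - y 0 i) <= F x - F y <= \sum_i (a i + eps) * (x 0 i - y 0 i).
Proof.
move=> bx by_ yx; have := lin bx by_; rewrite ler_norml.
have -> : \sum_i `|x 0 i - y 0 i| = \sum_i (x 0 i - y 0 i) by apply: eq_bigr => i _; rewrite ger0_norm ?subr_ge0.
have E (c : R) : \sum_i (a i + c) * (x 0 i - y 0 i) = \sum_i a i * (x 0 i - y 0 i) + c * \sum_i (x 0 i - y 0 i).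
  by rewrite mulr_sumr -big_split; apply: eq_bigr => i _; rewrite mulrDl.
rewrite (E eps) (E (- eps)) => /andP[h1 h2]; apply/andP; split; lra.
Qed.

Lemma sum_one (c f : 'I_m.+1 -> R) j : (forall i, i != j -> f i = 0) -> \sum_i c i * f i = c j * f j.
Proof. by move=> h; rewrite (bigD1 j) //= big1 ?addr0 // => i ij; rewrite h // mulr0. Qed.

Lemma legV_bounds i s : q 0 i <= s <= q 0 i + r ->
  (al i - eps) * (s - q 0 i) <= blegV i s <= (al i + eps) * (s - q 0 i).
Proof.
move=> hs; have bs := bleg_box hs; have := lin_mono bs bcor_box.
have h0 l : l != lift ord_max i -> setc (lift ord_max i) s bcor 0 l - bcor 0 l = 0.
  by move=> li; rewrite [X in X - _]mxE (negbTE li) subrr.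
have h1 : setc (lift ord_max i) s bcor 0 (lift ord_max i) - bcor 0 (lift ord_max i) = s - q 0 i.
  by rewrite [X in X - _]mxE eqxx ext_lift.
by rewrite !(sum_one _ h0) h1; apply; exact: box_ge_cor.
Qed.

Lemma mu_bounds x : bbox x -> \sum_(i < m) (al i - eps) * (x 0 (lift ord_max i) - q 0 i) <= bmu x
  <= \sum_(i < m) (al i + eps) * (x 0 (lift ord_max i) - q 0 i).
Proof.
move=> bx; have bl := bline_box (tbox bx); have := lin_mono bx bl.
have E (c : 'I_m.+1 -> R) : \sum_i c i * (x 0 i - ext q (x 0 ord_max) 0 i) = \sum_(i < m) c (lift ord_max i) * (x 0 (lift ord_max i) - q 0 i).
  by rewrite sum_lift ext_max subrr mulr0 addr0; apply: eq_bigr => i _; rewrite ext_lift.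
rewrite !E; apply => j; case: (unliftP ord_max j) => [i|] ->; rewrite ?ext_lift ?ext_max //.
by case/andP: (bbox_lift i bx).
Qed.

Lemma th_bounds t t' : t0 <= t -> t <= t' -> t' <= t1 ->
  (a ord_max - eps) * (t' - t) <= bth t' - bth t <= (a ord_max + eps) * (t' - t).
Proof.
move=> h0 h1 h2.
have b1 : bbox (ext q t) by apply: bline_box; apply/andP; split; lra.
have b2 : bbox (ext q t') by apply: bline_box; apply/andP; split; lra.
have := lin_mono b2 b1.
have h l : l != ord_max -> ext q t' 0 l - ext q t 0 l = 0.
  by case: (unliftP ord_max l) => [i|] ->; rewrite ?ext_lift ?subrr ?eqxx.
rewrite !(sum_one _ h) !ext_max; apply => j.
by case: (unliftP ord_max j) => [i|] ->; rewrite ?ext_lift ?ext_max.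
Qed.

(** By Pythagoras the variance is [bmu] minus the variances of the legs. Their linear parts a_i (x_i
    - q_i) cancel, and only the errors remain, 2 eps for each coordinate. *)
Lemma rem_bound x : bbox x -> ip (brem x) (brem x) <= 2 * eps * m%:R * r.
Proof.
move=> bx; rewrite rem_ip //; have /andP[_ h] := mu_bounds bx.
have h2 : \sum_(i < m) (al i - eps) * (x 0 (lift ord_max i) - q 0 i) <= \sum_(i < m) blegV i (x 0 (lift ord_max i)).
  by apply: ler_sum => i _; case/andP: (legV_bounds (bbox_lift i bx)).
apply: (@le_trans _ _ (\sum_(i < m) 2 * eps * r)).
  apply: (@le_trans _ _ (\sum_(i < m) 2 * eps * (x 0 (lift ord_max i) - q 0 i))).
    rewrite (_ : \sum_(i < m) 2 * eps * _ = \sum_(i < m) (al i + eps) * (x 0 (lift ord_max i) - q 0 i) - \sum_(i < m) (al i - eps) * (x 0 (lift ord_max i) - q 0 i)); first by lra.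
    by rewrite -sumrB; apply: eq_bigr => i _; ring.
  apply: ler_sum => i _; rewrite ler_wpM2l ?mulr_ge0 //.
  by case/andP: (bbox_lift i bx) => _; lra.
by rewrite sumr_const card_ord -[X in X <= _]mulr_natr mulrAC.
Qed.

Hypothesis m0 : (0 < m)%N.
Hypothesis al_gt : forall i, eps < al i.
Hypothesis top_lt : F btop < 1.

Lemma bmu_top : 0 < bmu btop < 1.
Proof.
apply/andP; split.
  have /andP[h _] := mu_bounds btop_box; apply: lt_le_trans h.
  rewrite (bigD1 (Ordinal m0)) //=; apply: ltr_pwDl.
    by rewrite ext_lift !mxE addrAC subrr add0r mulr_gt0 // subr_gt0.
  apply: sumr_ge0 => i _; rewrite ext_lift !mxE addrAC subrr add0r mulr_ge0 ?(ltW r0) //.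
  by rewrite subr_ge0 ltW.
apply: le_lt_trans top_lt; rewrite /bmu gerBl.
have bt : t0 <= btop 0 ord_max <= t1 := tbox btop_box.
by case/andP: (cdf01 HF (ext_cube bt)).
Qed.

Lemma bth_lt t : t0 <= t <= t1 -> bth t < 1 - bmu btop.
Proof.
move=> /andP[ht ht1]; rewrite /bmu ext_max.
apply: (@le_lt_trans _ _ (bth t1)); last by have := top_lt; lra.
apply: (cdf_le HF).
- by apply: ext_cube; rewrite ht.
- by apply: ext_cube; rewrite lexx; case: t01 => _ ->.
- by move=> j; case: (unliftP ord_max j) => [i|] ->; rewrite ?ext_lift ?ext_max.
Qed.

Lemma boff_o1 : ip (boff btop) one = bmu btop.
Proof. exact: boff_ip1 btop_box. Qed.
Lemma boff_oo : ip (boff btop) (boff btop) = bmu btop.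
Proof. exact: boff_le btop_box btop_box (fun _ => lexx _). Qed.
Lemma ip_one1 : ip one one = 1.
Proof. by rewrite ipd; [|exact: cube_ones|exact: cube_ones]; rewrite rmin_id // (cdf_ones HF). Qed.

(* Points of the box are indexed so that the time of the k-th one is the (kap k)-th sorted time. *)
Lemma block_upper (u w kp l : R) (s : seq 'rV[R]_m.+1) : (forall x, x \in s -> bbox x) ->
  0 < 2 * u - w -> 0 < kp ->
  l = 2 * colc (bmu btop) u w ->
  (P [set t | has (fun x => u < X (dl x) t - F x * (X one t - w))%R s] <=
   (colC (bmu btop) u w * (\prod_(i < m) (1 + (l * Num.sqrt ((al i + eps) * r)) ^+ 2 / 2 + 2 * (l * Num.sqrt ((al i + eps) * r))) *
     (1 + 2 ^+ m.+1 * (kp / 2 + (expR (2 * (l ^+ 2 * (2 * eps * m%:R * r))) - 1) / (2 * kp)))))%:E)%E.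
Proof.
move=> sb uw kp0 lE; pose v := bmu btop.
have v01 : 0 < v < 1 := bmu_top.
have l0 : 0 < l by rewrite lE mulr_gt0 // divr_gt0 // subr_gt0; case/andP: v01.
pose c := colc v u w.
pose pt j := nth bcor s j.
have ptb j : bbox (pt j).
  rewrite /pt; have [h|h] := ltnP j (size s); first by apply: sb; exact: mem_nth.
  by rewrite nth_default //; exact: bcor_box.
pose ts := sort <=%R (map (fun x : 'rV[R]_m.+1 => x 0 ord_max) s).
pose tk k := nth t1 ts k.
have t11 : t0 <= t1 <= t1 by rewrite lexx andbT; case: t01.
have tkb k : t0 <= tk k <= t1.
  rewrite /tk; have [h|h] := ltnP k (size ts); last by rewrite nth_default.
  have : nth t1 ts k \in map (fun x : 'rV[R]_m.+1 => x 0 ord_max) s by rewrite -(mem_sort <=%R) mem_nth.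
  by case/mapP => x /sb[_ hx] ->.
have tkle j k : (j <= k)%N -> tk j <= tk k.
  move=> jk; rewrite /tk; have [h|h] := ltnP k (size ts); last by rewrite [leRHS]nth_default //; case/andP: (tkb j).
  apply: (@sorted_leq_nth _ _ le_trans lexx t1 ts) => //; first exact: (sort_sorted le_total).
  by rewrite inE; exact: leq_ltn_trans h.
pose kap j := index (pt j 0 ord_max) ts.
have kapE j : (j < size s)%N -> tk (kap j) = pt j 0 ord_max.
  move=> h; rewrite /tk nth_index // mem_sort.
  by apply/mapP; exists (pt j) => //; exact: mem_nth.
have ipl j k : (j <= k)%N -> ip (bline (tk j)) (bline (tk k)) = bth (tk j).
  by move=> jk; apply: bline_ip; [case/andP: (tkb j)|exact: tkle|case/andP: (tkb k)].
have U := @column_upper R V d T P X one (boff btop) v v01 ip_one1 boff_o1 boff_oo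
  (fun k => bline (tk k)) (fun k => bth (tk k)) ipl (fun k => bline_ip1 (tkb k)) (fun k => bline_off (tkb k) btop_box)
  (fun k => bth_lt (tkb k)) kap (fun j => boff (pt j)) (fun j => bmu (pt j))
  (fun j => boff_ip1 (ptb j)) (fun j => boff_le (ptb j) btop_box (box_le_top (ptb j))) (fun j k => bline_off (tkb j) (ptb k))
  u w (size s) uw.
have -> : [set t | has (fun x => u < X (dl x) t - F x * (X one t - w)) s] =
  [set t | hits (size s) u (fun j => X (bline (tk (kap j)) + boff (pt j)) t - (bth (tk (kap j)) + bmu (pt j)) * (X one t - w))].
  apply/funext => t; rewrite /mkset -(hits_has bcor s (fun x => X (dl x) t - F x * (X one t - w))).
  congr is_true; apply: hits_ext => j js; rewrite kapE //.
  rewrite -/(pt j) (_ : bline _ + _ = dl (pt j)); last by rewrite /boff addrC subrK.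
  by congr (_ - _ * _); rewrite /bmu addrC subrK.
have lE' : 2 * colc v u w = l by rewrite lE.
rewrite lE' in U; apply: (le_trans U); rewrite [in leRHS]EFinM; apply: lee_wpmul2l; first by rewrite lee_fin; exact: colC_ge0.
(* Indices below m carry the legs and index m the remainder. Points outside the block get the zero
   vector, so that orthogonality holds for all indices. *)
pose phi (i : nat) (x : 'rV[R]_m.+1) : V :=
  if `[< bbox x >] then (if insub i is Some i' then bleg (i' : 'I_m) (x 0 (lift ord_max i')) else if i == m then brem x else 0) else 0.
pose f (i : nat) (y : @path R 'rV[R]_m.+1) : R :=
  if insub i is Some i' then expR (smax s (fun x => l * y x - l ^+ 2 * blegV (i' : 'I_m) (x 0 (lift ord_max i')) / 2))
  else expR (l * smax s y).
have phiE (i : 'I_m) x : bbox x -> phi i x = bleg i (x 0 (lift ord_max i)).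
  by move=> bx; rewrite /phi asboolT // valK.
have phim x : bbox x -> phi m x = brem x.
  by move=> bx; rewrite /phi asboolT // insubN ?ltnn // eqxx.
have orth i i' x x' : i != i' -> ip (phi i x) (phi i' x') = 0.
  rewrite /phi; case: asboolP => bx; last by rewrite gip0l.
  case: asboolP => bx'; last by rewrite gip0r.
  case: insubP => [j _ <-|_]; case: insubP => [j' _ <-|_] ii'.
  - rewrite leg_leg; [|exact: bbox_lift|exact: bbox_lift].
    by case: eqP => // E; rewrite E eqxx in ii'.
  - by case: eqP => _; rewrite ?gip0r // leg_rem //; exact: bbox_lift.
  - by case: eqP => _; rewrite ?gip0l // gip_sym leg_rem //; exact: bbox_lift.
  - case: eqP => [E|_]; rewrite ?gip0l //; case: eqP => [E'|_]; rewrite ?gip0r //.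
    by rewrite E E' eqxx in ii'.
have mf i : measurable_fun setT (f i).
  rewrite /f; case: insubP => [j _ _|_]; apply: (measurableT_comp (f := expR)); try exact: measurable_expR.
    apply: (measurable_smax s (f := fun x (y : @path R 'rV[R]_m.+1) => l * y x - l ^+ 2 * blegV j (x 0 (lift ord_max j)) / 2)) => x.
    by mreal.
  apply: measurable_funM; first exact: measurable_cst.
  by apply: (measurable_smax s (f := fun x (y : @path R 'rV[R]_m.+1) => y x)) => x; exact: measurable_coord.
have f0 i (y : path 'rV[R]_m.+1) : 0 <= f i y by rewrite /f; case: insub => [j|]; exact: expR_ge0.
pose b (i : nat) : R := if insub i is Some i' then
   1 + (l * Num.sqrt ((al (i' : 'I_m) + eps) * r)) ^+ 2 / 2 + 2 * (l * Num.sqrt ((al i' + eps) * r))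
   else 1 + 2 ^+ m.+1 * (kp / 2 + (expR (2 * (l ^+ 2 * (2 * eps * m%:R * r))) - 1) / (2 * kp)).
have bE : \prod_(i < m) (1 + (l * Num.sqrt ((al i + eps) * r)) ^+ 2 / 2 + 2 * (l * Num.sqrt ((al i + eps) * r))) *
     (1 + 2 ^+ m.+1 * (kp / 2 + (expR (2 * (l ^+ 2 * (2 * eps * m%:R * r))) - 1) / (2 * kp))) = \prod_(i < m.+1) b i.
  rewrite big_ord_recr /=; congr (_ * _); last by rewrite /b insubN ?ltnn.
  by apply: eq_bigr => i _; rewrite /b valK.
rewrite bE.
have smaxE (g h : 'rV[R]_m.+1 -> R) : (forall x, bbox x -> g x = h x) -> smax s g = smax s h.
  move=> gh; elim: s sb {U kapE ptb tkb tkle ipl pt kap ts tk f mf f0} => [//|x s' IH] sb' /=.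
  by rewrite gh ?IH // => [y ys|]; [apply: sb'; rewrite in_cons ys orbT|apply: sb'; rewrite mem_head].
have fb i : (i < m.+1)%N -> (\int[P]_t (f i (fun x => X (phi i x) t))%:E <= (b i)%:E)%E.
  rewrite ltnS leq_eqVlt => /predU1P[->|im].
    rewrite /f /b insubN ?ltnn //.
    under eq_integral => t _ do rewrite (smaxE _ (fun x => X (brem x) t) (fun x bx => congr1 (fun v => X v t) (phim x bx))).
    apply: (exp_smax_le (top := btop) (B := bbox)) => //.
    - move=> j x bx; rewrite (_ : upd btop j x = setc j (btop 0 j) x); last by apply/rowP => j'; rewrite !mxE; case: eqP => [->|].
      apply: setc_box => //; have [h1 h2] := btop_box.
      by case: (unliftP ord_max j) => [i'|] ->; [exact: h1|exact: h2].
    - by move=> j x y bx by_ yx; exact: rem_upd.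
    - exact: rem_bound btop_box.
  have [i' ii'] : exists i' : 'I_m, i = i' :> nat by exists (Ordinal im).
  rewrite {i im}ii' /f /b valK.
  pose W t (x : R) := l * X (bleg i' x) t - l ^+ 2 * blegV i' x / 2.
  under eq_integral => t _.
    rewrite (smaxE _ (fun x => W t (x 0 (lift ord_max i')))); last by move=> x bx; rewrite phiE.
    rewrite (_ : smax s _ = smax (map (fun x : 'rV[R]_m.+1 => x 0 (lift ord_max i')) s) (W t)); first over.
    by rewrite /smax foldr_map.
  have ler i0 : 0 < (al i0 + eps) * r by rewrite mulr_gt0 //; have := al_gt i0; have := eps0; lra.
  apply: (@exp_leg_le _ _ _ _ _ X (bleg i') (blegV i') (q 0 i') (q 0 i' + r)).
  - move=> x y h1 h2 h3; rewrite leg_leg ?eqxx ?(min_idPl h2) //; apply/andP; split; lra.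
  - exact: ltW.
  - by rewrite sqrtr_gt0.
  - by move=> x /mapP[x' /sb bx' ->]; exact: bbox_lift.
  - move=> x hx; rewrite sqr_sqrtr ?(ltW (ler _)) //; case/andP: (legV_bounds hx) => _ h; apply: (le_trans h).
    rewrite ler_wpM2l //; first by have := al_gt i'; have := eps0; lra.
    by case/andP: hx; lra.
apply: (le_trans _ (gX_indep_prod_le orth mf f0 fb)).
apply: int_le.
- apply/measurable_EFinP; apply: measurable_expRf.
  apply: measurable_funM; first exact: measurable_cst.
  by apply: (measurable_rmax (size s) (fun j t => X (boff (pt j)) t - colc v u w * bmu (pt j))) => j; mreal.
- apply/measurable_EFinP; apply: measurable_prod => i _; apply: (measurableT_comp (mf i)); exact: gX_path.
- by move=> t; rewrite lee_fin expR_ge0.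
move=> t; rewrite lee_fin -/c big_ord_recr /=.
have -> : f m (fun x => X (phi m x) t) = expR (l * smax s (fun x => X (brem x) t)).
  by rewrite /f insubN ?ltnn // (smaxE _ (fun x => X (brem x) t)) // => x bx; rewrite phim.
pose Wi (i : 'I_m) := smax s (fun x => l * X (bleg i (x 0 (lift ord_max i))) t - l ^+ 2 * blegV i (x 0 (lift ord_max i)) / 2).
have -> : \prod_(i < m) f i (fun x => X (phi i x) t) = expR (\sum_(i < m) Wi i).
  rewrite expR_sum; apply: eq_bigr => i _; rewrite /f valK; congr expR.
  by apply: smaxE => x bx; rewrite phiE.
rewrite -expRD ler_expR mulrC -ler_pdivlMr //.
have Wi0 i : 0 <= Wi i by exact: smax_ge0.
have rm0 : 0 <= l * smax s (fun x => X (brem x) t) by rewrite mulr_ge0 ?smax_ge0 // ltW.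
apply: rmax_le; first by rewrite divr_ge0 ?addr_ge0 ?sumr_ge0 // ltW.
move=> j js; rewrite ler_pdivlMr // mulrC.
have pts : pt j \in s by exact: mem_nth.
have bx := ptb j.
have h1 : \sum_(i < m) (l * X (bleg i (pt j 0 (lift ord_max i))) t - l ^+ 2 * blegV i (pt j 0 (lift ord_max i)) / 2) <= \sum_(i < m) Wi i.
  apply: ler_sum => i _.
  exact: (smax_ge (fun x : 'rV[R]_m.+1 => l * X (bleg i (x 0 (lift ord_max i))) t - l ^+ 2 * blegV i (x 0 (lift ord_max i)) / 2) pts).
have h2 : l * X (brem (pt j)) t <= l * smax s (fun x => X (brem x) t).
  by rewrite ler_wpM2l ?(ltW l0) //; exact: (smax_ge (fun x => X (brem x) t) pts).
(* The drift of the off-line noise exceeds that of the legs by a multiple of the variance of the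
   remainder; this surplus is nonnegative and is dropped. *)
have h3 : 0 <= bmu (pt j) - \sum_(i < m) blegV i (pt j 0 (lift ord_max i)) by rewrite -rem_ip // gip_ge0.
have h4 : X (boff (pt j)) t = \sum_(i < m) X (bleg i (pt j 0 (lift ord_max i))) t + X (brem (pt j)) t.
  by rewrite -gXsum -gXD /brem addrC subrK.
apply: le_trans (lerD h1 h2); rewrite h4 sumrB -mulr_sumr -mulr_suml -mulr_sumr.
have -> : l ^+ 2 = l * (2 * c) by rewrite expr2 {2}lE.
have : 0 <= l * c * (bmu (pt j) - \sum_(i < m) blegV i (pt j 0 (lift ord_max i))).
  by rewrite mulr_ge0 // mulr_ge0 ?(ltW l0) //; have := l0; rewrite lE -/c; lra.
by set S1 := \sum_(i < m) X _ _; set S2 := \sum_(i < m) blegV _ _; lra.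
Qed.
Lemma bbox_point (s : 'I_m -> R) t : (forall i, q 0 i <= s i <= q 0 i + r) -> t0 <= t <= t1 ->
  bbox (ext (\row_i s i) t).
Proof. by move=> hs ht; split=> [i|]; rewrite ?ext_lift ?ext_max // mxE. Qed.

(* The grid has (N+1)^m columns over K+1 times: index (f, k) carries the point with i-th coordinate
   sg i (f i) and time tg k. *)
Lemma block_lower (u w kp l L rho kap1 D0 D1 S p : R) (J : 'I_m -> nat) :
  0 < kp <= 1 -> 0 <= kap1 <= rho -> l = 2 * colc (bmu btop) u w -> 0 < l ->
  (3 * rho) ^+ 2 / (2 * (1 - bmu btop)) <= kp ->
  eps < a ord_max -> t0 < t1 -> 0 < L -> 0 < S -> 0 <= D0 -> 0 <= D1 ->
  (let tb t := bth t / ((1 - bmu btop) * (1 - bmu btop - bth t)) in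
   tb t0 <= S /\ tb t1 <= S /\
   forall M (x : R), `|M| <= rho -> `|x| <= rho ->
     let y := u - M in let b := w - x in
     [/\ b < y, 2 * (y - b) <= L,
        D0 <= 2 * y * (y - b) / (1 - bmu btop) - (2 * (y - b)) ^+ 2 * tb t0 / 2 &
        D1 < (2 * (y - b)) ^+ 2 * tb t1 / 2 - 2 * y * (y - b) / (1 - bmu btop)]) ->
  expR (- D0 ^+ 2 / (2 * (L ^+ 2 * S))) <= kp / 3 -> expR (- D1 ^+ 2 / (2 * (L ^+ 2 * S))) <= kp / 3 ->
  (forall i, exists2 E1, 0 <= E1 & E1 < l ^+ 2 * blegV i (q 0 i + r) / 2 - (J i)%:R * kp /\
      expR (- E1 ^+ 2 / (2 * (l ^+ 2 * blegV i (q 0 i + r)))) <= kp / 3) ->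
  (P [set t | (rho < `|X (boff btop) t - l / 2 * bmu btop|)%R] +
   \sum_(i < m) 2%:E * P [set t | (rho / m%:R < X (bleg i (q 0 i + r)) t)%R] +
   (2 ^+ m.+1)%:E * P [set t | (kap1 - l / 2 * (2 * eps * m%:R * r) < X (- brem btop) t)%R] <= p%:E)%E ->
  exists2 s : seq 'rV[R]_m.+1, (forall x, x \in s -> bbox x) &
  ((colC (bmu btop) u w * expR (- (2 * kp)) * (1 - kp) *
     (expR (- (l * kap1)) * (\prod_(i < m) ((J i)%:R * kp * expR (- (2 * kp)) * (1 - kp)) -
        (\prod_(i < m) expR ((J i)%:R * kp)) * p)))%:E <=
   P [set t | has (fun x => u < X (dl x) t - F x * (X one t - w))%R s])%E.
Proof.
move=> /andP[kp0 kp1] /andP[kap0 kaprho] lE l0 Hrho an_gt t01' L0 S0 D00 D10 [tS0 [tS1 Hbr]] HD0 HD1 HJ Hp.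
set v := bmu btop in Hrho Hbr tS0 tS1.
have v01 : 0 < v < 1 := bmu_top.
have th0 : 0 < 1 - v by rewrite subr_gt0; case/andP: v01.
have m0R : 0 < m%:R :> R by rewrite ltr0n.
have t0b : t0 <= t0 <= t1 by rewrite lexx ltW.
have t1b : t0 <= t1 <= t1 by rewrite lexx ltW.
have bth0 t : t0 <= t <= t1 -> 0 <= bth t by move=> /ext_cube /(cdf01 HF)/andP[].
have thl := bth_lt.
have bthm (x y : R) : t0 <= x -> x <= y -> y <= t1 -> 0 <= bth y - bth x <= (a ord_max + eps) * (y - x).
  move=> h1 h2 h3; have /andP[h4 ->] := th_bounds h1 h2 h3; rewrite andbT; apply: le_trans h4.
  by rewrite mulr_ge0 // subr_ge0 // ltW.
have bt01 : bth t0 < bth t1.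
  rewrite -subr_gt0; have /andP[h _] := th_bounds (lexx t0) (ltW t01') (lexx t1).
  by apply: lt_le_trans h; rewrite mulr_gt0 ?subr_gt0.
(* The first entry keeps the drift of each step below kp / 2, the second keeps the total probability
   of a large step below kp / 3. *)
pose h := Num.min (kp / L ^+ 2) (kp ^+ 5 / (3 * 128 * L ^+ 4 * S)).
have h0 : 0 < h by rewrite lt_min !divr_gt0 ?mulr_gt0 ?exprn_gt0.
have hL : L ^+ 2 * h <= kp by rewrite mulrC -ler_pdivlMr ?exprn_gt0 // ge_min lexx.
have hS : 128 * L ^+ 4 * h * S / kp ^+ 4 <= kp / 3.
  have : h <= kp ^+ 5 / (3 * 128 * L ^+ 4 * S) by rewrite ge_min lexx orbT.
  have c0 : 0 <= 128 * L ^+ 4 * S / kp ^+ 4 by rewrite divr_ge0 ?mulr_ge0 ?exprn_ge0 // ltW.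
  move/(ler_wpM2l c0); rewrite (_ : _ * (kp ^+ 5 / _) = kp / 3); last by field; rewrite !gt_eqF.
  by rewrite (_ : _ * h = 128 * L ^+ 4 * h * S / kp ^+ 4) //; ring.
pose tau (x : R) := x / ((1 - v) * (1 - v - x)).
have tauE (x y : R) : x < 1 - v -> y < 1 - v -> tau y - tau x = (y - x) / ((1 - v - x) * (1 - v - y)).
  by move=> hx hy; exact: bridge_time_diff.
pose D := 1 - v - bth t1.
have D_0 : 0 < D by rewrite subr_gt0; exact: thl.
(* K equal increments of [bth]. D bounds 1 - v - bth from below on the line, so dividing by D^2
   bounds the increments of the clock of the bridge. *)
have [K K0 HK] : exists2 K : nat, (0 < K)%N & (bth t1 - bth t0) / K%:R / D ^+ 2 <= h.
  pose K := (Num.bound ((bth t1 - bth t0) / D ^+ 2 / h)).+1; exists K => //.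
  have z0 : 0 <= (bth t1 - bth t0) / D ^+ 2 / h by rewrite !divr_ge0 ?sqr_ge0 ?subr_ge0 // ltW.
  have K0 : 0 < K%:R :> R by rewrite ltr0n.
  rewrite mulrAC ler_pdivrMr // -ler_pdivrMl // mulrC.
  by apply: (le_trans (ltW (archi_boundP z0))); rewrite ler_nat.
have [tg [tg0 tgb tgm tgE tgK]] := mono_grid (ltW t01') bt01 K0 bthm.
have tgKE : bth (tg K) = bth t1.
  by rewrite tgE // mulrCA divff ?pnatr_eq0 -?lt0n // mulr1 addrC subrK.
have Dle k : D <= 1 - v - bth (tg k).
  rewrite /D lerD2l lerN2; have [h1 h2] := andP (tgb k).
  by have /andP[] := bthm _ _ h1 h2 (lexx _); rewrite subr_ge0.
have dtau k : (k < K)%N -> 0 < tau (bth (tg k.+1)) - tau (bth (tg k)) <= h.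
  move=> kK; rewrite tauE; [|exact: thl|exact: thl].
  have -> : bth (tg k.+1) - bth (tg k) = (bth t1 - bth t0) / K%:R.
    by rewrite !tgE ?(ltnW kK) // -[k.+1]addn1 natrD; ring.
  have d0 : 0 < (bth t1 - bth t0) / K%:R by rewrite divr_gt0 ?ltr0n // subr_gt0.
  have Dk := lt_le_trans D_0 (Dle k); have Dk1 := lt_le_trans D_0 (Dle k.+1).
  have DD := mulr_gt0 Dk Dk1.
  apply/andP; split; first exact: (divr_gt0 d0 DD).
  apply: le_trans HK; apply: ler_wpM2l; first exact: ltW.
  rewrite lef_pV2 ?posrE ?exprn_gt0 // expr2.
  by apply: ler_pM; [exact: ltW|exact: ltW|exact: Dle|exact: Dle].
pose Vi i := blegV i (q 0 i + r).
have qb i : q 0 i <= q 0 i <= q 0 i + r by rewrite lexx lerDl ltW.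
have qrb i : q 0 i <= q 0 i + r <= q 0 i + r by rewrite lexx andbT lerDl ltW.
have legm i (x y : R) : q 0 i <= x -> x <= y -> y <= q 0 i + r -> 0 <= blegV i y - blegV i x <= (al i + eps) * (y - x).
  move=> h1 h2 h3.
  have bx : bbox (setc (lift ord_max i) x bcor) by apply: bleg_box; rewrite h1 (le_trans h2 h3).
  have by_ : bbox (setc (lift ord_max i) y bcor) by apply: bleg_box; rewrite h3 (le_trans h1 h2).
  have := lin_mono by_ bx.
  have hz j : j != lift ord_max i -> setc (lift ord_max i) y bcor 0 j - setc (lift ord_max i) x bcor 0 j = 0.
    by move=> ji; rewrite !mxE (negbTE ji) subrr.
  rewrite !(sum_one _ hz) !mxE eqxx /blegV.
  rewrite (_ : F (setc (lift ord_max i) y bcor) - F bcor - (F (setc (lift ord_max i) x bcor) - F bcor) = F (setc (lift ord_max i) y bcor) - F (setc (lift ord_max i) x bcor)); last by ring.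
  move=> /(_ _)/andP[j|h4 ->]; first by rewrite !mxE; case: eqP.
  rewrite andbT; apply: le_trans h4; rewrite mulr_ge0 ?subr_ge0 //; exact/ltW/al_gt.
have Vi0 i : 0 < Vi i.
  have /andP[h1 _] := legV_bounds (qrb i); apply: lt_le_trans h1.
  by rewrite addrAC subrr add0r mulr_gt0 // subr_gt0.
pose hl i := Num.min (kp / l ^+ 2) (kp ^+ 5 / (3 * 128 * l ^+ 4 * Vi i)).
have hl0 i : 0 < hl i by rewrite lt_min !divr_gt0 ?mulr_gt0 ?exprn_gt0.
have hlL i : l ^+ 2 * hl i <= kp by rewrite mulrC -ler_pdivlMr ?exprn_gt0 // ge_min lexx.
have hlS i : 128 * l ^+ 4 * hl i * Vi i / kp ^+ 4 <= kp / 3.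
  have : hl i <= kp ^+ 5 / (3 * 128 * l ^+ 4 * Vi i) by rewrite ge_min lexx orbT.
  have c0 : 0 <= 128 * l ^+ 4 * Vi i / kp ^+ 4 by rewrite divr_ge0 ?mulr_ge0 ?exprn_ge0 // ltW.
  move/(ler_wpM2l c0); rewrite (_ : _ * (kp ^+ 5 / _) = kp / 3); last by field; rewrite !gt_eqF.
  by rewrite (_ : _ * hl i = 128 * l ^+ 4 * hl i * Vi i / kp ^+ 4) //; ring.
have [N N0 HN] : exists2 N : nat, (0 < N)%N & forall i, Vi i / N%:R <= hl i.
  pose N := (\sum_i Num.bound (Vi i / hl i)).+1; exists N => // i.
  have N0 : 0 < N%:R :> R by rewrite ltr0n.
  have z0 : 0 <= Vi i / hl i by rewrite divr_ge0 // ltW.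
  rewrite ler_pdivrMr // -ler_pdivrMl // mulrC.
  apply: (le_trans (ltW (archi_boundP z0))); rewrite ler_nat /N (bigD1 i) //=.
  by rewrite -addSn addnC; apply: leq_trans (leq_addl _ _); rewrite leqnSn.
have ex_sg i : exists s : nat -> R, [/\ s 0%N = q 0 i, forall k, q 0 i <= s k <= q 0 i + r, forall j k, (j <= k)%N -> s j <= s k,
    forall k, (k <= N)%N -> blegV i (s k) = blegV i (q 0 i) + k%:R * ((blegV i (q 0 i + r) - blegV i (q 0 i)) / N%:R)
    & forall k, (N <= k)%N -> s k = s N].
  apply: (@mono_grid _ (blegV i) (q 0 i) (q 0 i + r) (al i + eps)) => //; last exact: legm.
  - by rewrite lerDl ltW.
  - by rewrite blegV0; exact: Vi0.
pose sg i := projT1 (cid (ex_sg i)).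
have sg0 i : sg i 0%N = q 0 i by case: (projT2 (cid (ex_sg i))).
have sgb i k : q 0 i <= sg i k <= q 0 i + r by have [_ hb _ _ _] := projT2 (cid (ex_sg i)); exact: hb.
have sgm i j k : (j <= k)%N -> sg i j <= sg i k by have [_ _ hm _ _] := projT2 (cid (ex_sg i)); exact: hm.
have sgE i k : (k <= N)%N -> blegV i (sg i k) = k%:R * (Vi i / N%:R).
  by have [_ _ _ hE _] := projT2 (cid (ex_sg i)); move=> /hE E; apply: (etrans E); rewrite blegV0 subr0 add0r.
pose I : finType := ({ffun 'I_m -> 'I_N.+1} * 'I_K.+1)%type.
pose i0 : I := ([ffun=> ord0], ord0).
pose en := enum I.
pose xp (p : I) : 'rV[R]_m.+1 := ext (\row_i sg i (p.1 i)) (tg p.2).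
pose pt j := xp (nth i0 en j).
pose idx (p : I) := index p en.
have idxE p' : nth i0 en (idx p') = p' by rewrite nth_index // mem_enum.
have idxlt p' : (idx p' < size en)%N by rewrite index_mem mem_enum.
have xpb p' : bbox (xp p') by apply: bbox_point => // i; exact: sgb.
have ptb j : bbox (pt j) by exact: xpb.
have ptidx p' : pt (idx p') = xp p' by rewrite /pt idxE.
pose kap j : nat := (nth i0 en j).2.
(* The a-th grid point of leg i: all other coordinates, and the time, are at their lowest. *)
pose lp i (a : nat) : I := ([ffun j => if j == i then inord a else ord0], ord0).
have xplp i b : (b <= N)%N -> xp (lp i b) = setc (lift ord_max i) (sg i b) bcor.
  move=> bN; apply: row_lift_eq => [j|]; last by rewrite ext_max mxE (negbTE (neq_lift _ _)) ext_max /= tg0.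
  rewrite ext_lift !mxE (inj_eq lift_inj) liftK ffunE; case: eqP => [->|_]; last exact: sg0.
  by rewrite inordK.
have bofflp i b : (b <= N)%N -> boff (xp (lp i b)) = bleg i (sg i b).
  by move=> bN; rewrite /boff xplp // mxE (negbTE (neq_lift _ _)) ext_max.
have bmulp i b : (b <= N)%N -> bmu (xp (lp i b)) = blegV i (sg i b).
  by move=> bN; rewrite /bmu xplp // mxE (negbTE (neq_lift _ _)) ext_max.
pose c := colc v u w.
have lc : l = 2 * c by [].
have c0 : 0 < c by move: l0; rewrite lc pmulr_rgt0.
have ipl j k : (j <= k)%N -> ip (bline (tg j)) (bline (tg k)) = bth (tg j).
  by move=> jk; apply: bline_ip; [case/andP: (tgb j)|exact: tgm|case/andP: (tgb k)].
pose lm (y : @path R (option nat)) i := rmax N.+1 (fun b => y (Some (idx (lp i b)))).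
(* The sum of the leg maxima, less an allowance kap1 for the remainder. The failures are: [b1], X o
   is large; [b2], a leg is large; [b3], a leg starts below 0, which the field never does; [b4], the
   remainder with its drift falls below - kap1. *)
pose M (y : @path R (option nat)) : R := \sum_(i < m) lm y i - kap1.
pose b1 (y : @path R (option nat)) := rho < `|y None|.
pose b2 (y : @path R (option nat)) := has (fun i => rho / m%:R < lm y i) (enum 'I_m).
pose b3 (y : @path R (option nat)) := has (fun i => y (Some (idx (lp i 0%N))) < 0) (enum 'I_m).
pose b4 (y : @path R (option nat)) := has (fun p : I => kap1 < \sum_(i < m) y (Some (idx (lp i (p.1 i)))) - y (Some (idx p))) en.
pose bad (y : @path R (option nat)) := [|| b1 y, b2 y, b3 y | b4 y].
have mco (j : option nat) : measurable_fun setT (fun y : @path R (option nat) => y j) by exact: measurable_coord.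
have mlm i : measurable_fun setT (lm^~ i).
  by apply: (measurable_rmax N.+1 (fun b (y : @path R (option nat)) => y (Some (idx (lp i b))))) => b; exact: mco.
have mM : measurable_fun setT M.
  by apply: measurable_funB; [apply: measurable_sum => i; exact: mlm|exact: measurable_cst].
have mb1 : measurable_fun setT b1.
  apply: measurable_fun_ltr; first exact: measurable_cst.
  by apply: measurableT_comp => //; exact: mco.
have mb2 : measurable_fun setT b2.
  by rewrite /b2; apply: measurable_hasb => i; apply: measurable_fun_ltr; [exact: measurable_cst|exact: mlm].
have mb3 : measurable_fun setT b3.
  rewrite /b3; apply: measurable_hasb => i; apply: measurable_fun_ltr; [exact: mco|exact: measurable_cst].
have mb4 : measurable_fun setT b4.
  rewrite /b4; apply: measurable_hasb => p'.
  apply: measurable_fun_ltr; first exact: measurable_cst.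
  by apply: measurable_funB; [apply: measurable_sum => i; exact: mco|exact: mco].
have mbad : measurable_fun setT bad by do 3 (apply: measurable_or => //).
have mG : measurable_fun setT (fun y : @path R (option nat) => ~~ bad y) by apply: measurable_neg.
have HG (y : path (option nat)) : ~~ bad y -> `|M y| <= rho /\ `|y None| <= rho.
  rewrite /bad !negb_or => /and4P[h1 h2 _ _]; split; last by rewrite leNgt.
  have lmle i : lm y i <= rho / m%:R.
    by rewrite leNgt; apply: contra h2 => h2; apply/hasP; exists i; rewrite ?mem_enum.
  have S0' : 0 <= \sum_(i < m) lm y i by apply: sumr_ge0 => i _; exact: rmax_ge0.
  have S1' : \sum_(i < m) lm y i <= rho.
    apply: (le_trans (ler_sum _ (fun i _ => lmle i))).
    by rewrite sumr_const card_ord -[leLHS]mulr_natr divfK // gt_eqF.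
  by rewrite ler_norml /M; exact: sub_between.
have Hd (y : path (option nat)) (z : nat -> R) : ~~ bad y -> hits K.+1 (u - M y) z -> hits (size en) u (fun j => z (kap j) + y (Some j)).
  rewrite /bad !negb_or => /and4P[_ _ h3 h4] /hitsP[k kK uz].
  (* The grid is a product, so one grid point realizes the maxima of all legs at once. *)
  have ex i : exists b : 'I_N.+1, lm y i <= y (Some (idx (lp i b))).
    have [|b bN hb] := @rmax_attained _ N (fun b => y (Some (idx (lp i b)))).
      by rewrite leNgt; apply: contra h3 => h3; apply/hasP; exists i; rewrite ?mem_enum.
    by exists (Ordinal (bN : (b < N.+1)%N)).
  pose f := [ffun i => projT1 (cid (ex i))] : {ffun 'I_m -> 'I_N.+1}.
  pose p' : I := (f, Ordinal kK).
  apply/hitsP; exists (idx p') => //.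
  rewrite /kap idxE /=.
  have h5 : \sum_(i < m) lm y i <= \sum_(i < m) y (Some (idx (lp i (f i)))).
    by apply: ler_sum => i _; rewrite ffunE; exact: (projT2 (cid (ex i))).
  have h6 : \sum_(i < m) y (Some (idx (lp i (f i)))) - y (Some (idx p')) <= kap1.
    by rewrite leNgt; apply: contra h4 => h4; apply/hasP; exists p'; rewrite ?mem_enum.
  exact: lt_through uz h5 h6.
have kp01 : 0 <= kp <= 1 by rewrite (ltW kp0) kp1.
have Hb (M' x' : R) : `|M'| <= rho -> `|x'| <= rho ->
    ((expR (- (2 * (u - M') * (u - M' - (w - x')) / (1 - v)) - kp) * (1 - kp))%:E <=
     P [set t | hits K.+1 (u - M') (fun k => X (colg one (boff btop) v (fun k => bline (tg k)) (fun k => bth (tg k)) k) t + bth (tg k) / (1 - v) * (w - x'))%R])%E.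
  move=> hM hx; have [yb yL HD0' HD1'] := Hbr M' x' hM hx.
  have iplt := @col_iplt R V d T P X one (boff btop) (fun k => bline (tg k)) (fun k => bth (tg k)) (fun k => bline_ip1 (tgb k)) (fun k => bline_off (tgb k) btop_box).
  have iptt := @col_iptt R V d T P X one (boff btop) v ip_one1 boff_o1 boff_oo.
  have B := @bridge_ge R V d T P X (fun k => bline (tg k)) (one - boff btop) (fun k => bth (tg k)) (1 - v) th0 ipl iplt iptt (fun k => thl _ (tgb k))
    (u - M') (w - x') L kp h D0 D1 S K yb yL kp0 (ltW h0) hL S0 D00.
  rewrite /taubr tg0 tgKE in B.
  apply: le_trans (B HD0' D10 HD1' tS0 tS1 dtau).
  rewrite lee_fin ler_wpM2l ?expR_ge0 //; rewrite lerD2l lerN2.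
  exact: three_thirds HD0 hS HD1.
have U := @column_lower R V d T P X one (boff btop) v v01 ip_one1 boff_o1 boff_oo
  (fun k => bline (tg k)) (fun k => bth (tg k)) (fun k => bline_ip1 (tgb k)) (fun k => bline_off (tgb k) btop_box)
  kap (fun j => boff (pt j)) (fun j => bmu (pt j))
  (fun j => boff_ip1 (ptb j)) (fun j => boff_le (ptb j) btop_box (box_le_top (ptb j))) (fun j k => bline_off (tgb j) (ptb k))
  u w kp rho (size en) K.+1 (fun y : @path R (option nat) => ~~ bad y) M kp01 Hrho mG mM Hb HG Hd.
exists (map xp en); first by move=> x /mapP[p' _ ->].
have -> : [set t | has (fun x => u < X (dl x) t - F x * (X one t - w)) (map xp en)] =
  [set t | hits (size en) u (fun j => X (bline (tg (kap j)) + boff (pt j)) t - (bth (tg (kap j)) + bmu (pt j)) * (X one t - w))].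
  apply/funext => t; rewrite /mkset has_map -(hits_has i0 en (fun p => X (dl (xp p)) t - F (xp p) * (X one t - w))).
  congr is_true; apply: hits_ext => j js; rewrite -/(pt j).
  have tE : tg (kap j) = pt j 0 ord_max by rewrite ext_max.
  rewrite tE (_ : bline _ + _ = dl (pt j)); last by rewrite /boff addrC subrK.
  by congr (_ - _ * _); rewrite /bmu addrC subrK.
apply: le_trans U; rewrite EFinM; apply: lee_wpmul2l.
  by rewrite lee_fin !mulr_ge0 ?colC_ge0 ?expR_ge0 // subr_ge0.
pose z t (i : option nat) : R := if i is Some j then X (boff (pt j)) t - c * bmu (pt j) else X (boff btop) t - c * v.
have mz : measurable_fun setT (fun t => z t : @path R (option nat)).
  by apply: (measurable_to_path (Y := fun i t => z t i)); case=> [j|]; rewrite /z; mreal.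
have zlp t i b : (b <= N)%N -> z t (Some (idx (lp i b))) = X (bleg i (sg i b)) t - c * blegV i (sg i b).
  by move=> bN; rewrite /z ptidx bofflp // bmulp.
pose B i := (J i)%:R * kp * expR (- (2 * kp)) * (1 - kp).
have B0 i : 0 <= B i by rewrite !mulr_ge0 ?expR_ge0 ?subr_ge0 // ltW.
pose C := \prod_(i < m) expR ((J i)%:R * kp).
have C0 : 0 <= C by apply: prodr_ge0 => i _; exact: expR_ge0.
pose Z i t (b : nat) := l * X (bleg i (sg i b)) t - l ^+ 2 * blegV i (sg i b) / 2.
pose Q t := \prod_(i < m) expR (Num.min (rmax N.+1 (Z i t)) ((J i)%:R * kp)).
have QC t : Q t <= C.
  apply: ler_prod => i _; rewrite expR_ge0 /= ler_expR; by rewrite ge_min lexx orbT.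
have mZ i b : measurable_fun setT (fun t => Z i t b) by rewrite /Z; mreal.
have mQ : measurable_fun setT Q.
  apply: measurable_prod => i _; apply: measurable_expRf.
  apply: measurable_minr; last exact: measurable_cst.
  exact: (measurable_rmax N.+1 (fun b t => Z i t b)).
have Q0 t : 0 <= Q t by apply: prodr_ge0 => i _; exact: expR_ge0.
have QM t : expR (- (l * kap1)) * Q t <= expR (2 * c * M (z t)).
  rewrite /Q -expR_sum -expRD ler_expR /M mulrBr -lc addrC lerD2r mulr_sumr.
  apply: ler_sum => i _; apply: (@le_trans _ _ (rmax N.+1 (Z i t))); first by rewrite ge_min lexx.
  rewrite /lm -rmax_scale ?(ltW l0) // (rmax_ext (y' := Z i t)) // => b bN.
  by rewrite zlp // /Z expr2 {3}lc; field.
have EQ : ((\prod_(i < m) B i)%:E <= \int[P]_t (Q t)%:E)%E.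
  pose phi (i b : nat) : V := if insub i is Some i' then bleg (i' : 'I_m) (sg i' b) else 0.
  pose f (i : nat) (y : @path R nat) : R := if insub i is Some i' then
    expR (Num.min (rmax N.+1 (fun b => l * y b - l ^+ 2 * blegV (i' : 'I_m) (sg i' b) / 2)) ((J i')%:R * kp)) else 1.
  pose bb (i : nat) : R := if insub i is Some i' then B (i' : 'I_m) else 1.
  have orth i i' b b' : i != i' -> ip (phi i b) (phi i' b') = 0.
    rewrite /phi; case: insubP => [j _ <-|_]; last by rewrite gip0l.
    case: insubP => [j' _ <-|_] ii'; last by rewrite gip0r.
    rewrite leg_leg; [|exact: sgb|exact: sgb].
    by case: eqP => // E; rewrite E eqxx in ii'.
  have mf i : measurable_fun setT (f i).
    rewrite /f; case: insubP => [j _ _|_]; last exact: measurable_cst.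
    apply: measurable_expRf.
    apply: measurable_minr; last exact: measurable_cst.
    by apply: (measurable_rmax N.+1 (fun b (y : @path R nat) => l * y b - l ^+ 2 * blegV j (sg j b) / 2)) => b; mreal.
  have f0 i (y : path nat) : 0 <= f i y by rewrite /f; case: insub => [j|] //; exact: expR_ge0.
  have bb0 i : 0 <= bb i by rewrite /bb; case: insub.
  have := @gX_indep_prod_ge R V d T P X nat m phi f bb orth mf f0 bb0.
  have -> : \prod_(i < m) bb i = \prod_(i < m) B i by apply: eq_bigr => i _; rewrite /bb valK.
  have -> : (\int[P]_t (\prod_(i < m) f i (fun j => X (phi i j) t))%:E = \int[P]_t (Q t)%:E)%E.
    apply: eq_integral => t _; congr EFin; apply: eq_bigr => i _; rewrite /f /phi valK //.
  apply => i im; have [i' ->] : exists i' : 'I_m, i = i' :> nat by exists (Ordinal im).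
  rewrite /bb /f /phi valK.
  have ipu j k : (j <= k)%N -> ip (bleg i' (sg i' j)) (bleg i' (sg i' k)) = blegV i' (sg i' j).
    move=> jk; rewrite leg_leg; [|exact: sgb|exact: sgb].
    by rewrite eqxx (min_idPl (sgm i' _ _ jk)).
  have [E1 E10 [E1l E1e]] := HJ i'.
  have VN : blegV i' (sg i' N) = Vi i' by rewrite sgE // mulrCA divff ?mulr1 // pnatr_eq0 -lt0n.
  (* Chosen so that kp^2 / (2 l^2 s0) is 3 / kp, and exp (- 3 / kp) is at most kp / 3. The leg
     starts with variance 0. *)
  pose s0 := kp ^+ 3 / (6 * l ^+ 2).
  have s00 : 0 < s0 by rewrite divr_gt0 ?mulr_gt0 ?exprn_gt0.
  apply: (@walk_exp_ge R V d T P X (fun b => bleg i' (sg i' b)) (fun b => blegV i' (sg i' b)) ipu l l kp (hl i') s0 E1 (Vi i') N (J i')) => //.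
  - exact: ltW.
  - by rewrite sg0 blegV0.
  - by rewrite VN.
  - by rewrite VN.
  - move=> k kN; rewrite !sgE ?(ltnW kN) // -mulrBl -natrB ?leqnSn // subSn // subnn mul1r HN andbT.
    by rewrite divr_gt0 ?ltr0n.
  have e1 : expR (- kp ^+ 2 / (2 * (l ^+ 2 * s0))) <= kp / 3.
    have -> : - kp ^+ 2 / (2 * (l ^+ 2 * s0)) = - (3 / kp) by rewrite /s0; field; rewrite !gt_eqF.
    rewrite expRN -[leRHS]invrK lef_pV2 ?posrE ?invr_gt0 ?divr_gt0 ?expR_gt0 // invf_div.
    by apply: le_trans (expR_ge1Dx _); rewrite lerDr.
  exact: three_thirds e1 (hlS i') E1e.
have mbz : measurable_fun setT (fun t => bad (z t)) by exact: (measurableT_comp mbad mz).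
have Pbad : (P [set t | bad (z t)] <= p%:E)%E.
  have mz1 : measurable_fun setT (fun t => b1 (z t)) by exact: (measurableT_comp mb1 mz).
  have mz2 : measurable_fun setT (fun t => b2 (z t)) by exact: (measurableT_comp mb2 mz).
  have mz4 : measurable_fun setT (fun t => b4 (z t)) by exact: (measurableT_comp mb4 mz).
  have nb3 t : b3 (z t) = false.
    apply/hasP => -[i _]; rewrite zlp // sg0 blegV0 mulr0 subr0 /bleg setc_cor subrr gX0 ltxx //.
  apply: le_trans Hp; have lc2 : l / 2 = c by rewrite lc; field.
  have -> : [set t | bad (z t)] = [set t | b1 (z t) || (b2 (z t) || b4 (z t))].
    by apply/funext => t; rewrite /mkset /bad nb3.
  apply: (le_trans (P_or P mz1 (measurable_or mz2 mz4))); rewrite -addeA; apply: leeD.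
    by rewrite lc2; exact: lexx.
  apply: (le_trans (P_or P mz2 mz4)); apply: leeD.
    have mz2i i : measurable_fun setT (fun t => rho / m%:R < lm (z t) i).
      by apply: measurable_fun_ltr; [exact: measurable_cst|exact: (measurableT_comp (mlm i) mz)].
    apply: (le_trans (@P_has R d T P _ (enum 'I_m) (fun i t => rho / m%:R < lm (z t) i) mz2i)).
    rewrite big_enum /=; apply: lee_sum => i _.
    have rm0 : 0 <= rho / m%:R by rewrite divr_ge0 ?(le_trans kap0 kaprho) // ltW.
    have mh : measurable_fun setT (fun t => hits N.+1 (rho / m%:R) (fun b => X (bleg i (sg i b)) t)).
      by apply: (measurable_hits N.+1 (rho / m%:R) (fun b t => X (bleg i (sg i b)) t)) => b; exact: gX_meas.
    have mh2 : measurable_fun setT (fun t => hits N.+1 (rho / m%:R) (fun b => X (bleg i (q 0 i + r)) t)).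
      by apply: (measurable_hits N.+1 (rho / m%:R) (fun b t => X (bleg i (q 0 i + r)) t)) => b; exact: gX_meas.
    apply: (@le_trans _ _ (P [set t | hits N.+1 (rho / m%:R) (fun b => X (bleg i (sg i b)) t)])).
      apply: (P_le P (mz2i i) mh) => t; rewrite /lm rmax_hits // => /hitsP[b bN hb].
      apply/hitsP; exists b => //; apply: lt_le_trans hb _; rewrite zlp // lerBlDr lerDl.
      rewrite mulr_ge0 ?(ltW c0) //; have [g1 g2] := andP (sgb i b).
      by have /andP[] := legm i _ _ (lexx (q 0 i)) g1 g2; rewrite blegV0 subr0.
    apply: (le_trans (@levy _ _ _ _ _ X (fun b => bleg i (sg i b)) (fun=> bleg i (q 0 i + r)) N.+1 (rho / m%:R) _)).
      move=> j k /andP[jk kN]; rewrite gipBl !leg_leg ?eqxx; [|exact: sgb|exact: sgb|exact: qrb|exact: sgb].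
      rewrite (min_idPr _); last by case/andP: (sgb i j).
      by rewrite (min_idPr _) ?subrr //; exact: sgm.
    apply: lee_wpmul2l; first by rewrite lee_fin.
    apply: (P_le P mh2); last by move=> t /hitsP[b _ hb].
    by apply: measurable_fun_ltr; [exact: measurable_cst|exact: gX_meas].
  have remv j x y : bbox x -> bbox y -> y 0 j <= x 0 j -> ip ((- brem (upd btop j x)) - (- brem x)) (- brem y) = 0.
    by move=> bx by_ yx; rewrite opprK addrC -opprB gipNl gipNr opprK rem_upd.
  have updb j x : bbox x -> bbox (upd btop j x).
    move=> bx; rewrite (_ : upd btop j x = setc j (btop 0 j) x); last by apply/rowP => j'; rewrite !mxE; case: eqP => [->|].
    apply: setc_box => //; have [h1 h2] := btop_box.
    by case: (unliftP ord_max j) => [i'|] ->; [exact: h1|exact: h2].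
  have sb x : x \in map xp en -> bbox x by move=> /mapP[p' _ ->].
  (* The remainder is controlled at the top of the block only; the drift that it carries has been
     taken off kap1 beforehand. *)
  apply: le_trans (@levy_box R V d T P X m.+1 (fun x => - brem x) btop bbox updb remv (map xp en) (kap1 - l / 2 * (2 * eps * m%:R * r)) sb).
  apply: (P_le P mz4).
    by apply: (measurable_has _ _ (f := fun x t => X (- brem x) t)) => x; exact: gX_meas.
  move=> t /hasP[p' p'en hp]; apply/hasP; exists (xp p'); first exact: map_f.
  move: hp; rewrite /z ptidx; under eq_bigr => i _.
    have fN : (p'.1 i <= N)%N by rewrite -ltnS ltn_ord.
    rewrite ptidx (bofflp i _ fN) (bmulp i _ fN); over.
  have xE i : xp p' 0 (lift ord_max i) = sg i (p'.1 i) by rewrite ext_lift mxE.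
  have h1 := rem_bound (xpb p'); have h2 := rem_ip (xpb p').
  have h3 : X (boff (xp p')) t = \sum_(i < m) X (bleg i (sg i (p'.1 i))) t + X (brem (xp p')) t.
    rewrite -gXsum -gXD /brem; under [in RHS]eq_bigr do rewrite -xE.
    by rewrite addrC subrK.
  rewrite gXN h3 sumrB -mulr_sumr lc2.
  move: h2; under eq_bigr do rewrite xE.
  move=> h2; have : c * (bmu (xp p') - \sum_(i < m) blegV i (sg i (p'.1 i))) <= c * (2 * eps * m%:R * r).
    by rewrite -h2 ler_wpM2l ?(ltW c0).
  move=> h4 h5; exact: lt_rem h5 h4.
rewrite -[leRHS]/(\int[P]_t ((~~ bad (z t))%:R * expR (2 * c * M (z t)))%:E)%E.
have e0 : 0 <= expR (- (l * kap1)) by exact: expR_ge0.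
have mE : measurable_fun setT (fun t => ((~~ bad (z t))%:R * expR (2 * c * M (z t)))%:E).
  apply/measurable_EFinP; apply: measurable_funM.
    by apply/measurable_EFinP; apply: measurable_nat_bool; exact: measurable_neg.
  apply: measurable_expRf.
  by apply: measurable_funM; [exact: measurable_cst|exact: (measurableT_comp mM mz)].
have mQE : measurable_fun setT (fun t => (Q t)%:E) by exact/measurable_EFinP.
have mbE : measurable_fun setT (fun t => (bad (z t))%:R%:E : \bar R) by exact: measurable_nat_bool.
have Ce0 : 0 <= expR (- (l * kap1)) * C by exact: mulr_ge0.
(* The lower bound on the expectation of Q ignores the bad event. There Q is at most C, so C times
   its probability is what has to be subtracted. *)
have main : ((expR (- (l * kap1)))%:E * \int[P]_t (Q t)%:E <=
   \int[P]_t ((~~ bad (z t))%:R * expR (2 * c * M (z t)))%:E + (expR (- (l * kap1)) * C)%:E * P [set t | bad (z t)])%E.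
  rewrite -(integral_bool P mbz) -(int_Zl P e0 mQE); last by move=> t; rewrite lee_fin.
  rewrite -(int_Zl P Ce0 mbE); last by move=> t; rewrite lee_fin.
  rewrite -int_D; last 4 first.
  - exact: mE.
  - exact: measurable_funeM.
  - by move=> t; rewrite lee_fin mulr_ge0 ?expR_ge0.
  - by move=> t; rewrite mule_ge0 // lee_fin.
  apply: int_le.
  - exact: measurable_funeM.
  - by apply: emeasurable_funD => //; exact: measurable_funeM.
  - by move=> t; rewrite mule_ge0 // lee_fin.
  move=> t; rewrite -!EFinM -EFinD lee_fin; case: (bad (z t)) => /=.
    by rewrite mul0r add0r mulr1 ler_wpM2l.
  by rewrite mul1r mulr0 addr0; exact: QM.
rewrite mulrBr EFinB leeBlDr //.
apply: (@le_trans _ _ ((expR (- (l * kap1)))%:E * \int[P]_t (Q t)%:E)%E).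
  by rewrite EFinM; apply: lee_wpmul2l.
apply: (le_trans main); apply: leeD => //.
rewrite mulrA -/C [leRHS]EFinM; exact: lee_wpmul2l.
Qed.

(** * Block estimates with constants in terms of u^2 r *)

Section block_simple.
Variables (amax Tt u kp : R).
Hypothesis al_max : forall i, al i + eps <= amax.
Hypothesis u1 : 1 <= u.
Hypothesis rT : u ^+ 2 * r <= 2 * Tt.
Hypothesis kp01 : 0 < kp <= 1.
Let Cv := m%:R * amax * (2 * Tt).
Hypothesis HCv1 : Cv / u ^+ 2 <= 2^-1.

Let u0 : 0 < u. Proof. exact: lt_le_trans u1. Qed.
Let kp0 : 0 < kp. Proof. by case/andP: kp01. Qed.
Let al0 i : 0 < al i + eps. Proof. by have := al_gt i; have := eps0; lra. Qed.

Lemma bmu_le : bmu btop <= Cv / u ^+ 2.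
Proof.
rewrite ler_pdivlMr ?exprn_gt0 //; have /andP[_ h] := mu_bounds btop_box.
apply: (@le_trans _ _ (m%:R * amax * r * u ^+ 2)).
  apply: ler_wpM2r; first exact: sqr_ge0.
  apply: (le_trans h); rewrite -mulrA mulr_natl -[X in _ *+ X](card_ord m) -sumr_const.
  apply: ler_sum => i _; rewrite ext_lift !mxE addrAC subrr add0r.
  by rewrite ler_wpM2r // ltW.
rewrite -mulrA (mulrC r) /Cv ler_wpM2l // mulr_ge0 //.
exact: le_trans (ltW (al0 (Ordinal m0))) (al_max _).
Qed.

(** Constants: l is at most 12 u; c^2 v^2 / 2 = l^2 v^2 / 8 is at most 18 Cv^2 / u^2; the exponent
    of the remainder is at most 2 (12 u)^2 (2 eps m r), hence 1152 eps m T. The remainder is run at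
    precision kp / 2^(m+1) to offset the factor 2^(m+1) of [exp_smax_le]. The level u' and the value
    w' are kept free of u and w because tilted pairs occur later. *)
Lemma block_upper_simple (u' w' lam : R) (s : seq 'rV[R]_m.+1) : (forall x, x \in s -> bbox x) ->
  0 < 2 * u' - w' -> 2 * colc (bmu btop) u' w' <= lam * u -> lam <= 12 ->
  (1 - Cv / u ^+ 2)^-1 <= 1 + kp -> expR (18 * Cv ^+ 2 / u ^+ 2) <= 1 + kp ->
  expR (1152 * eps * m%:R * Tt) - 1 <= (kp / 2 ^+ m.+1) ^+ 2 ->
  (P [set t | has (fun x => u' < X (dl x) t - F x * (X one t - w'))%R s] <=
   ((1 + kp) ^+ 3 * expR (- 2 * u' ^+ 2 + 2 * u' * w') *
     \prod_(i < m) ((1 + kp) * (lam ^+ 2 * (al i + eps) * (u ^+ 2 * r)) / 2 + 1 + 2 / kp))%:E)%E.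
Proof.
move=> sb uw llam lam12 Hth Hexp Heps.
have v01 := bmu_top; have vC := bmu_le; set v := bmu btop in llam v01 vC *.
have th0 : 0 < 1 - v by rewrite subr_gt0; case/andP: v01.
set l := 2 * colc v u' w' in llam.
have l0 : 0 < l by rewrite mulr_gt0 // divr_gt0.
have k20 : 0 < kp / 2 ^+ m.+1 by rewrite divr_gt0 ?exprn_gt0.
apply: (le_trans (block_upper sb uw k20 (erefl l))).
rewrite lee_fin.
have lu2 : l ^+ 2 <= lam ^+ 2 * u ^+ 2 by rewrite -exprMn ler_sqr ?nnegrE ?(ltW l0) ?(le_trans (ltW l0) llam).
have lam0 : 0 < lam by have := lt_le_trans l0 llam; rewrite pmulr_lgt0.
have lam2 : lam ^+ 2 <= 144.
  have -> : 144 = 12 ^+ 2 :> R by rewrite -natrX.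
  by rewrite ler_sqr ?nnegrE ?(ltW lam0).
have u20 : 0 < u ^+ 2 by rewrite exprn_gt0.
have lu144 : l ^+ 2 <= 144 * u ^+ 2 by apply: (le_trans lu2); rewrite ler_wpM2r ?(ltW u20).
have th1 : 1 - v <= 1 by rewrite gerBl; case/andP: v01 => /ltW.
have cC : colC v u' w' <= (1 + kp) ^+ 2 * expR (- 2 * u' ^+ 2 + 2 * u' * w').
  rewrite /colC expRD (mulrC (expR (- 2 * u' ^+ 2 + 2 * u' * w'))) mulrA.
  apply: ler_wpM2r; first exact: expR_ge0.
  rewrite expr2; apply: ler_pM; rewrite ?expR_ge0 ?invr_ge0 ?sqrtr_ge0 //.
    apply: sqrt_inv_le => //; apply: le_trans Hth.
    rewrite lef_pV2 ?posrE //; [by rewrite lerD2l lerN2|by have := HCv1; lra].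
  apply: le_trans Hexp; rewrite ler_expR.
  have -> : colc v u' w' ^+ 2 * v ^+ 2 / 2 = l ^+ 2 * v ^+ 2 / 8 by rewrite /l; field.
  have -> : 18 * Cv ^+ 2 / u ^+ 2 = 144 * u ^+ 2 * (Cv / u ^+ 2) ^+ 2 / 8 by field; rewrite gt_eqF.
  rewrite ler_wpM2r //; apply: ler_pM; rewrite ?sqr_ge0 // ler_sqr ?nnegrE //; first by case/andP: v01 => /ltW.
  by apply: le_trans vC; case/andP: v01 => /ltW.
have remC : 1 + 2 ^+ m.+1 * (kp / 2 ^+ m.+1 / 2 + (expR (2 * (l ^+ 2 * (2 * eps * m%:R * r))) - 1) / (2 * (kp / 2 ^+ m.+1))) <= 1 + kp.
  have h : expR (2 * (l ^+ 2 * (2 * eps * m%:R * r))) - 1 <= (kp / 2 ^+ m.+1) ^+ 2.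
    apply: le_trans Heps; rewrite lerD2r ler_expR.
    have -> : 2 * (l ^+ 2 * (2 * eps * m%:R * r)) = 4 * eps * m%:R * (l ^+ 2 * r) by ring.
    have -> : 1152 * eps * m%:R * Tt = 4 * eps * m%:R * (144 * (2 * Tt)) by ring.
    apply: ler_wpM2l; first by rewrite !mulr_ge0.
    apply: (@le_trans _ _ (144 * u ^+ 2 * r)); first by rewrite ler_wpM2r // ltW.
    by rewrite -mulrA ler_wpM2l.
  rewrite lerD2l mulrC -ler_pdivlMr ?exprn_gt0 //.
  exact: half_split_le.
have legC : \prod_(i < m) (1 + (l * Num.sqrt ((al i + eps) * r)) ^+ 2 / 2 + 2 * (l * Num.sqrt ((al i + eps) * r))) <=
   \prod_(i < m) ((1 + kp) * (lam ^+ 2 * (al i + eps) * (u ^+ 2 * r)) / 2 + 1 + 2 / kp).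
  apply: ler_prod => i _; have sq0 : 0 <= l * Num.sqrt ((al i + eps) * r) by rewrite mulr_ge0 ?sqrtr_ge0 // ltW.
  apply/andP; split; first by rewrite !addr_ge0 ?divr_ge0 ?sqr_ge0 // mulr_ge0.
  apply: (le_trans (leg_factor_le _ kp0)); rewrite !lerD2r ler_wpM2r // ler_wpM2l ?addr_ge0 ?(ltW kp0) //.
  have ar0 : 0 <= (al i + eps) * r by rewrite mulr_ge0 // ltW.
  rewrite exprMn sqr_sqrtr //.
  have -> : lam ^+ 2 * (al i + eps) * (u ^+ 2 * r) = lam ^+ 2 * u ^+ 2 * ((al i + eps) * r) by ring.
  by rewrite ler_wpM2r.
have leg0 : 0 <= \prod_(i < m) (1 + (l * Num.sqrt ((al i + eps) * r)) ^+ 2 / 2 + 2 * (l * Num.sqrt ((al i + eps) * r))).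
  apply: prodr_ge0 => i _; have sq0 : 0 <= l * Num.sqrt ((al i + eps) * r) by rewrite mulr_ge0 ?sqrtr_ge0 // ltW.
  by rewrite !addr_ge0 ?divr_ge0 ?sqr_ge0 // mulr_ge0.
have rem0 : 0 <= 1 + 2 ^+ m.+1 * (kp / 2 ^+ m.+1 / 2 + (expR (2 * (l ^+ 2 * (2 * eps * m%:R * r))) - 1) / (2 * (kp / 2 ^+ m.+1))).
  apply: addr_ge0 => //; apply: mulr_ge0; first exact: exprn_ge0.
  apply: addr_ge0; first by rewrite !divr_ge0 ?exprn_ge0 // ltW.
  apply: divr_ge0; last by rewrite mulr_ge0 // ltW.
  have x0 : 0 <= 2 * (l ^+ 2 * (2 * eps * m%:R * r)) by apply: mulr_ge0 => //; apply: mulr_ge0; [exact: sqr_ge0|by rewrite !mulr_ge0 // ltW].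
  by rewrite subr_ge0 -[leLHS]expR0 ler_expR.
have := ler_pM leg0 rem0 legC remC.
have lr0 := mulr_ge0 leg0 rem0.
move=> /(ler_pM (colC_ge0 v u' w') lr0 cC) H; apply: (le_trans H).
by apply: eqle; rewrite exprSr; ring.
Qed.

Lemma block_lower_simple (w R0 sg : R) :
  t0 < t1 -> eps < a ord_max -> 0 < sg <= 4^-1 ->
  0 <= bth t0 -> bth t0 <= 2^-1 - sg -> 2^-1 + sg <= bth t1 -> bth t1 <= 3 / 4 ->
  (forall i, eps <= kp * al i) -> 0 < eps ->
  (forall i, 1 <= 8 * al i * (u ^+ 2 * r) * (1 - kp) ^+ 8) ->
  (forall i, 16 * ln (3 / kp) <= kp ^+ 2 * (8 * al i * (u ^+ 2 * r) * (1 - kp) ^+ 3)) ->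
  kp <= 2^-1 ->
  Cv / u ^+ 2 <= sg / 2 -> Cv / u ^+ 2 <= 20^-1 ->
  `|w| <= kp * u -> 4 * (`|w| + 1) <= u * sg -> 4 * (`|w| + 2) <= u ->
  1152 * ln (3 / kp) <= u ^+ 2 * sg ^+ 2 ->
  0 < R0 -> R0 <= u -> 9 * R0 ^+ 2 <= kp * u ^+ 2 -> 6 * Cv <= R0 -> kp <= 5 * R0 ->
  200 * eps * m%:R * Tt <= kp ->
  expR (m%:R * (36 * amax * (2 * Tt)) / 2) * (2 * expR (- R0 ^+ 2 / (8 * Cv)) + 2 * m%:R * expR (- R0 ^+ 2 / (2 * m%:R ^+ 2 * (2 * amax * Tt)))
    + 2 ^+ m.+1 * expR (- kp ^+ 2 / (1152 * eps * m%:R * Tt))) <= kp ->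
  exists2 s : seq 'rV[R]_m.+1, (forall x, x \in s -> bbox x) &
  (((1 - kp) ^+ (5 + 8 * m) * expR (- 2 * u ^+ 2 + 2 * u * w) * \prod_(i < m) (8 * al i * (u ^+ 2 * r)))%:E <=
   P [set t | has (fun x => u < X (dl x) t - F x * (X one t - w))%R s])%E.
Proof.
move=> t01' an_gt /andP[sg0 sg4] bt0 hb0 hb1 hb1' epsk epsp Z1 Z2 kp2 Cs C20 wk wsg wu us R00 R0u R0k R0C kR epsT HC.
have v01 := bmu_top; have vC := bmu_le; set v := bmu btop in v01 vC *.
have v0 : 0 < v by case/andP: v01.
have vs : v <= sg / 2 by exact: le_trans vC Cs.
have v20 : v <= 20^-1 by exact: le_trans vC C20.
have th0 : 0 < 1 - v by rewrite subr_gt0; case/andP: v01.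
have kp1 : kp <= 1 by case/andP: kp01.
have [uw0 l4 l6] := slope_bounds u1 wk kp0 kp2 v0 v20.
pose l := 2 * colc v u w; rewrite -/(colc v u w) -/l in l4 l6.
have l0 : 0 < l by rewrite mulr_gt0 // divr_gt0.
have rho1 : R0 / u <= 1 by rewrite ler_pdivrMr // mul1r.
have rho0 : 0 < R0 / u by rewrite divr_gt0.
pose Vi i := blegV i (q 0 i + r).
have qrb i : q 0 i <= q 0 i + r <= q 0 i + r by rewrite lexx andbT lerDl ltW.
have Vb i : (al i - eps) * r <= Vi i <= (al i + eps) * r.
  by have := legV_bounds (qrb i); rewrite addrAC subrr add0r.
have alp i : 0 < al i := sub_lt_gt0 eps0 (al_gt i).
have Vlo i : (1 - kp) * al i * r <= Vi i.
  have /andP[h _] := Vb i; apply: le_trans h; rewrite ler_wpM2r ?(ltW r0) //.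
  exact: sub_scale.
have Vhi i : Vi i <= amax * (2 * Tt) / u ^+ 2.
  have /andP[_ h] := Vb i; apply: (le_trans h); rewrite ler_pdivlMr ?exprn_gt0 //.
  have -> : (al i + eps) * r * u ^+ 2 = (al i + eps) * (u ^+ 2 * r) by ring.
  apply: ler_pM => //; first exact: ltW.
  by rewrite mulr_ge0 ?sqr_ge0 // ltW.
have Zlo i : 8 * al i * (u ^+ 2 * r) * (1 - kp) ^+ 3 <= l ^+ 2 * Vi i / 2.
  have h : (4 * u * (1 - kp)) ^+ 2 * ((1 - kp) * al i * r) <= l ^+ 2 * Vi i.
    apply: ler_pM => //; first exact: sqr_ge0.
    - by rewrite !mulr_ge0 ?subr_ge0 ?(ltW r0) // ltW.
    - by rewrite ler_sqr ?nnegrE ?(ltW l0) // !mulr_ge0 ?subr_ge0 // ltW.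
  rewrite ler_pdivlMr //; apply: le_trans h.
  by apply: eqle; ring.
have exJ i := leg_levels kp0 kp2 (Zlo i) (Z1 i) (Z2 i).
pose J i := projT1 (cid (exJ i)).
have JP i : [/\ (J i)%:R * kp <= l ^+ 2 * Vi i / 2, 8 * al i * (u ^+ 2 * r) * (1 - kp) ^+ 8 <= (J i)%:R * kp * expR (- (2 * kp)) * (1 - kp),
    0 <= kp * (l ^+ 2 * Vi i / 2) / 2, kp * (l ^+ 2 * Vi i / 2) / 2 < l ^+ 2 * Vi i / 2 - (J i)%:R * kp &
    expR (- (kp * (l ^+ 2 * Vi i / 2) / 2) ^+ 2 / (4 * (l ^+ 2 * Vi i / 2))) <= kp / 3].
  exact: projT2 (cid (exJ i)).
have u20 : 0 < u ^+ 2 by rewrite exprn_gt0.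
have Tt0 : 0 < Tt by have := lt_le_trans (mulr_gt0 u20 r0) rT; rewrite pmulr_rgt0.
have amax0 : 0 < amax := lt_le_trans (al0 (Ordinal m0)) (al_max _).
have m0R : 0 < m%:R :> R by rewrite ltr0n.
have Cv0 : 0 < Cv by rewrite !mulr_gt0.
have kap0 : 0 <= kp / (6 * u) by rewrite divr_ge0 ?mulr_ge0 // ltW.
have kaprho : kp / (6 * u) <= R0 / u.
  rewrite invfM mulrA ler_wpM2r ?invr_ge0 ?(ltW u0) // ler_pdivrMr //.
  by apply: (le_trans kR); rewrite mulrC ler_wpM2l ?(ltW R00) // ler_nat.
have D00 : 0 <= u ^+ 2 * sg / 4 by rewrite divr_ge0 ?mulr_ge0 ?sqr_ge0 // ltW.
have bt1 : bth t1 < 1 - v by apply: bth_lt; rewrite lexx ltW.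
have bt10 : 0 <= bth t1 by apply: le_trans hb1; rewrite addr_ge0 ?invr_ge0 // ltW.
have expD := drift_tail kp0 us u0.
pose p := 2 * expR (- R0 ^+ 2 / (8 * Cv)) + 2 * m%:R * expR (- R0 ^+ 2 / (2 * m%:R ^+ 2 * (2 * amax * Tt)))
    + 2 ^+ m.+1 * expR (- kp ^+ 2 / (1152 * eps * m%:R * Tt)).
have p0 : 0 <= p by rewrite !addr_ge0 ?mulr_ge0 ?expR_ge0.
have [] := @block_lower u w kp l (3 * u) (R0 / u) (kp / (6 * u)) (u ^+ 2 * sg / 4) (u ^+ 2 * sg / 4) 4 p J.
- by [].
- by rewrite kap0.
- by [].
- by [].
- exact: rho_small u0 (ltW kp0) v20 R0k.
- by [].
- by [].
- by rewrite mulr_gt0.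
- by [].
- by [].
- by [].
- split; first by apply: bridge_time_le => //; exact: le_trans hb0 (half_sub_le sg0).
  split; first exact: bridge_time_le.
  move=> M x hM hx y b; have [g1 g2 g3 g4] := bridge_window u0 hM hx rho1 wsg wu.
  split.
  + by rewrite -subr_gt0; apply: lt_le_trans g1; rewrite divr_gt0.
  + exact: g2.
  + exact: drift_low.
  + exact: drift_high.
- exact: expD.
- exact: expD.
- move=> i; have [h1 h2 h3 h4 h5] := JP i; exists (kp * (l ^+ 2 * Vi i / 2) / 2) => //; split => //.
  move: h5; rewrite -/(Vi i) (_ : 4 * (l ^+ 2 * Vi i / 2) = 2 * (l ^+ 2 * Vi i)) //.
  by move: (Vi i) => z; field.
- rewrite /p !EFinD; apply: leeD; first apply: leeD.
  + have chs (e : V) : ip e e = v -> (P [set t | (R0 / (2 * u) < X e t)%R] <= (expR (- R0 ^+ 2 / (8 * Cv)))%:E)%E.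
      move=> ee; have s0 : 0 < Cv / u ^+ 2 by rewrite divr_gt0.
      have := @chernoff R V d T P X e (Cv / u ^+ 2) (R0 / (2 * u)) s0.
      have y0 : 0 <= R0 / (2 * u) by rewrite divr_ge0 ?mulr_ge0 // ltW.
      rewrite ee => /(_ vC y0) h; apply: (le_trans h).
      rewrite lee_fin ler_expR; apply: eqle.
      by field; rewrite !gt_eqF.
    have lv : l / 2 * v <= R0 / (2 * u).
      apply: (@le_trans _ _ (3 * u * (Cv / u ^+ 2))).
        apply: ler_pM => //; [by rewrite divr_ge0 // ltW|exact: ltW|].
        by rewrite ler_pdivrMr //; apply: (le_trans l6); rewrite mulrAC ler_wpM2r ?(ltW u0) // -natrM.
      have -> : 3 * u * (Cv / u ^+ 2) = (6 * Cv) / (2 * u) by field; rewrite gt_eqF.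
      by rewrite ler_wpM2r ?invr_ge0 ?mulr_ge0 // ltW.
    have mX1 (e : V) : measurable_fun setT (fun t => R0 / (2 * u) < X e t).
      by apply: measurable_fun_ltr; [exact: measurable_cst|exact: gX_meas].
    have mX2 : measurable_fun setT (fun t => R0 / u < `|X (boff btop) t - l / 2 * bmu btop|).
      apply: measurable_fun_ltr; first exact: measurable_cst.
      by apply: measurableT_comp => //; apply: measurable_funB; [exact: gX_meas|exact: measurable_cst].
    apply: (@le_trans _ _ (P [set t | (R0 / (2 * u) < X (boff btop) t) || (R0 / (2 * u) < X (- boff btop) t)])).
      apply: (P_le P mX2); first exact: measurable_or.
      have hR : R0 / u = R0 / (2 * u) + R0 / (2 * u) by field; rewrite gt_eqF.
      have lv0 : 0 <= l / 2 * v by rewrite mulr_ge0 ?divr_ge0 // ltW.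
      by move=> t; rewrite gXN; exact: norm_shift_gt lv0 lv hR.
    apply: (le_trans (P_or P (mX1 _) (mX1 _))).
    rewrite (_ : 2 * expR (- R0 ^+ 2 / (8 * Cv)) = expR (- R0 ^+ 2 / (8 * Cv)) + expR (- R0 ^+ 2 / (8 * Cv))); last by rewrite mulr_natl mulr2n.
    by rewrite EFinD; apply: leeD; apply: chs; rewrite ?gipNl ?gipNr ?opprK boff_oo.
  + apply: (@le_trans _ _ (\sum_(i < m) (2 * expR (- R0 ^+ 2 / (2 * m%:R ^+ 2 * (2 * amax * Tt))))%:E)%E); last first.
      by rewrite sumEFin lee_fin sumr_const card_ord -[leLHS]mulr_natr mulrAC.
    apply: lee_sum => i _; rewrite EFinM; apply: lee_wpmul2l; first by rewrite lee_fin.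
    have s0 : 0 < amax * (2 * Tt) / u ^+ 2 by rewrite divr_gt0 ?mulr_gt0.
    have vv : ip (bleg i (q 0 i + r)) (bleg i (q 0 i + r)) <= amax * (2 * Tt) / u ^+ 2.
      by rewrite leg_leg ?eqxx ?minxx //; exact: Vhi.
    have y0 : 0 <= R0 / u / m%:R by rewrite divr_ge0 // ltW.
    apply: (le_trans (chernoff s0 vv y0)).
    rewrite lee_fin ler_expR; apply: eqle.
    by field; rewrite !gt_eqF.
  + rewrite EFinM; apply: lee_wpmul2l; first by rewrite lee_fin exprn_ge0.
    have s0 : 0 < 2 * eps * m%:R * (2 * Tt) / u ^+ 2 by rewrite divr_gt0 ?mulr_gt0.
    have vv : ip (- brem btop) (- brem btop) <= 2 * eps * m%:R * (2 * Tt) / u ^+ 2.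
      rewrite gipNl gipNr opprK; apply: (le_trans (rem_bound btop_box)).
      have c0 : 0 <= 2 * eps * m%:R by rewrite !mulr_ge0 // ltW.
      rewrite ler_pdivlMr // -(mulrA (2 * eps * m%:R) r) (mulrC r); exact: ler_wpM2l.
    have y0 : 0 <= kp / (12 * u) by rewrite divr_ge0 ?mulr_ge0 // ltW.
    have mX1 (y : R) : measurable_fun setT (fun t => y < X (- brem btop) t).
      by apply: measurable_fun_ltr; [exact: measurable_cst|exact: gX_meas].
    have hy : kp / (12 * u) <= kp / (6 * u) - l / 2 * (2 * eps * m%:R * r).
      have h : l / 2 * (2 * eps * m%:R * r) <= kp / (12 * u); last first.
        have -> : kp / (6 * u) = kp / (12 * u) + kp / (12 * u) by field; rewrite gt_eqF.
        by rewrite -addrA lerDl subr_ge0.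
      apply: (@le_trans _ _ (3 * u * (2 * eps * m%:R * (2 * Tt / u ^+ 2)))).
        apply: ler_pM => //; first by rewrite divr_ge0 // ltW.
        - by rewrite !mulr_ge0 // ltW.
        - by rewrite ler_pdivrMr //; apply: (le_trans l6); rewrite mulrAC ler_wpM2r ?(ltW u0) // -natrM.
        - by rewrite ler_wpM2l ?mulr_ge0 // ler_pdivlMr // mulrC.
      rewrite ler_pdivlMr ?mulr_gt0 //.
      have -> : 3 * u * (2 * eps * m%:R * (2 * Tt / u ^+ 2)) * (12 * u) = 144 * eps * m%:R * Tt by field; rewrite gt_eqF.
      apply: le_trans epsT; apply: ler_wpM2r; first exact: ltW.
      apply: ler_wpM2r; first exact: ltW.
      by apply: ler_wpM2r; [exact: ltW|rewrite ler_nat].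
    apply: (@le_trans _ _ (P [set t | (kp / (12 * u) < X (- brem btop) t)%R])).
      by apply: (P_le P (mX1 _) (mX1 _)) => t; exact: le_lt_trans.
    apply: (le_trans (chernoff s0 vv y0)).
    rewrite lee_fin ler_expR; apply: eqle.
    by field; rewrite !gt_eqF.
move=> s sb hs; exists s => //; apply: le_trans hs; rewrite lee_fin.
have E0 := expR_ge0 (- 2 * u ^+ 2 + 2 * u * w).
have A0 i : 0 <= 8 * al i * (u ^+ 2 * r) by rewrite !mulr_ge0 ?sqr_ge0 ?(ltW r0) // ltW.
have e0 : 0 <= 1 - kp by rewrite subr_ge0.
pose Bp := \prod_(i < m) ((J i)%:R * kp * expR (- (2 * kp)) * (1 - kp)).
have DB : (\prod_(i < m) (8 * al i * (u ^+ 2 * r))) * (1 - kp) ^+ (8 * m) <= Bp.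
  have -> : (1 - kp) ^+ (8 * m) = \prod_(i < m) (1 - kp) ^+ 8 by rewrite prodr_const card_ord exprM.
  rewrite -big_split /=.
  apply: ler_prod => i _; have [_ h _ _ _] := JP i; rewrite h andbT.
  by rewrite mulr_ge0 ?exprn_ge0.
have B1 : 1 <= Bp.
  have -> : 1 = \prod_(i < m) 1 :> R by rewrite big1.
  apply: ler_prod => i _; rewrite ler01 /=; have [_ h _ _ _] := JP i.
  exact: le_trans (Z1 i) h.
have Cp : (\prod_(i < m) expR ((J i)%:R * kp)) * p <= kp.
  apply: le_trans HC; apply: ler_wpM2r => //.
  have -> : expR (m%:R * (36 * amax * (2 * Tt)) / 2) = \prod_(i < m) expR (36 * amax * (2 * Tt) / 2).
    by rewrite -expR_sum sumr_const card_ord -mulr_natl; congr expR; ring.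
  apply: ler_prod => i _; rewrite expR_ge0 ler_expR /=; have [h _ _ _ _] := JP i; apply: (le_trans h).
  rewrite ler_wpM2r //; apply: (@le_trans _ _ ((6 * u) ^+ 2 * (amax * (2 * Tt) / u ^+ 2))).
    apply: ler_pM => //; first exact: sqr_ge0.
    - by apply: le_trans (Vlo i); rewrite !mulr_ge0 ?(ltW r0) // ltW.
    - by rewrite ler_sqr ?nnegrE ?(ltW l0) // mulr_ge0 // ltW.
  by apply: eqle; field; rewrite gt_eqF.
have Dp0 : 0 <= \prod_(i < m) (8 * al i * (u ^+ 2 * r)) by apply: prodr_ge0 => i _; exact: A0.
apply: (le_trans (lower_combine (ltW kp0) kp1 B1 Cp E0 Dp0 DB)).
have lk : l * (kp / (6 * u)) <= kp.
  rewrite mulrA ler_pdivrMr ?mulr_gt0 // mulrC ler_wpM2l // ltW //.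
have Ec : expR (- 2 * u ^+ 2 + 2 * u * w) <= colC v u w.
  rewrite /colC -[leLHS]mul1r; apply: ler_pM => //.
    apply: sqrt_inv_ge1 => //; rewrite gerBl; exact: ltW.
  by rewrite ler_expR lerDl divr_ge0 // mulr_ge0 ?sqr_ge0.
have BC0 : 0 <= Bp - (\prod_(i < m) expR ((J i)%:R * kp)) * p.
  by rewrite subr_ge0; exact: le_trans Cp (le_trans kp1 B1).
apply: ler_pM.
- by rewrite !mulr_ge0 ?exprn_ge0.
- by rewrite mulr_ge0.
- apply: ler_wpM2r => //; apply: ler_pM => //; [exact: exprn_ge0|exact: expRN2_ge (ltW kp0) kp1].
- apply: ler_wpM2r => //; apply: le_trans (expRN_ge kp1) _.
  by rewrite ler_expR lerN2.
Qed.
End block_simple.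
End block.

(** * Outer Lebesgue measure of boxes, and Riemann sums *)

Section box_cover.
Context {R : realType}.

(* Induction on the dimension: slice by the last coordinate, the weights keep the boxes met by the slice. *)
Lemma cover_volume k (a b : nat -> R) (c : nat -> R) (A B : nat -> nat -> R) :
  (forall j i, A j i <= B j i) -> (forall i, a i <= b i) -> (forall j, 0 <= c j) ->
  (forall y : nat -> R, (forall i, (i < k)%N -> a i <= y i < b i) ->
     (1 <= \sum_(j <oo) (c j * [forall i : 'I_k, A j i <= y i <= B j i]%:R)%:E)%E) ->
  ((\prod_(i < k) (b i - a i))%:E <= \sum_(j <oo) (c j * \prod_(i < k) (B j i - A j i))%:E)%E.
Proof.
move=> AB ab; elim: k c => [|k IH] c c0 H.
  have := H a (fun i => _); rewrite big_ord0 => /(_ _)/le_trans; apply; first by [].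
  apply: eqle; apply: eq_eseriesr => j _.
  by rewrite big_ord0; congr (_ * _)%:E; case: forallP => // h; exfalso; apply: h; case.
have pr0 j : 0 <= \prod_(i < k) (B j i - A j i) by apply: prodr_ge0 => i _; rewrite subr_ge0.
pose inb j (x : R) : R := (A j k <= x <= B j k)%R%:R.
have slice x : a k <= x < b k -> ((\prod_(i < k) (b i - a i))%:E <=
    \sum_(j <oo) (c j * inb j x * \prod_(i < k) (B j i - A j i))%:E)%E.
  move=> hx; apply: IH => [j|y hy]; first by rewrite mulr_ge0.
  pose y' i := if i == k then x else y i.
  have y'k i : (i < k)%N -> y' i = y i by rewrite /y'; case: ltngtP.
  have y'E : y' k = x by rewrite /y' eqxx.
  apply: (le_trans (H y' _)).
    move=> i; rewrite ltnS leq_eqVlt => /predU1P[->|ik]; first by rewrite y'E.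
    by rewrite y'k // hy.
  apply: eqle; apply: eq_eseriesr => j _.
  rewrite -mulrA; congr (_ * _)%:E; rewrite /inb -natrM mulnb; congr (_ %:R); congr nat_of_bool.
  apply/forallP/andP => [h|[h1 /forallP h2] i].
    split; first by have := h ord_max; rewrite /= y'E.
    by apply/forallP => i; have := h (widen_ord (leqnSn k) i); rewrite /= y'k.
  have := ltn_ord i; rewrite ltnS leq_eqVlt => /predU1P[->|ik]; first by rewrite y'E.
  by rewrite y'k //; exact: (h2 (Ordinal ik)).
rewrite big_ord_recr /= mulrC.
have mI (l u : R) : measurable `[l, u[%classic by exact: measurable_itv.
pose g j x := (c j * inb j x * \prod_(i < k) (B j i - A j i))%:E : \bar R.
have inbE j x : inb j x = \1_(`[A j k, B j k]%classic : set R) x.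
  by rewrite /inb indicE; congr (_%:R); congr nat_of_bool; apply/idP/idP; rewrite ?inE /= in_itv.
have mg j : measurable_fun setT (g j).
  apply/measurable_EFinP; apply: measurable_funM; last exact: measurable_cst.
  apply: measurable_funM; first exact: measurable_cst.
  by rewrite (_ : inb j = \1_(`[A j k, B j k]%classic : set R)); [exact: measurable_indic|apply/funext => x; exact: inbE].
have g0 j x : (0 <= g j x)%E by rewrite lee_fin !mulr_ge0.
have -> : (((b k - a k) * \prod_(i < k) (b i - a i))%:E =
   \int[@lebesgue_measure R]_(x in `[a k, b k[%classic) (\prod_(i < k) (b i - a i))%:E)%E.
  have mE : @lebesgue_measure R `[a k, b k[%classic = (b k - a k)%:E.
    rewrite lebesgue_measure_itv /= lte_fin; case: ltP => [h|h]; first by rewrite EFinB.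
    by congr EFin; apply/eqP; rewrite eq_sym subr_eq0 eq_le h ab.
  rewrite integral_cst; last exact: measurable_itv.
  apply: esym; apply: (etrans (congr1 (mule _) mE)).
  by rewrite -EFinM; congr EFin; rewrite mulrC.
apply: (@le_trans _ _ (\int[@lebesgue_measure R]_(x in `[a k, b k[%classic) \sum_(j <oo) g j x)%E).
  apply: ge0_le_integral => //.
  - by move=> x _; rewrite lee_fin prodr_ge0 // => i _; rewrite subr_ge0.
  - by apply: ge0_emeasurable_sum => [j x _ _|j _]; [exact: g0|apply: measurable_funTS; exact: mg].
rewrite integral_nneseries; [|exact: mI|by move=> j; apply: measurable_funTS; exact: mg|by move=> j x _; exact: g0].
apply: lee_nneseries => [j _ _|j _]; first by apply: integral_ge0.
apply: (@le_trans _ _ (\int[@lebesgue_measure R]_x g j x)%E).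
  by apply: ge0_subset_integral => //; first [exact: mg|exact: mI].
have -> : g j = (fun x => (c j * \prod_(i < k) (B j i - A j i))%:E * (\1_(`[A j k, B j k]%classic : set R) x)%:E)%E.
  by apply/funext => x; rewrite /g -EFinM inbE mulrAC.
have cp0 : 0 <= c j * \prod_(i < k) (B j i - A j i) by rewrite mulr_ge0.
rewrite ge0_integralZl_EFin //; last by apply/measurable_EFinP; apply: measurable_indic; exact: measurable_itv.
rewrite integral_indic; [|exact: measurableT|exact: measurable_itv]. rewrite setIT.
have mE : @lebesgue_measure R `[A j k, B j k]%classic = (B j k - A j k)%:E.
  rewrite lebesgue_measure_itv /= lte_fin; case: ltP => h; first by rewrite EFinB.
  by congr EFin; apply/eqP; rewrite eq_sym subr_eq0 eq_le h AB.
apply: (@le_trans _ _ ((c j * \prod_(i < k) (B j i - A j i))%:E * (B j k - A j k)%:E)%E).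
  by apply: eqle; exact: (congr1 (mule _) mE).
by rewrite -EFinM lee_fin big_ord_recr /= mulrA.
Qed.
End box_cover.

Section outer_volume.
Context {R : realType} (m : nat).
Hypothesis m0 : (0 < m)%N.
Implicit Types (A B : set 'rV[R]_m) (a b : 'rV[R]_m).
Local Open Scope ereal_scope.

Lemma rvol_ge0 a b : (forall i, a 0 i <= b 0 i)%R -> (0 <= rvol a b)%R.
Proof. by move=> ab; apply: prodr_ge0 => i _; rewrite subr_ge0. Qed.

Lemma leb_ge0 A : 0 <= leb_outer A.
Proof.
apply: le_ereal_inf_tmp => s [a [b [ab [_ ->]]]]; apply: nneseries_ge0 => j _ _.
by rewrite lee_fin rvol_ge0.
Qed.

Lemma leb_mono A B : A `<=` B -> leb_outer A <= leb_outer B.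
Proof.
move=> AB; apply: ereal_inf_le_tmp => s [a [b [ab [cov sE]]]].
by exists a, b; split=> //; split=> //; exact: subset_trans cov.
Qed.

Lemma rvol_deg a : rvol a a = 0%R.
Proof. by rewrite /rvol (bigD1 (Ordinal m0)) //= subrr mul0r. Qed.

Lemma leb_box a b : (forall i, a 0 i <= b 0 i)%R -> leb_outer (rbox a b) <= (rvol a b)%:E.
Proof.
(* The cover is padded with degenerate boxes, of volume 0 because m > 0. *)
move=> ab; apply: ereal_inf_lbound; exists (fun j => if j == 0%N then a else 0%R), (fun j => if j == 0%N then b else 0%R).
split; first by move=> j i; case: eqP.
split; first by move=> x hx; exists 0%N.
apply: esym; rewrite (nneseries_split 0 1).
  rewrite big_nat1 eqxx eseries0 ?adde0 //.
  by move=> j j1 _; rewrite gtn_eqF // rvol_deg.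
by move=> k _; rewrite lee_fin; case: eqP => _; [exact: rvol_ge0|rewrite rvol_deg].
Qed.

Lemma leb0 : leb_outer (set0 : set 'rV[R]_m) = 0.
Proof.
apply/eqP; rewrite eq_le leb_ge0 andbT; apply: (@le_trans _ _ (leb_outer (rbox 0%R (0%R : 'rV[R]_m)))).
  by apply: leb_mono => x.
by apply: le_trans (leb_box (fun i => lexx _)) _; rewrite rvol_deg.
Qed.

(** Two near-optimal covers are interleaved along even and odd indices. *)
Lemma leb_setU A B : leb_outer (A `|` B) <= leb_outer A + leb_outer B.
Proof.
have [->|Af] := eqVneq (leb_outer A) +oo; first by rewrite addye ?leey // gt_eqF // (lt_le_trans _ (leb_ge0 B)).
have [->|Bf] := eqVneq (leb_outer B) +oo; first by rewrite addey ?leey // gt_eqF // (lt_le_trans _ (leb_ge0 A)).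
have fA : leb_outer A \is a fin_num by rewrite ge0_fin_numE ?leb_ge0 // ltey.
have fB : leb_outer B \is a fin_num by rewrite ge0_fin_numE ?leb_ge0 // ltey.
apply/lee_addgt0Pr => e e0; have e2 : (0 < e / 2)%R by rewrite divr_gt0.
have [sA [aA [bA [abA [covA ->]]]] hA] := lb_ereal_inf_adherent e2 fA.
have [sB [aB [bB [abB [covB ->]]]] hB] := lb_ereal_inf_adherent e2 fB.
pose mix (f g : nat -> 'rV[R]_m) j := if odd j then g j./2 else f j./2.
pose vA j := (rvol (aA j) (bA j))%:E; pose vB j := (rvol (aB j) (bB j))%:E.
pose v j := (rvol (mix aA aB j) (mix bA bB j))%:E.
have vA0 j : 0 <= vA j by rewrite lee_fin rvol_ge0.
have vB0 j : 0 <= vB j by rewrite lee_fin rvol_ge0.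
have v0 j : 0 <= v j by rewrite /v /mix lee_fin; case: odd; rewrite rvol_ge0.
have vE n : \sum_(0 <= j < n.*2) v j = \sum_(0 <= j < n) vA j + \sum_(0 <= j < n) vB j.
  have ve k : v k.*2 = vA k by rewrite /v /mix odd_double doubleK.
  have vo k : v k.*2.+1 = vB k by rewrite /v /mix oddS odd_double -[k.*2.+1]add1n halfD odd_double /= doubleK.
  elim: n => [|n IH]; first by rewrite !big_geq // adde0.
  by rewrite doubleS big_nat_recr //= big_nat_recr //= IH ve vo !big_nat_recr //= addeACA addeA.
apply: (@le_trans _ _ (\sum_(j <oo) v j)).
  apply: ereal_inf_lbound; exists (mix aA aB), (mix bA bB); split; first by move=> j i; rewrite /mix; case: odd.
  split=> // x [/covA|/covB] [j _ h].
    by exists j.*2 => //; rewrite /mix odd_double doubleK.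
  by exists j.*2.+1 => //; rewrite /mix /= odd_double uphalf_double.
apply: (@le_trans _ _ (\sum_(j <oo) vA j + \sum_(j <oo) vB j)).
  apply: lime_le; first exact: is_cvg_nneseries.
  apply: nearW => n; apply: (@le_trans _ _ (\sum_(0 <= j < n.*2) v j)).
    rewrite [leRHS](big_cat_nat (n := n)) //=; last by rewrite -addnn leq_addr.
    by rewrite leeDl // sume_ge0.
  by rewrite vE; apply: leeD; apply: nneseries_lim_ge.
have -> : leb_outer A + leb_outer B + e%:E = (leb_outer A + (e / 2)%:E) + (leb_outer B + (e / 2)%:E).
  by rewrite addeACA -EFinD -splitr.
by apply: leeD; exact: ltW.
Qed.

Lemma leb_bigsetU (I : Type) (s : seq I) (F : I -> set 'rV[R]_m) A :
  (forall x, A x -> exists2 i, List.In i s & F i x) -> leb_outer A <= \sum_(i <- s) leb_outer (A `&` F i).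
Proof.
elim: s A => [|i s IH] A H.
  by rewrite big_nil (_ : A = set0) ?leb0 //; apply/seteqP; split => // x /H[].
rewrite big_cons; apply: (@le_trans _ _ (leb_outer ((A `&` F i) `|` (A `&` ~` F i)))).
  by apply: leb_mono; rewrite -setIUr setUv setIT.
apply: (le_trans (leb_setU _ _)); apply: leeD => //.
apply: (le_trans (IH _ _)).
  by move=> x [/H[j /= [<-//|js] Fj]]; exists j.
elim: s {IH H} => [|j s IH]; rewrite ?big_nil // !big_cons; apply: leeD => //.
by apply: leb_mono => x [[]].
Qed.

Lemma leb_measurable_half (l : 'I_m) (c : R) : leb_measurable [set x : 'rV[R]_m | x 0 l < c]%R.
Proof.
move=> B; set H := [set x | _]; apply/eqP; rewrite eq_le; apply/andP; split.
  apply: le_trans (leb_setU _ _); apply: leb_mono; by rewrite -setIUr setUv setIT.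
apply: le_ereal_inf_tmp => s [a [b [ab [cov ->]]]].
(* c clamped to the side of the box: a box that lies on one side is cut into itself and a degenerate
   one. *)
pose cut j : R := (Num.max (a j 0 l) (Num.min (b j 0 l) c))%R.
have cut1 j : (a j 0 l <= cut j)%R by rewrite le_max lexx.
have cut2 j : (cut j <= b j 0 l)%R by rewrite ge_max ab ge_min lexx.
pose b' j : 'rV[R]_m := (\row_i if i == l then cut j else b j 0 i)%R.
pose a' j : 'rV[R]_m := (\row_i if i == l then cut j else a j 0 i)%R.
have ab' j i : (a j 0 i <= b' j 0 i)%R by rewrite mxE; case: eqP => [->|].
have a'b j i : (a' j 0 i <= b j 0 i)%R by rewrite mxE; case: eqP => [->|].
have vs j : (rvol (a j) (b j) = rvol (a j) (b' j) + rvol (a' j) (b j))%R.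
  rewrite /rvol (bigD1 l) //= [X in (_ = X + _)%R](bigD1 l) //= [X in (_ = _ + X)%R](bigD1 l) //= [b' j 0%R l]mxE [a' j 0%R l]mxE eqxx.
  have -> : (\prod_(i < m | i != l) (b' j 0 i - a j 0 i) = \prod_(i < m | i != l) (b j 0 i - a j 0 i))%R.
    by apply: eq_bigr => i /negbTE il; rewrite mxE il.
  have -> : (\prod_(i < m | i != l) (b j 0 i - a' j 0 i) = \prod_(i < m | i != l) (b j 0 i - a j 0 i))%R.
    by apply: eq_bigr => i /negbTE il; rewrite mxE il.
  by rewrite -mulrDl; congr (_ * _)%R; ring.
under eq_eseriesr do rewrite vs EFinD.
rewrite nneseriesD; [|by move=> j _; rewrite lee_fin rvol_ge0|by move=> j _; rewrite lee_fin rvol_ge0].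
apply: leeD; apply: ereal_inf_lbound.
  exists a, b'; split => //; split => // x [/cov[j _ hj] Hx]; exists j => // i.
  have /andP[h1 h2] := hj i; rewrite h1 mxE; case: eqP => [il|_] //=.
  by rewrite il in h2 *; rewrite le_max le_min h2 (ltW Hx) orbT.
exists a', b; split => //; split => // x [/cov[j _ hj] /negP Hx]; exists j => // i.
have /andP[h1 h2] := hj i; rewrite h2 andbT mxE; case: eqP => [il|_] //=.
rewrite il in h1 *; rewrite ge_max h1 /= ge_min; apply/orP; right.
by rewrite leNgt.
Qed.

Lemma leb_measurableC A : leb_measurable A -> leb_measurable (~` A).
Proof. by move=> mA B; rewrite setCK addeC. Qed.

Lemma leb_measurableI A B : leb_measurable A -> leb_measurable B -> leb_measurable (A `&` B).
Proof.
move=> mA mB X; apply/eqP; rewrite eq_le; apply/andP; split.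
  by apply: le_trans (leb_setU _ _); apply: leb_mono; rewrite -setIUr setUv setIT.
rewrite (mA X) (mB (X `&` A)) -addeA; apply: leeD; first by rewrite setIA.
apply: le_trans (leb_setU _ _); apply: leb_mono => x [Xx nAB].
by have [Ax|nA] := pselect (A x); [left|right]; split => // Bx; apply: nAB.
Qed.

Lemma leb_measurableT : leb_measurable (setT : set 'rV[R]_m).
Proof. by move=> X; rewrite setIT setCT setI0 leb0 adde0. Qed.

(** Half-open, so that the cells of a grid are disjoint; covers use the closed [rbox]. *)
Definition hbox a b : set 'rV[R]_m := [set x | forall i, a 0 i <= x 0 i < b 0 i]%R.

Lemma leb_measurable_hbox a b : leb_measurable (hbox a b).
Proof.
pose S (s : seq 'I_m) : set 'rV[R]_m := [set x | forall i, i \in s -> (a 0 i <= x 0 i < b 0 i)%R].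
have -> : hbox a b = S (enum 'I_m).
  by apply/seteqP; split => x h i; [move=> _; exact: h|apply: h; rewrite mem_enum].
have S0 : S [::] = setT by apply/seteqP; split.
have S1 i s : S (i :: s) = (~` [set x : 'rV[R]_m | x 0 i < a 0 i]%R `&` [set x : 'rV[R]_m | x 0 i < b 0 i]%R) `&` S s.
  apply/seteqP; split => x /=.
    move=> h; split; last by move=> j js; apply: h; rewrite in_cons js orbT.
    by have /andP[h1 h2] := h i (mem_head _ _); split=> //; apply/negP; rewrite -leNgt.
  move=> [[/negP h1 h2] h3] j; rewrite in_cons => /predU1P[->|/h3 //].
  by rewrite h2 leNgt h1.
elim: (enum 'I_m) => [|i s IH]; first by rewrite S0; exact: leb_measurableT.
rewrite S1; apply: leb_measurableI => //; apply: leb_measurableI; last exact: leb_measurable_half.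
by apply: leb_measurableC; exact: leb_measurable_half.
Qed.

Lemma leb_hbox_ge a b : (forall i, a 0 i <= b 0 i)%R -> (rvol a b)%:E <= leb_outer (hbox a b).
Proof.
move=> ab; apply: le_ereal_inf_tmp => s [c [e [ce [cov ->]]]].
pose f (x : 'rV[R]_m) (i : nat) : R := (if (insub i : option 'I_m) is Some i' then x 0 i' else 0)%R.
have fE x (i : 'I_m) : f x i = x 0%R i by rewrite /f valK.
have := @cover_volume R m (f a) (f b) (fun=> 1%R) (fun j => f (c j)) (fun j => f (e j)).
have -> : (\prod_(i < m) (f b i - f a i) = rvol a b)%R by apply: eq_bigr => i _; rewrite !fE.
under eq_eseriesr => j _.
  rewrite mul1r (_ : (\prod_(i < m) (f (e j) i - f (c j) i))%R = rvol (c j) (e j)); last by apply: eq_bigr => i _; rewrite !fE.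
  over.
apply.
- by move=> j i; rewrite /f; case: insub => // i'; rewrite ce.
- by move=> i; rewrite /f; case: insub => // i'; rewrite ab.
- by [].
move=> y hy.
have [j _ hj] : (\bigcup_j rbox (c j) (e j)) (\row_i y i)%R.
  by apply: cov => i; rewrite mxE; have := hy i (ltn_ord i); rewrite !fE.
apply: le_trans (nneseries_lim_ge (P := xpredT) (m := 0%N) j.+1 _); last by move=> k _; rewrite lee_fin mul1r.
rewrite big_nat_recr //= -[leLHS]add0e; apply: leeD; first by apply: sume_ge0 => k _; rewrite lee_fin mul1r.
rewrite lee_fin mul1r (_ : [forall i : 'I_m, _] = true) //.
by apply/forallP => i; rewrite !fE; have := hj i; rewrite mxE.
Qed.

Section riemann.
Variables (L : set 'rV[R]_m) (g : 'rV[R]_m -> R).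

Lemma leb_integral_ge (I : finType) (s : I -> R) (a b : I -> 'rV[R]_m) : (forall k, 0 <= s k)%R ->
  (forall k i, a k 0 i <= b k 0 i)%R ->
  (forall x, \sum_k s k * \1_(hbox (a k) (b k)) x <= if `[< L x >] then g x else 0)%R ->
  (\sum_k s k * rvol (a k) (b k))%:E <= leb_integral L g.
Proof.
move=> s0 ab H; apply: (@le_trans _ _ (\sum_k (s k)%:E * leb_outer (hbox (a k) (b k)))).
  rewrite -sumEFin; apply: lee_sum => k _; rewrite EFinM; apply: lee_wpmul2l; first by rewrite lee_fin.
  exact: leb_hbox_ge.
apply: ereal_sup_ubound; exists #|I|, (fun j => s (enum_val j)), (fun j => hbox (a (enum_val j)) (b (enum_val j))).
split; first by move=> j.
split; first by move=> j; exact: leb_measurable_hbox.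
split.
  move=> x; apply: le_trans (H x); apply: eqle; apply: esym.
  by rewrite (reindex (enum_val (A := predT))) //=; exists enum_rank => i _; rewrite ?enum_rankK ?enum_valK.
by rewrite (reindex (enum_val (A := predT))) //=; exists enum_rank => i _; rewrite ?enum_rankK ?enum_valK.
Qed.

(** Induction on the number of sets: inside the last set the others are bounded by s minus its
    coefficient, outside it by s. If that coefficient exceeds s, the last set misses B. *)
Let simple_le p (c : 'I_p -> R) (A : 'I_p -> set 'rV[R]_m) (B : set 'rV[R]_m) (s : R) : (0 <= s)%R ->
  (forall j, 0 <= c j)%R -> (forall j, leb_measurable (A j)) ->
  (forall x, B x -> (\sum_(j < p) c j * \1_(A j) x <= s)%R) ->
  \sum_(j < p) (c j)%:E * leb_outer (A j `&` B) <= s%:E * leb_outer B.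
Proof.
elim: p c A B s => [|p IH] c A B s s0 c0 mA H.
  by rewrite big_ord0 mule_ge0 ?lee_fin ?leb_ge0.
rewrite big_ord_recr /=; set cp := c ord_max; set Ap := A ord_max.
pose c' (j : 'I_p) := c (widen_ord (leqnSn p) j); pose A' (j : 'I_p) := A (widen_ord (leqnSn p) j).
have sp (j : 'I_p) : (c' j)%:E * leb_outer (A' j `&` B) =
   (c' j)%:E * leb_outer (A' j `&` (B `&` Ap)) + (c' j)%:E * leb_outer (A' j `&` (B `&` ~` Ap)).
  rewrite -muleDr ?ge0_adde_def ?inE ?leb_ge0 //; congr (_ * _).
  by rewrite (mA ord_max (A' j `&` B)) !setIA.
under eq_bigr do rewrite -/(c' _) -/(A' _) sp.
rewrite big_split /= addeAC.
have -> : s%:E * leb_outer B = s%:E * leb_outer (B `&` Ap) + s%:E * leb_outer (B `&` ~` Ap).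
  by rewrite -muleDr ?ge0_adde_def ?inE ?leb_ge0 //; congr (_ * _); exact: mA.
apply: leeD; last first.
  apply: IH => // [j|j|x [Bx nAx]]; [exact: c0|exact: mA|].
  have := H x Bx; rewrite big_ord_recr /= -/Ap (_ : \1_Ap x = 0%R) ?mulr0 ?addr0 //.
  by rewrite indicE memNset.
have [cps|scp] := leP cp s; last first.
  have E : B `&` Ap = set0.
    apply/seteqP; split => // x [Bx Ax]; have := H x Bx; rewrite big_ord_recr /= -/Ap (_ : \1_Ap x = 1%R) ?mulr1; last by rewrite indicE mem_set.
    have : (0 <= \sum_(i < p) c (widen_ord (leqnSn p) i) * \1_(A (widen_ord (leqnSn p) i)) x)%R by apply: sumr_ge0 => i _; rewrite mulr_ge0.
    by rewrite -/cp => h1 h2; lra.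
  by rewrite [Ap `&` B]setIC E big1 => [|j _]; rewrite ?setI0 leb0 ?mule0 ?adde0.
rewrite [Ap `&` B]setIC.
have -> : s%:E * leb_outer (B `&` Ap) = (s - cp)%:E * leb_outer (B `&` Ap) + cp%:E * leb_outer (B `&` Ap).
  rewrite -ge0_muleDl ?lee_fin ?subr_ge0 //; last exact: c0.
  by rewrite -EFinD subrK.
apply: leeD => //; apply: IH => // [|j|j|x [Bx Ax]]; [by rewrite subr_ge0|exact: c0|exact: mA|].
have := H x Bx; rewrite big_ord_recr /= -/Ap (_ : \1_Ap x = 1%R) ?mulr1; last by rewrite indicE mem_set.
by rewrite lerBrDr.
Qed.

(** Each set of a simple function is shared out among the covering boxes by subadditivity, so the
    boxes may overlap; [simple_le] treats each box. *)
Lemma leb_integral_le (I : eqType) (ks : seq I) (s : I -> R) (a b : I -> 'rV[R]_m) : (forall k, 0 <= s k)%R ->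
  (forall k i, a k 0 i <= b k 0 i)%R ->
  (forall x, L x -> exists2 k, k \in ks & rbox (a k) (b k) x) ->
  (forall k x, k \in ks -> L x -> rbox (a k) (b k) x -> g x <= s k)%R ->
  leb_integral L g <= (\sum_(k <- ks) s k * rvol (a k) (b k))%:E.
Proof.
move=> s0 ab cov gs; apply: ge_ereal_sup => _ [p [c [A [c0 [mA [H ->]]]]]].
apply: (@le_trans _ _ (\sum_(j < p) \sum_(k <- ks) (c j)%:E * leb_outer (A j `&` rbox (a k) (b k)))).
  apply: lee_sum => j _; have := c0 j; rewrite le_eqVlt => /predU1P[<-|cj].
    by rewrite mul0e; apply: sume_ge0 => k _; rewrite mul0e.
  rewrite -ge0_sume_distrr; last by move=> k _; exact: leb_ge0.
  apply: lee_wpmul2l; first by rewrite lee_fin ltW.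
  apply: leb_bigsetU => x Ax.
  have Lx : L x.
    have := H x; case: asboolP => // _; rewrite (bigD1 j) //= (_ : \1_(A j) x = 1%R); last by rewrite indicE mem_set.
    have : (0 <= \sum_(i < p | i != j) c i * \1_(A i) x)%R by apply: sumr_ge0 => i _; rewrite mulr_ge0.
    by rewrite mulr1 => h1 h2; exfalso; lra.
  have [k kks kx] := cov x Lx; exists k => //.
  by elim: ks kks {cov gs} => // k' ks IH; rewrite in_cons => /predU1P[->|/IH]; [left|right].
rewrite exchange_big /= -sumEFin big_seq [leRHS]big_seq; apply: lee_sum => k kks; rewrite EFinM.
apply: (@le_trans _ _ ((s k)%:E * leb_outer (rbox (a k) (b k)))).
  apply: simple_le => // x Bx; apply: (le_trans (H x)).
  by case: asboolP => // Lx; exact: gs.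
by apply: lee_wpmul2l; [rewrite lee_fin|exact: leb_box].
Qed.
End riemann.
End outer_volume.

(** * Grid cells and union bounds over classes of points *)

Section grid_cells.
Context {R : realType} (k N : nat).

(** Clipped at N so that t = 1 falls in the last cell. *)
Definition gcell (t : R) : 'I_N.+1 := inord (minn N (Num.truncn (N.+1%:R * t))).

Lemma gcell_in t : 0 <= t <= 1 -> (gcell t)%:R / N.+1%:R <= t <= (gcell t)%:R / N.+1%:R + N.+1%:R^-1.
Proof.
move=> /andP[t0 t1]; have N0 : 0 < N.+1%:R :> R by rewrite ltr0n.
have x0 : 0 <= N.+1%:R * t by rewrite mulr_ge0 // ltW.
have /andP[h1 h2] := truncn_itv x0.
rewrite /gcell inordK ?ltnS ?geq_minl // -{3}[N.+1%:R^-1]mul1r -mulrDl ler_pdivrMr // ler_pdivlMr // ![t * _]mulrC.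
have [h|h] := leqP N (Num.truncn (N.+1%:R * t)).
  apply/andP; split; first by apply: le_trans h1; rewrite ler_nat.
  by rewrite -natr1 ger_pMr // ltW.
by rewrite h1 /= natr1 ltW.
Qed.

Definition cellf (x : 'rV[R]_k) : {ffun 'I_k -> 'I_N.+1} := [ffun i => gcell (x 0 i)].
Definition corner (j : {ffun 'I_k -> 'I_N.+1}) : 'rV[R]_k := \row_i ((j i)%:R / N.+1%:R).

Lemma cellf_in (x : 'rV[R]_k) i : 0 <= x 0 i <= 1 ->
  corner (cellf x) 0 i <= x 0 i <= corner (cellf x) 0 i + N.+1%:R^-1.
Proof. by move=> h; rewrite mxE ffunE gcell_in. Qed.

Lemma corner01 (j : {ffun 'I_k -> 'I_N.+1}) (i : 'I_k) : 0 <= corner j 0 i /\ corner j 0 i + N.+1%:R^-1 <= 1.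
Proof.
rewrite mxE; split; first by rewrite divr_ge0.
by rewrite -[X in _ + X]mul1r -mulrDl ler_pdivrMr ?ltr0n // mul1r natr1 ler_nat ltn_ord.
Qed.
End grid_cells.

Section classes.
Context {R : realType} d (T : measurableType d) (P : probability T R).

Lemma P_classes (D : Type) (I : finType) (c : D -> I) (s : seq D) (b : D -> T -> bool) :
  (forall x, measurable_fun setT (b x)) ->
  (P [set t | has (b^~ t) s] <= \sum_j P [set t | has (b^~ t) [seq x <- s | c x == j]])%E.
Proof.
move=> mb; pose b' j t := has (b^~ t) [seq x <- s | c x == j].
have mb' j : measurable_fun setT (b' j) by exact: measurable_hasb.
apply: (@le_trans _ _ (P [set t | has (b'^~ t) (enum I)])).
  apply: P_le; [exact: measurable_hasb|exact: measurable_hasb|] => t h.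
  apply/hasP; suff [x xs bx] : exists2 x, c x \in enum I & has (b^~ t) [seq y <- s | c y == c x] by exists (c x).
  elim: s h {b' mb'} => //= x s IH /orP[h|/IH[y yI hy]].
    by exists x; rewrite ?mem_enum // eqxx /= h.
  by exists y => //; case: eqP => //= _; rewrite hy orbT.
by apply: le_trans (P_has (b := b') P (enum I) mb') _; rewrite big_enum.
Qed.

Lemma P_has0 (D : Type) (b : D -> T -> bool) : P [set t | has (b^~ t) [::]] = 0%E.
Proof. by rewrite (_ : [set t | _] = set0) ?measure0 //; apply/seteqP; split. Qed.
End classes.

Lemma row_shiftE {R : realType} k (p : 'rV[R]_k) (r : R) i : (p + const_mx r) 0 i = p 0 i + r.
Proof. by rewrite !mxE. Qed.

Lemma norm1_ge0 {R : realType} k (x : 'rV[R]_k) : 0 <= norm1 x.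
Proof. by apply: sumr_ge0 => i _. Qed.

Lemma norm1_le {R : realType} k (x : 'rV[R]_k) (c : R) : (forall i, `|x 0 i| <= c) -> norm1 x <= k%:R * c.
Proof.
move=> H; apply: (@le_trans _ _ (\sum_(i < k) c)); first by apply: ler_sum.
by rewrite sumr_const card_ord mulr_natl.
Qed.

(** * Exceedance away from D, and joint exceedance of two blocks *)

Section far_arithmetic.
Context {R : realType}.
Implicit Types u w x y z f p e k o : R.

(** x, y and z stand for the field at a point of a cell, at its corner and at [ones]; f and p for F
    at the first two. The conditional field at the point differs from the bridge at the corner by x
    - y, (f - p) z and f w, each contributing at most k u, which leaves (1 - 3 k) u to the
    corner. *)
Lemma far_split u w k o x y z f p : 0 < u -> `|w| <= k * u -> 0 <= p -> p <= f -> f <= 1 -> f - p <= o ->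
  u < x - f * (z - w) -> y - p * z <= (1 - 3 * k) * u -> x - y <= k * u -> o * z <= k * u -> - o * z <= k * u -> False.
Proof.
move=> u0; rewrite ler_norml => /andP[w1 w2] p0 pf f1 fo.
have h1 : f * w <= k * u.
  have [w0|w0] := leP 0 w; first by apply: le_trans w2; rewrite ler_piMl.
  apply: le_trans (_ : 0 <= _); last lra.
  by rewrite nmulr_lle0 // (le_trans p0).
have h2 : o * z <= k * u -> - o * z <= k * u -> (p - f) * z <= k * u.
  move=> h3 h4; have [z0|z0] := leP 0 z.
    apply: (@le_trans _ _ 0); first by rewrite mulr_le0_ge0 // subr_le0.
    by apply: le_trans h3; rewrite mulr_ge0 //; lra.
  apply: le_trans h4; rewrite -subr_ge0.
  have -> : - o * z - (p - f) * z = (o - (f - p)) * (- z) by ring.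
  by rewrite mulr_ge0 //; lra.
move=> a1 a2 a3 a4 a5; have a6 := h2 a4 a5.
have : (1 - 3 * k) * u + k * u + k * u + k * u = u by ring.
by move: a1; rewrite mulrBr; move: a6; rewrite mulrBl; lra.
Qed.

Lemma sq_quarter e : 0 < e -> e <= 2^-1 -> e ^+ 2 <= 4^-1.
Proof. by rewrite expr2 => ? ?; nra. Qed.

(** This fixes k = e^2 / 24: the level loses a fraction 3 k = e^2 / 8 while the variance is below
    1/4 by e^2 / 4, and the exponent still gains e^2 u^2. *)
Lemma far_main u e : 0 < e -> e <= 2^-1 ->
  - ((1 - 3 * (e ^+ 2 / 24)) * u) ^+ 2 / (2 * ((1 - e ^+ 2) / 4)) <= - (2 + e ^+ 2) * u ^+ 2.
Proof.
move=> e0 e2; have q0 : 0 <= e ^+ 2 by apply: sqr_ge0.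
have q1 : e ^+ 2 <= 4^-1 by exact: sq_quarter.
rewrite !mulNr lerN2 ler_pdivlMr; last lra.
have -> : (2 + e ^+ 2) * u ^+ 2 * (2 * ((1 - e ^+ 2) / 4)) = (2 + e ^+ 2) * (1 - e ^+ 2) / 2 * u ^+ 2 by field.
rewrite exprMn; apply: ler_wpM2r; first exact: sqr_ge0.
move: (e ^+ 2) q0 q1 => q q0 q1.
have : 0 <= q * q by rewrite mulr_ge0.
have -> : (1 - 3 * (q / 24)) ^+ 2 = 1 - q / 4 + q * q / 64 by field.
have -> : (2 + q) * (1 - q) / 2 = 1 - q / 2 - q * q / 2 by field.
lra.
Qed.

Lemma far_rest u e k o : 0 < e -> e <= 2^-1 -> 0 < k -> o = k ^+ 2 / 6 ->
  - (k * u) ^+ 2 / (2 * o) <= - (2 + e ^+ 2) * u ^+ 2.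
Proof.
move=> e0 e2 k0 ->; have q1 : e ^+ 2 <= 4^-1 by exact: sq_quarter.
have -> : - (k * u) ^+ 2 / (2 * (k ^+ 2 / 6)) = - (3 * u ^+ 2) by field; rewrite gt_eqF.
by rewrite mulNr lerN2; apply: ler_wpM2r; [exact: sqr_ge0|lra].
Qed.

Lemma far_var f e : 0 < e -> e / 2 <= `|f - 2^-1| -> f - f ^+ 2 <= (1 - e ^+ 2) / 4.
Proof.
move=> e0 h.
have : (e / 2) ^+ 2 <= (f - 2^-1) ^+ 2 by rewrite -[leRHS]real_normK ?num_real // ler_pXn2r ?nnegrE ?divr_ge0 // ltW.
by rewrite !expr2; nra.
Qed.
End far_arithmetic.

Section bonferroni.
Context {R : realType} d (T : measurableType d) (P : probability T R).

Lemma P_orand (b c : T -> bool) : measurable_fun setT b -> measurable_fun setT c ->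
  (P [set t | b t] + P [set t | c t] = P [set t | b t || c t] + P [set t | b t && c t])%E.
Proof.
move=> mb mc; have mo : measurable_fun setT (fun t => b t || c t) by exact: measurable_or.
have ma : measurable_fun setT (fun t => b t && c t) by exact: measurable_and.
rewrite -!integral_bool // -!int_D //; try exact: measurable_nat_bool.
by apply: eq_integral => t _; rewrite -!EFinD -!natrD; case: (b t); case: (c t).
Qed.

(** Every pair is counted in both orders, which costs a factor 2 on a term that will be small. *)
Lemma bonferroni (D : eqType) (s : seq D) (b : D -> T -> bool) : uniq s ->
  (forall x, measurable_fun setT (b x)) ->
  (\sum_(x <- s) P [set t | b x t] <= P [set t | has (b^~ t) s] +
     \sum_(x <- s) \sum_(y <- s | y != x) P [set t | b x t && b y t])%E.
Proof.
move=> us mb; elim: s us => [|x s IH] /=; first by rewrite !big_nil adde0 measure_ge0.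
move=> /andP[xs us]; have mh : measurable_fun setT (fun t => has (b^~ t) s) by exact: measurable_hasb.
have mxh : measurable_fun setT (fun t => b x t && has (b^~ t) s) by exact: measurable_and.
rewrite !big_cons eqxx /=.
have -> : (\sum_(y <- s | y != x) P [set t | b x t && b y t] = \sum_(y <- s) P [set t | b x t && b y t])%E.
  rewrite big_seq_cond [RHS]big_seq; apply: eq_bigl => y; case ys : (y \in s) => //=.
  by apply/eqP => yx; rewrite -yx ys in xs.
apply: (le_trans (leeD (lexx _) (IH us))).
rewrite addeA (P_orand (mb x) mh) -addeA; apply: leeD => //; apply: leeD.
  have mby y : measurable_fun setT (fun t => b x t && b y t) by exact: measurable_and.
  apply: le_trans (P_has (b := fun y t => b x t && b y t) P s mby).
  apply: P_le => //; first by apply: measurable_hasb => y; exact: mby.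
  by move=> t /andP[h /hasP[y ys hy]]; apply/hasP; exists y => //; rewrite h.
apply: lee_sum => y _; rewrite big_cons; case: ifP => _ //.
by rewrite leeDr // measure_ge0.
Qed.
End bonferroni.

Section bridge_tails.
Context {R : realType} (k : nat).
Variables (mu : probability (g_sigma_algebraType (@orthants R k)) R) (F : 'rV[R]_k -> R).
Hypothesis HF : is_cdf_on_cube mu F.
Context (V : lmodType R) d (T : measurableType d) (P : probability T R) (X : gfield V P) (dl : 'rV[R]_k -> V).
Hypothesis ipd : forall x y, cube k x -> cube k y -> gip X (dl x) (dl y) = F (rmin x y).
Local Notation ip := (gip X).
Local Notation one := (dl (ones k)).

Lemma rmin_idl (x y : 'rV[R]_k) : (forall j, x 0 j <= y 0 j) -> rmin x y = x.
Proof. by move=> h; apply/rowP => j; rewrite mxE; apply/min_idPl. Qed.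

Lemma ipd_le x y : cube k x -> cube k y -> (forall j, x 0 j <= y 0 j) -> ip (dl x) (dl y) = F x.
Proof. by move=> cx cy h; rewrite ipd // rmin_idl. Qed.

Lemma ipd1 x : cube k x -> ip (dl x) one = F x.
Proof. by move=> cx; apply: ipd_le => //; [exact: cube_ones|move=> j; rewrite mxE; have /andP[] := cx j]. Qed.

Lemma measurable_bridge u w x : measurable_fun setT (fun t => u < X (dl x) t - F x * (X one t - w)).
Proof.
apply: measurable_fun_ltr => //; apply: measurable_funB; first exact: gX_meas.
by apply: measurable_funM => //; apply: measurable_funB => //; exact: gX_meas.
Qed.

Lemma far_cell (p top : 'rV[R]_k) (w u e kp o : R) (s : seq 'rV[R]_k) : cube k p -> cube k top ->
  (forall x, x \in s -> forall i, p 0 i <= x 0 i <= top 0 i) -> (forall i, p 0 i <= top 0 i) ->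
  0 < e -> e <= 2^-1 -> kp = e ^+ 2 / 24 -> o = kp ^+ 2 / 6 -> F top - F p <= o -> e / 2 <= `|F p - 2^-1| ->
  0 < u -> `|w| <= kp * u ->
  (P [set t | has (fun x => u < X (dl x) t - F x * (X one t - w))%R s] <=
    ((2 ^+ k + 3) * expR (- (2 + e ^+ 2) * u ^+ 2))%:E)%E.
Proof.
move=> cp ct sb pt e0 e2 kpE oE Fo Fe u0 wu.
have kp0 : 0 < kp by rewrite kpE divr_gt0 // exprn_gt0.
have o0 : 0 < o by rewrite oE divr_gt0 // exprn_gt0.
have kpu : 0 <= kp * u by rewrite mulr_ge0 // ltW.
have cs x : x \in s -> cube k x.
  move=> xs i; have /andP[h1 h2] := sb x xs i; have /andP[h3 _] := cp i; have /andP[_ h4] := ct i.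
  by rewrite (le_trans h3 h1) (le_trans h2 h4).
pose b1 t := (1 - 3 * kp) * u < X (dl p - F p *: one) t.
pose b2 t := has (fun x => kp * u < X (dl x - dl p) t) s.
pose b3 t := kp * u < X (o *: one) t.
pose b4 t := kp * u < X (- o *: one) t.
have mX v y : measurable_fun setT (fun t => y < X v t).
  by apply: measurable_fun_ltr => //; exact: gX_meas.
have m1 : measurable_fun setT b1 by exact: mX.
have m2 : measurable_fun setT b2 by apply: measurable_has => x; exact: gX_meas.
have m3 : measurable_fun setT b3 by exact: mX.
have m4 : measurable_fun setT b4 by exact: mX.
have m34 : measurable_fun setT (fun t => b3 t || b4 t) by apply: measurable_or.
have m234 : measurable_fun setT (fun t => b2 t || (b3 t || b4 t)) by apply: measurable_or.
have m1234 : measurable_fun setT (fun t => b1 t || (b2 t || (b3 t || b4 t))) by apply: measurable_or.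
have mc : measurable_fun setT (fun t => has (fun x => u < X (dl x) t - F x * (X one t - w)) s).
  by apply: measurable_hasb => x; exact: measurable_bridge.
apply: (le_trans (P_le P mc m1234 _)).
  move=> t /hasP[x xs cx]; apply/negPn/negP; rewrite !negb_or => /and4P[n1 n2 n3 n4].
  have xp i : p 0 i <= x 0 i by have /andP[] := sb x xs i.
  have xt i : x 0 i <= top 0 i by have /andP[] := sb x xs i.
  have cx' := cs x xs.
  have Fp := cdf_le HF cp cx' xp; have Ft := cdf_le HF cx' ct xt.
  have /andP[Fp0 _] := cdf01 HF cp; have /andP[_ Fx1] := cdf01 HF cx'.
  move: n1 n3 n4; rewrite /b1 /b3 /b4 -!leNgt gXB !gXZ => n1 n3 n4.
  apply: (far_split u0 wu Fp0 Fp Fx1 _ cx n1 _ n3 n4).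
    by apply: le_trans Fo; rewrite lerD2r.
  by rewrite leNgt -gXB; apply: contra n2 => h; apply/hasP; exists x.
set E := expR _.
have B1 : (P [set t | b1 t] <= E%:E)%E.
  have q1 : e ^+ 2 <= 4^-1 by exact: sq_quarter.
  apply: le_trans (@chernoff _ _ _ _ _ _ _ ((1 - e ^+ 2) / 4) _ _ _ _) _.
  - by rewrite divr_gt0 //; lra.
  - rewrite !gipE (ipd1 cp) (gip_sym _ one) (ipd1 cp) (ipd1 (@cube_ones R k)) (cdf_ones HF) (ipd_le cp cp) //.
    by apply: le_trans (far_var e0 Fe); rewrite expr2; lra.
  - by apply: mulr_ge0; [rewrite kpE; lra|exact: ltW].
  - by rewrite lee_fin ler_expR kpE far_main.
have Bo v : ip v v <= o -> (P [set t | (kp * u < X v t)%R] <= E%:E)%E.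
  move=> vo; apply: le_trans (chernoff o0 vo kpu) _.
  by rewrite lee_fin ler_expR far_rest.
have o1 : o <= 1.
  have q1 : e ^+ 2 <= 4^-1 by exact: sq_quarter.
  have k1 : kp <= 1 by rewrite kpE; lra.
  by rewrite oE expr2; nra.
have oo : o * o <= o by rewrite ger_pMr.
have B2 : (P [set t | b2 t] <= (2 ^+ k)%:E * E%:E)%E.
  apply: le_trans (@levy_box _ V d T P X k (fun x => dl x - dl p) top [set x | forall i, p 0 i <= x 0 i <= top 0 i] _ _ s (kp * u) sb) _.
  - by move=> i x bx j; rewrite mxE; case: eqP => [->|_]; [rewrite pt lexx|exact: bx].
  - have cB (x : 'rV[R]_k) : (forall i, p 0 i <= x 0 i <= top 0 i) -> cube k x.
      move=> bx i; have /andP[h1 h2] := bx i; have /andP[h3 _] := cp i; have /andP[_ h4] := ct i.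
      by rewrite (le_trans h3 h1) (le_trans h2 h4).
    move=> i x y bx by_ yx.
    have bu j : p 0 j <= upd top i x 0 j <= top 0 j.
      by rewrite mxE; case: eqP => [->|_]; [rewrite pt lexx|exact: bx].
    have hu j : p 0 j <= upd top i x 0 j by have /andP[] := bu j.
    have hx j : p 0 j <= x 0 j by have /andP[] := bx j.
    have hy j : p 0 j <= y 0 j by have /andP[] := by_ j.
    rewrite !gipE (ipd (cB _ bu) (cB _ by_)) (ipd (cB _ bx) (cB _ by_)).
    rewrite (gip_sym _ (dl (upd top i x)) (dl p)) (gip_sym _ (dl x) (dl p)) (ipd_le cp (cB _ by_) hy) (ipd_le cp (cB _ bu) hu) (ipd_le cp (cB _ bx) hx) (ipd_le cp cp) //.
    have -> : rmin (upd top i x) y = rmin x y.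
      apply/rowP => j; rewrite !mxE; case: eqP => [->|//].
      have /andP[_ h] := by_ i.
      by rewrite (min_idPr h) (min_idPr yx).
    by ring.
  - apply: lee_wpmul2l; first by rewrite lee_fin exprn_ge0.
    apply: Bo; rewrite !gipE (gip_sym _ (dl top) (dl p)) (ipd_le ct ct) // !(ipd_le cp) //.
    by lra.
have B3 : (P [set t | b3 t] <= E%:E)%E.
  by apply: Bo; rewrite !gipE (ipd1 (@cube_ones R k)) (cdf_ones HF) mulr1.
have B4 : (P [set t | b4 t] <= E%:E)%E.
  by apply: Bo; rewrite !gipE (ipd1 (@cube_ones R k)) (cdf_ones HF) mulr1 mulrNN.
apply: (le_trans (P_or P m1 m234)); apply: (le_trans (leeD (lexx _) (P_or P m2 m34))).
apply: (le_trans (leeD (lexx _) (leeD (lexx _) (P_or P m3 m4)))).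
apply: (le_trans (leeD B1 (leeD B2 (leeD B3 B4)))).
by rewrite -EFinM -!EFinD lee_fin; lra.
Qed.

(** By uniform continuity finitely many cells suffice for F to vary by at most o, hence by at most e
    / 2, on each; C counts them. *)
Lemma far_bound (w e : R) :
  (forall eta : R, 0 < eta -> exists2 dd : R, 0 < dd & forall x y, cube k x -> cube k y -> norm1 (x - y) <= dd -> `|F x - F y| <= eta) ->
  0 < e -> e <= 2^-1 ->
  exists C : R, forall (u : R) (s : seq 'rV[R]_k), 0 < u -> `|w| <= e ^+ 2 / 24 * u ->
    (forall x, x \in s -> cube k x /\ e <= `|F x - 2^-1|) ->
  (P [set t | has (fun x => u < X (dl x) t - F x * (X one t - w))%R s] <=
    (C * expR (- (2 + e ^+ 2) * u ^+ 2))%:E)%E.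
Proof.
move=> Fu e0 e2; pose kp := e ^+ 2 / 24; pose o := kp ^+ 2 / 6.
have q1 : e ^+ 2 <= 4^-1 by exact: sq_quarter.
have q2 : e ^+ 2 <= e by rewrite expr2 ger_pMr //; lra.
have kp0 : 0 < kp by rewrite divr_gt0 // exprn_gt0.
have o0 : 0 < o by rewrite divr_gt0 // exprn_gt0.
have oe : o <= e / 2.
  have : kp * kp <= kp * 1 by rewrite ler_pM2l // /kp; lra.
  by rewrite /o expr2 /kp; lra.
have [dd dd0 Fd] := Fu o o0.
pose N := Num.truncn (k%:R / dd); pose r : R := N.+1%:R^-1.
have r0 : 0 < r by rewrite invr_gt0 ltr0n.
have kr : k%:R * r <= dd.
  rewrite /r ler_pdivrMr ?ltr0n // mulrC -ler_pdivrMr //; apply: ltW.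
  by have /andP[] := @truncn_itv R (k%:R / dd) (divr_ge0 (ler0n _ _) (ltW dd0)).
exists (#|{: {ffun 'I_k -> 'I_N.+1}}|%:R * (2 ^+ k + 3)) => u s u0 wu sb.
apply: (le_trans (P_classes (b := fun x t => u < X (dl x) t - F x * (X one t - w)) P (cellf N) s _)).
  by move=> x; exact: measurable_bridge.
rewrite -mulrA; set A := (2 ^+ k + 3) * expR _; rewrite [leRHS](_ : _ = (\sum_(j : {ffun 'I_k -> 'I_N.+1}) A%:E)%E); last first.
  by rewrite sumEFin sumr_const -[in RHS]mulr_natl mulrA.
apply: lee_sum => j _.
case E : [seq x <- s | cellf N x == j] => [|x0 s'].
  by rewrite P_has0 lee_fin mulr_ge0 ?expR_ge0 // addr_ge0 // exprn_ge0.
rewrite -E; set s1 := [seq x <- s | _].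
have s1P x : x \in s1 -> [/\ cube k x, e <= `|F x - 2^-1| & forall i, corner j 0 i <= x 0 i <= (corner j + const_mx r) 0 i].
  rewrite mem_filter => /andP[/eqP xj /sb[cx ex]]; split=> // i.
  by rewrite row_shiftE -xj; apply: cellf_in.
have c01 i := @corner01 R k N j i.
have cc : cube k (corner j : 'rV[R]_k).
  by move=> i; have [h1 h2] := c01 i; rewrite h1 /=; apply: le_trans h2; rewrite lerDl ltW.
have ct : cube k (corner j + const_mx r : 'rV[R]_k).
  move=> i; have [h1 h2] := c01 i; rewrite row_shiftE h2 andbT.
  by rewrite addr_ge0 // ltW.
have cle i : (corner j : 'rV[R]_k) 0 i <= (corner j + const_mx r) 0 i by rewrite row_shiftE lerDl ltW.
have dist (y z : 'rV[R]_k) : (forall i, corner j 0 i <= y 0 i <= (corner j + const_mx r) 0 i) ->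
   (forall i, corner j 0 i <= z 0 i <= (corner j + const_mx r) 0 i) -> norm1 (y - z) <= dd.
  move=> hy hz; apply: le_trans kr; apply: norm1_le => i; rewrite !mxE.
  have := hy i; have := hz i; rewrite ler_norml row_shiftE => /andP[? ?] /andP[? ?].
  by apply/andP; split; lra.
have bc i : corner j 0 i <= (corner j : 'rV[R]_k) 0 i <= (corner j + const_mx r) 0 i by rewrite lexx cle.
have bt i : corner j 0 i <= (corner j + const_mx r : 'rV[R]_k) 0 i <= (corner j + const_mx r) 0 i by rewrite lexx cle.
have Ft : F (corner j + const_mx r) - F (corner j) <= o.
  by apply: le_trans (ler_norm _) (Fd _ _ ct cc (dist _ _ bt bc)).
apply: (far_cell (p := corner j) (top := corner j + const_mx r) (kp := kp) (o := o)) => //.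
  by move=> x /s1P[].
have x0s : x0 \in s1 by rewrite /s1 E mem_head.
have [cx ex bx] := s1P x0 x0s.
have := Fd _ _ cx cc (dist _ _ bx bc).
have := ler_distD (F (corner j)) (F x0) 2^-1.
lra.
Qed.
Local Notation ev u w s := (fun t => has (fun x => (u < X (dl x) t - F x * (X one t - w))%R) s).

Lemma measurable_ev u w s : measurable_fun setT (ev u w s).
Proof. by apply: measurable_hasb => x; exact: measurable_bridge. Qed.

(** The tilt moves the level by the covariance with the points, and the conditioning value by the
    covariance with [one]. *)
Lemma tilt_has (e : V) (u w c1 c : R) (s : seq 'rV[R]_k) :
  (forall x, x \in s -> ip (dl x) e = c) -> ip one e = c1 ->
  (\int[P]_t ((expR (X e t - ip e e / 2))%:E * (ev u w s t)%:R%:E) = P [set t | ev (u - c) (w - c1) s t])%E.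
Proof.
move=> sc oc; pose phi (i : option 'rV[R]_k) := if i is Some x then dl x else one.
pose g (y : @path R (option 'rV[R]_k)) := has (fun x => u < y (Some x) - F x * (y None - w)) s.
have mg : measurable_fun setT g.
  apply: measurable_hasb => x; apply: measurable_fun_ltr => //; apply: measurable_funB; first exact: measurable_coord.
  by apply: measurable_funM => //; apply: measurable_funB => //; exact: measurable_coord.
have := @gX_tilt R V d T P X _ phi e (fun y => (g y)%:R%:E) (measurable_nat_bool mg) (fun y => _).
move=> /(_ (fun y => ltac:(by rewrite lee_fin)))/esym ->.
rewrite -(integral_bool P (measurable_ev (u - c) (w - c1) s)); apply: eq_integral => t _.
congr (nat_of_bool _)%:R%:E; rewrite /g; apply: eq_in_has => x xs /=.
by rewrite sc // oc; apply/idP/idP => h; lra.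
Qed.

(** nu is noise seen by s' and not by s. Since exp y or exp (-y) is at least 1 for y = l X nu, the
    joint event is bounded by the first event tilted along nu plus the second tilted the other way.
    The first tilt only lowers w; the second raises w and also the level of s'. *)
Lemma pair_split (nu : V) (u w l rho : R) (s s' : seq 'rV[R]_k) :
  (forall x, x \in s -> ip (dl x) nu = 0) -> (forall x, x \in s' -> ip (dl x) nu = rho) ->
  ip one nu = rho -> ip nu nu = rho ->
  (P [set t | ev u w s t && ev u w s' t] <= (expR (l ^+ 2 * rho / 2))%:E *
    (P [set t | ev u (w - l * rho) s t] + P [set t | ev (u + l * rho) (w + l * rho) s' t]))%E.
Proof.
move=> s0 s1 o1 n1.
have A0 : (\int[P]_t ((expR (X (l *: nu) t - ip (l *: nu) (l *: nu) / 2))%:E * (ev u w s t)%:R%:E) = P [set t | ev u (w - l * rho) s t])%E.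
  rewrite (@tilt_has (l *: nu) u w (l * rho) 0 s); last by rewrite gipZr o1.
    by rewrite subr0.
  by move=> x xs; rewrite gipZr s0 // mulr0.
have A1 : (\int[P]_t ((expR (X (- l *: nu) t - ip (- l *: nu) (- l *: nu) / 2))%:E * (ev u w s' t)%:R%:E) = P [set t | ev (u + l * rho) (w + l * rho) s' t])%E.
  rewrite (@tilt_has (- l *: nu) u w (- l * rho) (- l * rho) s'); last by rewrite gipZr o1.
    by rewrite mulNr !opprK.
  by move=> x xs; rewrite gipZr s1.
have me e : measurable_fun setT (fun t => (expR (X e t - ip e e / 2))%:E : \bar R).
  apply/measurable_EFinP; apply: measurable_expRf.
  by apply: measurable_funB => //; exact: gX_meas.
have mm e u' w' s'' : measurable_fun setT (fun t => (expR (X e t - ip e e / 2))%:E * (ev u' w' s'' t)%:R%:E : \bar R)%E.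
  by apply: emeasurable_funM => //; apply: measurable_nat_bool; exact: measurable_ev.
have ma : measurable_fun setT (fun t => ev u w s t && ev u w s' t) by apply: measurable_and; exact: measurable_ev.
have nn e u' w' s'' t : (0 <= (expR (X e t - ip e e / 2))%:E * (ev u' w' s'' t)%:R%:E)%E.
  by rewrite mule_ge0 // lee_fin expR_ge0.
rewrite -A0 -A1 -int_D // -int_Zl ?expR_ge0 //; first last.
- by move=> t; rewrite adde_ge0.
- by apply: emeasurable_funD.
rewrite -(integral_bool P ma); apply: int_le.
- exact: measurable_nat_bool.
- by apply: measurable_funeM; apply: emeasurable_funD.
- by move=> t; rewrite lee_fin.
move=> t; apply: (@le_trans _ _ ((expR (l ^+ 2 * rho / 2) *
   (expR (X (l *: nu) t - ip (l *: nu) (l *: nu) / 2) * (ev u w s t)%:R +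
    expR (X (- l *: nu) t - ip (- l *: nu) (- l *: nu) / 2) * (ev u w s' t)%:R))%R%:E)); last by rewrite EFinM EFinD !EFinM.
rewrite !gXZ !gipE n1 lee_fin.
have E0 : 0 < expR (l ^+ 2 * rho / 2) by exact: expR_gt0.
have [/=|_] := boolP (ev u w s t); last by rewrite mulr_ge0 // ?addr_ge0 ?mulr_ge0 ?expR_ge0 // ltW.
have [/= _ _|_ _] := boolP (ev u w s' t); last by rewrite mulr_ge0 // ?addr_ge0 ?mulr_ge0 ?expR_ge0 // ltW.
rewrite !mulr1 mulrDr -!expRD.
have -> : l ^+ 2 * rho / 2 + (l * X nu t - l * (l * rho) / 2) = l * X nu t by field.
have -> : l ^+ 2 * rho / 2 + (- l * X nu t - - l * (- l * rho) / 2) = - (l * X nu t) by field.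
have [h|h] := leP 0 (l * X nu t).
  have : 1 <= expR (l * X nu t) by rewrite -expR0 ler_expR.
  have := expR_ge0 (- (l * X nu t)); lra.
have : 1 <= expR (- (l * X nu t)) by rewrite -expR0 ler_expR; lra.
have := expR_ge0 (l * X nu t); lra.
Qed.

(* The choice l = 2u balances the two tilts: each of them gains exp(-2 u^2 rho). *)
Lemma pair_bound (nu : V) (u w rho C : R) (s s' : seq 'rV[R]_k) : 0 <= u ->
  (forall x, x \in s -> ip (dl x) nu = 0) -> (forall x, x \in s' -> ip (dl x) nu = rho) ->
  ip one nu = rho -> ip nu nu = rho -> 0 <= C ->
  (forall (u' w' : R) s'', (s'' = s /\ u' = u /\ w' = w - 2 * u * rho \/ s'' = s' /\ u' = u + 2 * u * rho /\ w' = w + 2 * u * rho)%R ->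
     P [set t | ev u' w' s'' t] <= (C * expR (- 2 * u' ^+ 2 + 2 * u' * w'))%:E)%E ->
  (P [set t | ev u w s t && ev u w s' t] <=
    (2 * C * expR (- 2 * u ^+ 2 + 2 * u * w) * expR (- 2 * u ^+ 2 * rho + 4 * u * rho * `|w|))%:E)%E.
Proof.
move=> u0 s0 s1 o1 n1 C0 H.
have r0 : 0 <= rho by rewrite -n1 gip_ge0.
apply: (le_trans (@pair_split nu u w (2 * u) rho s s' s0 s1 o1 n1)).
have H1 := H u (w - 2 * u * rho) s (or_introl _ (conj erefl (conj erefl erefl))).
have H2 := H (u + 2 * u * rho) (w + 2 * u * rho) s' (or_intror _ (conj erefl (conj erefl erefl))).
apply: (le_trans (lee_wpmul2l _ (leeD H1 H2))); first by rewrite lee_fin expR_ge0.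
rewrite -EFinD -EFinM lee_fin -mulrDr mulrCA mulrDr -!expRD.
set E1 := expR _; set E2 := expR _; set E3 := expR _; set E4 := expR _.
have h1 : E1 <= E3 * E4.
  rewrite -expRD ler_expR.
  have -> : (2 * u) ^+ 2 * rho / 2 + (- 2 * u ^+ 2 + 2 * u * (w - 2 * u * rho)) = - 2 * u ^+ 2 + 2 * u * w - 2 * u ^+ 2 * rho by field.
  have : 0 <= 4 * u * rho * `|w| by rewrite !mulr_ge0.
  lra.
have h2 : E2 <= E3 * E4.
  rewrite -expRD ler_expR.
  have -> : (2 * u) ^+ 2 * rho / 2 + (- 2 * (u + 2 * u * rho) ^+ 2 + 2 * (u + 2 * u * rho) * (w + 2 * u * rho)) =
     - 2 * u ^+ 2 + 2 * u * w - 2 * u ^+ 2 * rho + 4 * u * rho * w by field.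
  have : 4 * u * rho * w <= 4 * u * rho * `|w| by rewrite ler_wpM2l ?ler_norm // !mulr_ge0.
  lra.
have : C * (E1 + E2) <= C * (E3 * E4 + E3 * E4) by rewrite ler_wpM2l // lerD.
have -> : 2 * C * E3 * E4 = C * (E3 * E4 + E3 * E4) by ring.
by [].
Qed.
End bridge_tails.

(** * Slabs that separate two blocks *)

Section slab.
Context {R : realType} (m : nat).
Variables (mu : probability (g_sigma_algebraType (@orthants R m.+1)) R) (F : 'rV[R]_m.+1 -> R).
Hypothesis HF : is_cdf_on_cube mu F.
Context (V : lmodType R) d (T : measurableType d) (P : probability T R) (X : gfield V P) (dl : 'rV[R]_m.+1 -> V).
Hypothesis ipd : forall x y, cube m.+1 x -> cube m.+1 y -> gip X (dl x) (dl y) = F (rmin x y).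
Local Notation ip := (gip X).
Variables (p : 'rV[R]_m.+1) (j : 'I_m.+1) (c : R).
Hypotheses (cp : cube m.+1 p) (c0 : 0 <= c) (cj : c <= p 0 j).
Local Notation nu := (dl p - dl (setc j c p)).

Lemma setc_le i : setc j c p 0 i <= p 0 i.
Proof. by rewrite mxE; case: eqP => [->|]. Qed.

Lemma setc_cube : cube m.+1 (setc j c p).
Proof.
move=> i; have /andP[h1 h2] := cp i; rewrite (le_trans (setc_le i) h2) andbT mxE.
by case: eqP.
Qed.

(** [nu] is the noise of the slab between c and p 0 j in direction j: invisible to points below c,
    and seen in full by points above p. This is what [pair_split] asks of its vector. *)
Lemma slab_ip0 x : cube m.+1 x -> x 0 j <= c -> ip (dl x) nu = 0.
Proof.
move=> cx xc; have E : rmin x (setc j c p) = rmin x p.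
  apply/rowP => i; rewrite !mxE; case: eqP => [->|//].
  by rewrite !min_l // (le_trans xc).
by rewrite gipBr (ipd cx cp) (ipd cx setc_cube) E subrr.
Qed.

Lemma slab_ip x : cube m.+1 x -> (forall i, p 0 i <= x 0 i) -> ip (dl x) nu = F p - F (setc j c p).
Proof.
move=> cx px; rewrite gipBr ![ip (dl x) _]gip_sym !(ipd_le ipd) //; try exact: setc_cube.
by move=> i; exact: le_trans (setc_le i) (px i).
Qed.

Lemma slab_one : ip (dl (ones m.+1)) nu = F p - F (setc j c p).
Proof. by apply: slab_ip; [exact: cube_ones|move=> i; rewrite mxE; have /andP[] := cp i]. Qed.

Lemma slab_self : ip nu nu = F p - F (setc j c p).
Proof. by rewrite [LHS]gipBl slab_ip // slab_ip0 ?subr0 //; [exact: setc_cube|rewrite mxE eqxx]. Qed.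
End slab.

(** * Sums over the lattice of cells *)

Section lattice_sums.
Context {R : realType}.
Implicit Types (x : R).

Lemma geo_le2 x N : 0 <= x <= 2^-1 -> \sum_(j < N) x ^+ j <= 2.
Proof.
move=> /andP[x0 x1]; elim: N => [|N IH]; first by rewrite big_ord0.
rewrite big_ord_recl expr0; under eq_bigr do rewrite exprS.
rewrite -mulr_sumr; have : x * \sum_(j < N) x ^+ j <= 2^-1 * 2.
  by apply: ler_pM => //; apply: sumr_ge0 => i _; exact: exprn_ge0.
by rewrite mulVf //; lra.
Qed.

(** The term - x^c makes the induction on the centre c close, because 2 x^(c+1) <= x^c. *)
Lemma geo_dist x N c : 0 <= x <= 2^-1 -> \sum_(j < N) x ^+ ((j - c) + (c - j)) <= 3 - x ^+ c.
Proof.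
move=> hx; have /andP[x0 x1] := hx; elim: c N => [|c IH] N.
  under eq_bigr do rewrite subn0 sub0n addn0.
  by apply: le_trans (geo_le2 N hx) _; rewrite expr0; lra.
have xc : 0 <= x ^+ c by exact: exprn_ge0.
have xx : x ^+ c.+1 <= x ^+ c / 2 by rewrite exprS mulrC; apply: ler_wpM2l.
case: N => [|N]; first by rewrite big_ord0 subr_ge0; apply: (@le_trans _ _ 1); [rewrite exprn_ile1 //; lra|lra].
rewrite big_ord_recl /= sub0n subn0 add0n.
under eq_bigr do rewrite /bump /= add1n !subSS.
have := IH N; lra.
Qed.

Lemma lattice_sum m N x (c : {ffun 'I_m -> 'I_N}) : 0 <= x <= 2^-1 ->
  \sum_(j : {ffun 'I_m -> 'I_N}) x ^+ (\sum_i ((j i - c i) + (c i - j i)))%N <= 3 ^+ m.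
Proof.
move=> hx; have /andP[x0 _] := hx.
have E (j : {ffun 'I_m -> 'I_N}) : x ^+ (\sum_i ((j i - c i) + (c i - j i)))%N = \prod_i x ^+ ((j i - c i) + (c i - j i)).
  by elim/big_rec2: _ => [|i y z _ <-]; rewrite ?expr0 // exprD.
under eq_bigr do rewrite E.
rewrite -(bigA_distr_bigA (fun i (j : 'I_N) => x ^+ ((j - c i) + (c i - j)))) /=.
have -> : (3 ^+ m = \prod_(i < m) 3 :> R) by rewrite prodr_const card_ord.
apply: ler_prod => i _; apply/andP; split; first by apply: sumr_ge0 => j _; exact: exprn_ge0.
by apply: le_trans (geo_dist N (c i) hx) _; rewrite gerBl exprn_ge0.
Qed.

(** A largest coordinate gap controls the total distance up to a factor m: the estimate for a pair
    uses one coordinate, the summation over the lattice uses all. *)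
Lemma max_dist m N (c c' : {ffun 'I_m -> 'I_N}) : c != c' ->
  exists i, (0 < (c' i - c i) + (c i - c' i))%N /\ (\sum_i ((c' i - c i) + (c i - c' i)) <= m * ((c' i - c i) + (c i - c' i)))%N.
Proof.
move=> cc; pose f i := ((c' i - c i) + (c i - c' i))%N.
have [i0 fi0] : exists i, (0 < f i)%N.
  have [/existsP //|/existsPn h] := boolP [exists i, (0 < f i)%N].
  exfalso; move/negP: cc; apply; apply/eqP/ffunP => i; have := h i; rewrite -leqNgt leqn0 addn_eq0 !subn_eq0 => /andP[h1 h2].
  by apply/val_inj/eqP; rewrite eqn_leq h2 h1.
case: (@arg_maxnP _ i0 xpredT f isT) => i _ fm.
exists i; split; first by apply: leq_trans fi0 (fm i0 isT).
apply: (@leq_trans (\sum_(j < m) f i)); first by apply: leq_sum => j _; exact: fm.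
by rewrite sum_nat_const card_ord.
Qed.
End lattice_sums.

(** * Compactness of the cube in the 1-norm *)

Section norm1_theory.
Context {R : realType} (k : nat).
Implicit Types x y z p : 'rV[R]_k.

Lemma norm1_coord x i : `|x 0 i| <= norm1 x.
Proof. by rewrite /norm1 (bigD1 i) //= lerDl sumr_ge0. Qed.

Lemma norm1_tri x y z : norm1 (x - z) <= norm1 (x - y) + norm1 (y - z).
Proof.
rewrite /norm1 -big_split; apply: ler_sum => i _; rewrite !mxE.
have -> : x 0 i - z 0 i = (x 0 i - y 0 i) + (y 0 i - z 0 i) by ring.
exact: ler_normD.
Qed.

Lemma norm1C x y : norm1 (x - y) = norm1 (y - x).
Proof. by apply: eq_bigr => i _; rewrite !mxE distrC. Qed.

Lemma norm1_0 x : norm1 (x - x) = 0.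
Proof. by rewrite subrr /norm1 big1 // => i _; rewrite mxE normr0. Qed.

Lemma nbhs_norm1 p (A : set 'rV[R]_k) : nbhs p A <-> exists2 e : R, 0 < e & forall x, norm1 (x - p) <= e -> A x.
Proof.
split=> [/nbhs_ballP[e /= e0 H]|[e e0 H]].
  exists (e / 2); first by rewrite divr_gt0.
  move=> x xp; apply: H; split=> // i j; rewrite ord1; apply: (@le_lt_trans _ _ (e / 2)); last lra.
  by apply: le_trans xp; have := norm1_coord (x - p) j; rewrite !mxE distrC.
apply/nbhs_ballP; exists (e / k.+1%:R); first by rewrite /= divr_gt0.
move=> x px; apply: H; apply: (@le_trans _ _ (k%:R * (e / k.+1%:R))).
  apply: norm1_le => i; rewrite !mxE distrC; apply: ltW; exact: (px.2 0 i).
by rewrite mulrCA ger_pMr // ler_pdivrMr ?ltr0n // mul1r ler_nat.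
Qed.

Lemma compact_cube : compact (cube k : set 'rV[R]_k).
Proof.
suff -> : cube k = [set v : 'rV[R]_k | forall i, `[0, 1]%classic (v ord0 i)].
  exact: (@rV_compact R k (fun=> `[0, 1]%classic) (fun _ => @segment_compact R 0 1)).
apply/seteqP; split => x H i; first by rewrite /= in_itv /=; exact: H.
by have := H i; rewrite /= in_itv.
Qed.

(** Compactness in the form used below: near each point the property holds for all small e', so a
    single e serves the whole cube. *)
Lemma cube_uniform (Q : R -> 'rV[R]_k -> Prop) :
  (forall p, cube k p -> exists2 e, 0 < e & forall x e', cube k x -> norm1 (x - p) <= e -> 0 < e' -> e' <= e -> Q e' x) ->
  exists2 e, 0 < e & forall x, cube k x -> Q e x.
Proof.
move=> H; have /compact_near_coveringP cov := compact_cube.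
have := cov R (0^'+) (fun e x => cube k x -> Q e x) _ _.
case.
  move=> p cp; have [e e0 He] := H p cp.
  exists ([set x | norm1 (x - p) <= e], [set e' | 0 < e' /\ e' <= e]).
    split; first by apply/nbhs_norm1; exists e.
    near=> e'; split; [near: e'; exact: nbhs_right_gt|near: e'; exact: nbhs_right_le].
  by move=> [x e'] [/= xp [e'0 e'e]] cx; exact: He.
move=> e /= e0 He; exists (e / 2); first by rewrite divr_gt0.
move=> x cx; apply: (He (e / 2)) => //=; last by rewrite divr_gt0.
by rewrite sub0r normrN gtr0_norm ?divr_gt0 //; lra.
Unshelve. all: by end_near.
Qed.

Section continuous_on_cube.
Variable f : 'rV[R]_k -> R.
Hypothesis fc : {within cube k, continuous f}.

Lemma cube_cont p (eta : R) : cube k p -> 0 < eta ->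
  exists2 e : R, 0 < e & forall x, cube k x -> norm1 (x - p) <= e -> `|f x - f p| <= eta.
Proof.
move=> cp eta0; have /subspace_continuousP/(_ p cp) := fc.
move=> /cvgrPdist_le/(_ eta eta0) /nbhs_norm1[e e0 He]; exists e => // x cx xp.
by rewrite distrC; exact: He.
Qed.

Lemma cube_unif_cont (eta : R) : 0 < eta ->
  exists2 e : R, 0 < e & forall x y, cube k x -> cube k y -> norm1 (x - y) <= e -> `|f x - f y| <= eta.
Proof.
move=> eta0; have [|e e0 He] := @cube_uniform (fun e x => forall y, cube k y -> norm1 (x - y) <= e -> `|f x - f y| <= eta).
- move=> p cp; have [e e0 He] := cube_cont cp (divr_gt0 eta0 (ltr0Sn _ 1)).
  exists (e / 2); first by rewrite divr_gt0.
  move=> x e' cx xp e'0 e'e y cy xy.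
  have h1 := He x cx _; have h2 := He y cy _.
  have := h1 ltac:(lra); have : norm1 (y - p) <= e by apply: le_trans (norm1_tri y x p) _; rewrite norm1C; lra.
  by move=> /h2; have := ler_distD (f p) (f x) (f y); rewrite (distrC (f p) (f y)); lra.
by exists e => // x y cx cy xy; exact: He.
Qed.

Lemma cube_pos_lb : (forall x, cube k x -> 0 < f x) -> exists2 c : R, 0 < c & forall x, cube k x -> c <= f x.
Proof.
move=> f0; apply: (@cube_uniform (fun e x => e <= f x)) => p cp.
have fp := f0 p cp; have [e e0 He] := cube_cont cp (divr_gt0 fp (ltr0Sn _ 1)).
exists (Num.min e (f p / 2)); first by rewrite lt_min e0 divr_gt0.
move=> x e' cx; rewrite !le_min => /andP[xe _] _ /andP[_ h].
by have := He x cx xe; rewrite ler_norml => /andP[h1 _]; lra.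
Qed.

(** The bound is an inverse because [cube_uniform] produces small numbers. *)
Lemma cube_ub : exists2 c : R, 0 < c & forall x, cube k x -> f x <= c^-1.
Proof.
apply: (@cube_uniform (fun e x => f x <= e^-1)) => p cp.
have [e e0 He] := cube_cont cp ltr01.
have B0 : 0 < `|f p| + 1 by have := normr_ge0 (f p); lra.
exists (Num.min e (`|f p| + 1)^-1); first by rewrite lt_min e0 invr_gt0.
move=> x e' cx; rewrite !le_min => /andP[xe _] e'0 /andP[_ h].
apply: (@le_trans _ _ (`|f p| + 1)); last by rewrite -[leLHS]invrK lef_pV2 ?posrE ?invr_gt0.
have := He x cx xe; rewrite ler_norml => /andP[_ h1].
by have := ler_norm (f p); lra.
Qed.
End continuous_on_cube.
End norm1_theory.

Section finite_choice.
Context {R : realType}.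

Lemma fin_common (I : finType) (Q : I -> R -> Prop) : (forall i e e', 0 < e' -> e' <= e -> Q i e -> Q i e') ->
  (forall i, exists2 e, 0 < e & Q i e) -> exists2 e, 0 < e & forall i, Q i e.
Proof.
move=> mono H; pose f i := sval (cid2 (H i)).
have f0 i : 0 < f i by rewrite /f; case: cid2.
have fQ i : Q i (f i) by rewrite /f; case: cid2.
have s0 : 0 <= \sum_i (f i)^-1 by apply: sumr_ge0 => i _; rewrite invr_ge0 ltW.
have p0 : 0 < 1 + \sum_i (f i)^-1 by lra.
exists (1 + \sum_i (f i)^-1)^-1; first by rewrite invr_gt0.
move=> i; apply: mono (fQ i); first by rewrite invr_gt0.
rewrite -[leRHS]invrK lef_pV2 ?posrE ?invr_gt0 //.
rewrite (bigD1 i) //=; have : 0 <= \sum_(j | j != i) (f j)^-1 by apply: sumr_ge0 => j _; rewrite invr_ge0 ltW.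
lra.
Qed.

(** The left side is a polynomial in e, continuous at 0. *)
Lemma prod_enlarge (m : nat) (x : 'I_m -> R) (eta : R) : 0 < eta ->
  exists2 e : R, 0 < e & \prod_i (x i + 2 * e) <= \prod_i x i + eta.
Proof.
move=> eta0; pose p : {poly R} := \prod_i ((x i)%:P + 2 *: 'X).
have pE e : p.[e] = \prod_i (x i + 2 * e).
  by rewrite horner_prod; apply: eq_bigr => i _; rewrite !hornerE.
have pc : {for 0, continuous (fun e : R => p.[e])} by exact: continuous_horner.
have /nbhs_ballP[e /= e0 He] : \forall e \near (0 : R), `|p.[0] - p.[e]| <= eta by exact: (cvgrPdist_le _ _).1 pc eta eta0.
exists (e / 2); first by rewrite divr_gt0.
have /= := He (e / 2); rewrite /ball /= sub0r normrN gtr0_norm ?divr_gt0 // => /(_ ltac:(lra)).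
rewrite !pE distrC => /(le_trans (ler_norm _)).
rewrite (_ : \prod_i (x i + 2 * 0) = \prod_i x i); last by apply: eq_bigr => i _; rewrite mulr0 addr0.
lra.
Qed.
End finite_choice.

(** The case x = y, excluded from the supremum, is trivial. *)
Lemma lin_errP {R : realType} k (F : 'rV[R]_k -> R) (a : 'I_k -> 'rV[R]_k -> R) (D : set 'rV[R]_k) (eps : R) :
  lin_err F a D delta @[delta --> 0^'+] --> 0%E -> 0 < eps ->
  exists2 dd : R, 0 < dd & forall z x y, D z -> cube k x -> cube k y -> norm1 (x - z) <= dd -> norm1 (y - z) <= dd ->
    `|F x - F y - \sum_(i < k) a i z * (x 0 i - y 0 i)| <= eps * norm1 (x - y).
Proof.
move=> H eps0.
have : nbhs (0%E : \bar R) [set y | (y < eps%:E)%E] by apply: open_nbhs_nbhs; split; [exact: open_ereal_lt_ereal|rewrite /= lte_fin].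
move=> /H /= [dd /= dd0 Hd]; exists (dd / 2); first by rewrite divr_gt0.
move=> z x y Dz cx cy xz yz.
have [->|xy] := eqVneq x y.
  rewrite norm1_0 mulr0 subrr sub0r normrN big1 ?normr0 // => i _.
  by rewrite subrr mulr0.
have n0 : 0 < norm1 (x - y).
  rewrite lt_neqAle norm1_ge0 andbT eq_sym; apply: contra xy => /eqP n0; apply/eqP/rowP => i.
  have := norm1_coord (x - y) i; rewrite n0 normr_le0 !mxE subr_eq0 => /eqP //.
have : (lin_err F a D (dd / 2) < eps%:E)%E.
  by apply: (Hd (dd / 2)); rewrite /= ?divr_gt0 // sub0r normrN gtr0_norm ?divr_gt0 //; lra.
move=> /(le_lt_trans (ereal_sup_ubound _)) => /(_ ((`|F x - F y - \sum_(i < k) a i z * (x 0 i - y 0 i)|) / norm1 (x - y))%:E).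
rewrite lte_fin ltr_pdivrMr // => h; apply/ltW/h.
by exists z, x, y; do !split.
Qed.

Section ext_norm.
Context {R : realType} (m : nat).
Implicit Types (x y : 'rV[R]_m) (z : 'rV[R]_m.+1).

Definition low z : 'rV[R]_m := \row_i z 0 (lift ord_max i).

Lemma low_ext x (t : R) : low (ext x t) = x.
Proof. by apply/rowP => i; rewrite mxE ext_lift. Qed.

Lemma norm1_ext x y (s t : R) : norm1 (ext x s - ext y t) = norm1 (x - y) + `|s - t|.
Proof.
rewrite /norm1 sum_lift; congr (_ + _); last by rewrite !mxE unlift_none.
by apply: eq_bigr => i _; rewrite !mxE liftK.
Qed.

Lemma norm1_low z z' : norm1 (low z - low z') <= norm1 (z - z').
Proof.
rewrite [leRHS]/norm1 sum_lift /norm1 (eq_bigr (fun i => `|(z - z') 0 (lift ord_max i)|)); first by rewrite lerDl.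
by move=> i _; rewrite !mxE.
Qed.

Lemma cube_ext x (t : R) : cube m x -> 0 <= t <= 1 -> cube m.+1 (ext x t).
Proof.
move=> cx ht i; case: (unliftP ord_max i) => [j ->|->]; [by rewrite ext_lift; exact: cx|by rewrite ext_max].
Qed.
End ext_norm.

(** * Geometry of the level set D *)

Section level_set.
Context {R : realType} (m : nat).
Hypothesis m0 : (0 < m)%N.
Variables (mu : probability (g_sigma_algebraType (@orthants R m.+1)) R) (F : 'rV[R]_m.+1 -> R).
Hypothesis HF : is_cdf_on_cube mu F.
Hypothesis Fcont : {within cube m.+1, continuous F}.
Variables (L : set 'rV[R]_m) (h : 'rV[R]_m -> R).
Hypothesis HL : L `<=` cube m.
Hypothesis HD : [set ext xt (h xt) | xt in L] = [set x | cube m.+1 x /\ F x = 2^-1].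
Variables (a : 'I_m.+1 -> 'rV[R]_m.+1 -> R) (amin amax : R).
Hypothesis amin0 : 0 < amin.
Hypothesis abd : forall i x, cube m.+1 x -> amin <= a i x <= amax.
Hypothesis lin : forall eps : R, 0 < eps -> exists2 dd : R, 0 < dd & forall z x y, [set ext xt (h xt) | xt in L] z ->
  cube m.+1 x -> cube m.+1 y -> norm1 (x - z) <= dd -> norm1 (y - z) <= dd ->
    `|F x - F y - \sum_(i < m.+1) a i z * (x 0 i - y 0 i)| <= eps * norm1 (x - y).
Local Notation pth x := (ext x (h x)).

Lemma levelP x : L x -> cube m.+1 (pth x) /\ F (pth x) = 2^-1.
Proof. by move=> Lx; have : [set ext xt (h xt) | xt in L] (pth x) by [exists x]; rewrite HD. Qed.

Lemma level01 x : L x -> 0 <= h x <= 1.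
Proof. by move=> /levelP[/(_ ord_max)]; rewrite ext_max. Qed.

Lemma level_near (dd : R) : 0 < dd -> exists2 e : R, 0 < e &
  forall x, cube m.+1 x -> `|F x - 2^-1| < e -> exists2 z, L z & norm1 (x - pth z) <= dd.
Proof.
move=> dd0; apply: (@cube_uniform _ _ (fun e x => `|F x - 2^-1| < e -> exists2 z, L z & norm1 (x - pth z) <= dd)).
move=> p cp; have [Fp|Fp] := eqVneq (F p) 2^-1.
  exists dd => // x e' cx xp _ _ _.
  have : [set ext xt (h xt) | xt in L] p by rewrite HD.
  by case=> z Lz zp; exists z => //; rewrite zp.
have F0 : 0 < `|F p - 2^-1| by rewrite normr_gt0 subr_eq0.
have [e e0 He] := cube_cont Fcont cp (divr_gt0 F0 (ltr0Sn _ 1)).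
exists (Num.min e (`|F p - 2^-1| / 2)); first by rewrite lt_min e0 divr_gt0.
move=> x e' cx; rewrite !le_min => /andP[xp _] _ /andP[_ e'h] h1; exfalso.
have := He x cx xp; have := ler_distD (F x) (F p) 2^-1; rewrite (distrC (F p) (F x)); lra.
Qed.

(** At height t above the surface over x, F exceeds 1/2 by at least amin t / 2. If h y were larger
    than h x + th, monotonicity would keep F at most 1/2 at that height over y, against the uniform
    continuity of F. The modulus is therefore valid on all of L. *)
Lemma h_unif_half (th : R) : 0 < th -> exists2 dd : R, 0 < dd &
  forall x y, L x -> L y -> norm1 (x - y) <= dd -> h y <= h x + th.
Proof.
move=> th0; have [d1 d10 H1] := lin (divr_gt0 amin0 (ltr0Sn _ 1)).
pose t := Num.min th d1; have t0 : 0 < t by rewrite lt_min th0.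
have td : t <= d1 by rewrite ge_min lexx orbT.
have tth : t <= th by rewrite ge_min lexx.
have c0 : 0 < amin * t / 4 by rewrite divr_gt0 // mulr_gt0.
have [dd dd0 Hd] := cube_unif_cont Fcont c0; exists dd => // x y Lx Ly xy.
rewrite leNgt; apply/negP => hxy.
have /andP[hx0 hx1] := level01 Lx; have /andP[hy0 hy1] := level01 Ly.
have c1 : cube m.+1 (ext x (h x + t)) by apply: cube_ext; [exact: HL|apply/andP; split; lra].
have c2 : cube m.+1 (ext y (h x + t)) by apply: cube_ext; [exact: HL|apply/andP; split; lra].
have [cx Fx] := levelP Lx; have [cy Fy] := levelP Ly.
have Lz : [set ext xt (h xt) | xt in L] (pth x) by exists x.
have := H1 _ _ _ Lz c1 cx; rewrite !norm1_ext !norm1_0 !add0r subrr normr0.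
have -> : h x + t - h x = t by ring.
rewrite gtr0_norm // => /(_ td (ltW d10)).
rewrite sum_lift big1 ?add0r; last by move=> i _; rewrite !ext_lift subrr mulr0.
rewrite !ext_max; have -> : h x + t - h x = t by ring.
rewrite Fx ler_norml => /andP[l1 _].
have /andP[am _] := abd ord_max cx.
have amt : amin * t <= a ord_max (pth x) * t by rewrite ler_wpM2r // ltW.
have : F (ext y (h x + t)) <= F (pth y).
  apply: (cdf_le HF c2 cy) => i; case: (unliftP ord_max i) => [j ->|->]; first by rewrite !ext_lift.
  by rewrite !ext_max; lra.
have := Hd _ _ c1 c2; rewrite norm1_ext subrr normr0 addr0 => /(_ xy); rewrite ler_norml => /andP[_ l2].
have : 0 < amin * t by rewrite mulr_gt0.
rewrite Fy; lra.
Qed.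

Lemma h_unif (th : R) : 0 < th -> exists2 dd : R, 0 < dd &
  forall x y, L x -> L y -> norm1 (x - y) <= dd -> `|h x - h y| <= th.
Proof.
move=> /h_unif_half[dd dd0 H]; exists dd => // x y Lx Ly xy.
have h1 := H x y Lx Ly xy; have h2 := H y x Ly Lx; rewrite norm1C in h2; have := h2 xy.
by rewrite ler_norml => h3; apply/andP; split; lra.
Qed.

(** If h x were below th, a step e1 in the first coordinate would put F above 1/2 already at height
    0, and the surface could not continue there; the opposite step excludes heights close to 1. The
    choice of th makes amax th an eighth of amin e1. *)
Lemma h_window (e : R) : 0 < e -> exists2 th : R, 0 < th &
  forall x, (forall y, norm1 (y - x) <= e -> L y) -> th <= h x <= 1 - th.
Proof.
move=> e0; have [d1 d10 H1] := lin (divr_gt0 amin0 (ltr0Sn _ 1)).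
have [amx amn] : 0 < amax /\ amin <= amax.
  have : cube m.+1 (ones m.+1 : 'rV[R]_m.+1) by exact: cube_ones.
  by move=> /(abd ord_max)/andP[h1 h2]; split; [exact: lt_le_trans amin0 (le_trans h1 h2)|exact: le_trans h1 h2].
pose e1 := Num.min e (d1 / 2); have e10 : 0 < e1 by rewrite lt_min e0 divr_gt0.
have e1e : e1 <= e by rewrite ge_min lexx.
have e1d : e1 <= d1 / 2 by rewrite ge_min lexx orbT.
pose th := amin * e1 / (8 * amax); have th0 : 0 < th by rewrite divr_gt0 // mulr_gt0.
have thE : 8 * (amax * th) = amin * e1 by rewrite /th; field; rewrite gt_eqF.
have the : th <= e1 / 8.
  rewrite /th ler_pdivrMr ?mulr_gt0 //.
  have -> : e1 / 8 * (8 * amax) = amax * e1 by field.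
  by rewrite ler_wpM2r // ltW.
exists th => // x Hx.
have Lx : L x by apply: Hx; rewrite norm1_0 ltW.
have /andP[hx0 hx1] := level01 Lx; have [cx Fx] := levelP Lx.
have Lz : [set ext xt (h xt) | xt in L] (pth x) by exists x.
pose i0 := Ordinal m0.
pose mv (s : R) : 'rV[R]_m := \row_i (if i == i0 then x 0 i + s else x 0 i).
have mvn s : norm1 (mv s - x) = `|s|.
  rewrite /norm1 (bigD1 i0) //= big1 ?addr0; first by rewrite !mxE eqxx; congr `|_|; ring.
  by move=> i /negbTE ii; rewrite !mxE ii subrr normr0.
have key s t : `|s| = e1 -> 0 <= t <= 1 -> `|t - h x| <= th ->
    F (ext (mv s) t) - 2^-1 - (a (lift ord_max i0) (pth x) * s + a ord_max (pth x) * (t - h x)) <= amin / 2 * (e1 + `|t - h x|)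
    /\ - (amin / 2 * (e1 + `|t - h x|)) <= F (ext (mv s) t) - 2^-1 - (a (lift ord_max i0) (pth x) * s + a ord_max (pth x) * (t - h x)).
  move=> se t01 tth; have Lm : L (mv s) by apply: Hx; rewrite mvn se.
  have cm : cube m.+1 (ext (mv s) t) by apply: cube_ext => //; exact: HL.
  have := H1 _ _ _ Lz cm cx; rewrite !norm1_ext mvn se norm1_0 subrr normr0 addr0.
  move=> /(_ ltac:(lra) (ltW d10)); rewrite sum_lift Fx.
  rewrite (bigD1 i0) //= big1 ?addr0; last by move=> i /negbTE ii; rewrite !ext_lift mxE ii subrr mulr0.
  rewrite !ext_lift !ext_max mxE eqxx (_ : x 0 i0 + s - x 0 i0 = s); last by ring.
  by rewrite ler_norml => /andP[? ?]; split.
have lev s : `|s| = e1 -> F (pth (mv s)) = 2^-1 /\ cube m (mv s) /\ 0 <= h (mv s) <= 1.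
  move=> se; have Lm : L (mv s) by apply: Hx; rewrite mvn se.
  by have [_ ?] := levelP Lm; split=> //; split; [exact: HL|exact: level01].
have /andP[a1 _] := abd (lift ord_max i0) cx; have /andP[_ a2] := abd ord_max cx.
have pa : amin * e1 <= a (lift ord_max i0) (pth x) * e1 by rewrite ler_wpM2r // ltW.
have pb s : 0 <= s <= th -> a ord_max (pth x) * s <= amax * th /\ amin * s <= amax * th.
  have am0 : 0 <= a ord_max (pth x) by have /andP[q _] := abd ord_max cx; exact: le_trans (ltW amin0) q.
  by move=> /andP[s0 s1]; split; apply: ler_pM => //; exact: ltW amin0.
have pp : 0 < amin * e1 by rewrite mulr_gt0.
have mono s t t' : cube m (mv s) -> 0 <= t -> t <= t' -> t' <= 1 -> F (ext (mv s) t) <= F (ext (mv s) t').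
  move=> cm t00 tt t11; apply: (cdf_le HF).
  - by apply: cube_ext => //; apply/andP; split; lra.
  - by apply: cube_ext => //; apply/andP; split; lra.
  - by move=> i; case: (unliftP ord_max i) => [j ->|->]; rewrite ?ext_lift ?ext_max.
apply/andP; split; rewrite leNgt; apply/negP => hth.
  have e1n : `|e1| = e1 by rewrite gtr0_norm.
  have hn : `|0 - h x| = h x by rewrite sub0r normrN ger0_norm.
  have [_] := key e1 0 e1n ltac:(by rewrite lexx ler01) ltac:(by rewrite hn ltW).
  have [Fm [cm /andP[hm0 hm1]]] := lev e1 e1n.
  have := mono e1 0 _ cm (lexx _) hm0 hm1; rewrite Fm hn.
  have [p1 p2] := pb (h x) ltac:(by rewrite hx0 ltW).
  rewrite sub0r mulrN mulrDr; lra.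
have e1n : `|- e1| = e1 by rewrite normrN gtr0_norm.
have hn : `|1 - h x| = 1 - h x by rewrite ger0_norm // subr_ge0.
have [K _] := key (- e1) 1 e1n ltac:(by rewrite ler01 lexx) ltac:(by rewrite hn; lra).
have [Fm [cm /andP[hm0 hm1]]] := lev (- e1) e1n.
have := mono (- e1) _ 1 cm hm0 hm1 (lexx _); rewrite Fm.
have [p1 p2] := pb (1 - h x) ltac:(apply/andP; split; lra).
by move: K; rewrite hn mulrN mulrDr; lra.
Qed.

(** The usable form of Jordan measurability: points of L that are not e-deep in L lie, with their
    e-balls, in finitely many boxes of small total volume. Boxes covering the boundary are enlarged,
    the j-th at a cost of eta / 2^(j+2). *)
Lemma level_cover (eta : R) : leb_outer (boundary L) = 0%E -> 0 < eta ->
  exists2 e : R, 0 < e & exists (n : nat) (A B : 'I_n -> 'rV[R]_m),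
    [/\ forall j i, A j 0 i <= B j 0 i, \sum_j rvol (A j) (B j) <= eta &
     forall x, L x -> (exists j, forall y, norm1 (y - x) <= e -> rbox (A j) (B j) y) \/
                      (forall y, norm1 (y - x) <= e -> L y)].
Proof.
move=> HdL eta0; have : (leb_outer (boundary L) < (eta / 2)%:E)%E by rewrite HdL lte_fin divr_gt0.
move=> /ereal_inf_lt[_ [al [bl [ab [cov ->]]]] sum_lt].
have enl j : exists2 e : R, 0 < e & \prod_i (bl j 0 i - al j 0 i + 2 * e) <= rvol (al j) (bl j) + eta / 2 / 2 ^+ j.+1.
  by apply: prod_enlarge; rewrite !divr_gt0 // exprn_gt0.
pose ee j := sval (cid2 (enl j)).
have ee0 j : 0 < ee j by rewrite /ee; case: cid2.
have eeP j : \prod_i (bl j 0 i - al j 0 i + 2 * ee j) <= rvol (al j) (bl j) + eta / 2 / 2 ^+ j.+1 by rewrite /ee; case: cid2.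
pose Al j : 'rV[R]_m := al j + const_mx (- ee j).
pose Bl j : 'rV[R]_m := bl j + const_mx (ee j).
(* The index of the box is bounded by 1 / e, so that a uniform e leaves only finitely many boxes. *)
have [|e e0 He] := @cube_uniform R m (fun e x => L x -> (exists2 j : nat, j%:R <= e^-1 & forall y, norm1 (y - x) <= e -> rbox (Al j) (Bl j) y) \/
                      (forall y, norm1 (y - x) <= e -> L y)).
- move=> p cp; have [/nbhs_norm1[e e0 He]|nint] := pselect (interior L p).
    exists (e / 2); first by rewrite divr_gt0.
    move=> x e' _ xp _ e'e _; right => y yx; apply: He.
    by apply: le_trans (norm1_tri y x p) _; lra.
  have [cl|ncl] := pselect (closure L p); last first.
    have [B nB HB] : exists2 B, nbhs p B & forall x, L x -> B x -> False.
      apply: contrapT => hn; apply: ncl => B nB; apply/set0P/eqP => E0; apply: hn; exists B => // x Lx Bx.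
      by have : (L `&` B) x by []; rewrite E0.
    have /nbhs_norm1[e e0 He] := nB; exists e => // x e' _ xp _ _ Lx.
    by exfalso; apply: (HB x Lx); exact: He.
  have [j _ pj] := cov p (conj cl nint).
  exists (Num.min (ee j / 2) j.+1%:R^-1); first by rewrite lt_min divr_gt0 //= invr_gt0 ltr0n.
  move=> x e' _; rewrite !le_min => /andP[xp _] e'0 /andP[e'1 e'2] _; left; exists j.
    apply: (@le_trans _ _ j.+1%:R); first by rewrite ler_nat.
    by rewrite -[leLHS]invrK lef_pV2 ?posrE ?invr_gt0 ?ltr0n.
  move=> y yx i; rewrite /Al /Bl !row_shiftE.
  have := norm1_coord (y - p) i; have := norm1_tri y x p; rewrite !mxE => t1 t2.
  have : `|y 0 i - p 0 i| <= ee j by lra.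
  by rewrite ler_norml => /andP[? ?]; have /andP[? ?] := pj i; apply/andP; split; lra.
exists e => //; pose n := (Num.truncn e^-1).+1.
exists n, (fun j : 'I_n => Al j), (fun j : 'I_n => Bl j); split.
- by move=> j i; rewrite /Al /Bl !row_shiftE; have := ab j i; have := ee0 j; lra.
- have vE j : rvol (Al j) (Bl j) <= rvol (al j) (bl j) + eta / 2 / 2 ^+ j.+1.
    apply: le_trans (eeP j); apply: eqle; apply: eq_bigr => i _.
    by rewrite /Al /Bl !row_shiftE; ring.
  have S1 : \sum_(j < n) rvol (al j) (bl j) <= eta / 2.
    rewrite -lee_fin -sumEFin; apply: ltW; apply: le_lt_trans sum_lt.
    rewrite -(big_mkord xpredT (fun j => (rvol (al j) (bl j))%:E)).
    by apply: nneseries_lim_ge => j _ _; rewrite lee_fin rvol_ge0.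
  have S2 : \sum_(j < n) eta / 2 / 2 ^+ j.+1 <= eta / 2.
    suff : \sum_(j < n) eta / 2 / 2 ^+ j.+1 = eta / 2 * (1 - 2^-1 ^+ n).
      by move=> ->; rewrite ger_pMr ?divr_gt0 // gerBl exprn_ge0.
    elim: (n) => [|n' IH]; first by rewrite big_ord0 expr0 subrr mulr0.
    by rewrite big_ord_recr /= IH !exprS exprVn; field; rewrite expf_neq0.
  apply: (@le_trans _ _ (\sum_(j < n) (rvol (al j) (bl j) + eta / 2 / 2 ^+ j.+1))); first by apply: ler_sum => j _; exact: vE.
  by rewrite big_split /=; lra.
- move=> x Lx; have [[j je Hj]|Hr] := He x (HL Lx) Lx; [left|by right].
  have jn : (j < n)%N.
    rewrite -(ltr_nat R); apply: (le_lt_trans je).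
    have ei : 0 <= e^-1 by rewrite invr_ge0 ltW.
    by have /andP[] := truncn_itv ei.
  by exists (Ordinal jn).
Qed.
End level_set.

(** * Orders of magnitude for large u *)

Section near_infinity.
Context {R : realType}.
Implicit Types (b c d : R).

Lemma near_ge c : \forall u \near +oo, c <= (u : R).
Proof. exact: nbhs_pinfty_ge (num_real c). Qed.

Lemma near_div_sq c d : 0 < d -> \forall u \near +oo, c / (u : R) ^+ 2 <= d.
Proof.
move=> d0; near=> u.
have u1 : 1 <= u by near: u; exact: near_ge.
have u0 : 0 < u by lra.
have uc : `|c| / d <= u by near: u; exact: near_ge.
rewrite ler_pdivrMr ?exprn_gt0 //; apply: (le_trans (ler_norm c)).
rewrite ler_pdivrMr // in uc; apply: (le_trans uc).
by rewrite mulrC expr2 ler_pM2l // ler_peMr // ltW.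
Unshelve. all: by end_near.
Qed.

Lemma near_sq_ge c : \forall u \near +oo, c <= (u : R) ^+ 2.
Proof.
near=> u.
have u1 : 1 <= u by near: u; exact: near_ge.
have uc : c <= u by near: u; exact: near_ge.
by apply: le_trans uc _; rewrite expr2 ler_peMr //; lra.
Unshelve. all: by end_near.
Qed.

Lemma expRN_small c d x : 0 < c -> 0 < d -> ln (c / d) <= x -> c * expR (- x) <= d.
Proof.
move=> c0 d0 h; rewrite expRN ler_pdivrMr ?expR_gt0 // -ler_pdivrMl // mulrC.
by rewrite -[leLHS]lnK ?posrE ?divr_gt0 // ler_expR.
Qed.

Lemma near_expsq b c d : 0 < b -> 0 < c -> 0 < d -> \forall u \near +oo, c * expR (- (u : R) ^+ 2 / b) <= d.
Proof.
move=> b0 c0 d0; near=> u; rewrite mulNr; apply: expRN_small => //.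
by rewrite ler_pdivlMr //; near: u; exact: near_sq_ge.
Unshelve. all: by end_near.
Qed.

Lemma near_and3 (A B C : R -> Prop) : (\forall u \near +oo, A u) -> (\forall u \near +oo, B u) -> (\forall u \near +oo, C u) ->
  \forall u \near +oo, [/\ A u, B u & C u].
Proof.
by move=> HA HB HC; near=> u; split; near: u.
Unshelve. all: by end_near.
Qed.

(** Bernoulli's inequality gives the lower bound; the upper one follows from (1 + kp)(1 - kp) <=
    1. *)
Lemma pow_small (n : nat) (kap : R) : 0 < kap -> kap <= 1 ->
  exists2 kp : R, 0 < kp <= 2^-1 & (1 + kp) ^+ n <= 1 + kap /\ 1 - kap <= (1 - kp) ^+ n.
Proof.
move=> k0 k1; have bern (x : R) j : 0 <= x <= 1 -> 1 - j%:R * x <= (1 - x) ^+ j.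
  move=> /andP[x0 x1]; elim: j => [|j IH]; first by rewrite expr0; lra.
  rewrite exprS; apply: (@le_trans _ _ ((1 - x) * (1 - j%:R * x))); last by rewrite ler_wpM2l // subr_ge0.
  rewrite -natr1; have : 0 <= j%:R * x * x by rewrite !mulr_ge0.
  by nra.
pose kp := kap / (2 * n.+1%:R); have n1 : 1 <= n.+1%:R :> R by rewrite ler1n.
have kp0 : 0 < kp by rewrite divr_gt0 // mulr_gt0.
have nk : n.+1%:R * kp = kap / 2 by rewrite /kp; field; rewrite gt_eqF //; lra.
have kp1 : kp <= kap / 2 by rewrite -nk ler_peMl // ltW.
have nk' : n%:R * kp <= kap / 2 by rewrite -nk ler_wpM2r // ?ltW // ltr_nat.
have b := bern kp n ltac:(apply/andP; split; lra).
exists kp; first by rewrite kp0; lra.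
split; last by apply: le_trans b; lra.
have p0 : 0 < (1 - kp) ^+ n by rewrite exprn_gt0 //; lra.
rewrite -(ler_pM2r p0) -exprMn.
have -> : (1 + kp) * (1 - kp) = 1 - kp ^+ 2 by ring.
apply: (@le_trans _ _ 1).
  by apply: exprn_ile1; rewrite ?gerBl ?sqr_ge0 // subr_ge0 expr_le1 //; lra.
apply: (@le_trans _ _ ((1 + kap) * (1 - kap / 2))); first by nra.
by apply: ler_wpM2l; lra.
Qed.
End near_infinity.

Section cell_arithmetic.
Context {R : realType}.
Implicit Types (c kp a eps Z amin Tt : R).

Lemma inv_small c kp : 0 < kp -> kp <= 1 -> c <= kp / 8 -> (1 - c)^-1 <= 1 + kp.
Proof.
move=> k0 k1 ck; rewrite -[leLHS]mul1r ler_pdivrMr; last lra.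
apply: (@le_trans _ _ ((1 + kp) * (1 - kp / 8))); first by nra.
by apply: ler_wpM2l; lra.
Qed.

Lemma eps_facts a eps amin c : 0 < amin -> eps <= amin / 2 -> amin <= a -> a <= c -> eps < a /\ a + eps <= 2 * c.
Proof. by move=> ? ? ? ?; split; lra. Qed.

Lemma factor_ge0 lam kp a Z : 0 < kp -> 0 <= a -> 0 <= Z -> 0 <= (1 + kp) * (lam ^+ 2 * a * Z) / 2 + 1 + 2 / kp.
Proof.
move=> k0 a0 Z0; apply: addr_ge0; last by rewrite divr_ge0 // ltW.
rewrite addr_ge0 // divr_ge0 //; apply: mulr_ge0; first by rewrite addr_ge0 // ltW.
by rewrite mulr_ge0 // mulr_ge0 // sqr_ge0.
Qed.

(** For T large the terms 1 and 2 / kp are at most a fraction kp of the leading 8 a Z. *)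
Lemma factor_up kp a eps Z amin Tt : 0 < kp -> kp <= 1 -> 0 < amin -> amin <= a -> 0 <= eps -> eps <= kp * amin ->
  0 < Tt -> Tt <= Z -> 3 <= Tt * (kp ^+ 2 * (8 * amin)) ->
  (1 + kp) * ((4 * (1 + kp)) ^+ 2 * (a + eps) * Z) / 2 + 1 + 2 / kp <= (1 + kp) ^+ 5 * (8 * a * Z).
Proof.
move=> k0 k1 am0 ama e0 eka T0 TZ h3.
have aZ : amin * Tt <= a * Z by apply: ler_pM => //; exact: ltW.
have a0 : 0 < a by lra.
have Z0 : 0 < Z by lra.
have p1 : 1 <= (1 + kp) ^+ 4 by apply: exprn_ege1; lra.
have h4 : 3 / kp <= kp * (8 * (a * Z)).
  rewrite ler_pdivrMr //; apply: (le_trans h3).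
  have -> : Tt * (kp ^+ 2 * (8 * amin)) = 8 * kp ^+ 2 * (amin * Tt) by ring.
  have -> : kp * (8 * (a * Z)) * kp = 8 * kp ^+ 2 * (a * Z) by ring.
  by apply: ler_wpM2l => //; rewrite mulr_ge0 // sqr_ge0.
have h5 : 1 <= kp^-1 by rewrite invf_ge1.
have X0 : 0 <= 8 * (a * Z) by rewrite !mulr_ge0 // ltW.
have h6 : (a + eps) * Z <= (1 + kp) * (a * Z).
  rewrite mulrA; apply: ler_wpM2r; first exact: ltW.
  have : kp * amin <= kp * a by rewrite ler_pM2l.
  lra.
have -> : (1 + kp) * ((4 * (1 + kp)) ^+ 2 * (a + eps) * Z) / 2 = (1 + kp) ^+ 3 * 8 * ((a + eps) * Z) by field.
have -> : (1 + kp) ^+ 5 * (8 * a * Z) = (1 + kp) ^+ 3 * 8 * ((1 + kp) * (a * Z)) + (1 + kp) ^+ 4 * (kp * (8 * (a * Z))) by ring.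
have g1 : (1 + kp) ^+ 3 * 8 * ((a + eps) * Z) <= (1 + kp) ^+ 3 * 8 * ((1 + kp) * (a * Z)).
  by apply: ler_wpM2l => //; rewrite mulr_ge0 // exprn_ge0 //; lra.
have g2 : kp * (8 * (a * Z)) <= (1 + kp) ^+ 4 * (kp * (8 * (a * Z))).
  by rewrite ler_peMl // mulr_ge0 // ltW.
have : 3 / kp = kp^-1 + 2 / kp by field; rewrite gt_eqF.
lra.
Qed.
End cell_arithmetic.

(** * Exceedance over one block, for large u *)

Section cell_bounds.
Context {R : realType} (m : nat).
Hypothesis m0 : (0 < m)%N.
Variables (mu : probability (g_sigma_algebraType (@orthants R m.+1)) R) (F : 'rV[R]_m.+1 -> R).
Hypothesis HF : is_cdf_on_cube mu F.
Context (V : lmodType R) d (T : measurableType d) (P : probability T R) (X : gfield V P) (dl : 'rV[R]_m.+1 -> V).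
Hypothesis ipd : forall x y, cube m.+1 x -> cube m.+1 y -> gip X (dl x) (dl y) = F (rmin x y).
Local Notation ip := (gip X).
Local Notation one := (dl (ones m.+1)).
Local Notation ev u w s := (fun t => has (fun x => (u < X (dl x) t - F x * (X one t - w))%R) s).
Variables (amin amax w : R).
Hypothesis amin0 : 0 < amin.
Hypothesis amm : amin <= amax.

Definition blockP (q : 'rV[R]_m) (r t0 t1 : R) (a : 'I_m.+1 -> R) (eps : R) : Prop :=
  [/\ 0 < r, forall i, 0 <= q 0 i /\ q 0 i + r <= 1, [/\ 0 <= t0, t0 <= t1 & t1 <= 1],
      (forall i, amin <= a i <= amax) /\ F (btop q r t1) < 1
    & forall x y, bbox q r t0 t1 x -> bbox q r t0 t1 y ->
        `|F x - F y - \sum_i a i * (x 0 i - y 0 i)| <= eps * \sum_i `|x 0 i - y 0 i|].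

Let amax0 : 0 < amax. Proof. exact: lt_le_trans amm. Qed.
Let mR0 : 0 < m%:R :> R. Proof. by rewrite ltr0n. Qed.

(** lam bounds the slope of the legs in units of u: it is 4 (1 + kp) in the sharp bound and 12 for
    the shifted levels of the pair estimate. *)
Lemma cell_gen (kp Tt : R) : 0 < kp -> kp <= 1 -> 0 < Tt -> exists2 eps0 : R, 0 < eps0 & \forall u \near +oo,
  forall q r t0 t1 a eps (u' w' lam : R) (s : seq 'rV[R]_m.+1), blockP q r t0 t1 a eps -> 0 <= eps -> eps <= eps0 ->
    u ^+ 2 * r <= 2 * Tt -> (forall x, x \in s -> bbox q r t0 t1 x) ->
    0 < 2 * u' - w' -> 2 * (2 * u' - w') <= lam * u * (1 - kp / 8) -> lam <= 12 ->
  (P [set t | ev u' w' s t] <= ((1 + kp) ^+ 3 * expR (- 2 * u' ^+ 2 + 2 * u' * w') *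
     \prod_(i < m) ((1 + kp) * (lam ^+ 2 * (a (lift ord_max i) + eps) * (u ^+ 2 * r)) / 2 + 1 + 2 / kp))%:E)%E.
Proof.
move=> kp0 kp1 T0; have am0 := amin0; have ammx := amm.
have c1152 : 0 < 1152 :> R by rewrite ltr0n.
have [C1 C1E] : exists C, C = 1152 * m%:R * Tt by exists (1152 * m%:R * Tt).
have c1 : 0 < C1 by rewrite C1E; exact: mulr_gt0 (mulr_gt0 c1152 mR0) T0.
clear c1152.
have kp2 : 0 < kp / 2 ^+ m.+1 by rewrite divr_gt0 // exprn_gt0.
have l0 : 0 < ln (1 + (kp / 2 ^+ m.+1) ^+ 2) by rewrite ln_gt0 // ltrDl exprn_gt0.
exists (Num.min (amin / 2) (ln (1 + (kp / 2 ^+ m.+1) ^+ 2) / C1)); first by rewrite lt_min !divr_gt0.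
set Cv := m%:R * (2 * amax) * (2 * Tt).
near=> u => q r t0 t1 a eps u' w' lam s [r0 q01 t01 [abd tl] lin] e0; rewrite le_min => /andP[e1 e2] rT sb uw1 uw2 lam12.
have u1 : 1 <= u by near: u; exact: near_ge.
have cv : Cv / u ^+ 2 <= kp / 8 by near: u; apply: near_div_sq; rewrite divr_gt0.
have ce : 18 * Cv ^+ 2 / u ^+ 2 <= ln (1 + kp) by near: u; apply: near_div_sq; rewrite ln_gt0 // ltrDl.
have aeps i : eps < a (lift ord_max i) by have /andP[h _] := abd (lift ord_max i); lra.
have amx i : a (lift ord_max i) + eps <= 2 * amax by have /andP[_ h] := abd (lift ord_max i); lra.
have kp01 : 0 < kp <= 1 by rewrite kp0.
have cv2 : Cv / u ^+ 2 <= 2^-1 by lra.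
have /andP[v0 _] := bmu_top HF r0 q01 t01 lin m0 aeps tl.
have v1 : bmu F q (btop q r t1) <= kp / 8.
  by apply: le_trans cv; exact: (bmu_le r0 t01 e0 lin m0 aeps amx u1 rT).
apply: (block_upper_simple HF ipd r0 q01 t01 e0 lin m0 aeps tl amx u1 rT kp01 cv2 sb uw1 _ lam12).
- have lu : 0 < lam * u.
    rewrite -(@pmulr_lgt0 _ (1 - kp / 8)); last lra.
    by apply: lt_le_trans uw2; rewrite mulr_gt0.
  rewrite /colc mulrA ler_pdivrMr; last lra.
  by apply: (le_trans uw2); rewrite ler_pM2l //; lra.
- by apply: inv_small.
- by apply: le_trans (_ : expR (ln (1 + kp)) <= _); [rewrite ler_expR|rewrite lnK // posrE; lra].
- have -> : 1152 * eps * m%:R * Tt = eps * C1 by rewrite C1E !mulrA [eps * _]mulrC.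
  rewrite ler_pdivlMr // in e2.
  have : expR (eps * C1) <= expR (ln (1 + (kp / 2 ^+ m.+1) ^+ 2)) by rewrite ler_expR.
  by rewrite lnK ?posrE ?ltr_wpDr ?sqr_ge0 // lerBlDl.
Unshelve. all: by end_near.
Qed.

Lemma cell_upper (kap : R) : 0 < kap -> kap <= 1 -> exists2 T0 : R, 1 <= T0 & forall Tt, T0 <= Tt ->
  exists2 eps0 : R, 0 < eps0 & \forall u \near +oo,
  forall q r t0 t1 a eps (s : seq 'rV[R]_m.+1), blockP q r t0 t1 a eps -> 0 <= eps -> eps <= eps0 ->
    Tt <= u ^+ 2 * r -> u ^+ 2 * r <= 2 * Tt -> (forall x, x \in s -> bbox q r t0 t1 x) ->
  (P [set t | ev u w s t] <= ((1 + kap) * expR (- 2 * u ^+ 2 + 2 * u * w) *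
     \prod_(i < m) (8 * a (lift ord_max i) * (u ^+ 2 * r)))%:E)%E.
Proof.
move=> k0 k1; have [kp /andP[kp0 kph] [kpk _]] := pow_small (3 + 5 * m) k0 k1.
have am0 := amin0; have kp1 : kp <= 1 by lra.
have c0 : 0 < kp ^+ 2 * (8 * amin) by rewrite mulr_gt0 ?exprn_gt0 // mulr_gt0.
exists (1 + 3 / (kp ^+ 2 * (8 * amin))); first by rewrite lerDl divr_ge0 // ltW.
move=> Tt T0; have h3 : 0 <= 3 / (kp ^+ 2 * (8 * amin)) by rewrite divr_ge0 // ltW.
have Tt0 : 0 < Tt by lra.
have T3 : 3 <= Tt * (kp ^+ 2 * (8 * amin)) by rewrite -ler_pdivrMr //; lra.
have [e1 e10 H] := cell_gen kp0 kp1 Tt0.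
exists (Num.min e1 (kp * amin)); first by rewrite lt_min e10 mulr_gt0.
apply: filterS (near_and3 H (near_ge 1) (near_ge (`|w| / (kp / 4)))) => u [Hu u1 uw] q r t0 t1 a eps s B e0; rewrite le_min => /andP[ee1 ee2] rT1 rT2 sb.
rewrite ler_pdivrMr ?divr_gt0 // in uw.
have /andP[w1 w2] : - (u * (kp / 4)) <= w <= u * (kp / 4) by rewrite -ler_norml.
have uk : u * kp <= u by rewrite ger_pMr //; lra.
have uk0 : 0 < u * kp by rewrite mulr_gt0 //; lra.
have ukk : u * kp * kp <= u * kp by rewrite ger_pMr.
apply: (le_trans (Hu q r t0 t1 a eps u w (4 * (1 + kp)) s B e0 ee1 rT2 sb _ _ _)).
- by lra.
- have -> : 4 * (1 + kp) * u * (1 - kp / 8) = 4 * u + (7 * (u * kp) - u * kp * kp) / 2 by field.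
  by lra.
- by lra.
have [_ _ _ [abd _] _] := B.
rewrite lee_fin; set E := expR _; have E0 : 0 <= E by exact: expR_ge0.
have al0 i : 0 <= a (lift ord_max i) by have /andP[h _] := abd (lift ord_max i); lra.
have pp : 0 <= \prod_(i < m) (8 * a (lift ord_max i) * (u ^+ 2 * r)).
  by apply: prodr_ge0 => i _; apply: mulr_ge0; [rewrite mulr_ge0|lra].
apply: (@le_trans _ _ ((1 + kp) ^+ 3 * E * \prod_(i < m) ((1 + kp) ^+ 5 * (8 * a (lift ord_max i) * (u ^+ 2 * r))))).
  apply: ler_wpM2l; first by rewrite mulr_ge0 // exprn_ge0 //; lra.
  apply: ler_prod => i _; have /andP[h _] := abd (lift ord_max i); apply/andP; split.
    by apply: factor_ge0 => //; [apply: addr_ge0|exact: le_trans (ltW Tt0) rT1].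
  by apply: (factor_up (amin := amin) (Tt := Tt)) => //; lra.
rewrite big_split /= prodr_const card_ord -exprM mulrA; apply: ler_wpM2r => //.
rewrite mulrAC; apply: ler_wpM2r => //; rewrite -exprD; exact: kpk.
Qed.

(** Made for the levels that arise when two blocks are tilted apart. Cq is independent of T, so the
    growth in T is only T^m. Each factor is at most 144 (2 amax) (2 T) + 3 T, whence 576 amax +
    3. *)
Lemma cell_crude : exists2 Cq : R, 0 < Cq & forall Tt, 1 <= Tt ->
  exists2 eps0 : R, 0 < eps0 & \forall u \near +oo,
  forall q r t0 t1 a eps u' w' (s : seq 'rV[R]_m.+1), blockP q r t0 t1 a eps -> 0 <= eps -> eps <= eps0 ->
    u ^+ 2 * r <= 2 * Tt -> (forall x, x \in s -> bbox q r t0 t1 x) ->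
    0 < 2 * u' - w' -> 2 * u' - w' <= 5 * u ->
  (P [set t | ev u' w' s t] <= (8 * (Cq * Tt) ^+ m * expR (- 2 * u' ^+ 2 + 2 * u' * w'))%:E)%E.
Proof.
exists (576 * amax + 3).
  have c0 : 0 < 576 :> R by rewrite ltr0n.
  exact: addr_gt0 (mulr_gt0 c0 amax0) (ltr0Sn R 2).
move=> Tt T1; have T0 : 0 < Tt by exact: lt_le_trans ltr01 T1.
have [e1 e10 H] := cell_gen ltr01 (lexx _) T0.
exists (Num.min e1 amax); first by rewrite lt_min e10.
have am0 := amin0; have ammx := amm.
apply: filterS H => u Hu q r t0 t1 a eps u' w' s B e0; rewrite le_min => /andP[ee1 ee2] rT2 sb uw1 uw2.
apply: (le_trans (Hu q r t0 t1 a eps u' w' 12 s B e0 ee1 rT2 sb uw1 _ (lexx _))); first by lra.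
have [r0 _ _ [abd _] _] := B.
rewrite lee_fin [leLHS]mulrAC; apply: ler_wpM2r; first exact: expR_ge0.
have -> : (1 + 1) ^+ 3 = 8 :> R by ring.
apply: ler_wpM2l => //.
have -> : ((576 * amax + 3) * Tt) ^+ m = \prod_(i < m) ((576 * amax + 3) * Tt) by rewrite prodr_const card_ord.
have z0 : 0 <= u ^+ 2 * r by rewrite mulr_ge0 ?sqr_ge0 // ltW.
apply: ler_prod => i _; have /andP[h1 h2] := abd (lift ord_max i); apply/andP; split.
  by apply: factor_ge0 => //; apply: addr_ge0 => //; exact: le_trans (ltW amin0) h1.
have h : (a (lift ord_max i) + eps) * (u ^+ 2 * r) <= 2 * amax * (2 * Tt) by apply: ler_pM => //; lra.
have -> : (1 + 1) * (12 ^+ 2 * (a (lift ord_max i) + eps) * (u ^+ 2 * r)) / 2 = 144 * ((a (lift ord_max i) + eps) * (u ^+ 2 * r)).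
  by field.
have -> : (576 * amax + 3) * Tt = 144 * (2 * amax * (2 * Tt)) + 3 * Tt by ring.
have : 144 * ((a (lift ord_max i) + eps) * (u ^+ 2 * r)) <= 144 * (2 * amax * (2 * Tt)) by rewrite ler_wpM2l.
rewrite divr1; lra.
Qed.

(** Order of choices: T, so that every leg reaches enough levels; R0, so that the tails of X o and
    of the legs beat A, which is exponential in T; eps, so that the tail of the remainder does too;
    u last. *)
Lemma cell_lower (kap : R) : 0 < kap -> kap <= 1 -> exists2 T0 : R, 1 <= T0 & forall Tt, T0 <= Tt ->
  exists2 eps0 : R, 0 < eps0 & forall eps sg : R, 0 < eps -> eps <= eps0 -> 0 < sg -> sg <= 4^-1 -> \forall u \near +oo,
  forall q r t0 t1 a, blockP q r t0 t1 a eps -> t0 < t1 ->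
    Tt / 2 <= u ^+ 2 * r -> u ^+ 2 * r <= 2 * Tt ->
    0 <= bth F q t0 -> bth F q t0 <= 2^-1 - sg -> 2^-1 + sg <= bth F q t1 -> bth F q t1 <= 3 / 4 ->
  exists2 s : seq 'rV[R]_m.+1, (forall x, x \in s -> bbox q r t0 t1 x) &
  (((1 - kap) * expR (- 2 * u ^+ 2 + 2 * u * w) * \prod_(i < m) (8 * a (lift ord_max i) * (u ^+ 2 * r)))%:E <=
   P [set t | ev u w s t])%E.
Proof.
move=> k0 k1; have am0 := amin0; have ammx := amm.
have [K [KE K0]] : exists K : R, K \in [:: 1152] /\ 0 < K by exists 1152; rewrite inE eqxx ltr0n.
have [K2 [KE2 K20]] : exists K : R, K \in [:: 200] /\ 0 < K by exists 200; rewrite inE eqxx ltr0n.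
have [kp /andP[kp0 kph] [_ kpk]] := pow_small (5 + 8 * m) k0 k1.
have kq0 : 0 < 1 - kp by lra.
have kp01 : 0 < kp <= 1 by rewrite kp0; lra.
pose D1 := 4 * amin * (1 - kp) ^+ 8; have D10 : 0 < D1 by rewrite !mulr_gt0 // exprn_gt0.
pose D2 := kp ^+ 2 * (4 * amin * (1 - kp) ^+ 3); have D20 : 0 < D2 by rewrite !mulr_gt0 // exprn_gt0.
exists (1 + D1^-1 + `|16 * ln (3 / kp)| / D2).
  by rewrite -addrA lerDl addr_ge0 // ?invr_ge0 ?divr_ge0 // ltW.
move=> Tt HT.
have i1 : 0 <= D1^-1 by rewrite invr_ge0 ltW.
have i2 : 0 <= `|16 * ln (3 / kp)| / D2 by rewrite divr_ge0 // ltW.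
have T1 : 1 <= Tt by lra.
have T0 : 0 < Tt by lra.
have TD1 : 1 <= Tt * D1 by rewrite -ler_pdivrMr // mul1r; lra.
have TD2 : 16 * ln (3 / kp) <= Tt * D2.
  by apply: (le_trans (ler_norm _)); rewrite -ler_pdivrMr //; lra.
set Cv := m%:R * (2 * amax) * (2 * Tt).
have Cv0 : 0 < Cv by rewrite !mulr_gt0.
set A := expR (m%:R * (36 * (2 * amax) * (2 * Tt)) / 2); have A0 : 0 < A by exact: expR_gt0.
pose de := kp / (3 * A); have de0 : 0 < de by rewrite divr_gt0 // mulr_gt0.
have [R0 [R00 R01 R02 [R03 R04]]] : exists R0, [/\ 0 < R0, 6 * Cv <= R0, kp <= 5 * R0 &
   2 * expR (- R0 ^+ 2 / (8 * Cv)) <= de /\ 2 * m%:R * expR (- R0 ^+ 2 / (2 * m%:R ^+ 2 * (2 * (2 * amax) * Tt))) <= de].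
  suff : \forall R0 \near +oo, [/\ 0 < R0, 6 * Cv <= R0, kp <= 5 * R0 &
   2 * expR (- (R0 : R) ^+ 2 / (8 * Cv)) <= de /\ 2 * m%:R * expR (- R0 ^+ 2 / (2 * m%:R ^+ 2 * (2 * (2 * amax) * Tt))) <= de].
    by move=> /filter_ex.
  near=> R0; have h1 : 1 <= R0 by near: R0; exact: near_ge.
  split; [lra|near: R0; exact: near_ge|lra|split].
    by near: R0; apply: near_expsq => //; rewrite mulr_gt0.
  by near: R0; apply: near_expsq => //; rewrite !mulr_gt0 // exprn_gt0.
pose ll := `|ln (2 ^+ m.+1 / de)| + 1; have ll0 : 0 < ll by rewrite ltr_pwDr.
have cm : 0 < K * m%:R * Tt by rewrite !mulr_gt0.
have c200 : 0 < K2 * m%:R * Tt by rewrite !mulr_gt0.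
have cml : 0 < K * m%:R * Tt * ll by rewrite mulr_gt0.
exists (Num.min (Num.min (amin / 2) (kp * amin)) (Num.min (kp / (K2 * m%:R * Tt)) (kp ^+ 2 / (K * m%:R * Tt * ll)))).
  by rewrite !lt_min (divr_gt0 am0 (ltr0Sn _ 1)) (mulr_gt0 kp0 am0) (divr_gt0 kp0 c200) (divr_gt0 (exprn_gt0 _ kp0) cml).
move=> eps sg eps0; rewrite !le_min => /andP[/andP[e1 e2] /andP[e3 e4]] sg0 sg4.
near=> u => q r t0 t1 a B t01' rT1 rT2 th0 th1 th2 th3.
have [r0 q01 t01 [abd tl] lin] := B.
have u1 : 1 <= u by near: u; exact: near_ge.
have u0 : 0 < u by exact: lt_le_trans ltr01 u1.
have hT : 0 < Tt / 2 by rewrite divr_gt0.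
have cv1 : Cv / u ^+ 2 <= sg / 2 by near: u; apply: near_div_sq; rewrite divr_gt0.
have cv2 : Cv / u ^+ 2 <= 20^-1 by near: u; apply: near_div_sq; rewrite invr_gt0.
have wu1 : `|w| / kp <= u by near: u; exact: near_ge.
have wu2 : 4 * (`|w| + 1) / sg <= u by near: u; exact: near_ge.
have wu3 : 4 * (`|w| + 2) <= u by near: u; exact: near_ge.
have lu : K * ln (3 / kp) / u ^+ 2 <= sg ^+ 2 by near: u; apply: near_div_sq; rewrite exprn_gt0.
have R0u : R0 <= u by near: u; exact: near_ge.
have R0k : 9 * R0 ^+ 2 / u ^+ 2 <= kp by near: u; exact: near_div_sq.
rewrite ler_pdivrMr // in wu1; rewrite ler_pdivrMr // in wu2.
rewrite ler_pdivrMr ?exprn_gt0 // in lu; rewrite ler_pdivrMr ?exprn_gt0 // in R0k.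
rewrite (ler_pdivlMr _ _ c200) in e3; rewrite (ler_pdivlMr _ _ cml) in e4.
have all i : amin <= a (lift ord_max i) by have /andP[h _] := abd (lift ord_max i).
have aeps i : eps < a (lift ord_max i) by have /andP[h h'] := abd (lift ord_max i); have [] := eps_facts am0 e1 h h'.
have aem : eps < a ord_max by have /andP[h h'] := abd ord_max; have [] := eps_facts am0 e1 h h'.
have amx i : a (lift ord_max i) + eps <= 2 * amax by have /andP[h h'] := abd (lift ord_max i); have [] := eps_facts am0 e1 h h'.
have sg01 : 0 < sg <= 4^-1 by rewrite sg0.
have ek i : eps <= kp * a (lift ord_max i) by apply: (le_trans e2); rewrite ler_pM2l.
have az i : amin * (Tt / 2) <= a (lift ord_max i) * (u ^+ 2 * r) by exact: ler_pM (ltW am0) (ltW hT) (all i) rT1.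
have c1 i : 1 <= 8 * a (lift ord_max i) * (u ^+ 2 * r) * (1 - kp) ^+ 8.
  apply: (le_trans TD1); rewrite (_ : Tt * D1 = 8 * (amin * (Tt / 2)) * (1 - kp) ^+ 8); last by rewrite /D1; field.
  by rewrite ler_pM2r ?exprn_gt0 // -mulrA ler_pM2l.
have c2 i : 16 * ln (3 / kp) <= kp ^+ 2 * (8 * a (lift ord_max i) * (u ^+ 2 * r) * (1 - kp) ^+ 3).
  apply: (le_trans TD2); rewrite (_ : Tt * D2 = kp ^+ 2 * (8 * (amin * (Tt / 2)) * (1 - kp) ^+ 3)); last by rewrite /D2; field.
  by rewrite ler_pM2l ?exprn_gt0 // ler_pM2r ?exprn_gt0 // -mulrA ler_pM2l.
have l1 : K * ln (3 / kp) <= u ^+ 2 * sg ^+ 2 by rewrite [leRHS]mulrC.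
have e200 : K2 * eps * m%:R * Tt <= kp by apply: le_trans e3; apply: eqle; ring.
have wk : `|w| <= kp * u by rewrite mulrC.
have wsg : 4 * (`|w| + 1) <= u * sg by [].
have last : A * (2 * expR (- R0 ^+ 2 / (8 * Cv)) + 2 * m%:R * expR (- R0 ^+ 2 / (2 * m%:R ^+ 2 * (2 * (2 * amax) * Tt)))
    + 2 ^+ m.+1 * expR (- kp ^+ 2 / (K * eps * m%:R * Tt))) <= kp.
  have h3 : 2 ^+ m.+1 * expR (- kp ^+ 2 / (K * eps * m%:R * Tt)) <= de.
    rewrite mulNr; apply: expRN_small => //.
    apply: (@le_trans _ _ ll); first by rewrite /ll; apply: (le_trans (ler_norm _)); rewrite lerDl.
    rewrite ler_pdivlMr; last by rewrite !mulr_gt0.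
    apply: le_trans e4.
    by apply: eqle; ring.
  rewrite [leRHS](_ : kp = A * (de + de + de)); last by rewrite /de; field; rewrite gt_eqF.
  by rewrite ler_pM2l // !lerD.
move: KE KE2; rewrite !inE => /eqP KE /eqP KE2; rewrite KE in l1 last; rewrite KE2 in e200.
have [s sb Hs] := @block_lower_simple R m mu F HF V d T P X dl ipd q r t0 t1 r0 q01 t01 a eps (ltW eps0) lin m0 aeps tl
  (2 * amax) Tt u kp amx u1 rT2 kp01 w R0 sg t01' aem sg01 th0 th1 th2 th3 ek eps0 c1 c2 kph cv1 cv2 wk wsg wu3 l1
  R00 R0u R0k R01 R02 e200 last.
exists s => //; apply: le_trans Hs; rewrite lee_fin -mulrA -[leRHS]mulrA; apply: ler_wpM2r => //.
rewrite mulr_ge0 ?expR_ge0 // prodr_ge0 // => i _; rewrite mulr_ge0 // ?mulr_ge0 //; first by exact: le_trans (ltW am0) (all i).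
exact: ltW r0.
Unshelve. all: by end_near.
Qed.
End cell_bounds.

Lemma far_tail {R : realType} (C u w e : R) : 0 < u -> 4 * `|w| <= u * e ^+ 2 ->
  C * expR (- (2 + e ^+ 2) * u ^+ 2) <= expR (- 2 * u ^+ 2 + 2 * u * w) * (`|C| * expR (- (e ^+ 2 / 2 * u ^+ 2))).
Proof.
move=> u0 h; rewrite [leRHS]mulrCA -expRD.
apply: (@le_trans _ _ (`|C| * expR (- (2 + e ^+ 2) * u ^+ 2))); first by apply: ler_wpM2r; [exact: expR_ge0|exact: ler_norm].
apply: ler_wpM2l => //; rewrite ler_expR -subr_ge0.
have -> : - 2 * u ^+ 2 + 2 * u * w + - (e ^+ 2 / 2 * u ^+ 2) - - (2 + e ^+ 2) * u ^+ 2 = u * ((u * e ^+ 2) / 2 + 2 * w) by field.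
apply: mulr_ge0; first exact: ltW.
have : - w <= `|w| by rewrite -normrN ler_norm.
by move: (u * e ^+ 2) h => z *; lra.
Qed.

Section halves.
Context {R : realType}.
Implicit Types x y z kap : R.

Lemma le_half_double x y : x <= y / 2 -> 2 * x <= y. Proof. by move=> ?; lra. Qed.

Lemma le_half_le x y : 0 < y -> x <= y / 2 -> x <= y. Proof. by move=> ? ?; lra. Qed.

Lemma le_half_add x y : x <= y / 2 -> x + y / 2 <= y. Proof. by move=> ?; lra. Qed.

Lemma half_le_quarter x : x <= 2^-1 -> x / 2 <= 4^-1. Proof. by move=> ?; lra. Qed.
Lemma lower_final z kap y1 y2 y3 : 0 <= z -> 0 < kap ->
  z * y1 <= y3 + z * (kap / 2) -> z * y2 <= z * (y1 + kap / 4) -> z * y2 - z * kap <= y3.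
Proof.
move=> z0 k0; have zk : 0 <= z * kap by rewrite mulr_ge0 // ltW.
by rewrite mulrDr !mulrA; move: (z * kap) (z * y1) (z * y2) zk => p1 p2 p3 *; lra.
Qed.

Lemma le_three_quarters x : x - 2^-1 <= 4^-1 -> x <= 3 / 4. Proof. by move=> ?; lra. Qed.
End halves.

Lemma has_flatten_map (I D : Type) (p : pred D) (f : I -> seq D) (s : seq I) :
  has p (flatten [seq f i | i <- s]) = has (fun i => has p (f i)) s.
Proof. by elim: s => //= i s IH; rewrite has_cat IH. Qed.

Lemma norm1_last {R : realType} m (x : 'rV[R]_m.+1) y (t : R) : `|x 0 ord_max - t| <= norm1 (x - ext y t).
Proof. by have := norm1_coord (x - ext y t) ord_max; rewrite mxE [X in _ + X]mxE ext_max. Qed.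

(** * Cells of side about T / u^2 *)

Section grid_sums.
Context {R : realType} (m : nat).
Hypothesis m0 : (0 < m)%N.

(** N + 1 is the integer part of u^2 / T; as this is at least 1, rounding loses at most a factor
    2. *)
Lemma grid_size (u Tt : R) : 0 < Tt -> Tt <= u ^+ 2 -> exists N : nat, Tt <= u ^+ 2 * N.+1%:R^-1 /\ u ^+ 2 * N.+1%:R^-1 <= 2 * Tt.
Proof.
move=> T0 Tu; have x1 : 1 <= u ^+ 2 / Tt by rewrite ler_pdivlMr // mul1r.
have /andP[h1 h2] := truncn_itv (le_trans ler01 x1).
have : (0 < Num.truncn (u ^+ 2 / Tt))%N.
  by rewrite lt0n; apply/eqP => E; move: h2; rewrite E ltNge x1.
case E : (Num.truncn _) h1 h2 => [//|N] h1 h2 _; exists N.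
have N0 : 0 < N.+1%:R :> R by rewrite ltr0n.
rewrite ler_pdivlMr // ler_pdivrMr //; rewrite ler_pdivlMr // in h1; rewrite ltr_pdivrMr // in h2.
split; first by rewrite mulrC.
apply: (le_trans (ltW h2)); rewrite mulrAC; apply: ler_wpM2r; first exact: ltW.
by rewrite -natrM ler_nat mul2n -addnn addSn ltnS leq_addl.
Qed.

Section cells_of_size.
Variable N : nat.
Local Notation r := (N.+1%:R^-1 : R).
Local Notation cell := ({ffun 'I_m -> 'I_N.+1}).
Local Notation cq k := (corner k : 'rV[R]_m).

Lemma r_gt0 : 0 < r. Proof. by rewrite invr_gt0 ltr0n. Qed.

Lemma cell_vol (k : cell) : rvol (cq k) (cq k + const_mx r) = r ^+ m.
Proof.
rewrite /rvol -[in RHS](card_ord m) -prodr_const; apply: eq_bigr => i _.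
by rewrite row_shiftE addrAC subrr add0r.
Qed.

Lemma cell_disj (k k' : cell) x : hbox (cq k) (cq k + const_mx r) x -> hbox (cq k') (cq k' + const_mx r) x -> k = k'.
Proof.
move=> h h'; apply/ffunP => i; have N0 : 0 < N.+1%:R :> R by rewrite ltr0n.
have lt (j j' : cell) : hbox (cq j) (cq j + const_mx r) x -> hbox (cq j') (cq j' + const_mx r) x -> (j i <= j' i)%N.
  move=> /(_ i)/andP[h1 _] /(_ i)/andP[_]; rewrite row_shiftE => h2.
  have := le_lt_trans h1 h2; rewrite !mxE -[X in _ + X]mul1r -mulrDl ltr_pM2r ?invr_gt0 // natr1 ltr_nat ltnS //.
by apply/val_inj/eqP; rewrite eqn_leq !lt.
Qed.

(** A lower Riemann sum: the half-open cells are disjoint, so the step function stays below g. *)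
Lemma sum_cells (L : set 'rV[R]_m) (g : 'rV[R]_m -> R) (s : cell -> R) : (forall k, 0 <= s k) ->
  (forall x, L x -> 0 <= g x) ->
  (forall k x, 0 < s k -> hbox (cq k) (cq k + const_mx r) x -> L x /\ s k <= g x) ->
  ((\sum_k s k * r ^+ m)%:E <= leb_integral L g)%E.
Proof.
move=> s0 g0 H; under eq_bigr => k _ do rewrite -(cell_vol k).
apply: leb_integral_ge => //; first by move=> k i; rewrite row_shiftE lerDl ltW ?r_gt0.
move=> x; have R0 : 0 <= (if `[< L x >] then g x else 0) by case: asboolP => // /g0.
have [[k hk]|nk] := pselect (exists k : cell, hbox (cq k) (cq k + const_mx r) x); last first.
  rewrite big1 // => k _; rewrite indicE memNset ?mulr0 // => hk; apply: nk; by exists k.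
rewrite (bigD1 k) //= big1 ?addr0; last first.
  move=> k' /eqP kk; rewrite indicE memNset ?mulr0 // => hk'; apply: kk; exact: cell_disj hk' hk.
rewrite indicE mem_set // mulr1; have := s0 k; rewrite le_eqVlt => /predU1P[<- //|sk].
by have [Lx sg] := H k x sk hk; case: asboolP.
Qed.

Lemma cell_dist (k : cell) (x y : 'rV[R]_m) : rbox (cq k) (cq k + const_mx r) x -> rbox (cq k) (cq k + const_mx r) y ->
  norm1 (x - y) <= m%:R * r.
Proof.
move=> hx hy; apply: norm1_le => i; rewrite !mxE ler_norml.
have := hx i; have := hy i; rewrite row_shiftE => /andP[h1 h2] /andP[h3 h4].
by rewrite lerBlDr lerNl opprB lerBlDr (le_trans h2) ?(le_trans h4) // addrC lerD2l.
Qed.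

Lemma hbox_rbox (k : cell) (x : 'rV[R]_m) : hbox (cq k) (cq k + const_mx r) x -> rbox (cq k) (cq k + const_mx r) x.
Proof. by move=> h i; have /andP[-> h2] := h i; exact: ltW. Qed.

Lemma cellf_rbox (x : 'rV[R]_m) : cube m x -> rbox (cq (cellf N x)) (cq (cellf N x) + const_mx r) x.
Proof. by move=> cx i; rewrite row_shiftE; exact: cellf_in. Qed.
End cells_of_size.

(** exp (b v) is at least (b v / (n+1))^(n+1), one power of v more than needed. *)
Lemma near_powexp n (b c d : R) : 0 < b -> 0 < d -> \forall v \near +oo, c * (v : R) ^+ n * expR (- (b * v)) <= d.
Proof.
move=> b0 d0; pose q := (b / n.+1%:R) ^+ n.+1; have q0 : 0 < q by rewrite exprn_gt0 // divr_gt0 // ltr0n.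
near=> v.
have v1 : 1 <= v by near: v; exact: near_ge.
have vc : c / (d * q) <= v by near: v; exact: near_ge.
have v0 : 0 < v by exact: lt_le_trans ltr01 v1.
rewrite expRN ler_pdivrMr ?expR_gt0 //; rewrite ler_pdivrMr ?mulr_gt0 // in vc.
have h : q * v ^+ n.+1 <= expR (b * v).
  have -> : b * v = n.+1%:R * (b * v / n.+1%:R) by rewrite mulrCA mulfV ?mulr1 // pnatr_eq0.
  rewrite expRM_natl /q -exprMn mulrAC lerXn2r ?nnegrE ?expR_ge0 ?divr_ge0 ?mulr_ge0 ?(ltW b0) ?(ltW v0) //.
  by apply: le_trans (expR_ge1Dx _); rewrite lerDr.
apply: le_trans (_ : d * (q * v ^+ n.+1) <= _); last by rewrite ler_pM2l.
rewrite exprS [d * _](_ : _ = v * (d * q) * v ^+ n); last by ring.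
by apply: ler_wpM2r => //; exact: exprn_ge0 (ltW v0).
Unshelve. all: by end_near.
Qed.

Lemma near_sq (A : R -> Prop) : (\forall v \near +oo, A v) -> \forall u \near +oo, A ((u : R) ^+ 2).
Proof.
move=> [M [_ HM]]; have := near_sq_ge (M + 1); apply: filterS => u h; apply: HM.
by apply: lt_le_trans h; rewrite ltrDl.
Qed.

Lemma min_exists (s : seq R) : all (fun x => 0 < x) s -> exists2 y : R, 0 < y & all (fun x => y <= x) s.
Proof.
elim: s => [|x s IH] /=; first by exists 1.
move=> /andP[x0 /IH[y y0 ys]]; exists (Num.min x y); first by rewrite lt_min x0.
rewrite ge_min lexx /=; by apply: sub_all ys => z yz; rewrite ge_min yz orbT.
Qed.
End grid_sums.

(** * Upper and lower bounds over the whole cube *)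

Section assembly.
Context {R : realType} (m : nat).
Hypothesis m0 : (0 < m)%N.
Variables (mu : probability (g_sigma_algebraType (@orthants R m.+1)) R) (F : 'rV[R]_m.+1 -> R).
Hypothesis HF : is_cdf_on_cube mu F.
Hypothesis Fcont : {within cube m.+1, continuous F}.
Variables (L : set 'rV[R]_m) (h : 'rV[R]_m -> R).
Hypothesis HL : L `<=` cube m.
Hypothesis HdL : leb_outer (boundary L) = 0%E.
Hypothesis HD : [set ext xt (h xt) | xt in L] = [set x | cube m.+1 x /\ F x = 2^-1].
Variables (a : 'I_m.+1 -> 'rV[R]_m.+1 -> R) (amin amax : R).
Hypothesis amin0 : 0 < amin.
Hypothesis abd : forall i x, cube m.+1 x -> amin <= a i x <= amax.
Hypothesis acont : forall i, {within cube m.+1, continuous (a i)}.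
Local Notation linear_near dd eps := (forall z x y, [set ext xt (h xt) | xt in L] z -> cube m.+1 x -> cube m.+1 y -> norm1 (x - z) <= dd -> norm1 (y - z) <= dd ->
  `|F x - F y - \sum_(i < m.+1) a i z * (x 0 i - y 0 i)| <= eps * norm1 (x - y)).
Hypothesis lin : forall eps : R, 0 < eps -> exists2 dd : R, 0 < dd & linear_near dd eps.
Context (V : lmodType R) d (T : measurableType d) (P : probability T R) (X : gfield V P) (dl : 'rV[R]_m.+1 -> V).
Hypothesis ipd : forall x y, cube m.+1 x -> cube m.+1 y -> gip X (dl x) (dl y) = F (rmin x y).
Variable w : R.
Local Notation ip := (gip X).
Local Notation one := (dl (ones m.+1)).
Local Notation ev u w s := (fun t => has (fun x => (u < X (dl x) t - F x * (X one t - w))%R) s).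
Local Notation cellT N := ({ffun 'I_m -> 'I_N.+1}).
Local Notation pth x := (ext x (h x)).
Local Notation G x := (\prod_(i < m) a (lift ord_max i) (pth x)).
Local Notation E u := (expR (- 2 * u ^+ 2 + 2 * u * w)).

Lemma amm : amin <= amax.
Proof. by have /andP[h1 h2] := abd ord_max (@cube_ones R m.+1); exact: le_trans h1 h2. Qed.

Let amax0 : 0 < amax. Proof. exact: lt_le_trans amm. Qed.

Lemma a_ratio (kap : R) : 0 < kap -> exists2 da : R, 0 < da & forall i x y, cube m.+1 x -> cube m.+1 y ->
  norm1 (x - y) <= da -> a i x <= (1 + kap) * a i y.
Proof.
move=> k0; apply: (@fin_common R _ (fun i da => forall x y, cube m.+1 x -> cube m.+1 y ->
  norm1 (x - y) <= da -> a i x <= (1 + kap) * a i y)).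
  by move=> i e e' _ ee H x y cx cy xy; apply: H => //; exact: le_trans ee.
move=> i; have [e e0 He] := cube_unif_cont (@acont i) (mulr_gt0 k0 amin0); exists e => // x y cx cy xy.
have := He x y cx cy xy; rewrite ler_norml => /andP[_ h1]; have /andP[h2 _] := abd i cy.
have : kap * amin <= kap * a i y by rewrite ler_pM2l.
lra.
Qed.

Lemma G_bounds x : L x -> 0 <= G x /\ G x <= amax ^+ m.
Proof.
move=> Lx; have [cx _] := levelP HD Lx; split.
  by apply: prodr_ge0 => i _; have /andP[h1 _] := abd (lift ord_max i) cx; exact: le_trans (ltW amin0) h1.
rewrite -[in leRHS](card_ord m) -prodr_const; apply: ler_prod => i _.
by have /andP[h1 h2] := abd (lift ord_max i) cx; rewrite h2 (le_trans (ltW amin0) h1).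
Qed.

Lemma G_ratio (kap da : R) x y : 0 <= kap -> (forall i x y, cube m.+1 x -> cube m.+1 y ->
  norm1 (x - y) <= da -> a i x <= (1 + kap) * a i y) -> L x -> L y -> norm1 (pth x - pth y) <= da ->
  G x <= (1 + kap) ^+ m * G y.
Proof.
move=> k0 H Lx Ly xy; have [cx _] := levelP HD Lx; have [cy _] := levelP HD Ly.
rewrite -[in X in X * _](card_ord m) -prodr_const -big_split; apply: ler_prod => i _.
by rewrite H // andbT; have /andP[h1 _] := abd (lift ord_max i) cx; exact: le_trans (ltW amin0) h1.
Qed.

(** Heights range over h x0 plus or minus th, cut to [0, 1]. Every point of the block is then within
    dd of the surface point over x0, so the linearization at that point serves the whole block. *)
Lemma block_of (dd eps th rho r : R) (q x0 : 'rV[R]_m) :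
  linear_near dd eps ->
  (forall x y, cube m.+1 x -> cube m.+1 y -> norm1 (x - y) <= dd -> `|F x - F y| <= 4^-1) ->
  0 < r -> (forall i, 0 <= q 0 i /\ q 0 i + r <= 1) -> L x0 -> 0 <= th -> rho + th <= dd ->
  (forall y, rbox q (q + const_mx r) y -> norm1 (y - x0) <= rho) ->
  blockP F amin amax q r (Num.max 0 (h x0 - th)) (Num.min 1 (h x0 + th)) (fun i => a i (pth x0)) eps.
Proof.
move=> Hlin Fd r0 q01 Lx0 th0 rd Hq; have /andP[h0 h1] := level01 HD Lx0; have [cz Fz] := levelP HD Lx0.
have t01 : [/\ 0 <= Num.max 0 (h x0 - th), Num.max 0 (h x0 - th) <= Num.min 1 (h x0 + th) & Num.min 1 (h x0 + th) <= 1].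
  by split; rewrite ?le_max ?lexx // ?ge_min ?lexx // ge_max !le_min ler01 /=; do !(apply/andP; split); lra.
have near x : bbox q r (Num.max 0 (h x0 - th)) (Num.min 1 (h x0 + th)) x -> norm1 (x - pth x0) <= dd.
  move=> [b1 /andP[b2 b3]]; rewrite ge_max in b2; rewrite le_min in b3.
  have /andP[_ b4] := b2; have /andP[_ b5] := b3.
  have -> : x = ext (low x) (x 0 ord_max).
    by apply: row_lift_eq => [i|]; [rewrite ext_lift mxE|rewrite ext_max].
  rewrite norm1_ext; apply: le_trans rd; apply: lerD.
    by apply: Hq => i; rewrite row_shiftE mxE.
  by rewrite ler_norml; apply/andP; split; lra.
split => //.
- split; first by move=> i; exact: abd.
  have bt := btop_box q r0 t01; have cb := bbox_cube q01 t01 bt.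
  have := Fd _ _ cb cz (near _ bt); rewrite Fz ler_norml => /andP[_ f1].
  by apply: (@le_lt_trans _ _ (2^-1 + 4^-1)); lra.
- move=> x y bx by_; have -> : \sum_i `|x 0 i - y 0 i| = norm1 (x - y) by apply: eq_bigr => i _; rewrite !mxE.
  by apply: Hlin; [exists x0|exact: bbox_cube bx|exact: bbox_cube by_|exact: near|exact: near].
Qed.

Lemma prod_scale (x : 'rV[R]_m) (z : R) : \prod_(i < m) (8 * a (lift ord_max i) (pth x) * z) = (8 * z) ^+ m * G x.
Proof.
have -> : (8 * z) ^+ m = \prod_(i < m) (8 * z) by rewrite prodr_const card_ord.
by rewrite -big_split; apply: eq_bigr => i _ /=; ring.
Qed.

(** Points far from D go to [far_bound]; the others are sorted by cell, and a cell is compared with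
    a nearby point zf of L. If L contains the ball of radius e4 around zf, the cell enters a lower
    Riemann sum of G; otherwise it lies in the boxes of [level_cover], of total volume eta, where G
    is at most amax^m. The bound is uniform in s because the supremum is reached through longer and
    longer lists. *)
Lemma upper_bound (kap IG : R) : 0 < kap -> kap <= 1 -> 0 <= IG -> (leb_integral L (fun x => G x) <= IG%:E)%E ->
  \forall u \near +oo, forall s : seq 'rV[R]_m.+1, (forall x, x \in s -> cube m.+1 x) ->
  (P [set t | ev u w s t] <= (8 ^+ m * ((1 + kap) * IG + kap) * u ^+ (2 * m) * E u)%:E)%E.
Proof.
move=> k0 k1 IG0 HIG.
have [kp /andP[kp0 kph] [kpk _]] := pow_small m.+1 k0 k1.
have kp1 : kp <= 1 by lra.
have kp2 : 1 + kp <= 2 by lra.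
have AM : 0 < amax ^+ m by rewrite exprn_gt0.
pose eta := kap / (4 * amax ^+ m); have eta0 : 0 < eta by rewrite divr_gt0 // mulr_gt0.
have etaE : amax ^+ m * eta = kap / 4 by rewrite /eta; field; rewrite gt_eqF.
have [T0 T1 HT] := cell_upper m0 HF ipd w amin0 amm kp0 kp1.
have Tt0 : 0 < T0 by exact: lt_le_trans ltr01 T1.
have [e1 e10 Hcell] := HT T0 (lexx _).
have [d1 d10 Hlin] := lin e10.
have q4 : 0 < 4^-1 :> R by rewrite invr_gt0.
have [d2 d20 Hd2] := cube_unif_cont Fcont q4.
have [d3 d30 Hd3] := a_ratio kp0.
have [e4 e40 [n [A [B [AB SAB Hcov]]]]] := level_cover HL HdL eta0.
have [th th0 /and3P[thd1 thd2 _]] : exists2 y : R, 0 < y & all (fun x => y <= x) [:: d1 / 2; d2 / 2].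
  by apply: min_exists; rewrite /= !divr_gt0.
have thd1' := le_half_double thd1.
have thd2' := le_half_double thd2.
have [t2 t20 /and3P[t2th t2d _]] : exists2 y : R, 0 < y & all (fun x => y <= x) [:: th / 2; d3 / 2].
  by apply: min_exists; rewrite /= !divr_gt0.
have [dh dh0 Hh] := h_unif HF Fcont HL HD amin0 abd lin t20.
have [mm mm0 /and5P[mth md3 me4 mdh _]] : exists2 y : R, 0 < y & all (fun x => y <= x) [:: th; d3 / 2; e4; dh / 2].
  by apply: min_exists; rewrite /= th0 e40 !divr_gt0.
have mm32 : mm / 2 + mm <= dh by lra.
have mdh' : mm <= dh by lra.
have mdth : mm / 2 + t2 <= th by lra.
have m20 : 0 < mm / 2 by rewrite divr_gt0.
have [el el0 Hlev] := level_near Fcont HD m20.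
have [ef ef0 /and3P[efl ef2 _]] : exists2 y : R, 0 < y & all (fun x => y <= x) [:: el; 2^-1].
  by apply: min_exists; rewrite /= el0 invr_gt0 ltr0n.
have [C HC] := far_bound HF ipd w (cube_unif_cont Fcont) ef0 ef2.
have b0 : 0 < ef ^+ 2 / 2 by rewrite divr_gt0 // exprn_gt0.
have p80 : 0 < 8 ^+ m :> R by rewrite exprn_gt0.
have dd0 : 0 < kap / 2 * 8 ^+ m by rewrite mulr_gt0 // divr_gt0.
apply: filterS (near_and3 (near_and3 Hcell (near_sq_ge T0) (near_div_sq (m%:R * (2 * T0)) m20))
  (near_and3 (near_ge 1) (near_ge (`|w| / (ef ^+ 2 / 24))) (near_ge (4 * `|w| / ef ^+ 2)))
  (near_sq (near_powexp 0 `|C| b0 dd0))) => u [[Hu Tu mru] [u1 uw1 uw2] Hfar] s sc.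
have u0 : 0 < u by exact: lt_le_trans ltr01 u1.
have u20 : 0 < u ^+ 2 by rewrite exprn_gt0.
have [N [rT1 rT2]] := grid_size Tt0 Tu; have r0 : 0 < (N.+1%:R^-1 : R) by exact: r_gt0.
set r : R := N.+1%:R^-1 in rT1 rT2 r0 *.
have mr : m%:R * r <= mm / 2.
  by apply: le_trans mru; rewrite -mulrA; apply: ler_wpM2l => //; rewrite ler_pdivlMr // mulrC.
have E0 : 0 < E u by exact: expR_gt0.
pose c (x : 'rV[R]_m.+1) := `|F x - 2^-1| < ef.
apply: (le_trans (P_classes P c s (fun x => measurable_bridge F X dl u w x))).
rewrite big_bool /=; set s1 := [seq x <- s | _]; set s2 := [seq x <- s | _].
have U1 : 1 <= u ^+ (2 * m) by exact: exprn_ege1.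
have far : (P [set t | ev u w s2 t] <= (8 ^+ m * (kap / 2) * u ^+ (2 * m) * E u)%:E)%E.
  apply: le_trans (HC u s2 u0 _ _) _.
  - by rewrite mulrC -ler_pdivrMr // divr_gt0 // exprn_gt0.
  - move=> x; rewrite mem_filter /c => /andP[/eqP cx xs]; split; first exact: sc.
    by rewrite leNgt cx.
  rewrite lee_fin; apply: (@le_trans _ _ (E u * (kap / 2 * 8 ^+ m))); last first.
    have -> : 8 ^+ m * (kap / 2) * u ^+ (2 * m) * E u = E u * (kap / 2 * 8 ^+ m) * u ^+ (2 * m) by ring.
    by rewrite ler_peMr // mulr_ge0 // ltW.
  apply: (@le_trans _ _ (E u * (`|C| * expR (- (ef ^+ 2 / 2 * u ^+ 2))))); last first.
    by apply: ler_wpM2l; [exact: ltW|rewrite expr0 mulr1 in Hfar].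
  by apply: far_tail => //; rewrite -ler_pdivrMr // exprn_gt0.
have s1P x : x \in s1 -> cube m.+1 x /\ exists2 z, L z & norm1 (x - pth z) <= mm / 2.
  rewrite mem_filter /c => /andP[/eqP cx xs]; split; first exact: sc.
  by apply: Hlev; [exact: sc|exact: lt_le_trans efl].
pose cq (k : cellT N) : 'rV[R]_m := corner k.
(* A cell may stick out of L, so the reference point is in L but only close to the cell. *)
pose hit (k : cellT N) z := L z /\ exists2 x' : 'rV[R]_m, rbox (cq k) (cq k + const_mx r) x' & norm1 (x' - z) <= mm / 2.
have [zf zfP] : exists zf : cellT N -> 'rV[R]_m, forall k, (exists z, hit k z) -> hit k (zf k).
  exists (fun k => if pselect (exists z, hit k z) is left hz then sval (cid hz) else 0) => k hz.
  by case: pselect => // hz'; exact: (svalP (cid hz')).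
pose hb k : bool := `[< exists z, hit k z >].
have hbP k : hb k -> L (zf k) /\ forall x, rbox (cq k) (cq k + const_mx r) x -> norm1 (x - zf k) <= mm.
  move=> /asboolP/zfP[Lz [x' rx' x'z]]; split=> // x rx.
  apply: le_trans (norm1_tri x x' _) _; have := cell_dist rx rx'; rewrite -/r => h1.
  by rewrite [leRHS](splitr mm) lerD // (le_trans h1).
pose gk k : R := if hb k then G (zf k) else 0.
have cellb k : (P [set t | ev u w [seq x <- s1 | cellf N (low x) == k] t] <= ((1 + kp) * E u * ((8 * (u ^+ 2 * r)) ^+ m * gk k))%:E)%E.
  case Es : [seq x <- s1 | cellf N (low x) == k] => [|x0 s'].
    rewrite P_has0 lee_fin /gk; case hk : (hb k); rewrite ?mulr0 //.
    have [Lz _] := hbP k hk; have [g0 _] := G_bounds Lz.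
    by rewrite !mulr_ge0 ?exprn_ge0 ?mulr_ge0 ?(ltW u0) ?(ltW r0) ?addr_ge0 ?(ltW kp0) ?expR_ge0.
  rewrite -Es; set s3 := [seq x <- s1 | _].
  have s3P x : x \in s3 -> [/\ cube m.+1 x, rbox (cq k) (cq k + const_mx r) (low x) & exists2 z, L z & norm1 (x - pth z) <= mm / 2].
    rewrite mem_filter => /andP[/eqP <- /s1P[cx hz]]; split=> //.
    by apply: cellf_rbox => i; rewrite mxE; exact: cx.
  have hk : hb k.
    have [|_ rx [z Lz xz]] := s3P x0; first by rewrite /s3 Es mem_head.
    apply/asboolP; exists z; split=> //; exists (low x0) => //.
    by apply: le_trans xz; have := norm1_low x0 (pth z); rewrite low_ext.
  have [Lz zr] := hbP k hk; rewrite /gk hk.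
  have q01 i : 0 <= cq k 0 i /\ cq k 0 i + r <= 1 by exact: corner01.
  have B1 : blockP F amin amax (cq k) r (Num.max 0 (h (zf k) - th)) (Num.min 1 (h (zf k) + th)) (fun i => a i (pth (zf k))) e1.
    apply: (@block_of (2 * th) e1 th mm r (cq k) (zf k)) => //.
    - by move=> z x y Dz cx cy xz yz; apply: Hlin => //; exact: le_trans thd1'.
    - by move=> x y cx cy xy; apply: Hd2 => //; exact: le_trans thd2'.
    - exact: ltW.
    - by rewrite mulr_natl mulr2n lerD2r.
  apply: (le_trans (Hu _ _ _ _ _ _ s3 B1 (ltW e10) (lexx _) rT1 rT2 _)).
    move=> x /s3P[cx rx [z Lz' xz]].
    have zz : norm1 (z - zf k) <= dh.
      apply: le_trans (norm1_tri z (low x) _) _; have h1 := zr _ rx.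
      have h2 : norm1 (z - low x) <= mm / 2.
        by apply: le_trans xz; rewrite norm1C; have := norm1_low x (pth z); rewrite low_ext.
      by apply: le_trans mm32; exact: lerD.
    have hh := Hh z (zf k) Lz' Lz zz.
    have xl : `|x 0 ord_max - h z| <= mm / 2.
      by apply: le_trans xz; exact: norm1_last.
    split; first by move=> i; have := rx i; rewrite row_shiftE [low x 0 i]mxE.
    have /andP[x0' x1'] := cx ord_max.
    have : `|x 0 ord_max - h (zf k)| <= th.
      by apply: le_trans mdth; apply: le_trans (ler_distD (h z) _ _) _; exact: lerD.
    by rewrite ler_distl ge_max le_min x0' x1'.
  by rewrite lee_fin prod_scale.
have SG : \sum_k gk k * r ^+ m <= (1 + kp) ^+ m * IG + amax ^+ m * eta.
  have km0 : 0 < (1 + kp) ^+ m by rewrite exprn_gt0 // addr_gt0.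
  have rm0 : 0 <= r ^+ m by rewrite exprn_ge0 // ltW.
  pose good k : bool := hb k && `[< forall y, norm1 (y - zf k) <= e4 -> L y >].
  (* Divided by (1 + kp)^m, the value at zf is at most G everywhere on the cell. *)
  pose gs k : R := if good k then G (zf k) / (1 + kp) ^+ m else 0.
  pose bs k : R := if hb k && ~~ good k then 1 else 0.
  have S1 : \sum_k gs k * r ^+ m <= IG.
    rewrite -lee_fin; apply: le_trans HIG; apply: sum_cells => //.
    - move=> k; rewrite /gs; case gdk : (good k) => //; have /andP[hk _] := gdk.
      by have [Lz _] := hbP k hk; have [g0 _] := G_bounds Lz; rewrite divr_ge0 // ltW.
    - by move=> x Lx; have [] := G_bounds Lx.
    - move=> k x; rewrite /gs; case gdk : (good k); last by rewrite ltxx.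
      move=> _ /hbox_rbox rx; have /andP[hk /asboolP bl] := gdk; have [Lz zr] := hbP k hk.
      have xz := zr x rx.
      have Lx : L x by apply: bl; exact: le_trans me4.
      split=> //; rewrite ler_pdivrMr // mulrC; apply: (@G_ratio kp d3) => //; first exact: ltW.
      rewrite norm1_ext norm1C; have := Hh (zf k) x Lz Lx; rewrite norm1C => /(_ (le_trans xz mdh')) hh.
      by rewrite [leRHS](splitr d3) lerD // ?(le_trans xz) // (le_trans hh).
  have S2 : \sum_k bs k * r ^+ m <= eta.
    pose U : set 'rV[R]_m := [set y | exists j, rbox (A j) (B j) y].
    rewrite -lee_fin; apply: (@le_trans _ _ (leb_integral U (fun=> 1))).
      apply: sum_cells => //; first by move=> k; rewrite /bs; case: ifP.
      move=> k x; rewrite /bs; case: ifP => [/andP[hk ng] _ /hbox_rbox rx|_]; last by rewrite ltxx.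
      have [Lz zr] := hbP k hk; split=> //.
      have [[j Hj]|Hr] := Hcov _ Lz; first by exists j; apply: Hj; exact: le_trans (zr x rx) me4.
      by move: ng; rewrite /good hk /=; move/asboolP; case.
    apply: (@le_trans _ _ (\sum_(j <- enum 'I_n) 1 * rvol (A j) (B j))%:E).
      apply: leb_integral_le => //; move=> x [j Hj]; exists j => //; by rewrite mem_enum.
    by rewrite lee_fin big_enum /=; under eq_bigr do rewrite mul1r.
  apply: (@le_trans _ _ (\sum_k ((1 + kp) ^+ m * (gs k * r ^+ m) + amax ^+ m * (bs k * r ^+ m)))).
    apply: ler_sum => k _; rewrite !mulrA -mulrDl; apply: ler_wpM2r => //.
    rewrite /gk /gs /bs; case gdk : (good k).
      have /andP[hk _] := gdk; rewrite hk /= mulr0 addr0 mulrCA mulfV ?mulr1 // gt_eqF //.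
    case hk : (hb k) => /=; last by rewrite !mulr0 addr0.
    by have [Lz _] := hbP k hk; have [_ g1] := G_bounds Lz; rewrite mulr0 add0r mulr1.
  by rewrite big_split /= -!mulr_sumr lerD // ler_pM2l.
have near : (P [set t | ev u w s1 t] <= (8 ^+ m * ((1 + kap) * IG + kap / 2) * u ^+ (2 * m) * E u)%:E)%E.
  apply: (le_trans (P_classes P (fun x => cellf N (low x)) s1 (fun x => measurable_bridge F X dl u w x))).
  apply: (@le_trans _ _ (\sum_k ((1 + kp) * E u * ((8 * (u ^+ 2 * r)) ^+ m * gk k))%:E)%E); first by apply: lee_sum => k _; exact: cellb.
  rewrite sumEFin lee_fin -!mulr_sumr.
  have -> : (1 + kp) * E u * ((8 * (u ^+ 2 * r)) ^+ m * \sum_k gk k) = 8 ^+ m * u ^+ (2 * m) * E u * ((1 + kp) * \sum_k gk k * r ^+ m).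
    rewrite -mulr_suml !exprMn mul2n -addnn exprD; move: (8 ^+ m) (u ^+ m) (r ^+ m) (\sum_k gk k) (E u) => y1 y2 y3 y4 y5.
    by ring.
  have -> : 8 ^+ m * ((1 + kap) * IG + kap / 2) * u ^+ (2 * m) * E u = 8 ^+ m * u ^+ (2 * m) * E u * ((1 + kap) * IG + kap / 2) by ring.
  apply: ler_wpM2l; first by rewrite !mulr_ge0 ?(ltW p80) ?(ltW E0) // exprn_ge0 // ltW.
  have kp1' : 0 <= 1 + kp by rewrite addr_ge0 // ltW.
  apply: (le_trans (ler_wpM2l kp1' SG)); rewrite mulrDr mulrA -exprS etaE; apply: lerD; first by apply: ler_wpM2r.
  have -> : kap / 2 = 2 * (kap / 4) by field.
  by apply: ler_wpM2r => //; rewrite divr_ge0 // ltW.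
apply: (le_trans (leeD near far)); rewrite -EFinD lee_fin.
have -> : 8 ^+ m * ((1 + kap) * IG + kap) * u ^+ (2 * m) * E u = 8 ^+ m * ((1 + kap) * IG + kap / 2) * u ^+ (2 * m) * E u
  + 8 ^+ m * (kap / 2) * u ^+ (2 * m) * E u by field.
by [].
Qed.
(** This supplies the margin sg = amin th / 2 that the line of a block needs below and above 1/2. *)
Lemma level_step (dd eps th : R) x :
  linear_near dd eps ->
  eps <= amin / 2 -> L x -> 0 <= th -> th <= dd -> th <= h x <= 1 - th ->
  F (ext x (h x - th)) <= 2^-1 - amin * th / 2 /\ 2^-1 + amin * th / 2 <= F (ext x (h x + th)).
Proof.
move=> Hlin e2 Lx th0 thd /andP[hx0 hx1]; have [cx Fx] := levelP HD Lx.
have Lz : [set ext xt (h xt) | xt in L] (pth x) by exists x.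
have dd0 : 0 <= dd by exact: le_trans thd.
have /andP[am _] := abd ord_max cx.
have amt : amin * th <= a ord_max (pth x) * th by exact: ler_wpM2r.
have et : eps * th <= amin / 2 * th by exact: ler_wpM2r.
have key t : `|t| = th -> 0 <= h x + t <= 1 -> `|F (ext x (h x + t)) - 2^-1 - a ord_max (pth x) * t| <= eps * th.
  move=> tt h01; have c1 : cube m.+1 (ext x (h x + t)) by apply: cube_ext => //; exact: HL.
  have tE : h x + t - h x = t by ring.
  have := Hlin _ _ _ Lz c1 cx; rewrite !norm1_ext !norm1_0 !add0r subrr normr0 tE tt => /(_ thd dd0).
  rewrite sum_lift big1 ?add0r; last by move=> i _; rewrite !ext_lift subrr mulr0.
  by rewrite !ext_max tE Fx.
split.
  have := key (- th); rewrite normrN ger0_norm // => /(_ erefl).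
  have -> : (0 <= h x - th <= 1) by apply/andP; split; lra.
  move=> /(_ isT); rewrite ler_norml mulrN opprK => /andP[_ h2]; lra.
have := key th; rewrite ger0_norm // => /(_ erefl).
have -> : (0 <= h x + th <= 1) by apply/andP; split; lra.
move=> /(_ isT); rewrite ler_norml => /andP[h2 _]; lra.
Qed.

(** The slab lies within dd of the surface point over q, so its increment of F is at least (a_i -
    eps) tau. *)
Lemma slab_gain (dd eps th tau t0 : R) (q : 'rV[R]_m) (i : 'I_m) :
  linear_near dd eps ->
  eps <= amin / 2 -> L q -> 0 <= tau -> th + tau <= dd -> 0 <= t0 <= 1 -> `|t0 - h q| <= th -> 0 <= q 0 i - tau ->
  amin / 2 * tau <= F (ext q t0) - F (setc (lift ord_max i) (q 0 i - tau) (ext q t0)).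
Proof.
move=> Hlin e2 Lq tau0 thd t01 t0h q0; have [cz Fz] := levelP HD Lq.
have Lz : [set ext xt (h xt) | xt in L] (pth q) by exists q.
have cp : cube m.+1 (ext q t0) by apply: cube_ext => //; exact: HL.
have cj : q 0 i - tau <= (ext q t0) 0 (lift ord_max i) by rewrite ext_lift gerBl.
have cs := setc_cube cp q0 cj.
have n1 : norm1 (ext q t0 - setc (lift ord_max i) (q 0 i - tau) (ext q t0)) = tau.
  rewrite /norm1 (bigD1 (lift ord_max i)) //= big1 ?addr0.
    by rewrite !mxE eqxx liftK opprB addrC subrK ger0_norm.
  by move=> j /negbTE ji; rewrite mxE [X in _ + X]mxE [setc _ _ _ _ _]mxE ji subrr normr0.
have n2 : norm1 (ext q t0 - pth q) <= th by rewrite norm1_ext norm1_0 add0r.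
have thd' : th <= dd by apply: le_trans thd; rewrite lerDl.
have n3 : norm1 (setc (lift ord_max i) (q 0 i - tau) (ext q t0) - pth q) <= dd.
  apply: le_trans (norm1_tri _ (ext q t0) _) _; apply: le_trans thd.
  by rewrite [leRHS]addrC lerD // norm1C n1.
have := Hlin _ _ _ Lz cp cs (le_trans n2 thd') n3; rewrite n1.
rewrite (bigD1 (lift ord_max i)) //= big1 ?addr0; last first.
  by move=> j /negbTE ji; rewrite [setc _ _ _ _ _]mxE ji subrr mulr0.
rewrite ext_lift [X in _ * (_ - X)]mxE eqxx (_ : q 0 i - (q 0 i - tau) = tau); last by ring.
rewrite ler_norml => /andP[h1 _].
have /andP[am _] := abd (lift ord_max i) cz.
have h2 : amin * tau <= a (lift ord_max i) (pth q) * tau by exact: ler_wpM2r.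
have h3 : eps * tau <= amin / 2 * tau by exact: ler_wpM2r.
by lra.
Qed.

(** Blocks have side (1 - kp) r, so cells that differ by n in coordinate i leave room for a slab of
    width n kp r. The slab must stay where F is linearized, so its width is cut at ds; distant pairs
    get the second exponential instead. *)
Lemma pair_cells (dd eps th ds kp u Tt C : R) N (k k' : cellT N) (i : 'I_m) (t0 t1 t0' t1' : R) (s s' : seq 'rV[R]_m.+1) :
  linear_near dd eps ->
  eps <= amin / 2 -> L (corner k') -> 0 < ds -> th + ds <= dd -> `|t0' - h (corner k')| <= th ->
  [/\ 0 <= t0, t0 <= t1 & t1 <= 1] -> [/\ 0 <= t0', t0' <= t1' & t1' <= 1] ->
  0 < kp -> kp <= 1 -> 0 < u -> 4 * `|w| <= u -> 0 <= Tt -> Tt <= u ^+ 2 * N.+1%:R^-1 -> 0 <= C ->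
  (forall x, x \in s -> bbox (corner k) ((1 - kp) * N.+1%:R^-1) t0 t1 x) ->
  (forall x, x \in s' -> bbox (corner k') ((1 - kp) * N.+1%:R^-1) t0' t1' x) ->
  (forall u' w' s'', s'' = s \/ s'' = s' -> 0 < 2 * u' - w' -> 2 * u' - w' <= 5 * u ->
    (P [set t | ev u' w' s'' t] <= (C * expR (- 2 * u' ^+ 2 + 2 * u' * w'))%:E)%E) ->
  (k i < k' i)%N ->
  (P [set t | ev u w s t && ev u w s' t] <= (2 * C * E u *
     (expR (- (amin / 2 * kp * Tt * (k' i - k i)%:R)) + expR (- (amin / 2 * ds * u ^+ 2))))%:E)%E.
Proof.
move=> Hlin e2 Lq ds0 thd t0h t01 t01' kp0 kp1 u0 wu Tt0 TtN C0 sb sb' HC ki.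
have [t00 tt' t11] := t01'; have t0'1 : 0 <= t0' <= 1 by rewrite t00 (le_trans tt').
set r : R := N.+1%:R^-1 in TtN sb sb' *.
have r0 : 0 < r by exact: r_gt0.
set n := (k' i - k i)%N; have n1 : 1 <= n%:R :> R by rewrite ler1n subn_gt0.
have kr0 : 0 <= kp * r by rewrite mulr_ge0 // ltW.
have [tau tauE] : exists tau, tau = Num.min (n%:R * (kp * r)) ds by exists (Num.min (n%:R * (kp * r)) ds).
have tau0 : 0 <= tau by rewrite tauE le_min (ltW ds0) mulr_ge0.
have tau1 : tau <= n%:R * (kp * r) by rewrite tauE ge_min lexx.
have tau2 : tau <= ds by rewrite tauE ge_min lexx orbT.
have qq : (corner k' : 'rV[R]_m) 0 i = (corner k : 'rV[R]_m) 0 i + n%:R * r.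
  by rewrite !mxE -mulrDl -natrD subnKC // ltnW.
have [qk0 qk1] := @corner01 R m N k i.
have c0' : (corner k : 'rV[R]_m) 0 i + (1 - kp) * r <= (corner k' : 'rV[R]_m) 0 i - tau.
  rewrite qq -addrA lerD2l; apply: (@le_trans _ _ (n%:R * r - n%:R * (kp * r))); last by rewrite lerD2l lerN2.
  have -> : n%:R * r - n%:R * (kp * r) = n%:R * ((1 - kp) * r) by ring.
  by rewrite ler_peMl // mulr_ge0 ?subr_ge0 // ltW.
have rk0 : 0 <= (1 - kp) * r by rewrite mulr_ge0 ?subr_ge0 // ltW.
have c00 : 0 <= (corner k' : 'rV[R]_m) 0 i - tau by apply: le_trans c0'; exact: addr_ge0.
have thd2 : th + tau <= dd by apply: le_trans thd; rewrite lerD2l.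
have gain := slab_gain Hlin e2 Lq tau0 thd2 t0'1 t0h c00.
set p := ext (corner k') t0' in gain.
set c := (corner k' : 'rV[R]_m) 0 i - tau in gain c00 c0'.
set j := lift ord_max i in gain.
have cp : cube m.+1 p by apply: cube_ext => //; exact: HL.
have cj : c <= p 0 j by rewrite /p /j ext_lift gerBl.
have cs := setc_cube cp c00 cj.
set rho := F p - F (setc j c p) in gain.
have rho0 : 0 <= rho by apply: le_trans gain; rewrite mulr_ge0 // divr_ge0 // ltW.
have rho1 : rho <= 1.
  have /andP[_ f1] := cdf01 HF cp; have /andP[f2 _] := cdf01 HF cs.
  by rewrite /rho lerBlDr (le_trans f1) // lerDl.
have q01 (k'' : cellT N) i' : 0 <= (corner k'' : 'rV[R]_m) 0 i' /\ (corner k'' : 'rV[R]_m) 0 i' + (1 - kp) * r <= 1.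
  have [g0 g1] := @corner01 R m N k'' i'; split=> //; apply: le_trans g1; rewrite lerD2l ger_pMl //.
  by rewrite gerBl ltW.
have H0 x : x \in s -> ip (dl x) (dl p - dl (setc j c p)) = 0.
  move=> /sb bx; apply: (slab_ip0 ipd) => //; first exact: (bbox_cube (q01 k) t01 bx).
  have [/(_ i)/andP[_ h2] _] := bx; exact: le_trans h2 c0'.
have H1 x : x \in s' -> ip (dl x) (dl p - dl (setc j c p)) = rho.
  move=> /sb' bx; apply: (slab_ip ipd) => //; first exact: (bbox_cube (q01 k') t01' bx).
  have [h1 /andP[h2 _]] := bx => i'; case: (unliftP ord_max i') => [j' ->|->]; last by rewrite /p ext_max.
  by rewrite /p ext_lift; have /andP[] := h1 j'.
have H2 : ip one (dl p - dl (setc j c p)) = rho by apply: (slab_one ipd).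
have H3 : ip (dl p - dl (setc j c p)) (dl p - dl (setc j c p)) = rho by apply: (slab_self ipd).
have w1 : - w <= `|w| by rewrite -normrN ler_norm.
have w2 : w <= `|w| by exact: ler_norm.
have ur0 : 0 <= u * rho by rewrite mulr_ge0 // ltW.
have ur1 : u * rho <= u by rewrite ger_pMr.
apply: (le_trans (@pair_bound R m.+1 F V d T P X dl (dl p - dl (setc j c p)) u w rho C s s' (ltW u0) H0 H1 H2 H3 C0 _)).
  (* Both tilted pairs have the same 2 u' - w' = 2 u - w + 2 u rho, which lies in the range of the
     crude bound since rho <= 1. *)
  have rng : 0 < 2 * u - w + 2 * (u * rho) /\ 2 * u - w + 2 * (u * rho) <= 5 * u by move: (u * rho) (`|w|) ur0 ur1 wu w1 w2 => ? ? *; split; lra.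
  have [g1 g2] := rng.
  move=> u' w' s'' [[-> [-> ->]]|[-> [-> ->]]]; apply: HC; try by [left|right].
  - by have -> : 2 * u - (w - 2 * u * rho) = 2 * u - w + 2 * (u * rho) by ring.
  - by have -> : 2 * u - (w - 2 * u * rho) = 2 * u - w + 2 * (u * rho) by ring.
  - by have -> : 2 * (u + 2 * u * rho) - (w + 2 * u * rho) = 2 * u - w + 2 * (u * rho) by ring.
  - by have -> : 2 * (u + 2 * u * rho) - (w + 2 * u * rho) = 2 * u - w + 2 * (u * rho) by ring.
rewrite lee_fin; apply: ler_wpM2l; first by rewrite !mulr_ge0 ?expR_ge0.
apply: (@le_trans _ _ (expR (- (amin / 2 * tau * u ^+ 2)))).
  rewrite ler_expR.
  have h1 : amin / 2 * tau * u ^+ 2 <= rho * u ^+ 2 by apply: ler_wpM2r => //; exact: sqr_ge0.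
  have h2 : 4 * `|w| * (u * rho) <= u * (u * rho) by exact: ler_wpM2r.
  have -> : - 2 * u ^+ 2 * rho + 4 * u * rho * `|w| = 4 * `|w| * (u * rho) - 2 * (rho * u ^+ 2) by ring.
  by move: h2; rewrite (_ : u * (u * rho) = rho * u ^+ 2); [lra|ring].
have [tE|tE] := leP (n%:R * (kp * r)) ds; rewrite tauE.
  rewrite (min_idPl tE); apply: (@le_trans _ _ (expR (- (amin / 2 * kp * Tt * n%:R)))); last by rewrite lerDl expR_ge0.
  rewrite ler_expR lerN2 (_ : amin / 2 * (n%:R * (kp * r)) * u ^+ 2 = amin / 2 * kp * (u ^+ 2 * r) * n%:R); last by ring.
  apply: ler_wpM2r; first exact: ler0n.
  by apply: ler_wpM2l => //; rewrite mulr_ge0 ?divr_ge0 // ltW.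
by rewrite (min_idPr (ltW tE)) lerDr expR_ge0.
Qed.

(** Half of the decay is kept as a common small factor, the other half is spread over the total
    distance S. *)
Lemma dist_split (b : R) (n S : nat) : 0 <= b -> (0 < n)%N -> (S <= m * n)%N ->
  expR (- (b * n%:R)) <= expR (- (b / 2)) * expR (- (b / (2 * m%:R))) ^+ S.
Proof.
move=> b0 n0 Sn; rewrite -expRM_natl -expRD ler_expR mulrN -opprD lerN2.
have mR : 0 < m%:R :> R by rewrite ltr0n.
have h1 : S%:R * (b / (2 * m%:R)) <= (m * n)%:R * (b / (2 * m%:R)).
  by rewrite ler_wpM2r ?ler_nat // divr_ge0 // mulr_ge0.
have h2 : (m * n)%:R * (b / (2 * m%:R)) = b * n%:R / 2 by rewrite natrM; field; rewrite gt_eqF.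
have h3 : b <= b * n%:R by rewrite ler_peMr // ler1n.
by rewrite h2 in h1; lra.
Qed.

(** The loss (1 + kp)^m of the Riemann comparison is moved to the other side by (1 - kp)(1 + kp) <=
    1. *)
Lemma lower_sum (kp IG S c : R) : 0 < kp -> kp <= 1 -> 0 <= S -> 0 <= c -> 0 <= IG ->
  IG <= c + (1 + kp) ^+ m * S -> (1 - kp) ^+ (2 * m + 1) * IG <= (1 - kp) ^+ m.+1 * S + c.
Proof.
move=> k0 k1 S0 c0 I0 hle; have q0 : 0 <= 1 - kp by rewrite subr_ge0.
have q1 : 1 - kp <= 1 by rewrite gerBl ltW.
have -> : (1 - kp) ^+ (2 * m + 1) = (1 - kp) ^+ m.+1 * (1 - kp) ^+ m by rewrite -exprD addn1 mul2n -addnn addSn.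
set A := (1 - kp) ^+ m.+1; have A0 : 0 <= A by exact: exprn_ge0.
have A1 : A <= 1 by exact: exprn_ile1.
set B := (1 - kp) ^+ m; have B0 : 0 <= B by exact: exprn_ge0.
have B1 : B <= 1 by exact: exprn_ile1.
have BD : B * (1 + kp) ^+ m <= 1.
  rewrite -exprMn; apply: exprn_ile1; first by rewrite mulr_ge0 // addr_ge0 // ltW.
  by have -> : (1 - kp) * (1 + kp) = 1 - kp ^+ 2; [ring|rewrite gerBl sqr_ge0].
have AB1 : A * B <= 1 by apply: mulr_ile1.
apply: (@le_trans _ _ (A * B * (c + (1 + kp) ^+ m * S))); first by apply: ler_wpM2l => //; exact: mulr_ge0.
rewrite mulrDr addrC; apply: lerD; last by rewrite ler_piMl.
have -> : A * B * ((1 + kp) ^+ m * S) = A * S * (B * (1 + kp) ^+ m) by ring.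
by rewrite ler_piMr // mulr_ge0.
Qed.

(** Bonferroni over the blocks of the good cells. Relative to the exponential, the pairs of one
    block sum to order T^m exp (- bb T / 2) plus a term in exp (- cc u^2). T is fixed so large that
    the former is a small fraction of the main term, and u makes the latter negligible. *)
Lemma lower_bound (kap IG : R) : 0 < kap -> kap <= 1 -> 0 <= IG -> (IG%:E <= leb_integral L (fun x => G x))%E ->
  \forall u \near +oo, exists2 s : seq 'rV[R]_m.+1, (forall x, x \in s -> cube m.+1 x) &
  ((8 ^+ m * ((1 - kap) * IG - kap) * u ^+ (2 * m) * E u)%:E <= P [set t | ev u w s t])%E.
Proof.
move=> k0 k1 IG0 HIG.
have [kp /andP[kp0 kph] [_ kpk]] := pow_small (2 * m + 1) k0 k1.
have kp1 : kp <= 1 by lra.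
have kq : 2^-1 <= 1 - kp by lra.
have kq0 : 0 < 1 - kp by lra.
have AM : 0 < amax ^+ m by rewrite exprn_gt0.
have mR : 0 < m%:R :> R by rewrite ltr0n.
pose eta := kap / (4 * amax ^+ m); have eta0 : 0 < eta by rewrite divr_gt0 // mulr_gt0.
have etaE : amax ^+ m * eta = kap / 4 by rewrite /eta; field; rewrite gt_eqF.
have p80 : 0 < 8 ^+ m :> R by rewrite exprn_gt0.
have [T0 T01 HT] := cell_lower m0 HF ipd w amin0 amm kp0 kp1.
have [Cq Cq0 HCq] := cell_crude m0 HF ipd amin0 amm.
pose Ca : R := Cq ^+ m; have Ca0 : 0 < Ca by exact: exprn_gt0.
pose bb := amin / 2 * kp; have bb0 : 0 < bb by rewrite mulr_gt0 // divr_gt0.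
have pb0 : 0 < 8 ^+ m * (kap / 4) by rewrite mulr_gt0 // divr_gt0.
have bb2 : 0 < bb / 2 by rewrite divr_gt0.
have bbm : 0 < bb / (2 * m%:R) by rewrite divr_gt0 // mulr_gt0.
have half0 : 0 < 2^-1 :> R by rewrite invr_gt0.
(* 16 Ca T^m is twice the crude constant C; the last condition makes the ratio of the lattice sum at
   most 1/2. *)
have [Tt [HT0 Tp1 Tp2]] : exists Tt, [/\ T0 <= Tt, 16 * Ca * 3 ^+ m * Tt ^+ m * expR (- (bb / 2 * Tt)) <= 8 ^+ m * (kap / 4) &
    1 * Tt ^+ 0 * expR (- (bb / (2 * m%:R) * Tt)) <= 2^-1].
  have := near_and3 (near_ge T0) (near_powexp m (16 * Ca * 3 ^+ m) bb2 pb0) (near_powexp 0 1 bbm half0).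
  by move=> /filter_ex[Tt HTt]; exists Tt.
have T1 : 1 <= Tt by exact: le_trans HT0.
have Tt0 : 0 < Tt by exact: lt_le_trans ltr01 T1.
have [e1 e10 Hlow] := HT Tt HT0.
have [e2 e20 Hcr] := HCq Tt T1.
have [eps eps0 /and4P[ee1 ee2 eam _]] : exists2 y : R, 0 < y & all (fun x => y <= x) [:: e1; e2; amin / 2].
  by apply: min_exists; rewrite /= e10 e20 divr_gt0.
have [d1 d10 Hlin] := lin eps0.
have q4 : 0 < 4^-1 :> R by rewrite invr_gt0.
have [d2 d20 Hd2] := cube_unif_cont Fcont q4.
have [d3 d30 Hd3] := a_ratio kp0.
have [e4 e40 [n [A [B [AB SAB Hcov]]]]] := level_cover HL HdL eta0.
have e42 : 0 < e4 / 2 by rewrite divr_gt0.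
have [thw thw0 Hw] := h_window m0 HF HL HD amin0 abd lin e42.
have t20 : 0 < d3 / 2 by rewrite divr_gt0.
have [dh dh0 Hh] := h_unif HF Fcont HL HD amin0 abd lin t20.
have [th th0 /and5P[thd1 thd2 thw1 tha _]] : exists2 y : R, 0 < y & all (fun x => y <= x) [:: d1 / 2; d2 / 2; thw; (2 * amin)^-1].
  by apply: min_exists; rewrite /= thw0 invr_gt0 !divr_gt0 // mulr_gt0.
have thd1' := le_half_double thd1.
have thd2' := le_half_double thd2.
have thd1'' := le_half_le d10 thd1.
have thd2'' := le_half_le d20 thd2.
have thds := le_half_add thd1.
have [mm mm0 /and5P[mth md3 me4 mdh _]] : exists2 y : R, 0 < y & all (fun x => y <= x) [:: th; d3 / 2; e4 / 2; dh].
  by apply: min_exists; rewrite /= th0 dh0 !divr_gt0.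
pose sg := amin * th / 2; have sg0 : 0 < sg by rewrite divr_gt0 // mulr_gt0.
have sg4 : sg <= 4^-1.
  have : amin * th <= amin * (2 * amin)^-1 by rewrite ler_pM2l.
  have -> : amin * (2 * amin)^-1 = 2^-1 by field; rewrite gt_eqF.
  exact: half_le_quarter.
pose C := 8 * (Cq * Tt) ^+ m; have C0 : 0 < C by rewrite mulr_gt0 // exprn_gt0 // mulr_gt0.
have d120 : 0 < d1 / 2 by rewrite divr_gt0.
pose cc := amin / 2 * (d1 / 2); have cc0 : 0 < cc by rewrite mulr_gt0 // divr_gt0.
apply: filterS (near_and3 (near_and3 (Hlow eps sg eps0 ee1 sg0 sg4) Hcr (near_sq_ge Tt))
  (near_and3 (near_ge 1) (near_ge (4 * `|w|)) (near_div_sq (m%:R * (2 * Tt)) mm0))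
  (near_sq (near_powexp m (2 * C) cc0 pb0))) => u [[Hl Hc Tu] [u1 uw mru] Hpair].
have u0 : 0 < u by exact: lt_le_trans ltr01 u1.
have u20 : 0 < u ^+ 2 by rewrite exprn_gt0.
have [N [rT1 rT2]] := grid_size Tt0 Tu; have r0 : 0 < (N.+1%:R^-1 : R) by exact: r_gt0.
have mr : m%:R * N.+1%:R^-1 <= mm.
  by apply: le_trans mru; rewrite -mulrA; apply: ler_wpM2l => //; rewrite ler_pdivlMr // mulrC.
have E0 : 0 < E u by exact: expR_gt0.
pose r' : R := (1 - kp) * N.+1%:R^-1.
have r'0 : 0 < r' by rewrite mulr_gt0.
have r'r : r' <= N.+1%:R^-1 by rewrite ger_pMl // gerBl ltW.
have rT1' : Tt / 2 <= u ^+ 2 * r'.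
  have -> : u ^+ 2 * r' = (u ^+ 2 * N.+1%:R^-1) * (1 - kp) by rewrite /r'; ring.
  by apply: ler_pM => //; exact: ltW.
have rT2' : u ^+ 2 * r' <= 2 * Tt by apply: le_trans rT2; rewrite ler_pM2l.
pose cq (k : cellT N) : 'rV[R]_m := corner k.
(* A good cell meets the part of L that is e4-deep; its corner is then e4 / 2 deep, so [h_window]
   applies there. *)
pose good (k : cellT N) : bool := `[< exists x, [/\ L x, rbox (cq k) (cq k + const_mx N.+1%:R^-1) x & forall y, norm1 (y - x) <= e4 -> L y] >].
have qin k : rbox (cq k) (cq k + const_mx N.+1%:R^-1) (cq k) by move=> i; rewrite row_shiftE lexx lerDl ltW.
have goodP k : good k -> L (cq k) /\ thw <= h (cq k) <= 1 - thw.
  move=> /asboolP[x [Lx rx bx]].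
  have qx : norm1 (cq k - x) <= e4 / 2.
    by apply: le_trans me4; apply: le_trans mr; exact: cell_dist (qin k) rx.
  have bq y : norm1 (y - cq k) <= e4 / 2 -> L y.
    by move=> yq; apply: bx; apply: le_trans (norm1_tri y (cq k) x) _; rewrite (splitr e4) lerD.
  by split; [apply: bq; rewrite norm1_0 ltW|exact: Hw].
pose lo k := Num.max 0 (h (cq k) - th); pose hi k := Num.min 1 (h (cq k) + th).
have blk k : good k -> blockP F amin amax (cq k) r' (lo k) (hi k) (fun i => a i (pth (cq k))) eps.
  move=> /goodP[Lq _]; apply: (@block_of (2 * th) eps th (m%:R * N.+1%:R^-1) r' (cq k) (cq k)) => //.
  - by move=> z x y Dz cx cy xz yz; apply: Hlin => //; exact: le_trans thd1'.
  - by move=> x y cx cy xy; apply: Hd2 => //; exact: le_trans thd2'.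
  - move=> i; have [g0 g1] := @corner01 R m N k i; split=> //.
    by apply: le_trans g1; rewrite lerD2l.
  - exact: ltW.
  - by rewrite (_ : 2 * th = th + th); [rewrite lerD2r (le_trans mr)|ring].
  - move=> y ry; apply: (cell_dist (k := k)) (qin k) => i.
    by have /andP[g1 g2] := ry i; move: g2; rewrite !row_shiftE g1 => /le_trans; apply; rewrite lerD2l.
have win k : good k -> lo k = h (cq k) - th /\ hi k = h (cq k) + th.
  move=> /goodP[_ /andP[w1 w2]]; split; rewrite /lo /hi.
    by apply/max_idPr; rewrite subr_ge0 (le_trans thw1).
  by apply/min_idPr; rewrite -lerBrDr (le_trans w2) // lerD2l lerN2.
have cellb k : exists s : seq 'rV[R]_m.+1, good k -> (forall x, x \in s -> bbox (cq k) r' (lo k) (hi k) x) /\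
  (((1 - kp) * E u * ((8 * (u ^+ 2 * r')) ^+ m * G (cq k)))%:E <= P [set t | ev u w s t])%E.
  have [gk|ngk] := boolP (good k); last by exists [::].
  have [Lq hw] := goodP k gk; have [loE hiE] := win k gk; have Bk := blk k gk.
  have /andP[hw1 hw2] := hw.
  have hth : th <= h (cq k) <= 1 - th.
    by rewrite (le_trans thw1 hw1) (le_trans hw2) // lerD2l lerN2.
  have [f1 f2] := level_step Hlin eam Lq (ltW th0) thd1'' hth.
  have [cz Fz] := levelP HD Lq.
  have /andP[hth1 hth2] := hth.
  have cl : cube m.+1 (ext (cq k) (h (cq k) - th)).
    apply: cube_ext; first exact: HL.
    by rewrite subr_ge0 hth1 (le_trans _ (le_trans hth2 _)) ?gerBl ?lerBlDr ?lerDl ?(ltW th0).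
  have ch : cube m.+1 (ext (cq k) (h (cq k) + th)).
    apply: cube_ext; first exact: HL.
    by rewrite -lerBrDr hth2 andbT addr_ge0 ?(ltW th0) // (le_trans (ltW th0)).
  have f3 : F (ext (cq k) (h (cq k) + th)) <= 3 / 4.
    have := Hd2 _ _ ch cz; rewrite norm1_ext norm1_0 add0r Fz (_ : h (cq k) + th - h (cq k) = th); last by ring.
    by rewrite ger0_norm ?(ltW th0) // => /(_ thd2''); rewrite ler_norml => /andP[_ /le_three_quarters].
  have [|||||s sb sP] := Hl (cq k) r' (lo k) (hi k) _ Bk _ rT1' rT2'.
  - by rewrite loE hiE ltrBlDr -addrA ltrDl addr_gt0.
  - by rewrite /bth loE; have /andP[] := cdf01 HF cl.
  - by rewrite /bth loE.
  - by rewrite /bth hiE.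
  - by rewrite /bth hiE.
  by exists s => _; split=> //; rewrite -prod_scale.
pose sk k := sval (cid (cellb k)).
have skP k : good k -> (forall x, x \in sk k -> bbox (cq k) r' (lo k) (hi k) x) /\
  (((1 - kp) * E u * ((8 * (u ^+ 2 * r')) ^+ m * G (cq k)))%:E <= P [set t | ev u w (sk k) t])%E by rewrite /sk; case: cid.
pose ks := [seq k <- enum {: cellT N} | good k].
have ksP k : k \in ks -> good k by rewrite mem_filter => /andP[].
exists (flatten [seq sk k | k <- ks]).
  move=> x /flatten_mapP[k /ksP gk xk]; have [sb _] := skP k gk.
  have [_ q01 t01 _ _] := blk k gk; exact: (bbox_cube q01 t01 (sb x xk)).
have -> : [set t | ev u w (flatten [seq sk k | k <- ks]) t] = [set t | has (fun k => ev u w (sk k) t) ks].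
  by apply/seteqP; split => t /=; rewrite has_flatten_map.
have us : uniq ks by rewrite filter_uniq // enum_uniq.
have bon := bonferroni P us (b := fun k t => ev u w (sk k) t) (fun k => measurable_ev F X dl u w (sk k)).
set PU := P [set t | has (fun k => ev u w (sk k) t) ks] in bon *.
pose S := \sum_(k | good k) G (cq k) * N.+1%:R^-1 ^+ m.
have gG k : good k -> 0 <= G (cq k) by move=> /goodP[Lq _]; have [] := G_bounds Lq.
have S0 : 0 <= S by apply: sumr_ge0 => k gk; rewrite mulr_ge0 ?gG // exprn_ge0 // ltW.
(* An upper Riemann sum over the good cells and the boxes of [level_cover]. *)
have IS : IG <= kap / 4 + (1 + kp) ^+ m * S.
  pose I := ('I_n + cellT N)%type.
  pose ok (i : I) := if i is inr k then good k else true.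
  pose sI (i : I) : R := match i with inl _ => amax ^+ m | inr k => if good k then (1 + kp) ^+ m * G (cq k) else 0 end.
  pose aI (i : I) : 'rV[R]_m := match i with inl j => A j | inr k => cq k end.
  pose bI (i : I) : 'rV[R]_m := match i with inl j => B j | inr k => cq k + const_mx N.+1%:R^-1 end.
  have km0 : 0 < (1 + kp) ^+ m by rewrite exprn_gt0 // addr_gt0.
  have : (leb_integral L (fun x => G x) <= (\sum_(i <- [seq i <- enum {: I} | ok i]) sI i * rvol (aI i) (bI i))%:E)%E.
    apply: leb_integral_le => //.
    - by move=> [j|k] /=; [exact: ltW|case: ifP => // gk; rewrite mulr_ge0 ?gG // ltW].
    - by move=> [j|k] i /=; [exact: AB|rewrite row_shiftE lerDl ltW].
    - move=> x Lx; have [[j Hj]|Hr] := Hcov x Lx.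
        by exists (inl j); [rewrite mem_filter /= mem_enum|apply: Hj; rewrite norm1_0 ltW].
      have rx := @cellf_rbox R m N x (HL Lx).
      exists (inr (cellf N x)) => //; rewrite mem_filter /= mem_enum andbT.
      by apply/asboolP; exists x.
    - move=> [j|k] x; rewrite mem_filter; first by move=> _ Lx _; have [] := G_bounds Lx.
      move=> /andP[gk _] Lx rx; rewrite /= in gk; rewrite /= gk; have [Lq _] := goodP k gk; have xq := le_trans (cell_dist rx (qin k)) mr.
      apply: (@G_ratio kp d3) => //; first exact: ltW.
      rewrite norm1_ext (splitr d3) lerD //; first exact: le_trans xq md3.
      by apply: Hh => //; exact: le_trans xq mdh.
  move=> /(le_trans HIG); rewrite lee_fin => /le_trans; apply.
  rewrite big_filter big_enum_cond /= big_sumType /=; apply: lerD.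
    by rewrite -mulr_sumr -etaE; apply: ler_wpM2l; [exact: ltW|].
  rewrite /S mulr_sumr; apply: eqle; apply: eq_bigr => k gk.
  by rewrite gk cell_vol mulrA.
have main : (((1 - kp) ^+ m.+1 * S * 8 ^+ m * u ^+ (2 * m) * E u)%:E <= \sum_(k <- ks) P [set t | ev u w (sk k) t])%E.
  apply: (@le_trans _ _ (\sum_(k <- ks) ((1 - kp) * E u * ((8 * (u ^+ 2 * r')) ^+ m * G (cq k)))%:E)%E).
    rewrite sumEFin lee_fin big_filter big_enum_cond /= -!mulr_sumr /S -mulr_suml /r'.
    rewrite mul2n -addnn exprD exprS !exprMn.
    move: (8 ^+ m) (u ^+ m) ((1 - kp) ^+ m) (N.+1%:R^-1 ^+ m) (\sum_(i | good i) G (cq i)) (E u) (1 - kp) => y1 y2 y3 y4 y5 y6 y7.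
    by apply: eqle; ring.
  by rewrite big_seq [leRHS]big_seq; apply: lee_sum => k /ksP gk; have [] := skP k gk.
pose D2 := 2 * C * E u; have D20 : 0 < D2 by exact: mulr_gt0 (mulr_gt0 (ltr0Sn R 1) C0) E0.
pose xx := expR (- (bb * Tt / (2 * m%:R))).
have xx0 : 0 <= xx by exact: expR_ge0.
have xxh : 0 <= xx <= 2^-1.
  rewrite xx0 /=; apply: le_trans Tp2; rewrite expr0 !mul1r /xx; apply: eqle.
  by congr (expR (- _)); ring.
have pair k k' : k \in ks -> k' \in ks -> k' != k ->
  (P [set t | ev u w (sk k) t && ev u w (sk k') t] <=
   (D2 * (expR (- (bb * Tt / 2)) * xx ^+ (\sum_i ((k' i - k i) + (k i - k' i)))%N + expR (- (cc * u ^+ 2))))%:E)%E.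
  move=> /ksP gk /ksP gk' kk.
  have crude ka u' w' s'' : good ka -> s'' = sk ka -> 0 < 2 * u' - w' -> 2 * u' - w' <= 5 * u ->
    (P [set t | ev u' w' s'' t] <= (C * expR (- 2 * u' ^+ 2 + 2 * u' * w'))%:E)%E.
    move=> gka -> h1 h2; have [sb _] := skP ka gka.
    exact: (Hc _ _ _ _ _ _ u' w' (sk ka) (blk ka gka) (ltW eps0) ee2 rT2' sb h1 h2).
  have loh ka : good ka -> `|lo ka - h (cq ka)| <= th.
    by move=> gka; have [-> _] := win ka gka; rewrite addrAC subrr add0r normrN gtr0_norm.
  have half ka kb i : good ka -> good kb -> (ka i < kb i)%N ->
    (P [set t | ev u w (sk ka) t && ev u w (sk kb) t] <= (D2 * (expR (- (bb * Tt * (kb i - ka i)%:R)) + expR (- (cc * u ^+ 2))))%:E)%E.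
    move=> g1 g2 ki; have [_ _ t01 _ _] := blk ka g1; have [_ _ t01' _ _] := blk kb g2.
    have [sba _] := skP ka g1; have [sbb _] := skP kb g2; have [Lq _] := goodP kb g2.
    apply: (@pair_cells d1 eps th (d1 / 2) kp u Tt C N ka kb i (lo ka) (hi ka) (lo kb) (hi kb)) => //; try (exact: ltW); try (exact: loh).
    by move=> u' w' s'' [] sE; [exact: (crude ka)|exact: (crude kb)].
  rewrite eq_sym in kk; have [i [n0 Sn]] := max_dist kk.
  have bT0 : 0 <= bb * Tt by rewrite mulr_ge0 // ltW.
  have ds := dist_split bT0 n0 Sn.
  apply: (@le_trans _ _ (D2 * (expR (- (bb * Tt * ((k' i - k i) + (k i - k' i))%:R)) + expR (- (cc * u ^+ 2))))%:E); last first.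
    by rewrite lee_fin ler_pM2l // lerD2r.
  case: (ltngtP (k i) (k' i)) n0 => [ki _|ki _|ki]; last by rewrite ki subnn.
    by have /eqP -> : (k i - k' i == 0)%N; [rewrite subn_eq0 ltnW|rewrite addn0; exact: half].
  have /eqP -> : (k' i - k i == 0)%N by rewrite subn_eq0 ltnW.
  have -> : [set t | ev u w (sk k) t && ev u w (sk k') t] = [set t | ev u w (sk k') t && ev u w (sk k) t].
    by apply/seteqP; split => t /=; rewrite andbC.
  exact: half.
have Nu : N.+1%:R <= u ^+ 2.
  have h1 : 1 <= u ^+ 2 * N.+1%:R^-1 by exact: le_trans T1 rT1.
  by rewrite ler_pdivlMr ?ltr0n // mul1r in h1.
have cardN : #|{: cellT N}|%:R <= u ^+ (2 * m).
  by rewrite card_ffun !card_ord natrX exprM lerXn2r ?nnegrE // ltW.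
have pairs : (\sum_(k <- ks) \sum_(k' <- ks | k' != k) P [set t | ev u w (sk k) t && ev u w (sk k') t] <=
   (8 ^+ m * (kap / 2) * u ^+ (2 * m) * E u)%:E)%E.
  pose Q := D2 * (expR (- (bb * Tt / 2)) * 3 ^+ m + u ^+ (2 * m) * expR (- (cc * u ^+ 2))).
  have inner k : k \in ks -> (\sum_(k' <- ks | k' != k) P [set t | ev u w (sk k) t && ev u w (sk k') t] <= Q%:E)%E.
    move=> kks; pose f (k' : cellT N) := D2 * (expR (- (bb * Tt / 2)) * xx ^+ (\sum_i ((k' i - k i) + (k i - k' i)))%N + expR (- (cc * u ^+ 2))).
    have f0 k' : 0 <= f k' by rewrite mulr_ge0 ?(ltW D20) // addr_ge0 ?expR_ge0 // mulr_ge0 ?expR_ge0 // exprn_ge0.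
    apply: (@le_trans _ _ (\sum_(k' <- ks | k' != k) (f k')%:E)%E).
      rewrite big_seq_cond [leRHS]big_seq_cond; apply: lee_sum => k' /andP[k'ks kk]; exact: pair.
    rewrite sumEFin lee_fin big_filter_cond big_enum_cond /=.
    apply: (@le_trans _ _ (\sum_k' f k')).
      by rewrite [leRHS](bigID (fun k' => good k' && (k' != k))) /= lerDl sumr_ge0.
    rewrite /f -mulr_sumr /Q ler_pM2l // big_split /= -mulr_sumr; apply: lerD.
      by apply: ler_wpM2l; [exact: expR_ge0|exact: lattice_sum].
    by rewrite sumr_const -mulr_natl; apply: ler_wpM2r; [exact: expR_ge0|exact: cardN].
  have Q0 : 0 <= Q.
    by rewrite mulr_ge0 ?(ltW D20) // addr_ge0 // mulr_ge0 ?expR_ge0 // exprn_ge0 // ltW.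
  apply: (@le_trans _ _ (\sum_(k <- ks) Q%:E)%E).
    by rewrite big_seq [leRHS]big_seq; apply: lee_sum => k kks; exact: inner.
  rewrite sumEFin lee_fin big_filter big_enum_cond /=.
  apply: (@le_trans _ _ (\sum_(k : cellT N) Q)).
    by rewrite [leRHS](bigID good) /= lerDl sumr_ge0.
  rewrite sumr_const -[leLHS]mulr_natl; apply: (@le_trans _ _ (u ^+ (2 * m) * Q)); first exact: (ler_wpM2r Q0 cardN).
  have Q1 : 2 * C * (expR (- (bb * Tt / 2)) * 3 ^+ m) <= 8 ^+ m * (kap / 4).
    apply: le_trans Tp1; apply: eqle.
    rewrite /C /Ca exprMn (_ : bb / 2 * Tt = bb * Tt / 2); last by ring.
    by move: (expR _) (3 ^+ m) (Tt ^+ m) (Cq ^+ m) => *; ring.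
  have Q2 : 2 * C * (u ^+ (2 * m) * expR (- (cc * u ^+ 2))) <= 8 ^+ m * (kap / 4) by rewrite mulrA exprM.
  have -> : u ^+ (2 * m) * Q = u ^+ (2 * m) * E u * (2 * C * (expR (- (bb * Tt / 2)) * 3 ^+ m) + 2 * C * (u ^+ (2 * m) * expR (- (cc * u ^+ 2)))).
    by rewrite /Q /D2; ring.
  have -> : 8 ^+ m * (kap / 2) * u ^+ (2 * m) * E u = u ^+ (2 * m) * E u * (8 ^+ m * (kap / 4) + 8 ^+ m * (kap / 4)) by field.
  apply: ler_wpM2l; first by rewrite mulr_ge0 ?(ltW E0) // exprn_ge0 // ltW.
  exact: lerD.
have fPU : PU \is a fin_num by exact: fin_num_measure (measurable_set_bool (measurable_hasb ks (fun k => measurable_ev F X dl u w (sk k)))).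
have := le_trans main (le_trans bon (leeD (lexx PU) pairs)).
rewrite -(fineK fPU) -EFinD !lee_fin => hfin.
have c40 : 0 <= kap / 4 by rewrite divr_ge0 // ltW.
have ls := lower_sum kp0 kp1 S0 c40 IG0 IS.
have UE0 : 0 <= 8 ^+ m * u ^+ (2 * m) * E u by rewrite !mulr_ge0 ?(ltW E0) ?(ltW p80) // exprn_ge0 // ltW.
have ls2 : (1 - kap) * IG <= (1 - kp) ^+ m.+1 * S + kap / 4 by apply: le_trans ls; apply: ler_wpM2r.
have : (8 ^+ m * u ^+ (2 * m) * E u) * ((1 - kap) * IG) <= (8 ^+ m * u ^+ (2 * m) * E u) * ((1 - kp) ^+ m.+1 * S + kap / 4) by apply: ler_wpM2l.
move: hfin; rewrite (_ : (1 - kp) ^+ m.+1 * S * 8 ^+ m * u ^+ (2 * m) * E u = (8 ^+ m * u ^+ (2 * m) * E u) * ((1 - kp) ^+ m.+1 * S)); last by ring.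
rewrite (_ : 8 ^+ m * (kap / 2) * u ^+ (2 * m) * E u = (8 ^+ m * u ^+ (2 * m) * E u) * (kap / 2)); last by ring.
rewrite (_ : 8 ^+ m * ((1 - kap) * IG - kap) * u ^+ (2 * m) * E u = (8 ^+ m * u ^+ (2 * m) * E u) * ((1 - kap) * IG) - (8 ^+ m * u ^+ (2 * m) * E u) * kap); last by ring.
by move=> g1 g2; exact: (lower_final UE0 k0 g1 g2).
Qed.

(** Otherwise [level_cover] would put all of L into boxes of arbitrarily small total volume. *)
Lemma interior_ball : leb_outer L != 0%E -> exists x (e : R), [/\ L x, 0 < e & forall y, norm1 (y - x) <= e -> L y].
Proof.
move=> L0; apply: contrapT => nx; move/negP: L0; apply.
rewrite eq_le leb_ge0 andbT; apply/lee_addgt0Pr => eta eta0; rewrite add0e.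
have [e e0 [n [A [B [AB SAB Hcov]]]]] := level_cover HL HdL eta0.
apply: (le_trans (leb_bigsetU m0 (s := enum 'I_n) (F := fun j => rbox (A j) (B j)) _)).
  move=> x Lx; have [[j Hj]|Hr] := Hcov x Lx; last by exfalso; apply: nx; exists x, e.
  exists j; last by apply: Hj; rewrite norm1_0 ltW.
  have : j \in enum 'I_n by rewrite mem_enum.
  by elim: (enum 'I_n) => //= i s IH; rewrite in_cons => /predU1P[->|/IH]; [left|right].
rewrite big_enum /=; apply: (@le_trans _ _ (\sum_j (rvol (A j) (B j))%:E)%E); last by rewrite sumEFin lee_fin.
by apply: lee_sum => j _; apply: le_trans (leb_box m0 (AB j)); apply: leb_mono => x [].
Qed.

(** A small cube inside L bounds the integral from below, the unit cube from above. *)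
Lemma G_integral : leb_outer L != 0%E -> exists2 IG : R, 0 < IG & leb_integral L (fun x => G x) = IG%:E.
Proof.
move=> /interior_ball[x [e [Lx e0 bx]]].
have mR : 0 < m%:R :> R by rewrite ltr0n.
pose r := e / m%:R; have r0 : 0 < r by rewrite divr_gt0.
have volE : rvol x (x + const_mx r) = r ^+ m.
  rewrite /rvol -[in RHS](card_ord m) -prodr_const; apply: eq_bigr => i _.
  by rewrite row_shiftE addrAC subrr add0r.
have lb : ((amin ^+ m * r ^+ m)%:E <= leb_integral L (fun x => G x))%E.
  have := @leb_integral_ge R m m0 L (fun x => G x) 'I_1 (fun=> amin ^+ m) (fun=> x) (fun=> x + const_mx r).
  rewrite big_ord1 volE; apply.
  - by move=> _; rewrite exprn_ge0 // ltW.
  - by move=> _ i; rewrite row_shiftE lerDl ltW.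
  move=> y; rewrite big_ord1; have [yb|ny] := pselect (hbox x (x + const_mx r) y); last first.
    by rewrite indicE memNset // mulr0; case: asboolP => // Ly; have [] := G_bounds Ly.
  rewrite indicE mem_set // mulr1.
  have Ly : L y.
    apply: bx; rewrite (_ : e = m%:R * r); last by rewrite /r mulrCA mulfV ?mulr1 // gt_eqF.
    apply: norm1_le => i; have /andP[h1 h2] := yb i; rewrite !mxE ger0_norm ?subr_ge0 //.
    by rewrite lerBlDl ltW // -row_shiftE.
  case: asboolP => // _; have [cy _] := levelP HD Ly.
  rewrite -[in leLHS](card_ord m) -prodr_const; apply: ler_prod => i _.
  by have /andP[h1 _] := abd (lift ord_max i) cy; rewrite h1 ltW.
have ub : (leb_integral L (fun x => G x) <= (amax ^+ m)%:E)%E.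
  have := @leb_integral_le R m m0 L (fun x => G x) 'I_1 [:: ord0] (fun=> amax ^+ m) (fun=> 0) (fun=> ones m).
  rewrite big_seq1 (_ : rvol 0 (ones m) = 1); last by rewrite /rvol big1 // => i _; rewrite !mxE subr0.
  rewrite mulr1; apply.
  - by move=> _; rewrite exprn_ge0 // ltW.
  - by move=> _ i; rewrite !mxE.
  - by move=> y Ly; exists ord0 => // i; have := HL Ly i; rewrite !mxE.
  - by move=> _ y _ Ly _; have [] := G_bounds Ly.
have fin : leb_integral L (fun x => G x) \is a fin_num.
  by rewrite fin_numE gt_eqF ?lt_eqF // ?(le_lt_trans ub (ltry _)) // (lt_le_trans (ltNyr _) lb).
exists (fine (leb_integral L (fun x => G x))); last by rewrite fineK.
rewrite -lte_fin fineK //; apply: lt_le_trans lb.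
by rewrite lte_fin mulr_gt0 // exprn_gt0.
Qed.
End assembly.

(** * The supremum over the cube from rational points *)

Section rational_prefixes.
Context {R : realType} (k : nat).

(** Increasing finite lists that exhaust the rational points of the cube, along the codes of
    rational vectors. *)
Definition rat_prefix (n : nat) : seq 'rV[R]_k :=
  [seq x <- pmap (fun j => omap (map_mx ratr) (unpickle j : option 'rV[rat]_k)) (iota 0 n) | `[< cube k x >]].

Lemma rat_prefix_cube n x : x \in rat_prefix n -> cube k x.
Proof. by rewrite mem_filter => /andP[/asboolP]. Qed.

Lemma rat_prefix_sub n n' : (n <= n')%N -> {subset rat_prefix n <= rat_prefix n'}.
Proof.
move=> nn x; rewrite !mem_filter => /andP[-> /=]; rewrite -(subnKC nn) iotaD pmap_cat mem_cat => ->.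
by [].
Qed.

Lemma rat_prefixP (x : 'rV[R]_k) : rat_cube k x -> exists n, x \in rat_prefix n.
Proof.
move=> [cx rx]; pose f i := sval (cid (rx i)); have fE i : x 0 i = ratr (f i) by rewrite /f; case: cid.
pose y : 'rV[rat]_k := \row_i f i; exists (pickle y).+1.
rewrite mem_filter; apply/andP; split; first exact/asboolP.
rewrite mem_pmap; apply/mapP; exists (pickle y); first by rewrite mem_iota /= add0n.
by rewrite pickleK /=; congr Some; apply/rowP => i; rewrite !mxE fE.
Qed.
End rational_prefixes.

Section separable_supremum.
Context {R : realType} (k : nat) d (T : measurableType d) (P : probability T R).
Variables (W : T -> 'rV[R]_k -> R) (F : 'rV[R]_k -> R) (w u : R).
Hypothesis Fcont : {within cube k, continuous F}.
Hypothesis Wsep : forall om x, cube k x -> exists q : nat -> 'rV[R]_k,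
     (forall k0, rat_cube k (q k0)) /\ q k0 @[k0 --> \oo] --> x /\
     W om (q k0) @[k0 --> \oo] --> W om x.
Local Notation hit om x := (u < W om x - F x * W om (ones k) + F x * w).

(** A strict inequality that holds in the limit already holds at some term of the approximating
    rational sequence; F converges along it by continuity. *)
Lemma sup_prefixes : [set om | exists x, cube k x /\ hit om x] = \bigcup_n [set om | has (fun x => hit om x) (rat_prefix k n)].
Proof.
apply/seteqP; split => [om [x [cx hx]]|om [n _ /hasP[x xn hx]]]; last first.
  by exists x; split=> //; exact: rat_prefix_cube xn.
have [q [qr [qx Wq]]] := Wsep om cx.
have Fq : F (q j) @[j --> \oo] --> F x.
  apply/cvgrPdist_le => e e0; have [dd dd0 Hd] := cube_cont Fcont cx e0.
  have nb : nbhs x [set y | norm1 (y - x) <= dd] by apply/nbhs_norm1; exists dd.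
  have [N _ HN] := qx _ nb; exists N => // j Nj /=; rewrite distrC; apply: Hd; last exact: HN.
  by have [] := qr j.
have lim : (W om (q j) - F (q j) * W om (ones k) + F (q j) * w) @[j --> \oo] --> W om x - F x * W om (ones k) + F x * w.
  by apply: cvgD; [apply: cvgB => //; apply: cvgMl|apply: cvgMl].
have : \forall y \near (W om x - F x * W om (ones k) + F x * w), u < y by exact: lt_nbhsr.
move=> /lim [N _ HN]; have [n xn] := rat_prefixP (qr N).
by exists n => //; apply/hasP; exists (q N) => //; apply: (HN N) => /=.
Qed.

Hypothesis mh : forall x, cube k x -> measurable_fun setT (fun om => hit om x).

Lemma measurable_prefix n : measurable [set om | has (fun x => hit om x) (rat_prefix k n)].
Proof.
apply: measurable_set_bool.
pose b x om := `[< cube k x >] && hit om x.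
have -> : (fun om => has (fun x => hit om x) (rat_prefix k n)) = (fun om => has (b^~ om) (rat_prefix k n)).
  by apply/funext => om; apply: eq_in_has => x /rat_prefix_cube cx; rewrite /b asboolT.
apply: measurable_hasb => x; rewrite /b; case: asboolP => [cx|ncx] /=; first exact: mh.
exact: measurable_cst.
Qed.

Lemma measurable_sup : measurable [set om | exists x, cube k x /\ hit om x].
Proof. by rewrite sup_prefixes; apply: bigcupT_measurable => n; exact: measurable_prefix. Qed.

Lemma P_sup_le (B : \bar R) : (forall n, (P [set om | has (fun x => hit om x) (rat_prefix k n)] <= B)%E) ->
  (P [set om | exists x, cube k x /\ hit om x] <= B)%E.
Proof.
move=> H; pose A n := [set om | has (fun x => hit om x) (rat_prefix k n)].
have cv : (P \o A) n @[n --> \oo] --> P (\bigcup_n A n).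
  apply: nondecreasing_cvg_mu.
  - exact: measurable_prefix.
  - by apply: bigcupT_measurable => n; exact: measurable_prefix.
  - move=> n n' nn; apply/subsetPset => om /= /hasP[x xn hx]; apply/hasP; exists x => //.
    exact: rat_prefix_sub nn x xn.
rewrite sup_prefixes -(cvg_lim _ cv) //; apply: lime_le; first by apply/cvg_ex; exists (P (\bigcup_n A n)).
by apply: nearW => n; exact: H.
Qed.
End separable_supremum.

(** Both bounds differ from c I by c kap (I + 1), a fraction kap (1 + 1 / I) of it. *)
Lemma ratio_close {R : realType} (kap I e c p : R) : 0 < c -> 0 < I -> kap * (1 + I^-1) <= e ->
  c * ((1 - kap) * I - kap) <= p -> p <= c * ((1 + kap) * I + kap) -> `|1 - p / (c * I)| <= e.
Proof.
move=> c0 I0 ke h1 h2; have cI : 0 < c * I by rewrite mulr_gt0.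
apply: le_trans ke; rewrite distrC ler_distl ler_pdivlMr // ler_pdivrMr //; apply/andP; split.
  apply: le_trans h1; apply: eqle; field; exact: lt0r_neq0.
apply: (le_trans h2); apply: eqle; field; exact: lt0r_neq0.
Qed.

Unset Implicit Arguments.
(* n = m.+1 >= 2 ; points of R^n are row vectors 'rV[R]_(m.+1), x~ in 'rV[R]_m *)
Theorem theorem2p1 (R : realType) (m : nat) (hm : (1 <= m)%N)
  (F : 'rV[R]_m.+1 -> R)
  (mu : probability (g_sigma_algebraType (@orthants R m.+1)) R)
  (HF : is_cdf_on_cube mu F)
  (Fcont : {within cube m.+1, continuous F})
  (L : set 'rV[R]_m) (h : 'rV[R]_m -> R)
  (HL : L `<=` cube m)
  (HL0 : leb_outer L != 0%E)
  (HdL : leb_outer (boundary L) = 0%E)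
  (HD : [set ext xt (h xt) | xt in L] = [set x | cube m.+1 x /\ F x = 2^-1])
  (hdiff : forall xt, interior L xt -> differentiable h xt)
  (hC1 : forall (v : 'rV[R]_m) xt, interior L xt ->
           {for xt, continuous (fun yt => 'D_v h yt)})
  (a : 'I_m.+1 -> 'rV[R]_m.+1 -> R)
  (acont : forall i, {within cube m.+1, continuous (a i)})
  (apos : forall i x, cube m.+1 x -> 0 < a i x)
  (Hlin : lin_err F a [set ext xt (h xt) | xt in L] delta @[delta --> 0^'+] --> 0%E)
  (d : measure_display) (Omega : measurableType d) (P : probability Omega R)
  (W : Omega -> 'rV[R]_m.+1 -> R)
  (Wmeas : forall x, cube m.+1 x -> measurable_fun setT (fun om => W om x))
  (Wgauss : forall (p : nat) (xs : 'I_p -> 'rV[R]_m.+1) (c : 'I_p -> R) (A : set R),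
     (forall j, cube m.+1 (xs j)) -> measurable A ->
     P [set om | A (\sum_(j < p) c j * W om (xs j))] =
       centered_gauss (\sum_(j < p) \sum_(l < p) c j * c l * F (rmin (xs j) (xs l))) A)
  (Wsep : forall om x, cube m.+1 x -> exists q : nat -> 'rV[R]_m.+1,
     (forall k, rat_cube m.+1 (q k)) /\ q k @[k --> \oo] --> x /\
     W om (q k) @[k --> \oo] --> W om x)
  (w : R) :
  let K := ((2 ^+ (3 * m))%:E *
            leb_integral L (fun xt => (\prod_(i < m) a (lift ord_max i) (ext xt (h xt)))%R))%E in
  (0 < K < +oo)%E /\
  (fine (P [set om | exists x, cube m.+1 x /\
                 u < W om x - F x * W om (ones m.+1) + F x * w]) /
     (fine K * u ^+ (2 * m) * expR (- 2 * u ^+ 2 + 2 * u * w)))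
    @[u --> +oo] --> (1 : R).
Proof.
move=> K.
have m0 : (0 < m)%N by [].
(* On points of the cube this field is W, and the conditional field becomes X (dl x) - F x (X one -
   w). *)
pose X := sheet HF Wmeas Wgauss.
pose dl (x : 'rV[R]_m.+1) := pt x : @fmod R 'rV[R]_m.+1.
have ipd x y : cube m.+1 x -> cube m.+1 y -> gip X (dl x) (dl y) = F (rmin x y) by exact: sheet_ip.
have Xpt x om : cube m.+1 x -> X (dl x) om = W om x by exact: sheet_pt.
have [lo lo0 Hlo] : exists2 c : R, 0 < c & forall i x, cube m.+1 x -> c <= a i x.
  apply: (@fin_common R _ (fun i c => forall x, cube m.+1 x -> c <= a i x)) => [i e e' _ ee H x cx|i].
    exact: le_trans ee (H x cx).
  exact: cube_pos_lb (acont i) (apos i).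
have [up up0 Hup] : exists2 c : R, 0 < c & forall i x, cube m.+1 x -> a i x <= c^-1.
  apply: (@fin_common R _ (fun i c => forall x, cube m.+1 x -> a i x <= c^-1)) => [i e e' e0 ee H x cx|i].
    by apply: le_trans (H x cx) _; rewrite lef_pV2 ?posrE // (lt_le_trans e0).
  exact: cube_ub (acont i).
have abd i x : cube m.+1 x -> lo <= a i x <= up^-1 by move=> cx; rewrite Hlo // Hup.
have lin (eps : R) : 0 < eps -> _ := fun e0 => lin_errP Hlin e0.
have [IG IG0 IE] := G_integral m0 HL HdL HD lo0 abd HL0.
have KE : K = (8 ^+ m * IG)%:E by rewrite /K IE -EFinM exprM (_ : 2 ^+ 3 = 8) //; ring.
have K0 : 0 < 8 ^+ m * IG by rewrite mulr_gt0 // exprn_gt0.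
split; first by rewrite KE lte_fin K0 ltry.
have mh u x : cube m.+1 x -> measurable_fun setT (fun om => u < W om x - F x * W om (ones m.+1) + F x * w).
  move=> cx; apply: measurable_fun_ltr => //; apply: measurable_funD; last exact: measurable_cst.
  apply: measurable_funB; first exact (Wmeas x cx).
  by apply: measurable_funM => //; exact (Wmeas _ (@cube_ones R m.+1)).
have evE u (s : seq 'rV[R]_m.+1) : (forall x, x \in s -> cube m.+1 x) ->
   [set t | has (fun x => (u < X (dl x) t - F x * (X (dl (ones m.+1)) t - w))%R) s] =
   [set t | has (fun x => (u < W t x - F x * W t (ones m.+1) + F x * w)%R) s].
  move=> sc; apply: (congr1 (fun b : Omega -> bool => [set t | b t])); apply/funext => t.
  apply: eq_in_has => x xs; rewrite (Xpt x t (sc x xs)) (Xpt (ones m.+1) t (@cube_ones R m.+1)).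
  by congr (u < _); ring.
rewrite KE /=; apply/cvgrPdist_le => e e0.
have i1 : 0 < 1 + IG^-1 by rewrite addr_gt0 // invr_gt0.
(* The relative error allowed to both bounds, as [ratio_close] asks. *)
have [kap kap0 /and3P[kap1 kape _]] : exists2 y : R, 0 < y & all (fun x => y <= x) [:: 1; e / (1 + IG^-1)].
  by apply: min_exists; rewrite /= ltr01 divr_gt0.
rewrite ler_pdivlMr // in kape.
have leIG : (leb_integral L (fun xt => (\prod_(i < m) a (lift ord_max i) (ext xt (h xt)))%R) <= IG%:E)%E by rewrite IE.
have geIG : (IG%:E <= leb_integral L (fun xt => (\prod_(i < m) a (lift ord_max i) (ext xt (h xt)))%R))%E by rewrite IE.
have up_b := upper_bound m0 HF Fcont HL HdL HD lo0 abd acont lin ipd w kap0 kap1 (ltW IG0) leIG.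
have lo_b := lower_bound m0 HF Fcont HL HdL HD lo0 abd acont lin ipd w kap0 kap1 (ltW IG0) geIG.
apply: filterS (near_and3 up_b lo_b (near_ge 1)) => u [Hu [s sc Hl] u1].
have u0 : 0 < u by exact: lt_le_trans ltr01 u1.
have c0 : 0 < 8 ^+ m * u ^+ (2 * m) * expR (- 2 * u ^+ 2 + 2 * u * w).
  by rewrite mulr_gt0 ?expR_gt0 // mulr_gt0 ?exprn_gt0.
set Ev := [set om | _].
have mEv : measurable Ev by exact: (measurable_sup Fcont Wsep (mh u)).
have fEv : P Ev \is a fin_num by exact: fin_num_measure.
have Pu : (P Ev <= (8 ^+ m * ((1 + kap) * IG + kap) * u ^+ (2 * m) * expR (- 2 * u ^+ 2 + 2 * u * w))%:E)%E.
  apply: (P_sup_le Fcont Wsep (mh u)) => n; rewrite -evE; last by move=> x; exact: rat_prefix_cube.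
  by apply: Hu => x; exact: rat_prefix_cube.
have Pl : ((8 ^+ m * ((1 - kap) * IG - kap) * u ^+ (2 * m) * expR (- 2 * u ^+ 2 + 2 * u * w))%:E <= P Ev)%E.
  apply: (le_trans Hl); apply: le_measure; rewrite ?inE //.
    apply: measurable_set_bool; apply: measurable_hasb => x; exact: measurable_bridge.
  by rewrite evE // => om /hasP[x xs hx]; exists x; split=> //; exact: sc.
rewrite -(fineK fEv) !lee_fin in Pu Pl.
have -> : 8 ^+ m * IG * u ^+ (2 * m) * expR (- 2 * u ^+ 2 + 2 * u * w) = 8 ^+ m * u ^+ (2 * m) * expR (- 2 * u ^+ 2 + 2 * u * w) * IG by ring.
apply: (ratio_close c0 IG0 kape).
  apply: le_trans Pl; apply: eqle; ring.
apply: (le_trans Pu); apply: eqle; ring.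
Qed.
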